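(* Let $\Gamma$ be any congruence subgroup of $\mathrm{SL}(2,\mathbb{Z})$, let $\mathcal{A}(\Gamma)$ be the modular Hecke algebra of level $\Gamma$, and let $\mathcal{H}_1$ be the Hopf algebra described in the context. For $F\in\mathcal{A}(\Gamma)$, $\alpha\in G^+(\mathbb{Q})$ and $n\ge 1$ consider the formulae $$ Y(F)_\alpha := Y(F_\alpha),\qquad X(F)_\alpha := X(F_\alpha),\qquad \delta_n(F)_\alpha := X^{n-1}(\mu_\alpha)\cdot F_\alpha . \qquad ( * )$$ 1. The formulae $( * )$ define a Hopf action of the Hopf algebra $\mathcal{H}_1$ on the algebra $\mathcal{A}(\Gamma)$. 2. The Schwarzian derivation $\delta_2' = \delta_2-\tfrac12\delta_1^2$ of $\mathcal{A}(\Gamma)$ is inner and is implemented by $\omega_4 := -\tfrac{1}{72}E_4 \in \mathcal{A}(\Gamma)$, i.e. $\delta_2'(a) = a*\omega_4-\omega_4*a$ for all $a\in\mathcal{A}(\Gamma)$. 3. Let $F := X\otimes Y - Y\otimes X-\delta_1 Y\otimes Y\in\mathcal{H}_1\otimes\mathcal{H}_1$. Its image under the canonical map from the Hopf cyclic cohomology of $\mathcal{H}_1$ to the Hochschild cohomology of $\mathcal{A}(\Gamma)$, $$\chi(F)(a_1,a_2) := X(a_1)\,Y(a_2) - Y(a_1)\,X(a_2) - \delta_1(Y(a_1))\,Y(a_2),\qquad a_1,a_2\in\mathcal{A}(\Gamma),$$ is a Hochschild $2$-cocycle on $\mathcal{A}(\Gamma)$ with values in $\mathcal{A}(\Gamma)$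 which gives the natural extension of the first Rankin-Cohen bracket to $\mathcal{A}(\Gamma)$: its restriction to the subalgebra $\mathcal{M}(\Gamma)\subset\mathcal{A}(\Gamma)$ is the first Rankin-Cohen bracket $\{\cdot,\cdot\}_1$. 4. The cuspidal ideal $\mathcal{A}^0(\Gamma)$ is globally invariant under the action of $\mathcal{H}_1$.
   Context: Hopf algebra $\mathcal{H}_1$. As an algebra (over $\mathbb{C}$), $\mathcal{H}_1$ is the universal enveloping algebra of the Lie algebra with basis $\{X,Y,\delta_n; n\ge1\}$ and brackets $[Y,X]=X$, $[Y,\delta_n]=n\delta_n$, $[X,\delta_n]=\delta_{n+1}$, $[\delta_k,\delta_\ell]=0$. The coproduct is the algebra homomorphism $\Delta:\mathcal{H}_1\to\mathcal{H}_1\otimes\mathcal{H}_1$ with $\Delta Y=Y\otimes1+1\otimes Y$, $\Delta\delta_1=\delta_1\otimes1+1\otimes\delta_1$, $\Delta X=X\otimes1+1\otimes X+\delta_1\otimes Y$; the counit $\varepsilon$ kills all generators. A Hopf action of $\mathcal{H}_1$ on an algebra $\mathcal{A}$ is an $\mathcal{H}_1$-module structure with $h(ab)=\sum h_{(1)}(a)h_{(2)}(b)$, where $\Delta h=\sum h_{(1)}\otimes h_{(2)}$ (and $h(1)=\varepsilon(h)1$). Modular forms. $H$ is the upper half-plane, $G^+(\mathbb{Q})=\mathrm{GL}^+(2,\mathbb{Q})$ (positive determinant). For $\alpha=\begin{pmatrix}a&b\\c&d\end{pmatrix}\in\mathrm{GL}^+(2,\mathbb{R})$ put $f|_k\alpha(z)=\det(\alpha)^{k/2}f\left(\frac{az+b}{cz+d}\right)(cz+d)^{-k}$;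 one writes $f|\alpha$ when $k$ is the weight of $f$, extended linearly to sums of forms of different weights. For a congruence subgroup $\Gamma$, $\mathcal{M}(\Gamma)=\bigoplus_{k\ge0}\mathcal{M}_k(\Gamma)$ is the graded algebra of modular forms for $\Gamma$ (holomorphic on $H$ and at the cusps; weight $0$ are the constants), $\mathcal{M}^0(\Gamma)$ the cusp forms; $\mathcal{M}=\bigcup_N\mathcal{M}(\Gamma(N))$ and $\mathcal{M}^0=\bigcup_N\mathcal{M}^0(\Gamma(N))$ are the modular, resp. cusp, forms of all levels. Modular Hecke algebra. $\mathcal{A}(\Gamma)$ is the space of Hecke operator forms of level $\Gamma$: maps $F:\Gamma\backslash G^+(\mathbb{Q})\to\mathcal{M}$, $\Gamma\alpha\mapsto F_\alpha$, with finite support and $F_{\alpha\gamma}=F_\alpha|\gamma$ for all $\alpha\in G^+(\mathbb{Q})$, $\gamma\in\Gamma$. The product is $(F^1*F^2)_\alpha=\sum_{\beta\in\Gamma\backslash G^+(\mathbb{Q})}F^1_\beta\cdot F^2_{\alpha\beta^{-1}}|\beta$. In item 3 the products are taken in $\mathcal{A}(\Gamma)$. $\mathcal{A}^0(\Gamma)$ is the ideal of those $F$ with $F_\alpha\in\mathcal{M}^0$ for all $\alpha$. $\mathcal{M}(\Gamma)$ is embedded in $\mathcal{A}(\Gamma)$ as the subalgebra of $F$ supported on the trivial coset: $f\mapsto F$ with $F_\alpha=f$ for $\alpha\in\Gamma$ and $F_\alpha=0$ otherwise. Operators on $\mathcal{M}$. $Y(f)=\frac k2 f$ for $f\in\mathcal{M}_k$,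 and $X=\frac1{2\pi i}\frac{d}{dz}-\frac1{2\pi i}\frac{d}{dz}(\log\eta^4)\cdot Y$, where $\eta$ is the Dedekind eta function, $\eta^{24}=q\prod_{n\ge1}(1-q^n)^{24}$, $q=e^{2\pi iz}$. $X$ raises weight by $2$. For $\gamma\in G^+(\mathbb{Q})$, $\mu_\gamma(z)=\frac1{2\pi i}\frac{d}{dz}\log\frac{\eta^4|\gamma}{\eta^4}\in\mathcal{M}_2$, where $\eta^4|\gamma$ is the weight $2$ slash. $E_4=1+240\sum_{n\ge1}n^3\frac{q^n}{1-q^n}$. The first Rankin-Cohen bracket on modular forms is, in the normalization used here, $\{f,g\}_1=X(f)Y(g)-Y(f)X(g)=\frac1{4\pi i}(\ell f'g-kfg')$ for $f$ of weight $k$ and $g$ of weight $\ell$. A bilinear map $c$ is a Hochschild $2$-cocycle if $a_1c(a_2,a_3)-c(a_1a_2,a_3)+c(a_1,a_2a_3)-c(a_1,a_2)a_3=0$. *)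

(* Defs.v *)
From HB Require Import structures.
From mathcomp Require Import all_boot all_order all_algebra.
From mathcomp Require Import all_classical all_reals all_analysis.
From mathcomp Require Import ring lra.
From mathcomp.real_closed Require Import complex.

Set Implicit Arguments.
Unset Strict Implicit.
Unset Printing Implicit Defensive.

Import Order.TTheory GRing.Theory Num.Theory.
Import numFieldNormedType.Exports.

Local Open Scope classical_set_scope.
Local Open Scope quotient_scope.
Local Open Scope ring_scope.

(* Universal enveloping algebra of the Lie algebra with basis G and structure
   constants [x, y] = \sum_(p <- br x y) p.1 *: p.2: noncommutative polynomials
   in G modulo the relations x y = y x + [x, y]. *)
Section EnvelopingAlgebra.
Variables (K : comNzRingType) (G : Type) (br : G -> G -> seq (K * G)).

Inductive uterm :=
| UVar of G
| UCst of K
| UAdd of uterm & uterm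
| UMul of uterm & uterm.

Definition ulin (s : seq (K * G)) : uterm :=
  foldr (fun p t => UAdd (UMul (UCst p.1) (UVar p.2)) t) (UCst 0) s.

Inductive ueq : uterm -> uterm -> Prop :=
| ueq_refl s : ueq s s
| ueq_sym s t : ueq s t -> ueq t s
| ueq_trans s t u : ueq s t -> ueq t u -> ueq s u
| ueq_add s s' t t' : ueq s s' -> ueq t t' -> ueq (UAdd s t) (UAdd s' t')
| ueq_mul s s' t t' : ueq s s' -> ueq t t' -> ueq (UMul s t) (UMul s' t')
| ueq_addA s t u : ueq (UAdd s (UAdd t u)) (UAdd (UAdd s t) u)
| ueq_addC s t : ueq (UAdd s t) (UAdd t s)
| ueq_add0 s : ueq (UAdd (UCst 0) s) s
| ueq_addN s : ueq (UAdd (UMul (UCst (- 1)) s) s) (UCst 0)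
| ueq_mulA s t u : ueq (UMul s (UMul t u)) (UMul (UMul s t) u)
| ueq_mul1 s : ueq (UMul (UCst 1) s) s
| ueq_mulDl s t u : ueq (UMul (UAdd s t) u) (UAdd (UMul s u) (UMul t u))
| ueq_mulDr s t u : ueq (UMul u (UAdd s t)) (UAdd (UMul u s) (UMul u t))
| ueq_cstD c d : ueq (UCst (c + d)) (UAdd (UCst c) (UCst d))
| ueq_cstM c d : ueq (UCst (c * d)) (UMul (UCst c) (UCst d))
| ueq_cstC c s : ueq (UMul s (UCst c)) (UMul (UCst c) s)
| ueq_lie x y :
    ueq (UMul (UVar x) (UVar y))
        (UAdd (UMul (UVar y) (UVar x)) (ulin (br x y))).

HB.instance Definition _ := gen_eqMixin uterm.
HB.instance Definition _ := gen_choiceMixin uterm.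

Definition ueqb (s t : uterm) : bool := `[< ueq s t >].

Fact ueqb_refl : reflexive ueqb.
Proof. by move=> s; apply/asboolP/ueq_refl. Qed.
Fact ueqb_sym : symmetric ueqb.
Proof. by move=> s t; apply/asboolP/asboolP => /ueq_sym. Qed.
Fact ueqb_trans : transitive ueqb.
Proof. by move=> t s u /asboolP st /asboolP /(ueq_trans st) ?; apply/asboolP. Qed.

Canonical ueq_equiv := EquivRel ueqb ueqb_refl ueqb_sym ueqb_trans.

Definition uea := {eq_quot ueq_equiv}.
HB.instance Definition _ := Choice.on uea.

Definition ucls (s : uterm) : uea := \pi_{eq_quot ueq_equiv} s.

Lemma uclsP s t : ucls s = ucls t <-> ueq s t.
Proof.
split=> [/eqmodP/asboolP //|st].
by apply/eqmodP/asboolP.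
Qed.

Lemma ucls_ind (P : uea -> Prop) : (forall s, P (ucls s)) -> forall a, P a.
Proof. by move=> Ps; elim/quotW. Qed.

Definition uop2 (f : uterm -> uterm -> uterm) (a b : uea) : uea :=
  ucls (f (repr a) (repr b)).

Lemma ucls_repr s : ueq (repr (ucls s)) s.
Proof. by apply/uclsP; rewrite /ucls reprK. Qed.

Definition uadd := uop2 UAdd.
Definition umul := uop2 UMul.
Definition ucst c : uea := ucls (UCst c).
Definition uopp a := umul (ucst (- 1)) a.

Lemma uaddE s t : uadd (ucls s) (ucls t) = ucls (UAdd s t).
Proof. by apply/uclsP/ueq_add; apply: ucls_repr. Qed.
Lemma umulE s t : umul (ucls s) (ucls t) = ucls (UMul s t).
Proof. by apply/uclsP/ueq_mul; apply: ucls_repr. Qed.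

Local Ltac ueaP ax :=
  do !(elim/ucls_ind=> ?); rewrite /uopp /ucst !(uaddE, umulE);
  by apply/uclsP; apply: ax.

Fact uaddA : associative uadd. Proof. ueaP ueq_addA. Qed.
Fact uaddC : commutative uadd. Proof. ueaP ueq_addC. Qed.
Fact uadd0 : left_id (ucst 0) uadd. Proof. ueaP ueq_add0. Qed.
Fact uaddN : left_inverse (ucst 0) uopp uadd. Proof. ueaP ueq_addN. Qed.
HB.instance Definition _ := GRing.isZmodule.Build uea uaddA uaddC uadd0 uaddN.

Fact umulA : associative umul. Proof. ueaP ueq_mulA. Qed.
Fact umul1 : left_id (ucst 1) umul. Proof. ueaP ueq_mul1. Qed.
Fact umulC c a : umul a (ucst c) = umul (ucst c) a.
Proof. move: a; ueaP ueq_cstC. Qed.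
Fact umul1r : right_id (ucst 1) umul.
Proof. by move=> a; rewrite umulC umul1. Qed.
Fact umulDl : left_distributive umul uadd. Proof. ueaP ueq_mulDl. Qed.
Fact umulDr : right_distributive umul uadd. Proof.
move=> a b c; move: b c a; ueaP ueq_mulDr. Qed.

Fixpoint uaug (t : uterm) : K :=
  match t with
  | UVar _ => 0
  | UCst c => c
  | UAdd s t => uaug s + uaug t
  | UMul s t => uaug s * uaug t
  end.

Lemma uaug_eq s t : ueq s t -> uaug s = uaug t.
Proof.
elim=> //=.
- by move=> ? ? ? _ -> _ ->.
- by move=> ? ? ? ? _ -> _ ->.
- by move=> ? ? ? ? _ -> _ ->.
- by move=> *; rewrite addrA.
- by move=> *; rewrite addrC.
- by move=> *; rewrite add0r.
- by move=> *; rewrite mulN1r addNr.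
- by move=> *; rewrite mulrA.
- by move=> *; rewrite mul1r.
- by move=> *; rewrite mulrDl.
- by move=> *; rewrite mulrDr.
- by move=> *; rewrite mulrC.
move=> x y; rewrite mulr0 add0r; elim: (br x y) => //= p br_s <-.
by rewrite mulr0 addr0.
Qed.

Fact ucst_neq0 : ucst 1 != ucst 0.
Proof. by apply/eqP => /uclsP/uaug_eq/eqP /=; rewrite oner_eq0. Qed.

HB.instance Definition _ :=
  GRing.Zmodule_isNzRing.Build uea umulA umul1 umul1r umulDl umulDr ucst_neq0.

Definition uscale (c : K) (a : uea) : uea := umul (ucst c) a.

Fact ucstD c d : ucst (c + d) = uadd (ucst c) (ucst d).
Proof. by rewrite /ucst uaddE; apply/uclsP/ueq_cstD. Qed.
Fact ucstM c d : ucst (c * d) = umul (ucst c) (ucst d).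
Proof. by rewrite /ucst umulE; apply/uclsP/ueq_cstM. Qed.

Fact uscaleA c d a : uscale c (uscale d a) = uscale (c * d) a.
Proof. by rewrite /uscale umulA -ucstM. Qed.
Fact uscaleDr : right_distributive uscale uadd.
Proof. by move=> c a b; apply: umulDr. Qed.
Fact uscaleDl a : {morph uscale^~ a : c d / c + d}.
Proof. by move=> c d; rewrite /uscale ucstD umulDl. Qed.
HB.instance Definition _ :=
  GRing.Zmodule_isLmodule.Build K uea uscaleA umul1 uscaleDr uscaleDl.

Fact uscaleAl c (a b : uea) : c *: (a * b) = c *: a * b.
Proof. exact: umulA. Qed.
HB.instance Definition _ := GRing.Lmodule_isLalgebra.Build K uea uscaleAl.

Fact uscaleAr c (a b : uea) : c *: (a * b) = a * (c *: b).
Proof.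
change (umul (ucst c) (umul a b) = umul a (umul (ucst c) b)).
by rewrite !umulA umulC.
Qed.
HB.instance Definition _ := GRing.Lalgebra_isAlgebra.Build K uea uscaleAr.

Definition ugen (x : G) : uea := ucls (UVar x).

Lemma ugen_lie x y :
  ugen x * ugen y - ugen y * ugen x = \sum_(p <- br x y) p.1 *: ugen p.2.
Proof.
have gE z : ugen z = ucls (UVar z) by [].
have lE s : \sum_(p <- s) p.1 *: ugen p.2 = ucls (ulin s).
  elim: s => [|p s IHs]; first by rewrite big_nil.
  by rewrite big_cons IHs /= -uaddE -umulE.
rewrite lE; apply/eqP; rewrite subr_eq addrC; apply/eqP.
rewrite !gE /GRing.mul /GRing.add /= !(umulE, uaddE).
exact/uclsP/ueq_lie.
Qed.
End EnvelopingAlgebra.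

Section EnvelopingLift.
Variables (K : comNzRingType) (G : Type) (br : G -> G -> seq (K * G)).
Variables (A : algType K) (phi : G -> A).

Definition lie_map : Prop := forall x y,
  phi x * phi y - phi y * phi x = \sum_(p <- br x y) p.1 *: phi p.2.

Fixpoint ueval (t : uterm K G) : A :=
  match t with
  | UVar x => phi x
  | UCst c => c%:A
  | UAdd s t => ueval s + ueval t
  | UMul s t => ueval s * ueval t
  end.

Lemma ueval_eq (phiP : lie_map) s t : ueq br s t -> ueval s = ueval t.
Proof.
elim=> //=.
- by move=> ? ? ? _ -> _ ->.
- by move=> ? ? ? ? _ -> _ ->.
- by move=> ? ? ? ? _ -> _ ->.
- by move=> *; rewrite addrA.
- by move=> *; rewrite addrC.
- by move=> *; rewrite scale0r add0r.
- by move=> *; rewrite scaleN1r mulN1r addNr scale0r.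
- by move=> *; rewrite mulrA.
- by move=> *; rewrite scale1r mul1r.
- by move=> *; rewrite mulrDl.
- by move=> *; rewrite mulrDr.
- by move=> *; rewrite scalerDl.
- by move=> *; rewrite mulr_algl scalerA.
- by move=> *; rewrite mulr_algl mulr_algr.
move=> x y; have /eqP := phiP x y.
rewrite subr_eq addrC => /eqP ->; congr (_ + _).
elim: (br x y) => [|p l IH] /=; first by rewrite big_nil scale0r.
by rewrite big_cons IH mulr_algl.
Qed.

Definition ulift of lie_map := fun a : uea br => ueval (repr a).

Lemma uliftE (phiP : lie_map) s : ulift phiP (ucls br s) = ueval s.
Proof. exact/ueval_eq/ucls_repr. Qed.

Lemma ulift_gen (phiP : lie_map) x : ulift phiP (ugen br x) = phi x.
Proof. exact: uliftE. Qed.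

Fact ulift_linear (phiP : lie_map) : linear (ulift phiP).
Proof.
move=> c; elim/ucls_ind=> s; elim/ucls_ind=> t.
have -> : c *: ucls br s + ucls br t =
    ucls br (UAdd (UMul (UCst G c) s) t) by rewrite -uaddE -umulE.
by rewrite !uliftE /= mulr_algl.
Qed.
HB.instance Definition _ (phiP : lie_map) :=
  GRing.isLinear.Build K (uea br) A *:%R (ulift phiP) (ulift_linear phiP).

Fact ulift_multiplicative (phiP : lie_map) : monoid_morphism (ulift phiP).
Proof.
split; first by rewrite [LHS]uliftE /= scale1r.
elim/ucls_ind=> s; elim/ucls_ind=> t.
by rewrite [_ * _ in LHS](umulE br s t) !uliftE.
Qed.
HB.instance Definition _ (phiP : lie_map) :=
  GRing.isMonoidMorphism.Build (uea br) A (ulift phiP) (ulift_multiplicative phiP).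

End EnvelopingLift.

Section Counit.
Variables (K : comNzRingType) (G : Type) (br : G -> G -> seq (K * G)).

Fact ucounit_lie : @lie_map K G br K^o (fun=> 0).
Proof. by move=> x y; rewrite mulr0 subr0 big1 // => p _; rewrite scaler0. Qed.

Definition ucounit : {lrmorphism uea br -> K^o} := ulift ucounit_lie.

End Counit.

(* A (x) B: formal sums of pairs (a, b), identified when every bilinear map
   sums to the same value on them. *)
Section TensorProduct.
Variables (K : comNzRingType) (A B : algType K).

Definition bilin (V : lmodType K) (f : A -> B -> V) : Prop :=
  (forall a, linear (f a)) /\ (forall b, linear (f^~ b)).

Definition teq (s t : seq (A * B)) : Prop :=
  forall (V : lmodType K) (f : A -> B -> V), bilin f ->
    \sum_(p <- s) f p.1 p.2 = \sum_(p <- t) f p.1 p.2.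

Definition teqb (s t : seq (A * B)) : bool := `[< teq s t >].

Fact teqb_refl : reflexive teqb.
Proof. by move=> s; apply/asboolP. Qed.
Fact teqb_sym : symmetric teqb.
Proof.
by move=> s t; apply/asboolP/asboolP => st V f bf; rewrite (st V f bf).
Qed.
Fact teqb_trans : transitive teqb.
Proof.
move=> t s u /asboolP st /asboolP tu; apply/asboolP => V f bf.
by rewrite (st V f bf) (tu V f bf).
Qed.

Canonical teq_equiv := EquivRel teqb teqb_refl teqb_sym teqb_trans.

Definition tensor := {eq_quot teq_equiv}.
HB.instance Definition _ := Choice.on tensor.

Definition tcls (s : seq (A * B)) : tensor := \pi_{eq_quot teq_equiv} s.

Lemma tclsP s t : tcls s = tcls t <-> teq s t.
Proof.
split=> [/eqmodP/asboolP //|st].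
by apply/eqmodP/asboolP.
Qed.

Lemma tcls_ind (P : tensor -> Prop) : (forall s, P (tcls s)) -> forall a, P a.
Proof. by move=> Ps; elim/quotW. Qed.

Lemma tcls_repr s : teq (repr (tcls s)) s.
Proof. by apply/tclsP; rewrite /tcls reprK. Qed.

Section BilinTheory.
Variables (V : lmodType K) (f : A -> B -> V) (bf : bilin f).
Lemma bilinDl a a' b : f (a + a') b = f a b + f a' b.
Proof. by have := bf.2 b 1 a a'; rewrite /= !scale1r. Qed.
Lemma bilin0l b : f 0 b = 0.
Proof. by apply: (addIr (f 0 b)); rewrite -bilinDl !add0r. Qed.
Lemma bilinZl c a b : f (c *: a) b = c *: f a b.
Proof. by have := bf.2 b c a 0; rewrite /= bilin0l !addr0. Qed.
Lemma bilinDr a b b' : f a (b + b') = f a b + f a b'.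
Proof. by have := bf.1 a 1 b b'; rewrite !scale1r. Qed.
Lemma bilin0r a : f a 0 = 0.
Proof. by apply: (addIr (f a 0)); rewrite -bilinDr !add0r. Qed.
Lemma bilinZr c a b : f a (c *: b) = c *: f a b.
Proof. by have := bf.1 a c b 0; rewrite bilin0r !addr0. Qed.
End BilinTheory.

Definition tadds (s t : seq (A * B)) := s ++ t.
Definition tscales (c : K) (s : seq (A * B)) := [seq (c *: p.1, p.2) | p <- s].
Definition tmuls (s t : seq (A * B)) :=
  [seq (p.1 * q.1, p.2 * q.2) | p <- s, q <- t].

Definition tadd (x y : tensor) : tensor := tcls (tadds (repr x) (repr y)).
Definition tscale c (x : tensor) : tensor := tcls (tscales c (repr x)).
Definition tmul (x y : tensor) : tensor := tcls (tmuls (repr x) (repr y)).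

Lemma taddE s t : tadd (tcls s) (tcls t) = tcls (s ++ t).
Proof.
apply/tclsP => V f bf; rewrite !big_cat /=.
by rewrite (tcls_repr s bf) (tcls_repr t bf).
Qed.

Lemma tsum_scales (V : lmodType K) (f : A -> B -> V) c s : bilin f ->
  \sum_(p <- tscales c s) f p.1 p.2 = c *: \sum_(p <- s) f p.1 p.2.
Proof.
move=> bf; rewrite big_map scaler_sumr; apply: eq_bigr => p _.
by rewrite bilinZl.
Qed.

Lemma tscaleE c s : tscale c (tcls s) = tcls (tscales c s).
Proof.
by apply/tclsP => V f bf; rewrite !tsum_scales // (tcls_repr s bf).
Qed.

Lemma tsum_muls (V : lmodType K) (f : A -> B -> V) s t :
  \sum_(p <- tmuls s t) f p.1 p.2 =
  \sum_(p <- s) \sum_(q <- t) f (p.1 * q.1) (p.2 * q.2).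
Proof. by rewrite /tmuls big_allpairs_dep. Qed.

Lemma tmulE s t : tmul (tcls s) (tcls t) = tcls (tmuls s t).
Proof.
apply/tclsP => V f bf; rewrite !tsum_muls.
pose g a b := \sum_(q <- repr (tcls t)) f (a * q.1) (b * q.2).
have bg : bilin g.
  split=> [a c b b'|b c a a'] /=; rewrite /g scaler_sumr -big_split /=;
    apply: eq_bigr => q _.
    by rewrite mulrDl -scalerAl bilinDr // bilinZr.
  by rewrite mulrDl -scalerAl bilinDl // bilinZl.
rewrite [LHS](tcls_repr s bg); apply: eq_bigr => p _.
have bh : bilin (fun a b => f (p.1 * a) (p.2 * b)).
  split=> [a c b b'|b c a a'] /=.
    by rewrite mulrDr -scalerAr bilinDr // bilinZr.
  by rewrite mulrDr -scalerAr bilinDl // bilinZl.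
exact: (tcls_repr t bh).
Qed.

Fact taddA : associative tadd.
Proof. by do 3!elim/tcls_ind=> ?; rewrite !taddE catA. Qed.
Fact taddC : commutative tadd.
Proof.
do 2!elim/tcls_ind=> ?; rewrite !taddE; apply/tclsP => V f bf.
by rewrite !big_cat /= addrC.
Qed.
Fact tadd0 : left_id (tcls [::]) tadd.
Proof. by elim/tcls_ind=> ?; rewrite taddE. Qed.
Fact taddN : left_inverse (tcls [::]) (tscale (- 1)) tadd.
Proof.
elim/tcls_ind=> s; rewrite tscaleE taddE; apply/tclsP => V f bf.
by rewrite big_cat tsum_scales //= scaleN1r addNr big_nil.
Qed.
HB.instance Definition _ := GRing.isZmodule.Build tensor taddA taddC tadd0 taddN.

Fact tscaleA c d x : tscale c (tscale d x) = tscale (c * d) x.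
Proof.
move: x; elim/tcls_ind=> s; rewrite !tscaleE; apply/tclsP => V f bf.
by rewrite !tsum_scales // scalerA.
Qed.
Fact tscale1 : left_id 1 tscale.
Proof.
elim/tcls_ind=> s; rewrite !tscaleE; apply/tclsP => V f bf.
by rewrite !tsum_scales // scale1r.
Qed.
Fact tscaleDr : right_distributive tscale tadd.
Proof.
move=> c; do 2!elim/tcls_ind=> ?; rewrite !(tscaleE, taddE).
by rewrite /tscales map_cat.
Qed.
Fact tscaleDl x : {morph tscale^~ x : c d / c + d >-> tadd c d}.
Proof.
move=> c d; move: x; elim/tcls_ind=> s; rewrite !(tscaleE, taddE).
apply/tclsP => V f bf.
by rewrite big_cat /= !tsum_scales // scalerDl.
Qed.
HB.instance Definition _ :=
  GRing.Zmodule_isLmodule.Build K tensor tscaleA tscale1 tscaleDr tscaleDl.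

Fact tmulA : associative tmul.
Proof.
do 3!elim/tcls_ind=> ?; rewrite !tmulE; apply/tclsP => V f bf.
rewrite !tsum_muls; apply: esym; rewrite [LHS]big_allpairs_dep /=.
apply: eq_bigr => p _; rewrite [RHS]big_allpairs_dep /=.
by apply: eq_bigr => q _; apply: eq_bigr => r _; rewrite !mulrA.
Qed.
Fact tmul1 : left_id (tcls [:: (1, 1)]) tmul.
Proof.
elim/tcls_ind=> s; rewrite !tmulE; apply/tclsP => V f bf.
by rewrite tsum_muls big_seq1; apply: eq_bigr => p _; rewrite !mul1r.
Qed.
Fact tmul1r : right_id (tcls [:: (1, 1)]) tmul.
Proof.
elim/tcls_ind=> s; rewrite !tmulE; apply/tclsP => V f bf.
by rewrite tsum_muls; apply: eq_bigr => p _; rewrite big_seq1 !mulr1.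
Qed.
Fact tmulDl : left_distributive tmul tadd.
Proof.
do 3!elim/tcls_ind=> ?; rewrite !(taddE, tmulE); apply/tclsP => V f bf.
by rewrite !(tsum_muls, big_cat).
Qed.
Fact tmulDr : right_distributive tmul tadd.
Proof.
do 3!elim/tcls_ind=> ?; rewrite !(taddE, tmulE); apply/tclsP => V f bf.
rewrite !(tsum_muls, big_cat) /= -big_split; apply: eq_bigr => p _.
by rewrite big_cat.
Qed.
HB.instance Definition _ :=
  GRing.Zmodule_isPzRing.Build tensor tmulA tmul1 tmul1r tmulDl tmulDr.

Fact tscaleAl c (x y : tensor) : c *: (x * y) = c *: x * y.
Proof.
change (tscale c (tmul x y) = tmul (tscale c x) y).
move: x y; do 2!elim/tcls_ind=> ?; rewrite !(tscaleE, tmulE).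
apply/tclsP => V f bf; rewrite tsum_scales // !tsum_muls big_map scaler_sumr.
apply: eq_bigr => p _; rewrite scaler_sumr; apply: eq_bigr => q _ /=.
by rewrite -scalerAl bilinZl.
Qed.
Fact tscaleAr c (x y : tensor) : c *: (x * y) = x * (c *: y).
Proof.
change (tscale c (tmul x y) = tmul x (tscale c y)).
move: x y; do 2!elim/tcls_ind=> ?; rewrite !(tscaleE, tmulE).
apply/tclsP => V f bf; rewrite tsum_scales // !tsum_muls scaler_sumr.
apply: eq_bigr => p _; rewrite big_map scaler_sumr; apply: eq_bigr => q _ /=.
by rewrite -scalerAr bilinZl.
Qed.

Definition tens (a : A) (b : B) : tensor := tcls [:: (a, b)].

Lemma tens_bilin : bilin tens.
Proof.
split=> [a c b b'|b c a a'] /=; rewrite /tens.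
  transitivity (tadd (tscale c (tcls [:: (a, b)])) (tcls [:: (a, b')])) => //.
  rewrite tscaleE taddE; apply/tclsP => V f bf.
  by rewrite /= !big_cons !big_nil /= !addr0 bilinDr // bilinZr // bilinZl.
transitivity (tadd (tscale c (tcls [:: (a, b)])) (tcls [:: (a', b)])) => //.
rewrite tscaleE taddE; apply/tclsP => V f bf.
by rewrite /= !big_cons !big_nil /= !addr0 bilinDl // bilinZl.
Qed.

Lemma tens_mul a a' b b' : tens a b * tens a' b' = tens (a * a') (b * b').
Proof. exact: tmulE. Qed.

Lemma tclsE s : tcls s = \sum_(p <- s) tens p.1 p.2.
Proof.
elim: s => [|[a b] s IHs]; first by rewrite big_nil.
by rewrite big_cons -IHs; rewrite [RHS]taddE.
Qed.

Lemma tens_sum (x : tensor) : x = \sum_(p <- repr x) tens p.1 p.2.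
Proof. by rewrite -tclsE /tcls reprK. Qed.

End TensorProduct.


Section EnvelopingTensor.
Variables (K : comNzRingType) (G G' : Type).
Variables (br : G -> G -> seq (K * G)) (br' : G' -> G' -> seq (K * G')).
Local Notation T := (tensor (uea br) (uea br')).

Fact tensor_uea_neq0 : (1 : T) != 0.
Proof.
apply/eqP => /tclsP; pose f a b : K^o := ucounit br a * ucounit br' b.
have bf : bilin f.
  split=> [a c b b'|b c a a'] /=; rewrite /f !linearP.
    by rewrite mulrDr scalerAr.
  by rewrite mulrDl scalerAl.
move=> /(_ _ _ bf); rewrite big_seq1 big_nil /f !rmorph1 mulr1.
by move/eqP; rewrite oner_eq0.
Qed.

HB.instance Definition _ := GRing.PzSemiRing_isNonZero.Build T tensor_uea_neq0.
HB.instance Definition _ :=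
  GRing.Lmodule_isLalgebra.Build K T (@tscaleAl K (uea br) (uea br')).
HB.instance Definition _ :=
  GRing.Lalgebra_isAlgebra.Build K T (@tscaleAr K (uea br) (uea br')).

End EnvelopingTensor.

Definition lie {A : nzRingType} (x y : A) := x * y - y * x.

Section Lie.
Variable A : nzRingType.
Implicit Types x y z : A.
Lemma lieDl x y z : lie (x + y) z = lie x z + lie y z.
Proof. by rewrite /lie mulrDl mulrDr opprD addrACA. Qed.
Lemma lieDr x y z : lie x (y + z) = lie x y + lie x z.
Proof. by rewrite /lie mulrDl mulrDr opprD addrACA. Qed.
Lemma lieMr x y z : lie x (y * z) = lie x y * z + y * lie x z.
Proof. by rewrite /lie mulrBl mulrBr !mulrA addrA subrK. Qed.
Lemma lieC x y : lie y x = - lie x y.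
Proof. by rewrite /lie opprB. Qed.
Lemma liexx x : lie x x = 0.
Proof. exact: subrr. Qed.
Lemma lieNr x y : lie x (- y) = - lie x y.
Proof. by rewrite /lie mulrN mulNr opprD. Qed.
Lemma lie1r x : lie x 1 = 0.
Proof. by rewrite /lie mulr1 mul1r subrr. Qed.
Lemma lie0 x y : lie x y = 0 -> x * y = y * x.
Proof. by move/eqP; rewrite subr_eq0 => /eqP. Qed.
End Lie.

Section HopfH1.
Variable K : comNzRingType.

(* h1_D n is the basis vector delta_(n+1); H1D n below is delta_n, for n >= 1. *)
Variant h1_basis := h1_X | h1_Y | h1_D of nat.

Definition h1_bracket (x y : h1_basis) : seq (K * h1_basis) :=
  match x, y with
  | h1_Y, h1_X => [:: (1, h1_X)]
  | h1_X, h1_Y => [:: (-1, h1_X)]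
  | h1_Y, h1_D n => [:: (n.+1%:R, h1_D n)]
  | h1_D n, h1_Y => [:: (- n.+1%:R, h1_D n)]
  | h1_X, h1_D n => [:: (1, h1_D n.+1)]
  | h1_D n, h1_X => [:: (-1, h1_D n.+1)]
  | _, _ => [::]
  end.

Definition H1 : algType K := uea h1_bracket.
Definition H1H1 : algType K := tensor (uea h1_bracket) (uea h1_bracket).

Definition H1X : H1 := ugen h1_bracket h1_X.
Definition H1Y : H1 := ugen h1_bracket h1_Y.
Definition H1D (n : nat) : H1 := ugen h1_bracket (h1_D n.-1).

Definition H1tens (a b : H1) : H1H1 := tens a b.
Local Notation "a '⊗' b" := (H1tens a b) (at level 39, left associativity).

Fixpoint h1_comulD (n : nat) : H1H1 :=
  if n is m.+1 then lie (H1X ⊗ 1 + 1 ⊗ H1X + H1D 1 ⊗ H1Y) (h1_comulD m)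
  else H1D 1 ⊗ 1 + 1 ⊗ H1D 1.

Definition h1_comul_gen (x : h1_basis) : H1H1 :=
  match x with
  | h1_X => H1X ⊗ 1 + 1 ⊗ H1X + H1D 1 ⊗ H1Y
  | h1_Y => H1Y ⊗ 1 + 1 ⊗ H1Y
  | h1_D n => h1_comulD n
  end.

Lemma H1_lieYX : lie H1Y H1X = H1X.
Proof. by rewrite /lie ugen_lie big_seq1 scale1r. Qed.
Lemma H1_lieYD n : lie H1Y (H1D n.+1) = n.+1%:R *: H1D n.+1.
Proof. by rewrite /lie ugen_lie big_seq1. Qed.
Lemma H1_lieXD n : lie H1X (H1D n.+1) = H1D n.+2.
Proof. by rewrite /lie ugen_lie big_seq1 scale1r. Qed.
Lemma H1_lieDD m n : lie (H1D m) (H1D n) = 0.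
Proof. by rewrite /lie ugen_lie big_nil. Qed.

Lemma H1tens_bilin : @bilin K H1 H1 H1H1 H1tens. Proof. exact: tens_bilin. Qed.
Let tensDl := bilinDl H1tens_bilin.
Let tensDr := bilinDr H1tens_bilin.
Let tensZl := bilinZl H1tens_bilin.
Let tensZr := bilinZr H1tens_bilin.
Let tens0l := bilin0l H1tens_bilin.
Let tens0r := bilin0r H1tens_bilin.

Lemma H1tens_mul a a' b b' : (a ⊗ b) * (a' ⊗ b') = (a * a') ⊗ (b * b').
Proof. exact: tens_mul. Qed.

Lemma tensNl a b : (- a) ⊗ b = - (a ⊗ b).
Proof. by rewrite -scaleN1r tensZl scaleN1r. Qed.
Lemma tensNr a b : a ⊗ (- b) = - (a ⊗ b).
Proof. by rewrite -scaleN1r tensZr scaleN1r. Qed.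

Lemma lie_tens1 a b c : lie (a ⊗ 1) (b ⊗ c) = lie a b ⊗ c.
Proof. by rewrite /lie !H1tens_mul mul1r mulr1 tensDl tensNl. Qed.
Lemma lie_1tens a b c : lie (1 ⊗ a) (b ⊗ c) = b ⊗ lie a c.
Proof. by rewrite /lie !H1tens_mul mul1r mulr1 tensDr tensNr. Qed.

Let hX := h1_comul_gen h1_X.
Let hY := h1_comul_gen h1_Y.

Lemma h1_comul_YX : lie hY hX = hX.
Proof.
rewrite /hY /hX /= lieDl !lieDr !lie_tens1 !lie_1tens H1_lieYX H1_lieYD.
rewrite !liexx !lie1r scale1r !tens0l !tens0r !addr0 add0r.
by rewrite addrAC.
Qed.

Lemma h1_comul_YD n : lie hY (h1_comulD n) = n.+1%:R *: h1_comulD n.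
Proof.
elim: n => [|n IHn].
  rewrite /hY /= lieDl !lieDr !lie_tens1 !lie_1tens H1_lieYD.
  by rewrite !lie1r !scale1r !tens0l !tens0r !addr0 add0r.
rewrite /= -/hX; set d := h1_comulD n in IHn *.
have -> : lie hX d = hX * d + - (d * hX) by [].
rewrite lieDr lieNr !lieMr IHn h1_comul_YX -!scalerAr -!scalerAl.
rewrite [_ *: (d * _) + _]addrC opprD addrACA -scalerBr.
by rewrite [n.+2%:R]mulrS scalerDl scale1r.
Qed.

(* The subalgebra of H1 (x) H1 generated by the delta_n (x) 1 and 1 (x) delta_n:
   it is commutative and contains the coproducts of all delta_n. *)
Inductive h1_comulD_alg : H1H1 -> Prop :=
| hD_l n : h1_comulD_alg (H1D n.+1 ⊗ 1)
| hD_r n : h1_comulD_alg (1 ⊗ H1D n.+1)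
| hD_add x y : h1_comulD_alg x -> h1_comulD_alg y -> h1_comulD_alg (x + y)
| hD_mul x y : h1_comulD_alg x -> h1_comulD_alg y -> h1_comulD_alg (x * y)
| hD_scale c x : h1_comulD_alg x -> h1_comulD_alg (c *: x).

Lemma lie0_gen (A : algType K) (z : A) (x y : A) c : lie z x = 0 -> lie z y = 0 ->
  [/\ lie z (x + y) = 0, lie z (x * y) = 0 & lie z (c *: x) = 0].
Proof.
move=> zx zy; split; first by rewrite lieDr zx zy addr0.
  by rewrite lieMr zx zy mul0r mulr0 addr0.
by rewrite /lie -scalerAl -scalerAr -scalerBr -/(lie z x) zx scaler0.
Qed.

Lemma h1_comulD_algC x y : h1_comulD_alg x -> h1_comulD_alg y -> lie x y = 0.
Proof.
have base z : (forall n, lie z (H1D n.+1 ⊗ 1) = 0) ->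
    (forall n, lie z (1 ⊗ H1D n.+1) = 0) -> forall w, h1_comulD_alg w -> lie z w = 0.
  move=> zl zr w; elim=> // [u v _ zu _ zv|u v _ zu _ zv|c u _ zu].
  - by case: (lie0_gen 0 zu zv).
  - by case: (lie0_gen 0 zu zv).
  - by case: (lie0_gen c zu zu).
move=> Dx; apply: (base x) => n; rewrite lieC; apply/eqP; rewrite oppr_eq0;
  apply/eqP; apply: (base _ _ _ _ Dx) => m;
  rewrite ?lie_tens1 ?lie_1tens ?H1_lieDD ?lie1r ?tens0l ?tens0r //.
Qed.

Lemma h1_comulD_alg_lieX x : h1_comulD_alg x -> h1_comulD_alg (lie hX x).
Proof.
elim=> [n|n|u v _ Du _ Dv|u v Du Dlu Dv Dlv|c u _ Du].
- rewrite /hX /= !lieDl lie_tens1 lie_1tens H1_lieXD.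
  rewrite lie1r tens0r addr0 /lie !H1tens_mul mulr1 mul1r.
  rewrite (lie0 (H1_lieDD 1 n.+1)) subrr addr0; exact: hD_l.
- rewrite /hX /= !lieDl lie_tens1 lie_1tens H1_lieXD lie1r tens0l add0r.
  rewrite /lie !H1tens_mul mulr1 mul1r.
  have -> (a : H1) : a ⊗ (H1Y * H1D n.+1) - a ⊗ (H1D n.+1 * H1Y) =
      n.+1%:R *: ((a ⊗ 1) * (1 ⊗ H1D n.+1)).
    rewrite -tensNr -tensDr -/(lie H1Y _) H1_lieYD tensZr.
    by rewrite H1tens_mul mulr1 mul1r.
  apply: hD_add; first exact: hD_r.
  by apply: hD_scale; apply: hD_mul; [exact: (hD_l 0)|exact: hD_r].
- by rewrite lieDr; apply: hD_add.
- by rewrite lieMr; apply: hD_add; apply: hD_mul.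
- rewrite /lie -scalerAr -scalerAl -scalerBr; exact: hD_scale.
Qed.

Lemma h1_comulD_in n : h1_comulD_alg (h1_comulD n).
Proof.
elim: n => [|n IHn]; last exact: h1_comulD_alg_lieX.
by apply: hD_add; [exact: (hD_l 0)|exact: (hD_r 0)].
Qed.

Lemma h1_comul_lie : @lie_map K _ h1_bracket H1H1 h1_comul_gen.
Proof.
move=> x y; rewrite -/(lie _ _).
case: x y => [||m] [||n]; rewrite /= ?(big_nil, big_seq1) ?scale1r ?scaleN1r.
- exact: liexx.
- by rewrite lieC h1_comul_YX.
- by [].
- exact: h1_comul_YX.
- exact: liexx.
- exact: h1_comul_YD.
- by rewrite lieC.
- by rewrite lieC h1_comul_YD scaleNr.
- by apply: h1_comulD_algC; apply: h1_comulD_in.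
Qed.

Definition H1comul : {lrmorphism H1 -> H1H1} := ulift h1_comul_lie.
Definition H1counit : {lrmorphism H1 -> K^o} := ucounit h1_bracket.

Lemma H1comulE :
  [/\ H1comul H1X = H1X ⊗ 1 + 1 ⊗ H1X + H1D 1 ⊗ H1Y,
      H1comul H1Y = H1Y ⊗ 1 + 1 ⊗ H1Y &
      H1comul (H1D 1) = H1D 1 ⊗ 1 + 1 ⊗ H1D 1].
Proof. by split; apply: ulift_gen. Qed.

Lemma H1counitE :
  [/\ H1counit H1X = 0, H1counit H1Y = 0 & forall n, H1counit (H1D n) = 0].
Proof. by split=> *; apply: ulift_gen. Qed.

End HopfH1.

Definition GL2Qplus := {a : 'M[rat]_2 | 0 < \det a}.

Section GL2QplusGroup.
Implicit Types a b c : GL2Qplus.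

Fact glq_one_subproof : 0 < \det (1%:M : 'M[rat]_2).
Proof. by rewrite det1 ltr01. Qed.
Fact glq_mul_subproof a b : 0 < \det (val a *m val b).
Proof. by rewrite det_mulmx mulr_gt0 ?(valP a) ?(valP b). Qed.
Fact glq_inv_subproof a : 0 < \det (invmx (val a)).
Proof. by rewrite det_inv invr_gt0 (valP a). Qed.

Definition glq_one : GL2Qplus := Sub 1%:M glq_one_subproof.
Definition glq_mul a b : GL2Qplus := Sub (val a *m val b) (glq_mul_subproof a b).
Definition glq_inv a : GL2Qplus := Sub (invmx (val a)) (glq_inv_subproof a).

Lemma glq_unit a : val a \in unitmx.
Proof. by rewrite unitmxE unitfE gt_eqF ?(valP a). Qed.

Fact glq_mulA : associative glq_mul.
Proof. by move=> a b c; apply: val_inj; rewrite /= mulmxA. Qed.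
Fact glq_mul1 : left_id glq_one glq_mul.
Proof. by move=> a; apply: val_inj; rewrite /= mul1mx. Qed.
Fact glq_mul1r : right_id glq_one glq_mul.
Proof. by move=> a; apply: val_inj; rewrite /= mulmx1. Qed.
Fact glq_mulV : left_inverse glq_one glq_inv glq_mul.
Proof. by move=> a; apply: val_inj; rewrite /= mulVmx ?glq_unit. Qed.
Fact glq_mulVr : right_inverse glq_one glq_inv glq_mul.
Proof. by move=> a; apply: val_inj; rewrite /= mulmxV ?glq_unit. Qed.

HB.instance Definition _ := Choice.on GL2Qplus.
HB.instance Definition _ :=
  isGroup.Build GL2Qplus glq_mulA glq_mul1 glq_mul1r glq_mulV glq_mulVr.
HB.instance Definition _ := isPointed.Build GL2Qplus glq_one.
End GL2QplusGroup.


(* R[i] viewed as a numClosedFieldType: this is the view of R[i] for which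
   MathComp-Analysis provides the norm and the topology. *)
Definition cplx (R : realType) : numClosedFieldType := R[i].

Section UpperHalfPlane.
Variable R : realType.
Local Notation C := (cplx R).
Local Notation "x %:C" := ((x)%:C%C : C).
Implicit Types (a b g : GL2Qplus) (k N : nat).

Definition uhp := {z : C | 0 < complex.Im (z : R[i])}.
Implicit Types (f : uhp -> C) (z : uhp).

Definition glq_coef a (i j : 'I_2) : C := (ratr (val a i j) : R)%:C.

(* c z + d *)
Definition automorphy a z : C := glq_coef a 1 0 * val z + glq_coef a 1 1.

Lemma det_mx22 (T : comNzRingType) (M : 'M[T]_2) :
  \det M = M 0 0 * M 1 1 - M 0 1 * M 1 0.
Proof.
rewrite (expand_det_row _ 0) !big_ord_recl big_ord0 /cofactor !det_mx11 !mxE.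
rewrite /= addr0 expr0 mul1r expr1 mulN1r mulrN; congr (_ * M _ _ - M _ _ * M _ _);
  exact: val_inj.
Qed.

Fact moebius_subproof a z :
  0 < complex.Im ((glq_coef a 0 0 * val z + glq_coef a 0 1) / automorphy a z : R[i]).
Proof.
case: z => -[x y] /= y_gt0; rewrite /automorphy /glq_coef /=.
have: 0 < ratr (\det (val a)) :> R by rewrite ltr0q (valP a).
rewrite det_mx22 rmorphB !rmorphM /=.
set p := ratr _; set q := ratr (val a 1 1); set r := ratr (val a 0 1).
set s := ratr _ => det_gt0.
have N_gt0 : 0 < (s * x + q) ^+ 2 + (s * y) ^+ 2.
  rewrite lt_neqAle addr_ge0 ?sqr_ge0 // andbT eq_sym paddr_eq0 ?sqr_ge0 //.
  rewrite !sqrf_eq0 mulf_eq0 (gt_eqF y_gt0) orbF; apply/negP => /andP[sq /eqP s0].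
  by move: sq det_gt0; rewrite s0 mul0r add0r => /eqP ->; rewrite !mulr0 subrr ltxx.
rewrite !mul0r !subr0 !addr0; set D := (_ + _ : R) in N_gt0 *.
have -> : (p * x + r) * - (s * y / D) + p * y * ((s * x + q) / D) =
    (p * q - r * s) * y / D by ring.
by rewrite divr_gt0 ?mulr_gt0.
Qed.

Definition moebius a z : uhp :=
  exist _ ((glq_coef a 0 0 * val z + glq_coef a 0 1) / automorphy a z)
    (moebius_subproof a z).

Definition slash k f a : uhp -> C := fun z =>
  (Num.sqrt (ratr (\det (val a))))%:C ^+ k * f (moebius a z) * automorphy a z ^- k.

(* Differentiation in the complex variable; uhp is open, so the value of the
   extension outside of uhp does not matter. *)
Definition uext f (w : C) : C := if insub w is Some z then f z else 0.
Definition uderiv f : uhp -> C := fun z => derive1 (uext f) (val z).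
Definition holomorphic f : Prop := forall z, derivable (uext f) (val z) 1.

Definition cexp (w : C) : C :=
  let x := complex.Re (w : R[i]) in let y := complex.Im (w : R[i]) in
  (expR x)%:C * (cos y +i* sin y)%C.
Definition twopii : C := (0 +i* (2 * pi))%C.
(* e^(2 pi i z / N) *)
Definition qpar N z : C := cexp (twopii * val z / N%:R).

(* Holomorphy (vanishing) at the cusp oo: f is a convergent power series in
   e^(2 pi i z / N) for some N (with zero constant term). The other cusps are
   reached by slashing with SL2(Z). *)
Definition has_qexp N (c : nat -> C) f : Prop :=
  forall z, series (fun n => c n * qpar N z ^+ n) @ \oo --> f z.
Definition holomorphic_at_oo f : Prop :=
  exists2 N, (0 < N)%N & exists c, has_qexp N c f.
Definition vanishes_at_oo f : Prop :=
  exists2 N, (0 < N)%N & exists2 c, c 0%N = 0 & has_qexp N c f.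

Definition SL2Z : set GL2Qplus :=
  [set a : GL2Qplus | (forall i j, val a i j \is a Num.int) /\ \det (val a) = 1].
Definition Gamma N : set GL2Qplus :=
  [set a : GL2Qplus | SL2Z a /\
    forall i j, exists m : int, val a i j = (i == j)%:R + (m * N%:Z)%:~R].

Definition congruence_subgroup (Gam : set GL2Qplus) : Prop :=
  [/\ Gam `<=` SL2Z, Gam 1%g,
      forall a b, Gam a -> Gam b -> Gam (a * b^-1)%g &
      exists2 N, (0 < N)%N & Gamma N `<=` Gam].

Definition modular_form k (Gam : set GL2Qplus) f : Prop :=
  [/\ holomorphic f, forall g, Gam g -> slash k f g = f &
      forall g, SL2Z g -> holomorphic_at_oo (slash k f g)].

Definition cusp_form k (Gam : set GL2Qplus) f : Prop :=
  modular_form k Gam f /\ forall g, SL2Z g -> vanishes_at_oo (slash k f g).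

(* Elements of a direct sum over the weights are given by their components:
   u k is the component of weight k. *)
Definition gform := nat -> uhp -> C.
Implicit Types (u v : gform).

Definition graded_sum (P : nat -> (uhp -> C) -> Prop) : set gform :=
  [set u : gform | (forall k, P k (u k)) /\ exists d, forall k, (d <= k)%N -> u k = 0].

Definition modforms Gam : set gform := graded_sum (modular_form ^~ Gam).
Definition cuspforms Gam : set gform := graded_sum (cusp_form ^~ Gam).
Definition modforms_all : set gform :=
  \bigcup_(N in [set N | (0 < N)%N]) modforms (Gamma N).
Definition cuspforms_all : set gform :=
  \bigcup_(N in [set N | (0 < N)%N]) cuspforms (Gamma N).

Definition homog k f : gform := fun j => if j == k then f else 0.
Definition gmul u v : gform := fun k => \sum_(i < k.+1) u i * v (k - i)%N.
Definition gslash u a : gform := fun k => slash k (u k) a.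

(* d/dz (log f) *)
Definition dlog f : uhp -> C := fun z => uderiv f z / f z.

(* Dedekind eta: q^(1/24) \prod_(m >= 1) (1 - q^m) *)
Definition eta z : C :=
  cexp (twopii * val z / 24) *
  limn (fun n => \prod_(1 <= m < n) (1 - qpar 1 z ^+ m)).
Definition eta4 z : C := eta z ^+ 4.

Definition mu a : uhp -> C :=
  twopii^-1 *: dlog (fun z => slash 2 eta4 a z / eta4 z).

Definition E4 z : C :=
  1 + 240 * limn (fun n =>
    \sum_(1 <= m < n) m%:R ^+ 3 * (qpar 1 z ^+ m / (1 - qpar 1 z ^+ m))).

Definition gY u : gform := fun k => (k%:R / 2 : C) *: u k.
Definition gX u : gform := fun k =>
  if k is j.+2 then twopii^-1 *: uderiv (u j) - twopii^-1 *: (dlog eta4 * gY u j)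
  else 0.

(* 1/(4 pi i) (l f1' f2 - k f1 f2') for f1, f2 of weights k, l; rankin_cohen1 is
   the bilinear extension to sums of forms of different weights. *)
Definition rc1 k l (f1 f2 : uhp -> C) : uhp -> C :=
  (2 * twopii)^-1 *: (l%:R *: (uderiv f1 * f2) - k%:R *: (f1 * uderiv f2)).
Definition rankin_cohen1 u v : gform := fun n =>
  \sum_(i < n.-1) rc1 i (n - 2 - i) (u i) (v (n - 2 - i)%N).

End UpperHalfPlane.

(* Algebras, Hopf actions and cocycles on a subset S of a K-module V, for
   operations that are only meaningful on S. *)
Section Algebras.
Variables (K : comNzRingType) (V : lmodType K).
Variables (S : set V) (mul : V -> V -> V) (one : V).

Record unital_algebra : Prop := {
  ualg0 : S 0;
  ualgP : forall c a b, S a -> S b -> S (c *: a + b);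
  ualg1 : S one;
  ualgM : forall a b, S a -> S b -> S (mul a b);
  ualg_linl : forall c a b d, S a -> S b -> S d ->
    mul (c *: a + b) d = c *: mul a d + mul b d;
  ualg_linr : forall c a b d, S a -> S b -> S d ->
    mul d (c *: a + b) = c *: mul d a + mul d b;
  ualgA : forall a b d, S a -> S b -> S d -> mul a (mul b d) = mul (mul a b) d;
  ualg1l : forall a, S a -> mul one a = a;
  ualg1r : forall a, S a -> mul a one = a
}.

Section Hopf.
Variables (H : algType K) (Delta : H -> tensor H H) (eps : H -> K).
Variable act : H -> V -> V.

Record hopf_action : Prop := {
  hact_in : forall h a, S a -> S (act h a);
  hact_linr : forall h c a b, S a -> S b ->
    act h (c *: a + b) = c *: act h a + act h b;
  hact_linl : forall c h h' a, S a -> act (c *: h + h') a = c *: act h a + act h' a;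
  hact1 : forall a, S a -> act 1 a = a;
  hactM : forall h h' a, S a -> act (h * h') a = act h (act h' a);
  hact_mul : forall h (s : seq (H * H)) a b, S a -> S b ->
    Delta h = \sum_(p <- s) tens p.1 p.2 ->
    act h (mul a b) = \sum_(p <- s) mul (act p.1 a) (act p.2 b);
  hact_one : forall h, act h one = eps h *: one
}.

(* a1, a2 |-> \sum h(a1) h'(a2) for t = \sum h (x) h' *)
Definition chi (t : tensor H H) (a b : V) : V :=
  \sum_(p <- repr t) mul (act p.1 a) (act p.2 b).

End Hopf.

Record hochschild_2cocycle (c : V -> V -> V) : Prop := {
  hoch_in : forall a b, S a -> S b -> S (c a b);
  hoch_linl : forall k a b d, S a -> S b -> S d ->
    c (k *: a + b) d = k *: c a d + c b d;
  hoch_linr : forall k a b d, S a -> S b -> S d ->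
    c d (k *: a + b) = k *: c d a + c d b;
  hoch_cocycle : forall a1 a2 a3, S a1 -> S a2 -> S a3 ->
    mul a1 (c a2 a3) - c (mul a1 a2) a3 + c a1 (mul a2 a3) - mul (c a1 a2) a3 = 0
}.

End Algebras.

Section ModularHecke.
Variable R : realType.
Local Notation C := (cplx R).
Local Notation gform := (gform R).
Variable Gam : set GL2Qplus.

(* Maps on Gam\G+(Q) are given as left Gam-invariant maps on G+(Q). *)
Definition hform := GL2Qplus -> gform.

Definition rcoset (a : GL2Qplus) : set GL2Qplus := [set (g * a)%g | g in Gam].
Definition rcosets : set (set GL2Qplus) := range rcoset.

Definition hecke_in (M : set gform) : set hform :=
  [set F : hform | [/\ forall g a, Gam g -> F (g * a)%g = F a,
               finite_set (rcoset @` [set a | F a <> 0]),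
               forall a, M (F a) &
               forall a g, Gam g -> F (a * g)%g = gslash (F a) g]].
Definition hecke : set hform := hecke_in (@modforms_all R).
Definition hecke0 : set hform := hecke_in (@cuspforms_all R).

(* The summand does not depend on the representative b of the coset c, for
   F1 and F2 in A(Gam). *)
Definition hmul (F1 F2 : hform) : hform := fun a =>
  \sum_(c \in rcosets) let b := get c in
    gmul (F1 b) (gslash (F2 (a * b^-1)%g) b).

Definition hembed (u : gform) : hform := fun a => if `[< Gam a >] then u else 0.
Definition hone : hform := hembed (homog 0 1).
Definition omega4 : hform := hembed (homog 4 (- (1 / 72) *: @E4 R)).

Definition hX (F : hform) : hform := fun a => gX (F a).
Definition hY (F : hform) : hform := fun a => gY (F a).
Definition hdelta n (F : hform) : hform := fun a =>
  gmul (iter n.-1 (@gX R) (homog 2 (mu a))) (F a).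

Definition modular_H1_action (act : H1 C -> hform -> hform) : Prop :=
  [/\ hopf_action hecke hmul hone (@H1comul C) (@H1counit C) act,
      forall F, hecke F -> act (H1Y C) F = hY F,
      forall F, hecke F -> act (H1X C) F = hX F &
      forall n F, (0 < n)%N -> hecke F -> act (H1D C n) F = hdelta n F].

End ModularHecke.

(* Main.v *)
(* With D = (2 pi i)^-1 d/dz, the logarithmic derivative of eta^4 is 2 pi i G where
   G = E_2 / 6, so X f = D f - (k/2) G f in weight k and
   mu_a = G|a - G - kappa_a, kappa_a(z) = 2 c / (2 pi i (c z + d)).
   Hence mu is a cocycle, mu_(ab) = mu_a|b + mu_b, and differentiating f|a gives
   X (f|a) = (X f)|a + mu_a Y (f|a). The transformation of E_2 under z -> -1/z says
   that mu vanishes on SL_2(Z); it is obtained by comparing the two orders of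
   summation of the conditionally convergent series of (m z + n)^-2. Writing a
   rational matrix as an integral one of determinant 1 times an upper triangular one,
   f|a is a modular form of some level whenever f is, and mu_a is one of weight 2.
   These two rules, summed over cosets, are the compatibilities of X, Y and delta_1
   with the product of A(Gamma); the other delta_n are iterated commutators.
   Ramanujan's equation D G - G^2/2 = - E_4/72, i.e. the convolution formula for the
   divisor sum sigma_1, gives omega|a - omega = X mu_a - mu_a^2/2 for omega = - E_4/72,
   which is the assertion on the Schwarzian derivation. *)

Require Import Defs.
From mathcomp Require Import all_boot all_order all_algebra.
From mathcomp Require Import all_classical all_reals all_analysis.
From mathcomp Require Import ring lra zify.
From mathcomp.real_closed Require Import complex.
Set Implicit Arguments.
Unset Strict Implicit.
Unset Printing Implicit Defensive.
Import Order.TTheory GRing.Theory Num.Theory.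
Import numFieldNormedType.Exports.
Local Open Scope classical_set_scope.
Local Open Scope ring_scope.

(** * Real-valued norm of complex numbers *)

(** The analysis rests on absolutely convergent series, with two interchange theorems, Tannery's and
    Fubini's; no contour integral occurs. Closure of modular forms under differentiation is proved
    on q-expansions, where the derivative multiplies the n-th coefficient by a multiple of n and so
    keeps a vanishing constant term. The partial fractions of the cotangent come from its
    duplication formula, iterated and passed to the limit. The obstacle in weight 2 is conditional
    convergence: a telescoping comparison series is subtracted to make the double series absolutely
    convergent, and the value of the comparison depends on the order of summation by exactly the
    anomalous term of [Gf]. On the algebraic side, linearity of [gX] is available only for
    holomorphic components, so products and actions are studied relative to the subset A(Gamma) of
    the space of all maps. Since the coproduct is an algebra map, the product rule is checked on X,
    Y and delta_1 and then propagated. Invariance of the cuspidal ideal under an arbitrary action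
    follows from its agreement with the constructed one. *)

Section ComplexNorm.
Variable R : realType.
Local Notation C := (cplx R).
Local Notation "x %:C" := ((x)%:C%C : C).
Implicit Types (x y z : C) (a b : nat -> C).

(* The norm of the numClosedFieldType cplx R takes its values in cplx R. *)
Definition nm (x : C) : R := complex.Re (`|x| : C).

Lemma nmE x : (nm x)%:C = `|x|.
Proof. by rewrite /nm /cplx normc_def. Qed.

Lemma lecRE (r s : R) : ((r%:C : C) <= s%:C) = (r <= s).
Proof. exact: lecR. Qed.
Lemma ltcRE (r s : R) : ((r%:C : C) < s%:C) = (r < s).
Proof. exact: ltcR. Qed.
Lemma RtoCD (r s : R) : (r + s)%:C = r%:C + s%:C.
Proof. exact: rmorphD. Qed.
Lemma RtoCN (r : R) : (- r)%:C = - r%:C.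
Proof. exact: rmorphN. Qed.
Lemma RtoCM (r s : R) : (r * s)%:C = r%:C * s%:C.
Proof. exact: rmorphM. Qed.
Lemma RtoCX (r : R) n : (r ^+ n)%:C = r%:C ^+ n.
Proof. exact: rmorphXn. Qed.
Lemma RtoCV (r : R) : (r^-1)%:C = r%:C^-1.
Proof. exact: (fmorphV (real_complex R)). Qed.
Lemma RtoC_nat n : n%:R%:C = n%:R.
Proof. exact: rmorph_nat. Qed.
Lemma RtoCI : injective (fun r : R => r%:C).
Proof. by move=> r s []. Qed.

Lemma nm_ge0 x : 0 <= nm x.
Proof. by rewrite -lecRE nmE normr_ge0. Qed.
Lemma nm_eq0 x : (nm x == 0) = (x == 0).
Proof.
by rewrite -(normr_eq0 x) -nmE; apply/eqP/eqP => [-> //|/RtoCI].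
Qed.
Lemma nm0 : nm 0 = 0. Proof. by apply/eqP; rewrite nm_eq0. Qed.
Lemma nm_gt0 x : (0 < nm x) = (x != 0).
Proof. by rewrite lt_neqAle nm_ge0 andbT eq_sym nm_eq0. Qed.
Lemma nm1 : nm 1 = 1. Proof. by apply: RtoCI; rewrite nmE normr1. Qed.
Lemma nmN x : nm (- x) = nm x. Proof. by apply: RtoCI; rewrite !nmE normrN. Qed.
Lemma nmM x y : nm (x * y) = nm x * nm y.
Proof. by apply: RtoCI; rewrite RtoCM !nmE normrM. Qed.
Lemma nmX x n : nm (x ^+ n) = nm x ^+ n.
Proof. by apply: RtoCI; rewrite RtoCX !nmE normrX. Qed.
Lemma nmV x : nm (x^-1) = (nm x)^-1.
Proof. by apply: RtoCI; rewrite RtoCV !nmE normfV. Qed.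
Lemma nmD x y : nm (x + y) <= nm x + nm y.
Proof. by rewrite -lecRE RtoCD !nmE ler_normD. Qed.
Lemma nmB x y : nm (x - y) <= nm x + nm y.
Proof. by rewrite -(nmN y) nmD. Qed.
Lemma nm_distC x y : nm (x - y) = nm (y - x).
Proof. by rewrite -nmN opprB. Qed.
Lemma nm_real (r : R) : nm r%:C = `|r|.
Proof. by rewrite /nm /cplx normc_def /= expr0n /= addr0 sqrtr_sqr. Qed.
Lemma nm_nat n : nm n%:R = n%:R.
Proof. by rewrite -RtoC_nat nm_real normr_nat. Qed.
Lemma nm_sqr x : nm x ^+ 2 = complex.Re x ^+ 2 + complex.Im x ^+ 2.
Proof. by apply: RtoCI; rewrite RtoCX nmE add_Re2_Im2. Qed.
Lemma Re_le_nm x : `|complex.Re x| <= nm x.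
Proof. by rewrite -lecRE nmE normc_ge_Re. Qed.
Lemma Im_le_nm x : `|complex.Im x| <= nm x.
Proof.
rewrite -(@ler_pXn2r _ 2) ?nnegrE ?nm_ge0 // nm_sqr real_normK ?num_real //.
by rewrite lerDr sqr_ge0.
Qed.
Lemma nm_le_ReIm x : nm x <= `|complex.Re x| + `|complex.Im x|.
Proof.
rewrite -(@ler_pXn2r _ 2) ?nnegrE ?nm_ge0 ?addr_ge0 // nm_sqr sqrrD.
rewrite !real_normK ?num_real // lerD2r lerDl.
by rewrite mulrn_wge0 // mulr_ge0.
Qed.
Lemma nm_sum (I : Type) (r : seq I) (P : pred I) (F : I -> C) :
  nm (\sum_(i <- r | P i) F i) <= \sum_(i <- r | P i) nm (F i).
Proof.
elim/big_rec2: _ => [|i y1 y2 _ le12]; first by rewrite nm0.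
by rewrite (le_trans (nmD _ _)) // lerD2l.
Qed.

Lemma ReD x y : complex.Re (x + y) = complex.Re x + complex.Re y.
Proof. exact: (raddfD (@complex.Re R)). Qed.
Lemma ImD x y : complex.Im (x + y) = complex.Im x + complex.Im y.
Proof. exact: (raddfD (@complex.Im R)). Qed.
Lemma ReN x : complex.Re (- x) = - complex.Re x. Proof. by case: x. Qed.
Lemma ImN x : complex.Im (- x) = - complex.Im x. Proof. by case: x. Qed.
Lemma Re_sum (I : Type) (r : seq I) (P : pred I) (F : I -> C) :
  complex.Re (\sum_(i <- r | P i) F i) = \sum_(i <- r | P i) complex.Re (F i).
Proof. exact: (raddf_sum (@complex.Re R)). Qed.
Lemma Im_sum (I : Type) (r : seq I) (P : pred I) (F : I -> C) :
  complex.Im (\sum_(i <- r | P i) F i) = \sum_(i <- r | P i) complex.Im (F i).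
Proof. exact: (raddf_sum (@complex.Im R)). Qed.

(** Positivity in [cplx R] forces the imaginary part to vanish, so radii and epsilons can be taken
    real; the descriptions of limits and neighbourhoods by [nm] below depend on this. *)
Lemma posCE (e : C) : 0 < e -> exists2 r : R, 0 < r & e = r%:C.
Proof.
case: e => r s; rewrite ltcE /= => /andP[/eqP s0 r0]; exists r => //.
by rewrite s0.
Qed.

Lemma cvgCP (T : Type) (F : set_system T) {FF : Filter F} (f : T -> C) (l : C) :
  (f @ F --> l) <-> forall e : R, 0 < e -> \forall t \near F, nm (f t - l) < e.
Proof.
split=> [/cvgrPdist_lt H|H]; last apply/cvgrPdist_lt; move=> e e0.
  have := H e%:C; rewrite -[0]/(0%:C) ltcRE => /(_ e0).
  by apply: filterS => t; rewrite -nmE ltcRE nm_distC.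
have [r r0 ->] := posCE e0; apply: filterS (H _ r0) => t.
by rewrite -nmE ltcRE nm_distC.
Qed.

Lemma nbhsCP x (P : set C) :
  nbhs x P <-> exists2 d : R, 0 < d & forall y, nm (y - x) < d -> P y.
Proof.
rewrite nbhs_ballP; split=> -[e /= e0 He].
  have [r r0 er] := posCE e0; exists r => // y yx; apply: He.
  by rewrite /ball /= er -nmE ltcRE nm_distC.
exists e%:C => /=; first by rewrite -[0]/(0%:C) ltcRE.
by move=> y; rewrite /ball /= -nmE ltcRE nm_distC => /He.
Qed.
End ComplexNorm.

Lemma cvg_sumn (K : numFieldType) (V : normedModType K) (T : Type)
    (F : set_system T) {FF : Filter F} (f : nat -> T -> V) (l : nat -> V) m n :
  (forall i, f i @ F --> l i) ->
  (fun t => \sum_(m <= i < n) f i t) @ F --> \sum_(m <= i < n) l i.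
Proof.
move=> fl; elim: (index_iota m n) => [|i s IHs].
  under eq_fun do rewrite big_nil; rewrite big_nil; exact: cvg_cst.
under eq_fun do rewrite big_cons.
by rewrite big_cons; apply: cvgD.
Qed.

(** * Absolutely convergent series *)

Section RealSeries.
Variable R : realType.
Implicit Types (b : nat -> R).

Lemma ge0_series_tail b (B : R) : (forall i, 0 <= b i) ->
  (forall n, series b n <= B) ->
  forall e : R, 0 < e -> exists K, forall m, \sum_(K <= i < m) b i <= e.
Proof.
move=> b0 bB e e0.
have nd : nondecreasing_seq (series b).
  by apply/nondecreasing_seqP => n; rewrite /series /= big_nat_recr //= lerDl.
have cv : cvgn (series b).
  apply: nondecreasing_is_cvgn => //; exists B => _ [n _ <-]; exact: bB.
have le_lim n : series b n <= limn (series b) by apply: nondecreasing_cvgn_le.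
have /cvgrPdist_lt/(_ e e0)[K _ HK] := cv.
exists K => m; have [mK|Km] := leqP m K.
  by rewrite big_geq // ltW.
rewrite -(lerD2l (series b K)) /series /= -big_cat_nat //=; last exact: ltnW.
apply: (le_trans (le_lim m)); rewrite -lerBlDl.
have := HK K (leqnn K); rewrite ger0_norm ?subr_ge0 //; exact: ltW.
Qed.

Lemma ge0_series_limP b (B : R) : (forall i, 0 <= b i) ->
  (forall n, series b n <= B) ->
  [/\ series b @ \oo --> limn (series b), limn (series b) <= B &
      forall n, series b n <= limn (series b)].
Proof.
move=> b0 bB.
have nd : nondecreasing_seq (series b).
  by apply/nondecreasing_seqP => n; rewrite /series /= big_nat_recr //= lerDl.
have cv : cvgn (series b).
  apply: nondecreasing_is_cvgn => //; exists B => _ [n _ <-]; exact: bB.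
split=> // [|n]; last by apply: nondecreasing_cvgn_le.
by apply: limr_le => //; apply: nearW.
Qed.
End RealSeries.

Section AbsSum.
Variable R : realType.
Local Notation C := (cplx R).
Implicit Types (x y z : C) (a b : nat -> C).

(** The bound [B] is kept explicit because [csum_nm_le] turns it into a bound on the sum itself,
    which is how remainders of power series are estimated. *)
Definition abounded a (B : R) := forall n, \sum_(0 <= i < n) nm (a i) <= B.
Definition absum a := exists B, abounded a B.
Definition csum a : C := limn (series a).

Lemma cvgnCP (u : nat -> C) (l : C) :
  (u @ \oo --> l) <->
  forall e : R, 0 < e -> exists N, forall n, (N <= n)%N -> nm (u n - l) < e.
Proof.
split=> [/cvgCP H e e0|H]; first by have [N _ HN] := H e e0; exists N.
by apply/cvgCP => e /H[N HN]; exists N.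
Qed.

Lemma absum_cvg a : absum a -> series a @ \oo --> csum a.
Proof.
move=> [B aB].
(* Serves both the real and the imaginary part, each dominated by the norm, so that completeness is
   invoked for real series. *)
have bd (f : C -> R) : (forall x, `|f x| <= nm x) -> cvgn (series (f \o a)).
  move=> fn; apply: normed_cvg.
  apply: nondecreasing_is_cvgn.
    apply/nondecreasing_seqP => n.
    change (series (fun n => `|f (a n)|) n <= series (fun n => `|f (a n)|) n.+1).
    by rewrite /series /= big_nat_recr //= lerDl.
  exists B => _ [n _ <-]; apply: le_trans (aB n).
  change (series (fun n => `|f (a n)|) n <= \sum_(0 <= i < n) nm (a i)).
  by rewrite /series /=; apply: ler_sum => i _; apply: fn.
have /cvgrPdist_lt rc := bd _ (@Re_le_nm R).
have /cvgrPdist_lt ic := bd _ (@Im_le_nm R).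
set r := lim _ in rc; set s := lim _ in ic.
suff H : series a @ \oo --> ((r +i* s)%C : C) by rewrite /csum (cvg_lim _ H).
apply/cvgCP => e e0; have e20 : 0 < e / 2 by rewrite divr_gt0.
near=> n.
apply: (le_lt_trans (nm_le_ReIm _)); rewrite ReD ImD ReN ImN /=.
rewrite Re_sum Im_sum [e](splitr e).
apply: ltrD; rewrite distrC.
  by near: n; apply: rc.
by near: n; apply: ic.
Unshelve. all: by end_near. Qed.

Lemma csumE a s : series a @ \oo --> s -> csum a = s.
Proof. exact: cvg_lim. Qed.

Lemma nm_lim_le (u : nat -> C) l c (T : R) K : u @ \oo --> l ->
  (forall n, (K <= n)%N -> nm (u n - c) <= T) -> nm (l - c) <= T.
Proof.
move=> /cvgnCP ul uT; rewrite leNgt; apply/negP => lt.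
have := ul (nm (l - c) - T); rewrite subr_gt0 => /(_ lt)[N HN].
have := HN (maxn N K) (leq_maxl _ _); have := uT (maxn N K) (leq_maxr _ _).
move: (u _) => v vT; rewrite ltNge => /negP; apply.
rewrite lerBlDr; apply: le_trans (lerD (lexx _) vT).
rewrite [nm (v - l)]nm_distC; apply: le_trans (nmD _ _).
by rewrite addrA subrK.
Qed.

Lemma csum_tail a K (T : R) : absum a ->
  (forall m, \sum_(K <= i < m) nm (a i) <= T) ->
  nm (csum a - series a K) <= T.
Proof.
move=> /absum_cvg ac aT; apply: (nm_lim_le (K := K) ac) => n Kn.
rewrite /series /= (big_cat_nat _ Kn) //= [X in nm X]addrC addKr.
exact: (le_trans (nm_sum _ _ _)).
Qed.

Lemma csum_nm_le a (B : R) : abounded a B -> nm (csum a) <= B.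
Proof.
move=> aB; have := @csum_tail a 0 B; rewrite /series /= big_geq // subr0.
by apply=> //; exists B.
Qed.

Lemma absum_le a (b : nat -> R) (B : R) : (forall i, nm (a i) <= b i) ->
  (forall n, \sum_(0 <= i < n) b i <= B) -> absum a.
Proof.
move=> ab bB; exists B => n; apply: le_trans (bB n); apply: ler_sum => i _.
exact: ab.
Qed.

Lemma absumD a b : absum a -> absum b -> absum (fun n => a n + b n).
Proof.
move=> [A aA] [B bB]; exists (A + B) => n; apply: le_trans (lerD (aA n) (bB n)).
by rewrite -big_split /=; apply: ler_sum => i _; apply: nmD.
Qed.

Lemma absumZ (c : C) a : absum a -> absum (fun n => c * a n).
Proof.
move=> [A aA]; exists (nm c * A) => n.
have -> : \sum_(0 <= i < n) nm (c * a i) = nm c * \sum_(0 <= i < n) nm (a i).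
  by rewrite mulr_sumr; apply: eq_bigr => i _; rewrite nmM.
by rewrite ler_wpM2l // nm_ge0.
Qed.

Lemma absumB a b : absum a -> absum b -> absum (fun n => a n - b n).
Proof.
move=> sa sb; have := absumD sa (absumZ (-1) sb).
by under [X in _ -> absum X]eq_fun do rewrite -mulN1r.
Qed.

Lemma seriesD a b : series (fun n => a n + b n) = series a + series b.
Proof. by apply/funext => n; rewrite /series /= big_split. Qed.
Lemma seriesB a b : series (fun n => a n - b n) = series a - series b.
Proof. by apply/funext => n; rewrite /series /= sumrB. Qed.
Lemma seriesZ c a : series (fun n => c * a n) = (fun n => c * series a n).
Proof. by apply/funext => n; rewrite /series /= mulr_sumr. Qed.

Lemma csumD a b : absum a -> absum b ->
  csum (fun n => a n + b n) = csum a + csum b.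
Proof.
move=> sa sb; apply: csumE; rewrite seriesD.
exact: (cvgD (absum_cvg sa) (absum_cvg sb)).
Qed.
Lemma csumB a b : absum a -> absum b ->
  csum (fun n => a n - b n) = csum a - csum b.
Proof.
move=> sa sb; apply: csumE; rewrite seriesB.
exact: (cvgB (absum_cvg sa) (absum_cvg sb)).
Qed.
Lemma csumZ c a : absum a -> csum (fun n => c * a n) = c * csum a.
Proof.
move=> sa; apply: csumE; rewrite seriesZ.
apply: cvgM; [exact: cvg_cst|exact: absum_cvg].
Qed.

Lemma csum_fin a K : (forall n, (K <= n)%N -> a n = 0) ->
  csum a = \sum_(0 <= i < K) a i.
Proof.
move=> a0; apply: csumE; apply/cvgnCP => e e0; exists K => n Kn.
rewrite /series /= (big_cat_nat _ Kn) //= [X in nm X]addrC addKr.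
by rewrite big_nat_cond big1 ?nm0 // => i /andP[/andP[Ki _] _]; apply: a0.
Qed.

Lemma absum_shift a : absum a -> absum (fun n => a n.+1).
Proof.
move=> [B aB]; exists B => n; apply: le_trans (aB n.+1).
by rewrite big_nat_recl // lerDr nm_ge0.
Qed.
Lemma absum_unshift a : absum (fun n => a n.+1) -> absum a.
Proof.
move=> [B aB]; exists (nm (a 0%N) + B) => -[|n].
  rewrite big_geq // addr_ge0 ?nm_ge0 //.
  by have := aB 0%N; rewrite big_geq.
by rewrite big_nat_recl // lerD2l.
Qed.
Lemma csum_recl a : absum a -> csum a = a 0%N + csum (fun n => a n.+1).
Proof.
move=> sa; have sa' := absum_shift sa; apply: csumE.
rewrite -(cvg_shiftS (series a)).
have -> : (fun n => series a n.+1) = (fun n => a 0%N + series (fun n => a n.+1) n).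
  by apply/funext => n; rewrite /series /= big_nat_recl.
by apply: cvgD; [exact: cvg_cst|exact: absum_cvg].
Qed.

(** Dominated convergence for series. Past an index [K] where the tail of [b] is at most e/4, every
    sum in sight is within e/4 of its partial sum, and the partial sums up to [K] converge term by
    term. *)
Lemma tannery (u : nat -> nat -> C) a (b : nat -> R) (B : R) N0 :
  (forall N n, (N0 <= N)%N -> nm (u N n) <= b n) ->
  (forall n, \sum_(0 <= i < n) b i <= B) ->
  (forall n, (fun N => u N n) @ \oo --> a n) ->
  absum a /\ (fun N => csum (u N)) @ \oo --> csum a.
Proof.
move=> ub bB ua.
have ab n : nm (a n) <= b n.
  have := @nm_lim_le (fun N => u N n) (a n) 0 (b n) N0; rewrite subr0.
  by apply; [exact: ua|move=> N N0N; rewrite subr0 ub].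
have sa : absum a by apply: absum_le ab bB.
have b0 n : 0 <= b n by apply: le_trans (ab n); apply: nm_ge0.
split=> //; apply/cvgnCP => e e0; have e40 : 0 < e / 4 by rewrite divr_gt0.
have [K HK] := ge0_series_tail b0 bB e40.
have ca : (fun N => series (u N) K) @ \oo --> series a K.
  by apply: cvg_sumn => i; apply: ua.
have /cvgnCP/(_ _ e40)[N1 HN1] := ca.
exists (maxn N0 N1) => N; rewrite geq_max => /andP[N0N N1N].
have su : absum (u N) by apply: absum_le (fun n => ub N n N0N) bB.
have t1 : nm (csum (u N) - series (u N) K) <= e / 4.
  apply: csum_tail => // m; apply: le_trans (HK m); apply: ler_sum => i _.
  exact: ub.
have t2 : nm (csum a - series a K) <= e / 4.
  apply: csum_tail => // m; apply: le_trans (HK m); apply: ler_sum => i _.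
  exact: ab.
have -> : csum (u N) - csum a = (csum (u N) - series (u N) K)
  + (series (u N) K - series a K) - (csum a - series a K) by ring.
apply: (le_lt_trans (nmB _ _)); apply: (@le_lt_trans _ _ (e / 4 + e / 4 + e / 4)).
  apply: lerD => //; apply: (le_trans (nmD _ _)); apply: lerD => //.
  by apply: ltW; apply: HN1.
lra.
Qed.

(** The partial sums over the rows, read as series along [n], are dominated by the sums of norms in
    the columns; Tannery's theorem then moves the limit over rows inside the sum over columns. *)
Lemma fubini_nat (a : nat -> nat -> C) (B : R) :
  (forall M N, \sum_(0 <= m < M) \sum_(0 <= n < N) nm (a m n) <= B) ->
  [/\ (forall m, absum (a m)), (forall n, absum (a ^~ n)),
      absum (fun m => csum (a m)), absum (fun n => csum (a ^~ n)) &
      csum (fun m => csum (a m)) = csum (fun n => csum (a ^~ n))].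
Proof.
(* Stated for any array so that it applies to [a] and to its transpose; [b n] will be the sum of the
   norms in column [n]. *)
have main (c : nat -> nat -> C) (cB : forall M N,
    \sum_(0 <= m < M) \sum_(0 <= n < N) nm (c m n) <= B) :
    (forall m, absum (c m)) /\ exists b : nat -> R,
    [/\ (forall M n, \sum_(0 <= m < M) nm (c m n) <= b n),
        (forall N, \sum_(0 <= n < N) b n <= B) & absum (fun n => csum (c ^~ n))].
  have rB m N : \sum_(0 <= n < N) nm (c m n) <= B.
    apply: le_trans (cB m.+1 N); rewrite big_nat_recr //= lerDr.
    by do 2!(apply: sumr_ge0 => ? _); apply: nm_ge0.
  have qB n M : series (fun m => nm (c m n)) M <= B.
    apply: le_trans (cB M n.+1); apply: ler_sum => m _.
    rewrite big_nat_recr //= lerDr; apply: sumr_ge0 => ? _; exact: nm_ge0.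
  pose b n := limn (series (fun m => nm (c m n))).
  have bP n := ge0_series_limP (fun m => nm_ge0 (c m n)) (qB n).
  have bB N : \sum_(0 <= n < N) b n <= B.
    have cv : (fun M => \sum_(0 <= n < N) series (fun m => nm (c m n)) M) @ \oo -->
        \sum_(0 <= n < N) b n.
      by apply: cvg_sumn => n; have [] := bP n.
    rewrite -(cvg_lim _ cv) //; apply: limr_le.
      by apply/cvg_ex; eexists; exact: cv.
    by apply: nearW => M /=; rewrite exchange_big.
  split=> [m|]; first by exists B => N; apply: rB.
  exists b; split=> // [M n|]; first by have [_ _] := bP n; apply.
  apply: (@absum_le _ b B) => // n; apply: csum_nm_le => M.
  by have [_ _] := bP n; apply.
move=> aB; have [s1 _] := main a aB.
have aB' N M : \sum_(0 <= n < N) \sum_(0 <= m < M) nm (a m n) <= B.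
  by rewrite exchange_big.
have [s2 [b [bm bB s4]]] := main (fun n m => a m n) aB'.
have [_ [b' [bm' bB' s3]]] := main a aB.
split=> //.
apply: csumE.
have [||_ cv] := @tannery (fun M n => \sum_(0 <= m < M) a m n)
    (fun n => csum (a ^~ n)) b' B 0 _ bB'.
- by move=> M n _; apply: le_trans (bm' M n); apply: nm_sum.
- by move=> n; apply: absum_cvg; apply: s2.
have -> // : series (fun m => csum (a m)) =
  (fun M => csum (fun n => \sum_(0 <= m < M) a m n)).
apply/funext => M; rewrite /series /=; elim: M => [|M IH].
  rewrite big_geq // (@csum_fin _ 0) ?big_geq // => n _; exact: big_geq.
rewrite big_nat_recr //= IH -csumD //.
  by congr csum; apply/funext => n; rewrite big_nat_recr.
by apply: (@absum_le _ b' B) => // n; apply: le_trans (bm' M n); apply: nm_sum.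
Qed.
End AbsSum.

(** * Complex derivatives *)

Section ComplexDerivative.
Variable R : realType.
Local Notation C := (cplx R).
Implicit Types (x y z w h : C) (f g : C -> C).

(** The o(h) form of differentiability with real epsilons. Nothing is divided by h, so h = 0 needs
    no separate case in the rules for products and compositions. *)
Definition cder f x (d : C) := forall e : R, 0 < e ->
  \forall h \near (0 : C), nm (f (x + h) - f x - h * d) <= e * nm h.

Lemma near_nm_lt (s : R) : 0 < s -> \forall h \near (0 : C), nm h < s.
Proof. by move=> s0; apply/nbhsCP; exists s => // h; rewrite subr0. Qed.

Lemma is_deriveCP f x (d : C) : is_derive (x : C) (1 : C) f d <-> cder f x d.
Proof.
split=> [[df fd] e e0|H].
  have /cvgCP/(_ e e0) : (fun h : C => h^-1 *: ((f \o shift x) (h *: (1 : C)) - f x)) @ 0^' --> d.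
    by rewrite -fd.
  rewrite /dnbhs /within /= => /nbhsCP[s s0 Hs]; apply/nbhsCP; exists s => // h hs.
  have [->|h0] := eqVneq h 0; first by rewrite addr0 subrr mul0r subrr nm0 mulr0.
  move: (Hs h hs h0); rewrite -[h *: 1]/(h * 1) mulr1 -[_ *: _]/(_ * _) (addrC h) => /ltW.
  rewrite -(@ler_pM2r _ (nm h)) ?nm_gt0 // -nmM mulrBl mulrAC mulVf // mul1r.
  by rewrite (mulrC d).
suff cv : (fun h : C => h^-1 *: ((f \o shift x) (h *: (1 : C)) - f x)) @ 0^' --> d.
  split; first by apply: cvgP cv.
  exact: cvg_lim cv.
apply/cvgCP => e e0; have e20 : 0 < e / 2 by rewrite divr_gt0.
have /nbhsCP[s s0 Hs] := H _ e20.
rewrite /dnbhs /within /=; apply/nbhsCP; exists s => // h hs h0; move: (Hs h hs).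
rewrite -[h *: 1]/(h * 1) mulr1 -[_ *: _]/(_ * _) (addrC h) => le.
rewrite -(@ltr_pM2r _ (nm h)) ?nm_gt0 // -nmM mulrBl mulrAC mulVf // mul1r.
rewrite (mulrC d); apply: le_lt_trans le _.
rewrite ltr_pM2r ?nm_gt0 // ltr_pdivrMr // ltr_pMr // ltr1n //.
Qed.

Lemma is_derive_eps (f : R -> R) (x d e : R) : is_derive x 1 f d -> 0 < e ->
  exists2 s : R, 0 < s &
    forall h : R, `|h| < s -> `|f (x + h) - f x - h * d| <= e * `|h|.
Proof.
move=> [df fd] e0.
have /cvgrPdist_lt/(_ e e0) :
    (fun h : R => h^-1 *: ((f \o shift x) (h *: (1 : R)) - f x)) @ 0^' --> d by rewrite -fd.
rewrite /dnbhs /within /= => /nbhs_ballP[s /= s0 Hs]; exists s => // h hs.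
have [->|h0] := eqVneq h 0; first by rewrite addr0 subrr mul0r subrr normr0 mulr0.
have := Hs h; rewrite /ball /= sub0r normrN => /(_ hs h0) /=.
rewrite -[h *: 1]/(h * 1) mulr1 -[_ *: _]/(_ * _) (addrC h) distrC => /ltW.
rewrite -(@ler_pM2r _ `|h|) ?normr_gt0 // -normrM mulrBl mulrAC mulVf // mul1r.
by rewrite (mulrC d).
Qed.

Lemma cder_quad f x (d : C) (K s : R) : 0 < s ->
  (forall h, nm h < s -> nm (f (x + h) - f x - h * d) <= K * nm h ^+ 2) ->
  cder f x d.
Proof.
move=> s0 Hf e e0; have K0 : 0 < `|K| + 1 by rewrite ltr_wpDl.
near=> h; have hs : nm h < s by near: h; apply: near_nm_lt.
have he : nm h < e / (`|K| + 1).
  by near: h; apply: near_nm_lt; rewrite divr_gt0.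
apply: le_trans (Hf _ hs) _; rewrite expr2 mulrA ler_wpM2r ?nm_ge0 //.
move: he; rewrite ltr_pdivlMr // mulrC => /ltW; apply: le_trans.
by rewrite ler_wpM2r ?nm_ge0 // (le_trans (ler_norm K)) // lerDl.
Unshelve. all: by end_near. Qed.

Lemma cder_near f g x (d : C) : (\forall y \near x, f y = g y) -> cder f x d -> cder g x d.
Proof.
move=> /nbhsCP[s s0 fg] H e /H /nbhsCP[t t0 Ht].
apply/nbhsCP; exists (Num.min s t) => [|h]; first by rewrite lt_min s0.
rewrite subr0 lt_min => /andP[hs ht]; rewrite -!fg ?subrr ?nm0 //; last by rewrite addrC addKr.
by apply: Ht; rewrite subr0.
Qed.

Lemma cder_cst (c : C) x : cder (fun=> c) x 0.
Proof.
move=> e e0; apply/nbhsCP; exists 1 => // h _.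
by rewrite subrr mulr0 subrr nm0 mulr_ge0 ?nm_ge0 ?ltW.
Qed.

Lemma cder_id x : cder id x 1.
Proof.
move=> e e0; apply/nbhsCP; exists 1 => // h _.
have -> : id (x + h) - id x - h * 1 = 0 by rewrite /=; ring.
by rewrite nm0 mulr_ge0 ?nm_ge0 ?ltW.
Qed.

Lemma cderD f g x (df dg : C) : cder f x df -> cder g x dg ->
  cder (fun y => f y + g y) x (df + dg).
Proof.
move=> Hf Hg e e0; have e20 : 0 < e / 2 by rewrite divr_gt0.
apply: filterS2 (Hf _ e20) (Hg _ e20) => h hf hg.
have -> : f (x + h) + g (x + h) - (f x + g x) - h * (df + dg) =
  (f (x + h) - f x - h * df) + (g (x + h) - g x - h * dg) by ring.
by rewrite [e](splitr e) mulrDl (le_trans (nmD _ _)) // lerD.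
Qed.

Lemma cderM f g x (df dg : C) : cder f x df -> cder g x dg ->
  cder (fun y => f y * g y) x (df * g x + f x * dg).
Proof.
(* [K] collects the coefficients of [e' * nm h] in the three parts of the remainder of the product,
   once [nm h] is at most [e'] and hence at most 1. *)
move=> Hf Hg e e0; pose K := nm (g x) + nm dg + 1 + nm (f x) + nm df + nm df * nm dg.
have K0 : 0 < K.
  rewrite /K; have := nm_ge0 (g x); have := nm_ge0 dg; have := nm_ge0 (f x).
  have := nm_ge0 df; have := mulr_ge0 (nm_ge0 df) (nm_ge0 dg); lra.
pose e' := Num.min 1 (e / K).
have e'0 : 0 < e' by rewrite lt_min ltr01 divr_gt0.
have [e'1 e'e] : e' <= 1 /\ e' <= e / K by apply/andP; rewrite -le_min.
near=> h.
have h1 : nm h <= e' by apply: ltW; near: h; apply: near_nm_lt.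
have rf : nm (f (x + h) - f x - h * df) <= e' * nm h by near: h; apply: Hf.
have rg : nm (g (x + h) - g x - h * dg) <= e' * nm h by near: h; apply: Hg.
set r1 := f _ - f x - _ in rf *; set r2 := g _ - g x - _ in rg *.
have -> : f (x + h) = f x + h * df + r1 by rewrite /r1; ring.
have -> : g (x + h) = g x + h * dg + r2 by rewrite /r2; ring.
have -> : (f x + h * df + r1) * (g x + h * dg + r2) - f x * g x -
    h * (df * g x + f x * dg) =
  r1 * (g x + h * dg + r2) + (f x + h * df) * r2 + h * h * (df * dg) by ring.
have H1 : nm h <= 1 by apply: le_trans e'1.
have n0 := nm_ge0 h; have g0 := nm_ge0 dg; have f0 := nm_ge0 df.
have nr2 : nm r2 <= 1 by apply: le_trans rg _; rewrite -[1]mulr1 ler_pM // ltW.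
have B1 : nm (g x + h * dg + r2) <= nm (g x) + nm dg + 1.
  do 2!(apply: le_trans (nmD _ _) _; apply: lerD => //).
  by rewrite nmM -[leRHS]mul1r ler_wpM2r.
have B2 : nm (f x + h * df) <= nm (f x) + nm df.
  apply: le_trans (nmD _ _) _; apply: lerD => //.
  by rewrite nmM -[leRHS]mul1r ler_wpM2r.
apply: (@le_trans _ _ (e' * nm h * K)).
  rewrite /K; apply: le_trans (nmD _ _) _; apply: le_trans (lerD (nmD _ _) (lexx _)) _.
  rewrite !nmM; have := ler_pM (nm_ge0 _) (nm_ge0 _) rf B1.
  have := ler_pM (nm_ge0 _) (nm_ge0 _) B2 rg.
  have : nm h * nm h * (nm df * nm dg) <= e' * nm h * (nm df * nm dg).
    by do 2!(apply: ler_wpM2r => //; rewrite ?mulr_ge0 //).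
  lra.
by rewrite mulrAC ler_wpM2r // -ler_pdivlMr.
Unshelve. all: by end_near. Qed.

Lemma cderZ (c : C) f x (df : C) : cder f x df -> cder (fun y => c * f y) x (c * df).
Proof.
by move=> Hf; have := cderM (cder_cst c x) Hf; rewrite mul0r add0r.
Qed.

Lemma cder_comp f g x (df dg : C) : cder f (g x) df -> cder g x dg ->
  cder (f \o g) x (df * dg).
Proof.
move=> Hf Hg e e0; pose K := nm dg + 1 + nm df.
have f0 := nm_ge0 df; have g0 := nm_ge0 dg.
have K0 : 0 < K by rewrite /K; lra.
pose e' := Num.min 1 (e / K).
have e'0 : 0 < e' by rewrite lt_min ltr01 divr_gt0.
have [e'1 e'e] : e' <= 1 /\ e' <= e / K by apply/andP; rewrite -le_min.
have /nbhsCP[s s0 Hs] := Hf _ e'0.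
near=> h.
have rg : nm (g (x + h) - g x - h * dg) <= e' * nm h by near: h; apply: Hg.
set r := g _ - g x - _ in rg.
have kE : g (x + h) - g x = h * dg + r by rewrite /r; ring.
have kb : nm (g (x + h) - g x) <= (nm dg + 1) * nm h.
  rewrite kE mulrDl; apply: le_trans (nmD _ _) _; rewrite nmM mulrC lerD2l.
  by apply: le_trans rg _; rewrite ler_wpM2r ?nm_ge0.
have ks : nm (g (x + h) - g x) < s.
  apply: le_lt_trans kb _; rewrite mulrC -ltr_pdivlMr; last lra.
  by near: h; apply: near_nm_lt; rewrite divr_gt0 //; lra.
have := Hs (g (x + h) - g x); rewrite subr0 => /(_ ks).
rewrite [g x + _]addrC subrK => le.
have -> : (f \o g) (x + h) - (f \o g) x - h * (df * dg) =
   (f (g (x + h)) - f (g x) - (g (x + h) - g x) * df) + r * df by rewrite /= /r; ring.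
apply: (@le_trans _ _ (e' * nm h * K)).
  rewrite /K; apply: le_trans (nmD _ _) _; rewrite nmM.
  have := ler_wpM2r f0 rg; have := ler_wpM2l (ltW e'0) kb; lra.
by rewrite mulrAC ler_wpM2r ?nm_ge0 // -ler_pdivlMr.
Unshelve. all: by end_near. Qed.

Lemma cder_inv x : x != 0 -> cder (fun y => y^-1) x (- x ^- 2).
Proof.
move=> x0; have nx0 : 0 < nm x by rewrite nm_gt0.
apply: (@cder_quad _ _ _ (2 / nm x ^+ 3) (nm x / 2)) => [|h hs].
  by rewrite divr_gt0.
have xh : nm x / 2 <= nm (x + h).
  have := nmB (x + h) h; rewrite addrK => le; lra.
have xh0 : x + h != 0 by rewrite -nm_gt0 (lt_le_trans _ xh) // divr_gt0.
have -> : (x + h)^-1 - x^-1 - h * (- x ^- 2) = h ^+ 2 * (x ^- 2 * (x + h)^-1).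
  by field; rewrite xh0 x0.
rewrite !nmM !nmV !nmX mulrC ler_wpM2r ?exprn_ge0 ?mulr_ge0 ?nm_ge0 //.
have -> : 2 / nm x ^+ 3 = nm x ^- 2 * (2 / nm x) by field; rewrite gt_eqF.
rewrite ler_wpM2l ?invr_ge0 ?exprn_ge0 ?nm_ge0 //.
have -> : 2 / nm x = (nm x / 2)^-1 by rewrite invfM invrK mulrC.
by rewrite lef_pV2 // posrE ?(lt_le_trans _ xh) ?divr_gt0.
Qed.

Lemma nm_cexp w : nm (cexp w) = expR (complex.Re w).
Proof.
rewrite /cexp nmM nm_real ger0_norm ?expR_ge0 //.
rewrite -[RHS]mulr1; congr (_ * _); apply/eqP.
by rewrite -(@eqrXn2 _ 2) ?nm_ge0 // nm_sqr /= cos2Dsin2 expr1n.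
Qed.
Lemma cexp_neq0 w : cexp w != 0.
Proof. by rewrite -nm_gt0 nm_cexp expR_gt0. Qed.
Lemma cexp0 : cexp (0 : C) = 1.
Proof. by rewrite /cexp /= expR0 cos0 sin0 mul1r. Qed.
Lemma cexpD w h : cexp (w + h) = cexp w * cexp h.
Proof.
rewrite /cexp ReD ImD expRD cosD sinD; move: (expR _) (expR _) => a b.
move: (cos _) (sin _) (cos _) (sin _) => c s c' s'.
by apply/eqP; rewrite eq_complex /=; apply/andP; split; apply/eqP; ring.
Qed.
Lemma cexpN w : cexp (- w) = (cexp w)^-1.
Proof.
by apply: (mulfI (cexp_neq0 w)); rewrite -cexpD subrr cexp0 divff ?cexp_neq0.
Qed.
Lemma cexpX w n : cexp w ^+ n = cexp (w *+ n).
Proof.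
by elim: n => [|n IHn]; rewrite ?expr0 ?mulr0n ?cexp0 // exprS IHn -cexpD -mulrS.
Qed.

(** Since [cexp] is built from the real exponential, cosine and sine, its derivative at 0 is
    assembled from their three first order expansions; [cexpD] then carries it to every point. The
    16 exceeds 1 + 3 + 3 + 2, the total of the coefficients in the estimates [t1] and [t2]. *)
Lemma cder_cexp0 : cder (@cexp R) 0 1.
Proof.
move=> e e0; pose e' := Num.min 1 (e / 16).
have e'0 : 0 < e' by rewrite lt_min ltr01 divr_gt0.
have [e'1 e'e] : e' <= 1 /\ e' <= e / 16 by apply/andP; rewrite -le_min.
clearbody e'.
have [s1 s10 H1] := is_derive_eps (is_derive_expR (0 : R)) e'0.
have [s2 s20 H2] := is_derive_eps (is_derive_cos (0 : R)) e'0.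
have [s3 s30 H3] := is_derive_eps (is_derive_sin (0 : R)) e'0.
apply/nbhsCP; exists (Num.min s1 (Num.min s2 (Num.min s3 e'))) => [|h].
  by rewrite !lt_min s10 s20 s30.
rewrite subr0 !lt_min => /and4P[h1 h2 h3 he']; rewrite add0r cexp0 mulr1.
have := le_lt_trans (Re_le_nm h) h1; have := le_lt_trans (Im_le_nm h) h2.
have := le_lt_trans (Im_le_nm h) h3; have := le_lt_trans (Re_le_nm h) he'.
have xn := Re_le_nm h; have yn := Im_le_nm h.
move=> xe ys3 ys2 xs1; apply: le_trans (nm_le_ReIm _) _; rewrite !(ReD, ImD, ReN, ImN) /cexp /=.
move: xn yn xe ys3 ys2 xs1; set x := complex.Re h; set y := complex.Im h => xn yn xe ys3 ys2 xs1.
have := H1 x xs1; have := H2 y ys2; have := H3 y ys3.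
rewrite !add0r expR0 sin0 cos0 oppr0 !mulr1 mulr0 !subr0 !mul0r !subr0 addr0.
move: (expR x) (cos y) (sin y) (nm h) xn yn => E c s n xn yn Hs Hc HE.
have E3 : `|E| <= 3.
  have -> : E = (E - 1 - x) + 1 + x by ring.
  apply: le_trans (ler_normD _ _) _; apply: le_trans (lerD (ler_normD _ _) (lexx _)) _.
  rewrite normr1; have : `|x| <= 1 by apply: le_trans (ltW xe) _.
  have : e' * `|x| <= 1 * 1 by rewrite ler_pM // ?ltW // (lt_le_trans xe).
  lra.
have t1 : `|E * c - 1 - x| <= e' * `|x| + 3 * (e' * `|y|).
  have -> : E * c - 1 - x = (E - 1 - x) + E * (c - 1) by ring.
  apply: le_trans (ler_normD _ _) _; apply: lerD => //.
  by rewrite normrM ler_pM.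
have t2 : `|E * s - y| <= 3 * (e' * `|y|) + 2 * e' * `|y|.
  have -> : E * s - y = E * (s - y) + (E - 1) * y by ring.
  apply: le_trans (ler_normD _ _) _; apply: lerD; first by rewrite normrM ler_pM.
  rewrite normrM ler_wpM2r //.
  have -> : E - 1 = (E - 1 - x) + x by ring.
  apply: le_trans (ler_normD _ _) _.
  have : e' * `|x| <= 1 * e' by rewrite ler_pM // ?ltW.
  lra.
have n0 : 0 <= n by apply: le_trans xn.
have e'x : e' * `|x| <= e / 16 * n by rewrite ler_pM // ltW.
have e'y : e' * `|y| <= e / 16 * n by rewrite ler_pM // ltW.
have en : 0 <= e * n by rewrite mulr_ge0 // ltW.
rewrite !addr0; lra.
Qed.

Lemma cder_cexp w : cder (@cexp R) w (cexp w).
Proof.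
move=> e e0; have N0 : 0 < nm (cexp w) by rewrite nm_gt0 cexp_neq0.
have e'0 : 0 < e / nm (cexp w) by rewrite divr_gt0.
apply: filterS (cder_cexp0 e'0) => h.
rewrite add0r cexp0 mulr1 => le; rewrite cexpD.
have -> : cexp w * cexp h - cexp w - h * cexp w = cexp w * (cexp h - 1 - h) by ring.
by rewrite nmM mulrC -ler_pdivlMr // mulrAC.
Qed.
End ComplexDerivative.

(** * Calculus of functions on the upper half-plane *)

Section UpperHalfPlaneCalculus.
Variable R : realType.
Local Notation C := (cplx R).
Local Notation uhp := (uhp R).
Implicit Types (z : uhp) (f g : uhp -> C) (F : C -> C).

Definition uder f z (d : C) := cder (uext f) (val z) d.

Lemma uextE f z : uext f (val z) = f z.
Proof. by rewrite /uext valK. Qed.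

Lemma near_uhp z (P : set C) : (forall w : uhp, P (val w)) ->
  \forall w \near val z, P w.
Proof.
move=> HP; apply/nbhsCP; exists (complex.Im (val z)); first exact: (valP z).
move=> y yz; have y0 : 0 < complex.Im y.
  have := le_lt_trans (Im_le_nm _) yz; rewrite ImD ImN ltr_norml => /andP[+ _].
  by rewrite ltrBrDr addNr.
exact: (HP (exist _ y y0)).
Qed.

(** The half-plane is open, so any function on the plane agreeing with [f] there may be
    differentiated in place of the extension of [f] by zero. *)
Lemma uderP F f z (d : C) : (forall w : uhp, F (val w) = f w) -> cder F (val z) d ->
  uder f z d.
Proof.
move=> Ff; apply: cder_near; apply: near_uhp => w.
by rewrite uextE.
Qed.

Lemma uder_uderiv f z d : uder f z d -> uderiv f z = d.
Proof. by move=> /is_deriveCP[df fd]; rewrite /uderiv derive1E fd. Qed.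

Lemma holo_uder f z : holomorphic f -> uder f z (uderiv f z).
Proof.
move=> hf; apply/is_deriveCP; apply: (DeriveDef (hf z)).
by rewrite /uderiv derive1E.
Qed.

Lemma uder_holo f : (forall z, exists d, uder f z d) -> holomorphic f.
Proof. by move=> H z; have [d /is_deriveCP[]] := H z. Qed.

Lemma uder_eq f z d d' : uder f z d -> d = d' -> uder f z d'.
Proof. by move=> + <-. Qed.

Lemma uder_cst (c : C) z : uder (fun=> c) z 0.
Proof. by apply: (@uderP (fun=> c)) => //; apply: cder_cst. Qed.
Lemma uder_id z : uder (fun w => val w) z 1.
Proof. by apply: (@uderP id) => //; apply: cder_id. Qed.
Lemma uderD f g z df dg : uder f z df -> uder g z dg ->
  uder (fun w => f w + g w) z (df + dg).
Proof.
move=> Hf Hg; apply: (@uderP (fun y => uext f y + uext g y)) => [w|].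
  by rewrite !uextE.
exact: cderD.
Qed.
Lemma uderM f g z df dg : uder f z df -> uder g z dg ->
  uder (fun w => f w * g w) z (df * g z + f z * dg).
Proof.
move=> Hf Hg; apply: (@uderP (fun y => uext f y * uext g y)) => [w|].
  by rewrite !uextE.
by rewrite -(uextE f) -(uextE g); apply: cderM.
Qed.
Lemma uderZ (c : C) f z df : uder f z df -> uder (fun w => c * f w) z (c * df).
Proof.
by move=> Hf; have := uderM (uder_cst c z) Hf; rewrite mul0r add0r.
Qed.
Lemma uderN f z df : uder f z df -> uder (fun w => - f w) z (- df).
Proof.
move=> /(uderZ (-1)); rewrite mulN1r.
by under [X in uder X]eq_fun do rewrite mulN1r.
Qed.
Lemma uderB f g z df dg : uder f z df -> uder g z dg ->
  uder (fun w => f w - g w) z (df - dg).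
Proof. by move=> Hf Hg; apply: uderD Hf (uderN Hg). Qed.
Lemma uder_comp F f z (d df : C) : cder F (f z) d -> uder f z df ->
  uder (fun w => F (f w)) z (d * df).
Proof.
move=> HF Hf; apply: (@uderP (F \o uext f)) => [w|]; first by rewrite /= uextE.
by apply: cder_comp => //; rewrite uextE.
Qed.
Lemma uderV f z df : f z != 0 -> uder f z df ->
  uder (fun w => (f w)^-1) z (- (f z) ^- 2 * df).
Proof. by move=> f0 Hf; apply: uder_comp Hf; apply: cder_inv. Qed.
Lemma uderX f n z df : uder f z df ->
  uder (fun w => f w ^+ n) z (n%:R * f z ^+ n.-1 * df).
Proof.
move=> Hf; elim: n => [|n IHn].
  by rewrite !mul0r; under [X in uder X]eq_fun do rewrite expr0; apply: uder_cst.
under [X in uder X]eq_fun do rewrite exprS.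
apply: uder_eq; first exact: uderM Hf IHn.
case: n IHn => [|n] _ /=; first by rewrite !expr0 !mul0r mulr0 addr0 !mulr1 mul1r.
rewrite !exprS [in RHS]mulrS; ring.
Qed.
End UpperHalfPlaneCalculus.

(** * Power series and q-expansions *)

Section PowerSeries.
Variable R : realType.
Local Notation C := (cplx R).
Implicit Types (x y h : C) (c d : nat -> C).

Lemma geometric_bound (t : R) n : 0 <= t < 1 -> \sum_(0 <= i < n) t ^+ i <= (1 - t)^-1.
Proof.
move=> /andP[t0 t1]; have t1' : 0 < 1 - t by rewrite subr_gt0.
rewrite -[leRHS]mul1r ler_pdivlMr // big_mkord -mulrC mulrC.
rewrite mulrC -opprB mulNr -subrX1 opprB gerDl oppr_le0.
exact: exprn_ge0.
Qed.

(** Each of the first n terms of the geometric series is at least t^n. *)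
Lemma nat_geometric_bound (t : R) n : 0 <= t < 1 -> n%:R * t ^+ n <= (1 - t)^-1.
Proof.
move=> /[dup] t01 /andP[t0 t1]; apply: le_trans (geometric_bound n t01).
rewrite mulr_natl -[n in leLHS]subn0 -sumr_const_nat.
rewrite [leLHS]big_nat_cond [leRHS]big_nat_cond; apply: ler_sum => i /andP[/andP[_ ni] _].
by rewrite subn0 ler_wiXn2l ?(ltW t1) // ltnW.
Qed.

(* Abel's condition for convergence in the open unit disc. *)
Definition tame c := forall r : R, 0 < r < 1 ->
  exists M : R, forall n, nm (c n) * r ^+ n <= M.

Definition pser c x : C := csum (fun n => c n * x ^+ n).

Lemma ltr_between (r s : R) : r < s -> exists2 t, r < t & t < s.
Proof. by move=> rs; exists ((r + s) / 2); [rewrite midf_lt|rewrite midf_lt]. Qed.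

(** Boundedness of the terms at a radius s strictly between r and 1 becomes geometric decay at r,
    with ratio r / s. *)
Lemma tame_bound c (r : R) : tame c -> 0 <= r < 1 ->
  exists M t : R, [/\ 0 <= M, 0 <= t < 1 & forall n, nm (c n) * r ^+ n <= M * t ^+ n].
Proof.
move=> tc /andP[r0 r1]; have [s rs s1] := ltr_between r1.
have s0 : 0 < s by apply: le_lt_trans rs.
have [|M HM] := tc s; first by rewrite s0.
exists M, (r / s); split.
- by apply: le_trans (HM 0%N); rewrite mulr_ge0 ?nm_ge0 // expr0.
- by rewrite divr_ge0 ?(ltW s0) //= ltr_pdivrMr // mul1r.
move=> n; have -> : r ^+ n = s ^+ n * (r / s) ^+ n.
  by rewrite -exprMn mulrCA divff ?mulr1 // gt_eqF.
by rewrite mulrA ler_wpM2r ?exprn_ge0 // divr_ge0 // ltW.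
Qed.

Lemma tame_absum_nm c (r : R) : tame c -> 0 <= r < 1 ->
  exists B, forall n, \sum_(0 <= i < n) nm (c i) * r ^+ i <= B.
Proof.
move=> tc r01; have [M [t [M0 t01 H]]] := tame_bound tc r01.
exists (M * (1 - t)^-1) => n; apply: le_trans (ler_wpM2l M0 (geometric_bound n t01)).
by rewrite mulr_sumr; apply: ler_sum => i _.
Qed.

Lemma tame_absum c x : tame c -> nm x < 1 -> absum (fun n => c n * x ^+ n).
Proof.
move=> tc x1; have [|B HB] := @tame_absum_nm c (nm x) tc; first by rewrite nm_ge0.
by exists B => n; under eq_bigr do rewrite nmM nmX.
Qed.

Lemma tame_le c d : (forall n, nm (c n) <= nm (d n)) -> tame d -> tame c.
Proof.
move=> cd td r /[dup] r01 /andP[r0 r1]; have [M HM] := td r r01; exists M => n.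
by apply: le_trans (HM n); rewrite ler_wpM2r // exprn_ge0 // ltW.
Qed.

Lemma tame_cst (k : C) : tame (fun=> k).
Proof.
move=> r /andP[r0 r1]; exists (nm k) => n.
by rewrite ler_piMr ?nm_ge0 // exprn_ile1 // ltW.
Qed.

Lemma tameD c d : tame c -> tame d -> tame (fun n => c n + d n).
Proof.
move=> tc td r /[dup] r01 /andP[r0 r1].
have [M HM] := tc r r01; have [M' HM'] := td r r01; exists (M + M') => n.
apply: le_trans (lerD (HM n) (HM' n)); rewrite -mulrDl ler_wpM2r ?nmD //.
by rewrite exprn_ge0 // ltW.
Qed.

Lemma tameZ (k : C) c : tame c -> tame (fun n => k * c n).
Proof.
move=> tc r r01; have [M HM] := tc r r01; exists (nm k * M) => n.
by rewrite nmM -mulrA ler_wpM2l // nm_ge0.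
Qed.

Lemma tame_nat c : tame c -> tame (fun n => n%:R * c n).
Proof.
move=> tc r /andP[r0 r1].
have [|M [t [M0 t01 H]]] := @tame_bound c r tc; first by rewrite ltW.
exists (M * (1 - t)^-1) => n; rewrite nmM nm_nat -mulrA.
apply: le_trans (ler_wpM2l M0 (nat_geometric_bound n t01)).
by rewrite [leRHS]mulrCA ler_wpM2l ?ler0n.
Qed.

Lemma tame_natX k : tame (fun n => n%:R ^+ k).
Proof.
elim: k => [|k IHk]; first by under eq_fun do rewrite expr0; apply: tame_cst.
by under eq_fun do rewrite exprS; apply: tame_nat.
Qed.

Lemma tame_natS c : tame c -> tame (fun n => n.+1%:R * c n.+1).
Proof.
move=> /tame_nat tc r /[dup] r01 /andP[r0 r1]; have [M HM] := tc r r01.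
exists (M / r) => n; rewrite ler_pdivlMr // -mulrA -exprSr; exact: HM.
Qed.

Definition conv c d n : C := \sum_(i < n.+1) c i * d (n - i)%N.

(** Each of the n + 1 products is at most M M' s^n, where s is the larger of the two ratios, and (n
    + 1) s^n is bounded by 1/(1 - s) + 1. *)
Lemma tame_conv c d : tame c -> tame d -> tame (conv c d).
Proof.
move=> tc td r /andP[r0 r1].
have r01 : 0 <= r < 1 by rewrite ltW.
have [M [t [M0 t01 H]]] := tame_bound tc r01.
have [M' [t' [M'0 t'01 H']]] := tame_bound td r01.
pose s := Num.max t t'.
have s01 : 0 <= s < 1.
  by case/andP: t01 => t0 t1; case/andP: t'01 => t'0 t'1; rewrite le_max t0 gt_max t1.
exists (M * M' * ((1 - s)^-1 + 1)) => n.
have s1 : s ^+ n <= 1 by case/andP: s01 => s0 s1; rewrite exprn_ile1 // ltW.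
apply: (@le_trans _ _ (M * M' * (n.+1%:R * s ^+ n))); last first.
  rewrite ler_wpM2l ?mulr_ge0 // mulrSr mulrDl mul1r lerD //.
  exact: nat_geometric_bound.
have -> : M * M' * (n.+1%:R * s ^+ n) = \sum_(i < n.+1) M * M' * s ^+ n.
  by rewrite sumr_const card_ord mulr_natl mulrnAr.
rewrite /conv; apply: le_trans (ler_wpM2r _ (nm_sum _ _ _)) _.
  by rewrite exprn_ge0 // ltW.
rewrite mulr_suml; apply: ler_sum => i _.
have E (y : R) : y ^+ n = y ^+ i * y ^+ (n - i) by rewrite -exprD subnKC // leq_ord.
rewrite nmM E mulrACA.
have /andP[t0 _] := t01; have /andP[t'0 _] := t'01.
apply: le_trans (ler_pM _ _ (H i) (H' _)) _; rewrite ?mulr_ge0 ?nm_ge0 ?exprn_ge0 ?(ltW r0) //.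
rewrite mulrACA ler_wpM2l ?mulr_ge0 // E.
by rewrite ler_pM ?exprn_ge0 // lerXn2r ?nnegrE ?le_max ?lexx ?t0 ?t'0 ?orbT.
Qed.

Lemma csum_shift (a : nat -> C) m : absum a ->
  absum (fun n => if (m <= n)%N then a (n - m)%N else 0) /\
  csum (fun n => if (m <= n)%N then a (n - m)%N else 0) = csum a.
Proof.
move=> sa; elim: m => [|m [IH1 IH2]].
  have -> // : (fun n => if (0 <= n)%N then a (n - 0)%N else 0) = a.
  by apply/funext => n; rewrite subn0.
have s : absum (fun n => if (m < n)%N then a (n - m.+1)%N else 0).
  by apply: absum_unshift; exact: IH1.
split=> //; rewrite csum_recl // ltn0 add0r -IH2.
by congr csum.
Qed.

Lemma pser_conv c d x : tame c -> tame d -> nm x < 1 ->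
  pser (conv c d) x = pser c x * pser d x.
Proof.
move=> tc td x1.
have sc := tame_absum tc x1; have sd := tame_absum td x1.
(* Cauchy product by Fubini: row [m] is the second series multiplied by the [m]-th term of the first
   and shifted by [m], while column [N] adds up to the [N]-th term of the convolution. *)
pose a m N := if (m <= N)%N then c m * d (N - m)%N * x ^+ N else 0.
have aE m : (fun N => a m N) =
    (fun n => if (m <= n)%N then (fun n => c m * x ^+ m * (d n * x ^+ n)) (n - m)%N else 0).
  apply/funext => N; rewrite /a; case: leqP => // mN.
  by rewrite -{2}(subnKC mN) exprD; ring.
have [B HB] := sc; have [B' HB'] := sd.
have [|_ _ _ _ E] := @fubini_nat R a (B * B').
  move=> M N.
  have B'0 : 0 <= B' by apply: le_trans (HB' 0%N); rewrite big_geq.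
  apply: le_trans (ler_wpM2r B'0 (HB M)); rewrite mulr_suml; apply: ler_sum => m _.
  apply: le_trans (ler_wpM2l (nm_ge0 _) (HB' N)); rewrite mulr_sumr.
  have := @csum_shift (fun n => if (n < N)%N then c m * x ^+ m * (d n * x ^+ n) else 0) m.
  move=> _; have [Nm|mN] := leqP N m.
    rewrite big_nat_cond big1 => [|i /andP[/andP[_ iN] _]].
      by apply: sumr_ge0 => i _; rewrite mulr_ge0 ?nm_ge0.
    by rewrite /a leqNgt (leq_trans iN Nm) nm0.
  rewrite (big_cat_nat _ (ltnW mN)) //= big_nat_cond big1 => [|i /andP[/andP[_ im] _]].
    rewrite add0r -{1}[m]add0n big_addn.
    rewrite [leRHS](big_cat_nat _ (leq_subr m N)) //=.
    rewrite -[leLHS]addr0 lerD //; last first.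
      by apply: sumr_ge0 => i _; rewrite mulr_ge0 ?nm_ge0.
    apply: ler_sum => i _; rewrite /a leq_addl addnK -nmM exprD.
    by rewrite (_ : c m * d i * _ = c m * x ^+ m * (d i * x ^+ i)) //; ring.
  by rewrite /a leqNgt im nm0.
rewrite /pser; transitivity (csum (fun n => csum (a ^~ n))).
  congr csum; apply/funext => n; rewrite (@csum_fin _ _ n.+1) => [|m nm'].
    rewrite /conv mulr_suml big_mkord; apply: eq_bigr => i _.
    by rewrite /a leq_ord.
  by rewrite /a leqNgt nm'.
rewrite -E [RHS]mulrC -csumZ //; congr csum; apply/funext => m.
rewrite (aE m : a m = _) (csum_shift (a := fun n => c m * x ^+ m * (d n * x ^+ n)) m _).2; last exact: absumZ.
by rewrite csumZ // mulrC.
Qed.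

Lemma pserD c d x : tame c -> tame d -> nm x < 1 ->
  pser (fun n => c n + d n) x = pser c x + pser d x.
Proof.
move=> tc td x1; rewrite /pser -csumD; try exact: tame_absum.
by congr csum; apply/funext => n; rewrite mulrDl.
Qed.
Lemma pserZ (k : C) c x : tame c -> nm x < 1 ->
  pser (fun n => k * c n) x = k * pser c x.
Proof.
move=> tc x1; rewrite /pser -csumZ; try exact: tame_absum.
by congr csum; apply/funext => n; rewrite mulrA.
Qed.

(** One induction proves both bounds, the second using the first. The factors r and r^2 on the left
    avoid the exponents n - 1 and n - 2 on the right, which would be truncated for small n. *)
Lemma expr_diff_bound (r : R) x h n : 0 <= r -> nm x <= r -> nm (x + h) <= r ->
  r * nm ((x + h) ^+ n - x ^+ n) <= n%:R * nm h * r ^+ n /\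
  r ^+ 2 * nm ((x + h) ^+ n - x ^+ n - h * (n%:R * x ^+ n.-1)) <=
    n%:R ^+ 2 * nm h ^+ 2 * r ^+ n.
Proof.
move=> r0 xr xhr; elim: n => [|n [IH1 IH2]].
  by rewrite expr0n /= !expr0 !mul0r mulr0 subrr subr0 nm0 !mulr0.
have h0 := nm_ge0 h.
have Xn : nm ((x + h) ^+ n) <= r ^+ n by rewrite nmX lerXn2r ?nnegrE ?nm_ge0.
split.
  have -> : (x + h) ^+ n.+1 - x ^+ n.+1 =
    h * (x + h) ^+ n + x * ((x + h) ^+ n - x ^+ n) by rewrite !exprS; ring.
  apply: le_trans (ler_wpM2l r0 (nmD _ _)) _; rewrite !nmM mulrDr.
  rewrite exprS mulrSr !mulrDl mul1r addrC; apply: lerD.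
    rewrite mulrCA; apply: le_trans (ler_pM _ _ xr IH1) _; rewrite ?nm_ge0 ?mulr_ge0 ?nm_ge0 //.
    by rewrite le_eqVlt; apply/orP; left; apply/eqP; ring.
  by rewrite mulrCA ler_wpM2l // ler_wpM2l.
have -> : (x + h) ^+ n.+1 - x ^+ n.+1 - h * (n.+1%:R * x ^+ n.+1.-1) =
   h * ((x + h) ^+ n - x ^+ n) + x * ((x + h) ^+ n - x ^+ n - h * (n%:R * x ^+ n.-1)).
  rewrite /= !exprS mulrSr; case: n {IH1 IH2 Xn} => [|n] /=; first by ring.
  by rewrite !exprS; ring.
apply: le_trans (ler_wpM2l (exprn_ge0 _ r0) (nmD _ _)) _; rewrite !nmM mulrDr.
apply: (@le_trans _ _ (nm h * r * (n%:R * nm h * r ^+ n) + r * (n%:R ^+ 2 * nm h ^+ 2 * r ^+ n))).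
  apply: lerD.
    have -> : r ^+ 2 * (nm h * nm ((x + h) ^+ n - x ^+ n)) =
      nm h * r * (r * nm ((x + h) ^+ n - x ^+ n)) by ring.
    by rewrite ler_wpM2l ?mulr_ge0.
  by rewrite mulrCA ler_pM ?mulr_ge0 ?exprn_ge0 ?nm_ge0.
have -> : nm h * r * (n%:R * nm h * r ^+ n) + r * (n%:R ^+ 2 * nm h ^+ 2 * r ^+ n) =
  (n%:R + n%:R ^+ 2) * (nm h ^+ 2 * r ^+ n.+1) by rewrite !exprS; ring.
rewrite -mulrA ler_wpM2r ?mulr_ge0 ?exprn_ge0 //.
rewrite mulrSr sqrrD expr1n mulr1; have : 0 <= n%:R :> R by []; lra.
Qed.

(** For a radius r between [nm x] and 1 the second order remainder of the n-th term is at most n^2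
    nm (c n) r^n nm(h)^2 / r^2. Tameness survives multiplication by n^2, so these bounds are
    summable and the total remainder is quadratic in h. *)
Lemma cder_pser c x : tame c -> nm x < 1 ->
  cder (pser c) x (pser (fun n => n.+1%:R * c n.+1) x).
Proof.
move=> tc x1; have [r xr r1] := ltr_between x1.
have r0 : 0 < r by apply: le_lt_trans xr; apply: nm_ge0.
have [||B HB] := @tame_absum_nm (fun n => n%:R * (n%:R * c n)) r.
- by do 2!apply: tame_nat.
- by rewrite ltW.
apply: (@cder_quad _ _ _ _ (B / r ^+ 2) (r - nm x)) => [|h hr].
  by rewrite subr_gt0.
have xhr : nm (x + h) <= r by apply: le_trans (nmD _ _) _; lra.
have xh1 : nm (x + h) < 1 by apply: le_lt_trans r1.
have td := tame_natS tc; have sd := tame_absum td x1.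
have E : h * pser (fun n => n.+1%:R * c n.+1) x =
    csum (fun n => h * (n%:R * c n * x ^+ n.-1)).
  rewrite /pser -csumZ // [RHS]csum_recl ?mul0r ?mulr0 ?add0r //.
  by apply: absum_unshift; apply: absumZ.
have sh : absum (fun n => h * (n%:R * c n * x ^+ n.-1)).
  by apply: absum_unshift; apply: absumZ.
have s1 := tame_absum tc x1; have s2 := tame_absum tc xh1.
rewrite E /pser -csumB // -csumB //; last exact: absumB.
rewrite mulrAC ler_pdivlMr ?exprn_gt0 // mulrC.
rewrite -[r ^+ 2]ger0_norm ?exprn_ge0 ?(ltW r0) // -nm_real -nmM -csumZ; last first.
  by apply: absumB => //; apply: absumB.
apply: csum_nm_le => n; apply: le_trans (ler_wpM2r _ (HB n)).
  rewrite mulr_suml; apply: ler_sum => i _.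
  have [_] := @expr_diff_bound r x h i (ltW r0) (ltW xr) xhr.
  move=> le; have -> : c i * (x + h) ^+ i - c i * x ^+ i - h * (i%:R * c i * x ^+ i.-1) =
    c i * ((x + h) ^+ i - x ^+ i - h * (i%:R * x ^+ i.-1)) by ring.
  rewrite !nmM nm_real ger0_norm ?exprn_ge0 ?(ltW r0) // mulrCA.
  apply: le_trans (ler_wpM2l (nm_ge0 _) le) _; rewrite !nm_nat.
  by rewrite le_eqVlt; apply/orP; left; apply/eqP; ring.
by rewrite exprn_ge0 // nm_ge0.
Qed.
End PowerSeries.

(** The new upper limit is the ceiling of n / M, which is the number of multiples of M below n. *)
Lemma big_sparse (V : nmodType) (a : nat -> V) M n : (0 < M)%N ->
  \sum_(0 <= i < n) (if (M %| i)%N then a (i %/ M)%N else 0) =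
  \sum_(0 <= j < (n + M.-1) %/ M) a j.
Proof.
move=> M0; elim: n => [|n IHn].
  by rewrite add0n divn_small ?prednK // !big_geq.
rewrite big_nat_recr //= IHn; have [/dvdnP[k ->]|nM] := boolP (M %| n)%N.
  rewrite mulnK // addSn -addnS prednK // divnMDl // divnMDl // divnn M0.
  by rewrite divn_small ?prednK // addn0 addn1 big_nat_recr.
rewrite addr0; congr (\sum_(_ <= _ < _) _).
have r0 : (0 < n %% M)%N by rewrite lt0n.
have rM : (n %% M < M)%N by rewrite ltn_mod.
have nE := divn_eq n M.
have -> : (n + M.-1 = (n %/ M).+1 * M + (n %% M).-1)%N by rewrite mulSn; lia.
have -> : (n.+1 + M.-1 = (n %/ M).+1 * M + n %% M)%N by rewrite mulSn; lia.
by rewrite !divnMDl // (divn_small rM) (divn_small (leq_ltn_trans (leq_pred _) rM)).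
Qed.

(** * Expansions in powers of e^(2 pi i z / N) and regularity at infinity *)

Section QExpansion.
Variable R : realType.
Local Notation C := (cplx R).
Local Notation "x %:C" := ((x)%:C%C : C).
Local Notation uhp := (uhp R).
Local Notation twopii := (twopii R).
Implicit Types (z : uhp) (f g : uhp -> C) (c d : nat -> C) (N M : nat).

Lemma twopii_neq0 : twopii != 0.
Proof.
by rewrite eq_complex /= negb_and eqxx /= gt_eqF // mulr_gt0 // pi_gt0.
Qed.

Lemma twopiiE : twopii = 2 * pi%:C * ('i%C : C).
Proof. by apply/eqP; rewrite eq_complex /=; apply/andP; split; apply/eqP; ring. Qed.

Lemma Re_twopiiM (w : C) : complex.Re (twopii * w) = - (2 * pi * complex.Im w).
Proof. by case: w => x y /=; rewrite mul0r sub0r. Qed.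

Lemma divC_nat (w : C) N :
  (complex.Re (w / N%:R) = complex.Re w / N%:R) * (complex.Im (w / N%:R) = complex.Im w / N%:R).
Proof.
rewrite -RtoC_nat -RtoCV; by case: w => x y; split=> /=; rewrite !mulr0 ?subr0 ?add0r.
Qed.

Lemma nm_qpar N z : nm (qpar N z) = expR (- (2 * pi * (complex.Im (val z) / N%:R))).
Proof. by rewrite /qpar nm_cexp -mulrA Re_twopiiM divC_nat. Qed.

Lemma qpar_lt1 N z : (0 < N)%N -> nm (qpar N z) < 1.
Proof.
move=> N0; rewrite nm_qpar -[ltRHS]expR0 ltr_expR oppr_lt0.
by rewrite !mulr_gt0 ?pi_gt0 ?invr_gt0 ?ltr0n //; exact: (valP z).
Qed.

Lemma qpar_nm_onto N (r : R) : (0 < N)%N -> 0 < r < 1 -> exists z, nm (qpar N z) = r.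
Proof.
move=> N0 /andP[r0 r1]; have N0' : 0 < N%:R :> R by rewrite ltr0n.
have p0 := pi_gt0 R.
(* The point iy on the imaginary axis with exp(- 2 pi y / N) = r. *)
pose y : R := - ln r * N%:R / (2 * pi).
have y0 : 0 < complex.Im ((0 +i* y)%C : C).
  by rewrite /= divr_gt0 ?mulr_gt0 // oppr_gt0 ln_lt0 // r0.
exists (exist (fun w : C => is_true (0 < complex.Im (w : R[i]))) _ y0); rewrite nm_qpar /=.
have E (p n l : R) : p != 0 -> n != 0 -> - (p * (- l * n / p / n)) = l.
  by move=> p0' n0'; field; rewrite ?p0' ?n0'.
rewrite /y E ?gt_eqF ?mulr_gt0 //.
by rewrite lnK.
Qed.

Lemma qpar_mul N M z : (0 < M)%N -> qpar N z = qpar (N * M) z ^+ M.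
Proof.
move=> M0; rewrite /qpar cexpX -[X in _ = cexp X]mulr_natr; congr cexp.
have M0' : M%:R != 0 :> C by rewrite pnatr_eq0 -lt0n.
by rewrite natrM invfM mulrA divfK.
Qed.

Definition qf N c : uhp -> C := fun z => pser c (qpar N z).

Lemma has_qexp_qf N c : (0 < N)%N -> tame c -> has_qexp N c (qf N c).
Proof.
by move=> N0 tc z; apply: absum_cvg; apply: tame_absum => //; apply: qpar_lt1.
Qed.

(** Every radius in (0, 1) is the modulus of some [qpar N z], and the terms of a series that
    converges at this point are bounded. *)
Lemma has_qexp_tame N c f : (0 < N)%N -> has_qexp N c f -> tame c.
Proof.
move=> N0 cf r r01; have [z zr] := qpar_nm_onto N0 r01.
have /cvgnCP/(_ 1 ltr01)[K HK] := cf z; set u := fun n => _ in HK.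
exists (\sum_(0 <= i < K) nm (u i) + 2) => n.
have -> : nm (c n) * r ^+ n = nm (u n) by rewrite /u nmM nmX zr.
have S0 : 0 <= \sum_(0 <= i < K) nm (u i).
  by apply: sumr_ge0 => i _; apply: nm_ge0.
have [nK|Kn] := ltnP n K.
  rewrite ler_wpDr //; rewrite (big_cat_nat _ (ltnW nK)) //= [X in _ + X]big_ltn //.
  rewrite addrCA lerDl addr_ge0 //; apply: sumr_ge0 => i _; exact: nm_ge0.
rewrite ler_wpDl //.
have -> : u n = (series u n.+1 - f z) - (series u n - f z).
  by rewrite /series /= big_nat_recr //=; ring.
apply: le_trans (nmB _ _) _; rewrite -[2]/(1 + 1) lerD //.
  by apply: ltW; apply: HK; rewrite (leq_trans Kn).
by apply: ltW; apply: HK.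
Qed.

Lemma has_qexpE N c f : (0 < N)%N -> has_qexp N c f -> f = qf N c.
Proof.
move=> N0 cf; have tc := has_qexp_tame N0 cf; apply/funext => z.
by apply/esym/csumE; apply: cf.
Qed.

Lemma uder_qpar N z : uder (qpar N) z (twopii / N%:R * qpar N z).
Proof.
have -> : qpar N = (fun w => cexp (twopii / N%:R * val w)).
  by apply/funext => w; rewrite /qpar mulrAC.
have H := uderZ (twopii / N%:R) (uder_id z).
apply: uder_eq; first exact: (uder_comp (cder_cexp _) H).
by rewrite mulr1 mulrC.
Qed.

Lemma uder_qf N c z : (0 < N)%N -> tame c ->
  uder (qf N c) z (twopii / N%:R * qf N (fun n => n%:R * c n) z).
Proof.
move=> N0 tc; have q1 := qpar_lt1 z N0.
apply: uder_eq; first by apply: uder_comp (uder_qpar N z); apply: cder_pser.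
rewrite mulrC -[LHS]mulrA; congr (_ * _).
rewrite /qf [in RHS]/pser csum_recl; last by apply: tame_absum => //; apply: tame_nat.
rewrite mul0r mul0r add0r /pser -csumZ; last by apply: tame_absum => //; apply: tame_natS.
by congr csum; apply/funext => n; rewrite exprS mulrCA.
Qed.

(** Since [qpar N] is the M-th power of [qpar (N * M)], passing to the finer parameter moves the
    n-th coefficient to index M n. Two expansions with different [N] are brought to a common
    parameter this way before they are added or multiplied. *)
Definition dil M c n : C := if (M %| n)%N then c (n %/ M)%N else 0.

Lemma tame_dil M c : (0 < M)%N -> tame c -> tame (dil M c).
Proof.
move=> M0 tc r /[dup] r01 /andP[r0 r1]; have [K HK] := tc r r01; exists K => n.
rewrite /dil; case: ifP => [/dvdnP[k ->]|_].
  rewrite mulnK //; apply: le_trans (HK k); rewrite ler_wpM2l ?nm_ge0 //.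
  by rewrite ler_wiXn2l ?(ltW r0) ?(ltW r1) // leq_pmulr.
by rewrite nm0 mul0r; apply: le_trans (HK 0%N); rewrite expr0 mulr1 nm_ge0.
Qed.

Lemma csum_sparse (a : nat -> C) M : (0 < M)%N -> absum a ->
  absum (fun n => if (M %| n)%N then a (n %/ M)%N else 0) /\
  csum (fun n => if (M %| n)%N then a (n %/ M)%N else 0) = csum a.
Proof.
move=> M0 [B aB]; set b := fun n => _.
have sb : absum b.
  exists B => n; apply: le_trans (aB ((n + M.-1) %/ M)%N).
  rewrite -(big_sparse (fun i => nm (a i)) n M0); apply: ler_sum => i _.
  by rewrite /b; case: ifP => // _; rewrite nm0.
split=> //; apply: csumE; apply/cvgnCP => e e0.
have sa : absum a by exists B.
have /cvgnCP/(_ e e0)[K HK] := absum_cvg sa.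
exists (K * M)%N => n nK; rewrite /series /= big_sparse //; apply: HK.
by rewrite leq_divRL // (leq_trans nK) // leq_addr.
Qed.

Lemma pser_dil M c (x : C) : (0 < M)%N -> tame c -> nm x < 1 ->
  pser (dil M c) x = pser c (x ^+ M).
Proof.
move=> M0 tc x1.
have xM1 : nm (x ^+ M) < 1.
  by rewrite nmX exprn_ilt1 ?nm_ge0 // -lt0n.
rewrite /pser -(csum_sparse M0 (tame_absum tc xM1)).2.
congr csum; apply/funext => n; rewrite /dil; case: ifP => [/dvdnP[k ->]|_].
  by rewrite mulnK // -exprM mulnC.
by rewrite mul0r.
Qed.

Lemma qf_dil N M c : (0 < N)%N -> (0 < M)%N -> tame c ->
  qf N c = qf (N * M) (dil M c).
Proof.
move=> N0 M0 tc; apply/funext => z; rewrite /qf pser_dil -?qpar_mul //.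
by apply: qpar_lt1; rewrite muln_gt0 N0.
Qed.

(* [qreg true] is vanishing at the cusp oo, [qreg false] is holomorphy there. *)
Definition qreg (b : bool) f :=
  exists N c, [/\ (0 < N)%N, tame c, (b -> c 0%N = 0) & f = qf N c].

Lemma qreg_holoE f : holomorphic_at_oo f <-> qreg false f.
Proof.
split=> [[N N0 [c cf]]|[N [c [N0 tc _ ->]]]].
  by exists N, c; split=> //; [apply: has_qexp_tame cf|apply: has_qexpE].
by exists N => //; exists c; apply: has_qexp_qf.
Qed.

Lemma qreg_vanE f : vanishes_at_oo f <-> qreg true f.
Proof.
split=> [[N N0 [c c0 cf]]|[N [c [N0 tc c0 ->]]]].
  by exists N, c; split=> //; [apply: has_qexp_tame cf|apply: has_qexpE].
by exists N => //; exists c; [apply: c0|apply: has_qexp_qf].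
Qed.

Lemma qreg_weak b f : qreg b f -> qreg false f.
Proof. by move=> [N [c [? ? _ ?]]]; exists N, c. Qed.

Lemma qreg_uder b f z : qreg b f -> exists d : C, uder f z d.
Proof. by move=> [N [c [N0 tc _ ->]]]; eexists; apply: uder_qf. Qed.

Lemma qreg_holo b f : qreg b f -> holomorphic f.
Proof. by move=> qf; apply: uder_holo => z; apply: qreg_uder qf. Qed.

Lemma qreg_cst k : qreg false (fun=> k).
Proof.
exists 1%N, (fun n => if n is 0 then k else 0); split=> //.
  by apply: tame_le (tame_cst k) => -[|n] //; rewrite nm0 nm_ge0.
apply/funext => z; rewrite /qf /pser (@csum_fin _ _ 1) => [|[|n] // _].
  by rewrite big_nat1 expr0 mulr1.
by rewrite mul0r.
Qed.

Lemma qreg0 b : qreg b 0.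
Proof.
exists 1%N, (fun=> 0); split=> //; first exact: tame_cst.
apply/funext => z; rewrite /qf /pser (@csum_fin _ _ 0) ?big_geq // => n _.
by rewrite mul0r.
Qed.

Lemma qregZ b k f : qreg b f -> qreg b (k *: f).
Proof.
move=> [N [c [N0 tc c0 ->]]]; exists N, (fun n => k * c n); split=> //.
- exact: tameZ.
- by move=> /c0 ->; rewrite mulr0.
- by apply/funext => z; rewrite /qf pserZ // qpar_lt1.
Qed.

Lemma qregD b f g : qreg b f -> qreg b g -> qreg b (f + g).
Proof.
move=> [N [c [N0 tc c0 ->]]] [M [d [M0 td d0 ->]]].
rewrite (qf_dil N0 M0) // (qf_dil M0 N0) // mulnC.
exists (M * N)%N, (fun n => dil M c n + dil N d n); split.
- by rewrite muln_gt0 M0.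
- by apply: tameD; apply: tame_dil.
- by move=> b1; rewrite /dil !dvdn0 !div0n c0 // d0 // addr0.
- apply/funext => z; rewrite !fctE /qf pserD //; try exact: tame_dil.
  by rewrite qpar_lt1 // muln_gt0 M0.
Qed.

Lemma qregM b f g : qreg b f -> qreg false g -> qreg b (f * g).
Proof.
move=> [N [c [N0 tc c0 ->]]] [M [d [M0 td d0 ->]]].
rewrite (qf_dil N0 M0) // (qf_dil M0 N0) // mulnC.
exists (M * N)%N, (conv (dil M c) (dil N d)); split.
- by rewrite muln_gt0 M0.
- by apply: tame_conv; apply: tame_dil.
- by move=> b1; rewrite /conv big_ord1 /dil !dvdn0 !div0n c0 // mul0r.
- apply/funext => z; rewrite !fctE /qf pser_conv //; try exact: tame_dil.
  by rewrite qpar_lt1 // muln_gt0 M0.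
Qed.

Lemma qreg_uderiv b f : qreg b f -> qreg b (uderiv f).
Proof.
move=> [N [c [N0 tc c0 ->]]].
exists N, (fun n => twopii / N%:R * (n%:R * c n)); split=> //.
- by apply: tameZ; apply: tame_nat.
- by rewrite mul0r mulr0.
- apply/funext => z; rewrite (uder_uderiv (uder_qf z N0 tc)) /qf pserZ ?qpar_lt1 //.
  exact: tame_nat.
Qed.

Lemma affine_aux (F : fieldType) (t a w e d n : F) : d != 0 -> n != 0 ->
  t * ((a * w + e) / d) / n = t * e / (n * d) + t * w / (n * d) * a.
Proof. by move=> d0 n0; field; rewrite d0 n0. Qed.

(** At (a z + e) / d the parameter [qpar N] becomes zeta times the a-th power of [qpar (N * d) z],
    with zeta of modulus 1. The n-th coefficient is multiplied by zeta^n and moved to index a n; a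
    zero constant term stays zero. *)
Lemma qreg_affine b f (a d : nat) (e : int) (g : uhp -> uhp) : (0 < a)%N -> (0 < d)%N ->
  (forall z, val (g z) = (a%:R * val z + e%:~R) / d%:R) ->
  qreg b f -> qreg b (fun z => f (g z)).
Proof.
move=> a0 d0 gE [N [c [N0 tc c0 ->]]].
have d0' : d%:R != 0 :> C by rewrite pnatr_eq0 -lt0n.
have N0' : N%:R != 0 :> C by rewrite pnatr_eq0 -lt0n.
pose zeta : C := cexp (twopii * e%:~R / (N * d)%:R).
have nz : nm zeta = 1.
  rewrite /zeta nm_cexp -mulrA Re_twopiiM divC_nat.
  have -> : complex.Im (e%:~R : C) = 0 by rewrite -(rmorph_int (real_complex R)).
  by rewrite mul0r mulr0 oppr0 expR0.
have tz : tame (fun n => c n * zeta ^+ n).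
  by apply: tame_le tc => n; rewrite nmM nmX nz expr1n mulr1.
exists (N * d)%N, (dil a (fun n => c n * zeta ^+ n)); split.
- by rewrite muln_gt0 N0.
- exact: tame_dil.
- by move=> /c0; rewrite /dil dvdn0 div0n => ->; rewrite mul0r.
have Nd0 : (0 < N * d)%N by rewrite muln_gt0 N0.
apply/funext => z; rewrite /qf (pser_dil a0 tz (qpar_lt1 z Nd0)).
rewrite /pser; congr csum; apply/funext => n; rewrite -[RHS]mulrA; congr (_ * _).
rewrite -exprMn; congr (_ ^+ _); rewrite /zeta /qpar gE cexpX -cexpD; congr cexp.
by rewrite -[X in _ = _ + X]mulr_natr natrM affine_aux.
Qed.
End QExpansion.

Lemma big_nat_double (V : nmodType) (F : nat -> V) m :
  \sum_(0 <= i < m + m) F i = \sum_(0 <= i < m) F i + \sum_(0 <= i < m) F (i + m)%N.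
Proof.
rewrite (@big_cat_nat _ _ _ m) ?leq_addr //=; congr (_ + _).
by have := @big_addn V 0 +%R 0%N (m + m)%N m xpredT F; rewrite add0n addnK.
Qed.

(** * Partial fractions of the cotangent and the weight 2 Eisenstein series *)

Section ComplexSequences.
Variable R : realType.
Local Notation C := (cplx R).
Implicit Types (f g : nat -> C) (a b : C).

(* A constant, so that unification does not unfold convergence. *)
Definition tends f a : Prop := f @ \oo --> a.

Lemma tendsP f a : tends f a <-> forall e : R, 0 < e ->
  exists N, forall n, (N <= n)%N -> nm (f n - a) < e.
Proof. exact: cvgnCP. Qed.
Lemma tends_eq f a b : tends f a -> a = b -> tends f b.
Proof. by move=> + <-. Qed.
Lemma tends_near f g a K : (forall n, (K <= n)%N -> f n = g n) -> tends f a -> tends g a.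
Proof.
move=> fg /tendsP fa; apply/tendsP => e /fa[N HN]; exists (maxn N K) => n.
by rewrite geq_max => /andP[Nn Kn]; rewrite -fg // HN.
Qed.
Lemma tendsD f g a b : tends f a -> tends g b -> tends (fun n => f n + g n) (a + b).
Proof. exact: cvgD. Qed.
Lemma tendsB f g a b : tends f a -> tends g b -> tends (fun n => f n - g n) (a - b).
Proof. exact: cvgB. Qed.
Lemma tendsM f g a b : tends f a -> tends g b -> tends (fun n => f n * g n) (a * b).
Proof. exact: cvgM. Qed.
Lemma tends_cst a : tends (fun=> a) a.
Proof. exact: cvg_cst. Qed.
Lemma tendsZ c f a : tends f a -> tends (fun n => c * f n) (c * a).
Proof. by move=> fa; apply: (tendsM (f := fun=> c)) fa; apply: tends_cst. Qed.
Lemma tendsV f a : a != 0 -> tends f a -> tends (fun n => (f n)^-1) (a^-1).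
Proof. exact: cvgV. Qed.
Lemma tends_unique f a b : tends f a -> tends f b -> a = b.
Proof. by move=> fa fb; rewrite -(cvg_lim _ fa) // -(cvg_lim _ fb). Qed.
Lemma absum_tends f : absum f -> tends (series f) (csum f).
Proof. exact: absum_cvg. Qed.
End ComplexSequences.
Arguments tends_cst {R} a.
Arguments tendsZ {R} c {f a}.
Arguments tends_near {R f g a} K.

Section PartialFractions.
Variable R : realType.
Local Notation C := (cplx R).
Local Notation "x %:C" := ((x)%:C%C : C).
Local Notation twopii := (twopii R).
Local Notation "f ~~> l" := (tends f l) (at level 70, no associativity).
Implicit Types (u v w x : C) (phi psi : C -> C).

Definition ee w : C := cexp (twopii * w).

Lemma eeD u v : ee (u + v) = ee u * ee v.
Proof. by rewrite /ee mulrDr cexpD. Qed.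
Lemma ee_nat n : ee n%:R = 1.
Proof.
have e1 : ee 1 = 1.
  rewrite /ee mulr1 /cexp /= expR0 mul1r mulr_natl cos2pi sin_mulr2n sinpi mulr0 mul0rn.
  by [].
elim: n => [|n IHn]; first by rewrite /ee mulr0 cexp0.
by rewrite -addn1 natrD eeD IHn e1 mulr1.
Qed.
Lemma ee_half : ee (2^-1) = -1.
Proof.
have -> : ee 2^-1 = cexp ((0 +i* pi)%C : C).
  rewrite /ee; congr cexp; rewrite twopiiE mulrAC [2 * _]mulrC mulfK ?pnatr_eq0 //.
  by apply/eqP; rewrite eq_complex /=; apply/andP; split; apply/eqP; ring.
rewrite /cexp /= expR0 mul1r cospi sinpi.
by apply/eqP; rewrite eq_complex /= oppr0 !eqxx.
Qed.
Lemma nm_ee w : nm (ee w) = expR (- (2 * pi * complex.Im w)).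
Proof. by rewrite /ee nm_cexp Re_twopiiM. Qed.
Lemma eeS w n : ee (w + n%:R) = ee w.
Proof. by rewrite eeD ee_nat mulr1. Qed.
Lemma eeX w n : ee w ^+ n = ee (w *+ n).
Proof. by rewrite /ee cexpX mulrnAr. Qed.
Lemma ee_pow2 w n : ee (w / 2 ^+ n) ^+ (2 ^ n) = ee w.
Proof.
by rewrite eeX; congr ee; rewrite -[LHS]mulr_natr natrX divfK // expf_neq0 // pnatr_eq0.
Qed.
Lemma ee_neq1 w : 0 < complex.Im w -> ee w != 1.
Proof.
move=> w0; apply/eqP => /(congr1 (@nm R)); rewrite nm_ee nm1 => /eqP.
by rewrite lt_eqF // -[ltRHS]expR0 ltr_expR oppr_lt0 !mulr_gt0 // pi_gt0.
Qed.
Lemma ee_le1 w : 0 <= complex.Im w -> nm (ee w) <= 1.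
Proof.
move=> w0; rewrite nm_ee -[leRHS]expR0 ler_expR oppr_le0.
by rewrite !mulr_ge0 // pi_ge0.
Qed.

(* pi cot(pi w) and pi^2 / sin(pi w)^2 *)
Definition cotf w : C := twopii / 2 * (ee w + 1) / (ee w - 1).
Definition csc2f w : C := twopii ^+ 2 * ee w / (1 - ee w) ^+ 2.

Lemma ee_double w : ee w != 1 -> [/\ ee (w / 2) != 1, ee (w / 2) != -1,
  ee w = ee (w / 2) ^+ 2 & ee ((w + 1) / 2) = - ee (w / 2)].
Proof.
have E : ee w = ee (w / 2) ^+ 2.
  by rewrite eeX; congr ee; rewrite -[RHS]mulr_natr divfK ?pnatr_eq0.
move=> w1; split=> //.
- by apply: contraNneq w1; rewrite E => ->; rewrite expr1n.
- by apply: contraNneq w1; rewrite E => ->; rewrite sqrrN expr1n.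
- by rewrite mulrDl eeD mul1r ee_half mulrN1.
Qed.

(** With [E = ee (w / 2)] the points w / 2 and (w + 1) / 2 give E and - E, and [ee w] is E^2, so the
    duplication formulas are rational identities in E. *)
Lemma cotf_aux (F : numFieldType) (t E : F) : E != 1 -> E != -1 ->
  t / 2 * (E ^+ 2 + 1) / (E ^+ 2 - 1) =
  2^-1 * (t / 2 * (E + 1) / (E - 1) + t / 2 * (- E + 1) / (- E - 1)).
Proof.
move=> E1 EN1; have h1 : E - 1 != 0 by rewrite subr_eq0.
have h2 : E + 1 != 0 by rewrite addr_eq0.
have -> : - E - 1 = - (E + 1) by ring.
have -> : E ^+ 2 - 1 = (E - 1) * (E + 1) by ring.
by field; rewrite h1 h2.
Qed.

Lemma csc2f_aux (F : numFieldType) (t E : F) : E != 1 -> E != -1 ->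
  t * E ^+ 2 / (1 - E ^+ 2) ^+ 2 =
  4^-1 * (t * E / (1 - E) ^+ 2 + t * (- E) / (1 - - E) ^+ 2).
Proof.
move=> E1 EN1; have h1 : 1 - E != 0 by rewrite subr_eq0 eq_sym.
have h2 : 1 + E != 0 by rewrite addrC addr_eq0.
rewrite opprK.
have -> : 1 - E ^+ 2 = (1 - E) * (1 + E) by ring.
by field; rewrite h1 h2.
Qed.

Lemma cotf_double w : ee w != 1 ->
  cotf w = 2^-1 * (cotf (w / 2) + cotf ((w + 1) / 2)).
Proof.
by move=> /ee_double[E1 EN1 E2 EN]; rewrite /cotf E2 EN; apply: cotf_aux.
Qed.

Lemma csc2f_double w : ee w != 1 ->
  csc2f w = 4^-1 * (csc2f (w / 2) + csc2f ((w + 1) / 2)).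
Proof.
by move=> /ee_double[E1 EN1 E2 EN]; rewrite /csc2f E2 EN; apply: csc2f_aux.
Qed.

Lemma cotfS w n : cotf (w + n%:R) = cotf w. Proof. by rewrite /cotf eeS. Qed.
Lemma csc2fS w n : csc2f (w + n%:R) = csc2f w. Proof. by rewrite /csc2f eeS. Qed.

Section Window.
Variables (phi : C -> C) (c : C).
Hypothesis phi2 : forall w, ee w != 1 -> phi w = c * (phi (w / 2) + phi ((w + 1) / 2)).
Hypothesis phiS : forall w, phi (w + 1) = phi w.

Lemma double_iter n w : ee w != 1 ->
  phi w = c ^+ n * \sum_(0 <= k < 2 ^ n) phi ((w + k%:R) / 2 ^+ n).
Proof.
move=> w1; elim: n => [|n IHn].
  by rewrite expr0 mul1r expn0 big_nat1 addr0 expr0 divr1.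
have p0 : (2 ^+ n : C) != 0 by rewrite expf_neq0 // pnatr_eq0.
rewrite IHn exprSr -mulrA; congr (_ * _); rewrite expnS mul2n -addnn.
rewrite big_nat_double -big_split /= mulr_sumr.
apply: eq_bigr => k _; rewrite phi2; last first.
  by apply: contraNneq w1 => E; rewrite -(eeS w k) -(ee_pow2 _ n) E expr1n.
congr (_ * (_ + _)); congr phi; rewrite exprSr invfM mulrA //.
congr (_ / _); by rewrite natrD natrX addrA [RHS]mulrDl divff.
Qed.

(* The terms of the (n+1)-fold iterated doubling formula, paired so that for fixed k
   the pair converges as n grows, which allows Tannery's theorem. *)
Definition wterm n w k : C :=
  if (k < 2 ^ n)%N then c ^+ n.+1 * (phi ((w + k%:R) / 2 ^+ n.+1) +
                                     phi ((w - 1 - k%:R) / 2 ^+ n.+1)) else 0.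

(** Of the 2^(n+1) points the upper half is traversed backwards and moved by one period of [phi],
    which turns w + k with k >= 2^n into w - 1 - k with k < 2^n. *)
Lemma window n w : ee w != 1 -> phi w = csum (wterm n w).
Proof.
move=> w1; rewrite (@csum_fin _ _ (2 ^ n)%N) => [|k nk]; last first.
  by rewrite /wterm ltnNge nk.
rewrite (double_iter n.+1 w1) expnS mul2n -addnn.
rewrite big_nat_double [X in _ + X]big_nat_rev /= -big_split /= mulr_sumr.
rewrite [LHS]big_nat_cond [RHS]big_nat_cond; apply: eq_bigr => k /andP[/andP[_ kn] _].
rewrite /wterm kn; congr (_ * (_ + _)).
rewrite -[RHS]phiS; congr phi.
have p0 : (2 ^+ n.+1 : C) != 0 by rewrite expf_neq0 // pnatr_eq0.
rewrite add0n -[X in _ = _ + X](divff p0) -mulrDl; congr (_ / _).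
have -> : (2 ^ n - k.+1 + 2 ^ n)%N = (2 ^ n.+1 - k.+1)%N.
  by rewrite expnS mul2n -addnn; lia.
rewrite natrB; last by rewrite expnS mul2n -addnn; lia.
by rewrite natrX mulrS; ring.
Qed.

End Window.

Lemma cos_ge_half (y : R) : 0 <= y <= pi / 4 -> 1 / 2 <= cos y.
Proof.
move=> /andP[y0 y4]; have p0 := pi_gt0 R.
have c0 : 0 <= cos y by apply: cos_ge0_pihalf; apply/andP; split; lra.
have : 0 <= cos (y *+ 2) by apply: cos_ge0_pihalf; apply/andP; split; lra.
rewrite cos_mulr2n; nra.
Qed.

(** A crude form of Jordan's inequality: with x = y / 2 at most pi / 4, the mean value theorem gives
    sin x = x cos c, and both cosines in sin y = 2 cos x sin x are at least 1/2. *)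
Lemma sin_lb (y : R) : 0 <= y <= pi / 2 -> y / 4 <= sin y.
Proof.
move=> /andP[y0 y2]; have p0 := pi_gt0 R.
have [->|yn0] := eqVneq y 0; first by rewrite sin0 mul0r.
pose x := y / 2; have -> : y = x *+ 2 by rewrite /x; lra.
have x0 : 0 < x by rewrite divr_gt0 // lt_neqAle eq_sym yn0.
have x4 : x <= pi / 4 by rewrite /x; lra.
have sD t : t \in `]0, x[ -> is_derive t 1 sin (cos t) by move=> _; exact: is_derive_sin.
have sC : {within `[0, x], continuous (@sin R)}.
  by apply: continuous_subspaceT => t; exact: continuous_sin.
have [c] := MVT x0 sD sC.
rewrite in_itv /= => /andP[c0 cx]; rewrite sin0 !subr0 sin_mulr2n => ->.
have h1 : 1 / 2 <= cos x by apply: cos_ge_half; rewrite ltW.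
have h2 : 1 / 2 <= cos c by apply: cos_ge_half; rewrite ltW //=; lra.
have hp : x * (1 / 2) <= x * cos c by rewrite ler_wpM2l // ltW.
have : (1 / 2) * (x * (1 / 2)) <= cos x * (x * cos c).
  by apply: ler_pM => //; rewrite mulr_ge0 // ltW.
rewrite [cos c * x]mulrC; lra.
Qed.

Lemma sinpi_lb (x : R) : `|x| <= 1 / 2 -> `|x| / 2 <= `|sin (pi * x)|.
Proof.
move=> x2; have p0 := pi_gt0 R; have p2 := pi_ge2 R.
have -> : `|sin (pi * x)| = `|sin (pi * `|x|)|.
  by have [x0|x0] := ger0P x; rewrite ?(ger0_norm x0) // mulrN sinN normrN.
move: x2; have : 0 <= `|x| by []; move: `|x| => y y0 y2.
apply: le_trans (ler_norm _); apply: le_trans (sin_lb _); last first.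
  by rewrite mulr_ge0 ?pi_ge0 //=; nra.
nra.
Qed.

(** For rho = |ee u| the squared distance from 1 is (1 - rho)^2 + 4 rho sin(pi Re u)^2; the first
    square is dropped and the sine is bounded below by |Re u| / 2. *)
Lemma ee_sub1_lb u : `|complex.Re u| <= 1 / 2 ->
  nm (ee u) * complex.Re u ^+ 2 <= nm (1 - ee u) ^+ 2.
Proof.
move=> u2; rewrite nm_ee nm_sqr ReD ImD ReN ImN /ee /cexp Re_twopiiM.
set rho := expR _; set th := complex.Im _.
have -> : th = (pi * complex.Re u) *+ 2 by rewrite /th; case: (u) => a b /=; ring.
have := sinpi_lb u2; move: (complex.Re u) => a sa.
have r0 : 0 < rho by apply: expR_gt0.
rewrite /= !mul0r addr0 subr0 cos_mulr2n sin_mulr2n.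
have := cos2Dsin2 (pi * a); move: sa; move: (cos _) (sin _) => c s sa cs.
have : (`|a| / 2) ^+ 2 <= s ^+ 2.
  by rewrite -[s ^+ 2]real_normK ?num_real // lerXn2r ?nnegrE ?divr_ge0.
rewrite exprMn real_normK ?num_real // => as2.
have -> : (1 - rho * (c ^+ 2 *+ 2 - 1)) ^+ 2 + (0 - rho * (c * s *+ 2)) ^+ 2 =
  (1 - rho) ^+ 2 + 4 * rho * s ^+ 2.
  have -> : c ^+ 2 = 1 - s ^+ 2 by rewrite -cs addrK.
  have -> : (0 - rho * (c * s *+ 2)) ^+ 2 = 4 * rho ^+ 2 * c ^+ 2 * s ^+ 2 by ring.
  have -> : c ^+ 2 = 1 - s ^+ 2 by rewrite -cs addrK.
  ring.
apply: le_trans (_ : 4 * rho * s ^+ 2 <= _); last by rewrite lerDr sqr_ge0.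
have : rho * (a ^+ 2 * 2^-1 ^+ 2) <= rho * s ^+ 2 by rewrite ler_wpM2l // ltW.
lra.
Qed.

Lemma cvgn_bounded (f : nat -> C) (l : C) : f ~~> l -> exists B, forall n, nm (f n) <= B.
Proof.
move=> /tendsP/(_ 1 ltr01)[K HK].
exists (\sum_(0 <= i < K) nm (f i) + (1 + nm l)) => n.
have S0 i j : 0 <= \sum_(i <= k < j) nm (f k) by apply: sumr_ge0 => k _; apply: nm_ge0.
have [nK|Kn] := ltnP n K.
  apply: ler_wpDr; first by rewrite addr_ge0 ?nm_ge0.
  rewrite (big_cat_nat _ (ltnW nK)) //= [X in _ + X]big_ltn //.
  by rewrite addrCA lerDl addr_ge0.
rewrite ler_wpDl // -[f n](subrK l); apply: le_trans (nmD _ _) _.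
by rewrite lerD2r ltW // HK.
Qed.

Lemma cvgn_half (v : C) : (fun n => v / 2 ^+ n.+1) ~~> (0 : C).
Proof.
apply/tendsP => e e0; pose N := (Num.truncn (nm v / e)).+1.
exists N => n Nn; rewrite subr0 nmM nmV nmX nm_nat ltr_pdivrMr ?exprn_gt0 //.
rewrite mulrC -ltr_pdivrMr //.
apply: (@lt_le_trans _ _ N%:R); first by rewrite truncnS_gt.
rewrite -natrX ler_nat; apply: (leq_trans Nn); apply: ltnW.
exact: (leq_trans (ltn_expl n _) (leq_pexp2l _ _)).
Qed.

Lemma ee_slope (x : nat -> C) : x ~~> (0 : C) -> (forall n, x n != 0) ->
  (fun n => (ee (x n) - 1) / x n) ~~> twopii.
Proof.
move=> x0 xn; apply/tendsP => e e0.
have cd : cder ee 0 twopii.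
  have -> : ee = (@cexp R) \o (fun y => twopii * y) by [].
  rewrite -[X in cder _ _ X]mul1r; apply: cder_comp.
    by rewrite mulr0; apply: cder_cexp0.
  by have := cderZ twopii (cder_id 0); rewrite mulr1.
have e20 : 0 < e / 2 by rewrite divr_gt0.
have /nbhsCP[s s0 Hs] := cd _ e20.
have /tendsP/(_ s s0)[N HN] := x0; exists N => n Nn.
have := Hs (x n) (HN n Nn); rewrite add0r /ee mulr0 cexp0 => le.
have -> : (cexp (twopii * x n) - 1) / x n - twopii =
   (cexp (twopii * x n) - 1 - x n * twopii) / x n.
  by apply: (mulIf (xn n)); rewrite mulrBl !divfK // [twopii * _]mulrC.
rewrite nmM nmV ltr_pdivrMr ?nm_gt0 //; apply: le_lt_trans le _.
by rewrite ltr_pM2r ?nm_gt0 //; lra.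
Qed.

Lemma ee_cvg1 (x : nat -> C) : x ~~> (0 : C) -> (forall n, x n != 0) ->
  (fun n => ee (x n)) ~~> (1 : C).
Proof.
move=> x0 xn; have := tendsM (ee_slope x0 xn) x0; rewrite mulr0 => cv.
have -> : (fun n => ee (x n)) = (fun n => (ee (x n) - 1) / x n * x n + 1).
  by apply/funext => n; rewrite divfK // subrK.
apply: tends_eq; [apply: tendsD cv _; apply: tends_cst|exact: add0r].
Qed.

(** Near 0 the numerator of [cotf] tends to [twopii] and its denominator is asymptotic to [twopii]
    times the argument, so the principal part is 1/v. The factor 2^-(n+1) is the one produced by
    iterating the duplication formula n + 1 times. *)
Lemma cot_local (v : C) : v != 0 ->
  (fun n => 2^-1 ^+ n.+1 * cotf (v / 2 ^+ n.+1)) ~~> v^-1.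
Proof.
move=> v0; pose x n : C := v / 2 ^+ n.+1.
have p0 n : (2 ^+ n : C) != 0 by rewrite expf_neq0 // pnatr_eq0.
have xn n : x n != 0 by rewrite mulf_neq0 ?invr_neq0.
have cx : x ~~> (0 : C) by apply: cvgn_half.
have t0 := twopii_neq0 R.
have -> : (fun n => 2^-1 ^+ n.+1 * cotf (v / 2 ^+ n.+1)) =
    (fun n => v^-1 * (twopii / 2) * (ee (x n) + 1) * ((ee (x n) - 1) / x n)^-1).
  apply/funext => n; rewrite -/(x n) /cotf invfM invrK.
  have -> : v^-1 = (x n)^-1 * 2^-1 ^+ n.+1.
    by rewrite /x invfM invrK exprVn -mulrA divff ?mulr1.
  rewrite -[RHS]mulrA [_^-1 * x n]mulrC.
  transitivity ((x n)^-1 * x n * (2^-1 ^+ n.+1 * (twopii / 2 * (ee (x n) + 1) / (ee (x n) - 1)))).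
    by rewrite mulVf ?mul1r.
  by ring.
have E : v^-1 * (twopii / 2) * (1 + 1) * twopii^-1 = v^-1.
  have -> : (1 + 1 : C) = 2 by [].
  by rewrite -!(mulrA v^-1) divfK ?pnatr_eq0 // divff ?mulr1.
apply: (tends_eq _ E).
exact: (tendsM (tendsZ _ (tendsD (ee_cvg1 cx xn) (tends_cst 1))) (tendsV t0 (ee_slope cx xn))).
Qed.

Lemma csc2_local (v : C) : v != 0 ->
  (fun n => 4^-1 ^+ n.+1 * csc2f (v / 2 ^+ n.+1)) ~~> v ^- 2.
Proof.
move=> v0; pose x n : C := v / 2 ^+ n.+1.
have p0 n : (2 ^+ n : C) != 0 by rewrite expf_neq0 // pnatr_eq0.
have xn n : x n != 0 by rewrite mulf_neq0 ?invr_neq0.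
have cx : x ~~> (0 : C) by apply: cvgn_half.
have t0 := twopii_neq0 R.
have -> : (fun n => 4^-1 ^+ n.+1 * csc2f (v / 2 ^+ n.+1)) =
    (fun n => v ^- 2 * twopii ^+ 2 * ee (x n) *
      (((ee (x n) - 1) / x n)^-1 * ((ee (x n) - 1) / x n)^-1)).
  apply/funext => n; rewrite -/(x n) /csc2f -invfM -expr2 expr_div_n invf_div.
  have -> : (1 - ee (x n)) ^+ 2 = (ee (x n) - 1) ^+ 2 by rewrite -sqrrN opprB.
  have -> : 4^-1 ^+ n.+1 = x n ^+ 2 * v ^- 2.
    rewrite /x expr_div_n mulrC mulKf ?expf_neq0 // exprVn; congr (_^-1).
    have -> : (4 : C) = 2 ^+ 2 by rewrite -natrX.
    by rewrite -!exprM mulnC.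
  by ring.
have E : v ^- 2 * twopii ^+ 2 * 1 * (twopii^-1 * twopii^-1) = v ^- 2.
  by rewrite mulr1 -invfM -expr2 mulfK ?expf_neq0.
apply: (tends_eq _ E); have cV := tendsV t0 (ee_slope cx xn).
exact: (tendsM (tendsZ _ (ee_cvg1 cx xn)) (tendsM cV cV)).
Qed.

Lemma inv_sqr_sum n : \sum_(0 <= k < n) (k.+1%:R ^- 2 : R) <= 2.
Proof.
(* The sharper bound makes the induction go through, because 1/(n+1)^2 is at most 1/n - 1/(n+1). *)
suff H : \sum_(0 <= k < n.+1) (k.+1%:R ^- 2 : R) <= 2 - n.+1%:R^-1.
  apply: le_trans (_ : \sum_(0 <= k < n.+1) (k.+1%:R ^- 2 : R) <= _).
    by rewrite big_nat_recr //= lerDl invr_ge0 exprn_ge0.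
  by apply: le_trans H _; rewrite gerBl invr_ge0.
elim: n => [|n IHn]; first by rewrite big_nat1 expr1n invr1; lra.
rewrite big_nat_recr //=; apply: le_trans (lerD IHn (lexx _)) _.
rewrite -addrA lerD2l addrC -subr_ge0.
have p1 : 0 < n.+1%:R :> R by []; have p2 : 0 < n.+2%:R :> R by [].
have E : n.+2%:R = n.+1%:R + 1 :> R by rewrite [in LHS]mulrSr.
move: p1 p2; rewrite E; move: (n.+1%:R) => t t0 t1.
have -> : - (t + 1)^-1 - ((t + 1) ^- 2 - t^-1) = (t * (t + 1) ^+ 2)^-1.
  by field; rewrite (gt_eqF t0) (gt_eqF t1).
by rewrite invr_ge0 mulr_ge0 ?exprn_ge0 ?ltW.
Qed.

Lemma natC_shift_neq0 w k : ee w != 1 -> (w + k%:R != 0) /\ (w - 1 - k%:R != 0).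
Proof.
move=> w1; split; apply: contraNneq w1 => E.
  by rewrite -(eeS w k) E -(ee_nat 0).
have -> : w = (w - 1 - k%:R) + k.+1%:R by rewrite mulrS; ring.
by rewrite E add0r ee_nat.
Qed.

Lemma ee_divn_neq1 v n : ee v != 1 -> ee (v / 2 ^+ n) != 1.
Proof.
by apply: contraNneq => E; rewrite -(ee_pow2 _ n) E expr1n.
Qed.

Section UnitStrip.
Variable w : C.
Hypotheses (w1 : ee w != 1) (w0 : 0 <= complex.Im w) (wx : 0 <= complex.Re w < 1).

Let c0 : R := expR (- (pi * complex.Im w)).

(** In the strip 0 <= Re w < 1 both points have real part between k / 2^(n+1) and 1/2 in absolute
    value, the range of [ee_sub1_lb]. There [nm (ee _)] is at least c0^2, because dividing by
    2^(n+1) only shrinks the non-negative imaginary part. *)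
Lemma strip_lb n k : (0 < k < 2 ^ n)%N ->
  c0 * (k%:R / 2 ^+ n.+1) <= nm (1 - ee ((w + k%:R) / 2 ^+ n.+1)) /\
  c0 * (k%:R / 2 ^+ n.+1) <= nm (1 - ee ((w - 1 - k%:R) / 2 ^+ n.+1)).
Proof.
move=> /andP[k0 kn]; have p0 : (0 : R) < 2 ^+ n.+1 by rewrite exprn_gt0.
have np : `|2 ^+ n.+1| = 2 ^+ n.+1 :> R by rewrite gtr0_norm.
have main (v : C) : complex.Im v = complex.Im w ->
    k%:R <= `|complex.Re v| <= 2 ^+ n ->
    c0 * (k%:R / 2 ^+ n.+1) <= nm (1 - ee (v / 2 ^+ n.+1)).
  move=> vi /andP[kv vn].
  have [Er Ei] := divC_nat v (2 ^ n.+1); rewrite !natrX in Er Ei.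
  have c00 : 0 < c0 by apply: expR_gt0.
  rewrite -(@ler_pXn2r _ 2) ?nnegrE ?nm_ge0 ?mulr_ge0 ?divr_ge0 ?(ltW c00) ?(ltW p0) //.
  apply: le_trans (ee_sub1_lb _); last first.
    rewrite Er normrM normfV np ler_pdivrMr //.
    by apply: le_trans vn _; rewrite exprS; lra.
  rewrite exprMn; apply: ler_pM; rewrite ?exprn_ge0 ?divr_ge0 ?(ltW c00) ?(ltW p0) //.
    rewrite nm_ee Ei vi /c0 -expRM_natl ler_expR.
    have : complex.Im w / 2 ^+ n.+1 <= complex.Im w.
      rewrite ler_pdivrMr // ler_peMr // exprn_ege1 // ler1n //.
    have pp : 0 <= 2 * pi :> R by rewrite mulr_ge0 // pi_ge0.
    move/(ler_wpM2l pp); rewrite -!mulrA; lra.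
  rewrite Er -[leRHS]real_normK ?num_real // lerXn2r ?nnegrE ?divr_ge0 ?(ltW p0) //.
  by rewrite normrM normfV np ler_pM2r ?invr_gt0.
have kn' : k.+1%:R <= 2 ^+ n :> R by rewrite -natrX ler_nat.
have ReN_nat j : complex.Re (j%:R : C) = j%:R by rewrite -RtoC_nat.
have ImN_nat j : complex.Im (j%:R : C) = 0 by rewrite -RtoC_nat.
case/andP: wx => x0 x1; move: kn'; rewrite mulrSr => kn'.
have k0' : 0 <= k%:R :> R by [].
split; apply: main.
- by rewrite ImD ImN_nat addr0.
- rewrite ReD ReN_nat ger0_norm ?addr_ge0 //; apply/andP; split; lra.
- rewrite !ImD !ImN ImN_nat /= !subr0 //.
- rewrite !ReD !ReN ReN_nat /= ltr0_norm; last lra.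
  apply/andP; split; lra.
Qed.

Lemma strip_le1 n k : nm (ee ((w + k%:R) / 2 ^+ n)) <= 1.
Proof.
apply: ee_le1; have [_ Ei] := divC_nat (w + k%:R) (2 ^ n); rewrite !natrX in Ei.
by rewrite Ei ImD -RtoC_nat /= addr0 divr_ge0 // exprn_ge0.
Qed.

Lemma strip_le1' n k : nm (ee ((w - 1 - k%:R) / 2 ^+ n)) <= 1.
Proof.
apply: ee_le1; have [_ Ei] := divC_nat (w - 1 - k%:R) (2 ^ n); rewrite !natrX in Ei.
by rewrite Ei !ImD !ImN -RtoC_nat /= !subr0 divr_ge0 // exprn_ge0.
Qed.

Lemma strip_tannery (phi psi : C -> C) (c : C) (K : R) :
  (forall v, ee v != 1 -> phi v = c * (phi (v / 2) + phi ((v + 1) / 2))) ->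
  (forall v, phi (v + 1) = phi v) ->
  (forall v : C, v != 0 -> (fun n => c ^+ n.+1 * phi (v / 2 ^+ n.+1)) ~~> psi v) ->
  (forall n k, (0 < k < 2 ^ n)%N -> nm (wterm phi c n w k) <= K / k%:R ^+ 2) ->
  series (fun k => psi (w + k%:R) + psi (w - 1 - k%:R)) ~~> phi w.
Proof.
move=> phi2 phiS loc Hb.
pose a k := psi (w + k%:R) + psi (w - 1 - k%:R).
have cva k : (fun n => wterm phi c n w k) ~~> a k.
  have [n1 n2] := natC_shift_neq0 k w1.
  apply: (tends_near k _ (tendsD (loc _ n1) (loc _ n2))) => n kn.
  by rewrite /wterm (leq_ltn_trans kn (ltn_expl n _)) // mulrDr.
(* The bound K / k^2 says nothing for k = 0; that term is bounded because it converges as n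
   grows. *)
have [B0 HB0] := cvgn_bounded (cva 0%N).
have K0 : 0 <= K by have := le_trans (nm_ge0 _) (Hb 1%N 1%N isT); rewrite expr1n divr1.
pose b k := if k is j.+1 then K / k%:R ^+ 2 else B0.
have B00 : 0 <= B0 by apply: le_trans (HB0 0%N); apply: nm_ge0.
have [|||sa cv] := @tannery R (fun n => wterm phi c n w) a b (B0 + K * 2) 0.
- move=> n [|k] _; first exact: HB0.
  have [kn|kn] := ltnP k.+1 (2 ^ n); first by apply: Hb.
  by rewrite /wterm ltnNge kn nm0 /b divr_ge0 ?exprn_ge0.
- move=> [|n]; first by rewrite big_geq // addr_ge0 // mulr_ge0.
  rewrite big_nat_recl // lerD2l /= -mulr_sumr ler_wpM2l //.
  exact: inv_sqr_sum.
- exact: cva.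
have -> : phi w = csum a.
  apply: tends_unique cv; under eq_fun do rewrite -(window phi2 phiS _ w1).
  exact: tends_cst.
exact: absum_cvg.
Qed.

Lemma csc2_strip :
  series (fun k => (w + k%:R) ^- 2 + (w - 1 - k%:R) ^- 2) ~~> csc2f w.
Proof.
have c00 : 0 < c0 by apply: expR_gt0.
pose K := 2 * (nm twopii ^+ 2 / c0 ^+ 2).
apply: (@strip_tannery csc2f (fun v => v ^- 2) 4^-1 K).
- exact: csc2f_double.
- by move=> v; apply: (csc2fS v 1).
- exact: csc2_local.
move=> n k /[dup] knk /andP[k0 kn]; rewrite /wterm kn.
have [l1 l2] := strip_lb knk.
have p0 : (0 : R) < 2 ^+ n.+1 by rewrite exprn_gt0.
have k0' : 0 < k%:R :> R by rewrite ltr0n.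
have tb (v : C) : nm (ee v) <= 1 -> c0 * (k%:R / 2 ^+ n.+1) <= nm (1 - ee v) ->
    nm (4^-1 ^+ n.+1 * csc2f v) <= nm twopii ^+ 2 / c0 ^+ 2 / k%:R ^+ 2.
  move=> v1 lv; have cp : 0 < c0 * (k%:R / 2 ^+ n.+1) by rewrite mulr_gt0 ?divr_gt0.
  have -> : nm twopii ^+ 2 / c0 ^+ 2 / k%:R ^+ 2 =
      (4 ^+ n.+1)^-1 * (nm twopii ^+ 2 * 1 / (c0 * (k%:R / 2 ^+ n.+1)) ^+ 2).
    have -> : (4 : R) ^+ n.+1 = (2 ^+ n.+1) ^+ 2.
      have -> : (4 : R) = 2 ^+ 2 by rewrite -natrX.
      by rewrite -!exprM mulnC.
    move: (2 ^+ n.+1) p0 => P p0.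
    by field; rewrite (gt_eqF p0) (gt_eqF k0') (gt_eqF c00).
  rewrite /csc2f; move: (ee v) v1 lv => E v1 lv.
  have NE : nm (twopii ^+ 2 * E / (1 - E) ^+ 2) = nm twopii ^+ 2 * nm E / nm (1 - E) ^+ 2.
    by rewrite nmM nmV [nm (_ * E)]nmM !nmX.
  rewrite nmM NE nmX nmV nm_nat exprVn ler_wpM2l ?invr_ge0 ?exprn_ge0 //.
  apply: ler_pM; rewrite ?mulr_ge0 ?invr_ge0 ?exprn_ge0 ?nm_ge0 //.
    by apply: ler_pM; rewrite ?exprn_ge0 ?nm_ge0.
  rewrite lef_pV2 ?posrE ?exprn_gt0 ?(lt_le_trans cp) //.
  by rewrite lerXn2r ?nnegrE ?nm_ge0 ?(ltW cp).
rewrite mulrDr; apply: le_trans (nmD _ _) _.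
rewrite /K -mulrA mulr_natl mulr2n; apply: lerD; apply: tb => //.
  exact: strip_le1.
exact: strip_le1'.
Qed.

Lemma cot_sum_aux (t U V : C) : U != 1 -> V != 1 ->
  t / 2 * (U + 1) / (U - 1) + t / 2 * (V + 1) / (V - 1) =
  t * (U * V - 1) / ((1 - U) * (1 - V)).
Proof.
move=> U1 V1; have h1 : U - 1 != 0 by rewrite subr_eq0.
have h2 : V - 1 != 0 by rewrite subr_eq0.
have -> : (1 - U) * (1 - V) = (U - 1) * (V - 1) by ring.
by field; rewrite h1 h2.
Qed.

Lemma cot_strip :
  series (fun k => (w + k%:R)^-1 + (w - 1 - k%:R)^-1) ~~> cotf w.
Proof.
have c00 : 0 < c0 by apply: expR_gt0.
(* A single cotangent term is only of order 1/k. In the sum of the pair the numerator becomes U V -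
   1 = ee ((2 w - 1) / 2^(n+1)) - 1, of order 2^-(n+1) by this bound, and that yields the order
   1/k^2. *)
have [B HB] : exists B : R, forall n,
    nm ((2 ^+ n.+1) * (ee ((w + w - 1) / 2 ^+ n.+1) - 1)) <= B.
  have [->|v0] := eqVneq (w + w - 1) 0.
    by exists 0 => n; rewrite mul0r (ee_nat 0) subrr mulr0 nm0.
  have sl : (fun n => (w + w - 1) * ((ee ((w + w - 1) / 2 ^+ n.+1) - 1) / ((w + w - 1) / 2 ^+ n.+1))) ~~> (w + w - 1) * twopii.
    apply: tendsZ; apply: ee_slope; first exact: cvgn_half.
    by move=> n; rewrite mulf_neq0 // invr_neq0 // expf_neq0 // pnatr_eq0.
  have [B HB] := cvgn_bounded sl; exists B => n; apply: le_trans (HB n).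
  have E (F : fieldType) (v P e : F) : v != 0 -> P != 0 -> v * (e / (v / P)) = P * e.
    by move=> v0' P0; field; rewrite v0' P0.
  by rewrite E // expf_neq0 // pnatr_eq0.
apply: (@strip_tannery cotf (fun v => v^-1) 2^-1 (nm twopii * B / c0 ^+ 2)).
- exact: cotf_double.
- by move=> v; apply: (cotfS v 1).
- exact: cot_local.
move=> n k /[dup] knk /andP[k0 kn]; rewrite /wterm kn.
have [l1 l2] := strip_lb knk; have [n1 n2] := natC_shift_neq0 k w1.
have p0 : (0 : R) < 2 ^+ n.+1 by rewrite exprn_gt0.
have k0' : 0 < k%:R :> R by rewrite ltr0n.
have cp : 0 < c0 * (k%:R / 2 ^+ n.+1) by rewrite mulr_gt0 ?divr_gt0.
rewrite /cotf cot_sum_aux; last first.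
- apply: ee_divn_neq1; have -> : ee (w - 1 - k%:R) = ee w.
    by rewrite -[LHS](eeS _ k.+1); congr ee; rewrite mulrS; ring.
  exact: w1.
- by apply: ee_divn_neq1; rewrite eeS.
rewrite -eeD -mulrDl; have -> : w + k%:R + (w - 1 - k%:R) = w + w - 1 by ring.
set U := ee ((w + k%:R) / _) in l1 *; set V := ee ((w - 1 - _) / _) in l2 *.
have -> : 2^-1 ^+ n.+1 * (twopii * (ee ((w + w - 1) / 2 ^+ n.+1) - 1) / ((1 - U) * (1 - V))) =
   twopii * (2 ^+ n.+1 * (ee ((w + w - 1) / 2 ^+ n.+1) - 1)) *
   ((2 ^+ n.+1) ^- 2 * ((1 - U) * (1 - V))^-1).
  have P0 : (2 ^+ n.+1 : C) != 0 by rewrite expf_neq0 // pnatr_eq0.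
  rewrite exprVn; move: (2 ^+ n.+1) P0 => P P0; rewrite expr2 invfM.
  have E (F : fieldType) (p t x y : F) : p != 0 ->
      p^-1 * (t * x * y) = t * (p * x) * ((p * p)^-1 * y).
    by move=> p0'; field; rewrite p0'.
  exact: E.
rewrite 2!nmM; have -> : nm twopii * B / c0 ^+ 2 / k%:R ^+ 2 =
   nm twopii * B * ((2 ^+ n.+1) ^- 2 * (c0 * (k%:R / 2 ^+ n.+1)) ^- 2).
  move: (2 ^+ n.+1) p0 => P p0.
  by field; rewrite (gt_eqF p0) (gt_eqF k0') (gt_eqF c00).
rewrite ler_pM ?mulr_ge0 ?nm_ge0 //; first by rewrite ler_wpM2l ?nm_ge0.
rewrite nmM nmV !nmX nm_nat ler_wpM2l ?invr_ge0 ?exprn_ge0 ?(ltW p0) //.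
rewrite nmV nmM lef_pV2 ?posrE ?exprn_gt0 ?mulr_gt0 //.
- by rewrite expr2 ler_pM // ltW.
- exact: lt_le_trans l1.
- exact: lt_le_trans l2.
Qed.
End UnitStrip.

Lemma tends_inv_shift (w : C) :
  (fun n => (w + n%:R)^-1) ~~> 0 /\ (fun n => (w - n%:R)^-1) ~~> 0.
Proof.
have main (f : nat -> C) : (forall n, n%:R - nm w <= nm (f n)) -> (fun n => (f n)^-1) ~~> 0.
  move=> Hf; apply/tendsP => e e0; exists (Num.truncn (nm w + e^-1)).+1 => n Nn.
  have lt : nm w + e^-1 < n%:R.
    by apply: lt_le_trans (truncnS_gt _) _; rewrite ler_nat.
  have fe : e^-1 < nm (f n) by apply: lt_le_trans (Hf n); lra.
  by rewrite subr0 nmV -[e]invrK ltf_pV2 ?posrE ?invr_gt0 // (lt_trans _ fe) // invr_gt0.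
split; apply: main => n; rewrite lerBlDr.
  have E : n%:R = (w + n%:R) - w by ring.
  by rewrite -(nm_nat R n) {1}E; apply: nmB.
have E : n%:R = w - (w - n%:R) by ring.
by rewrite -(nm_nat R n) {1}E [leRHS]addrC; apply: nmB.
Qed.

(** Replacing w by w + 1 changes a partial sum by the two boundary terms psi (w + K) and - psi (w -
    K), which tend to 0. Hence the expansion known in the unit strip holds after every integer
    translation, upwards and downwards. *)
Lemma bilateral_series (phi psi : C -> C) :
  (forall v, phi (v + 1) = phi v) ->
  (forall w : C, (fun n => psi (w + n%:R)) ~~> 0 /\ (fun n => psi (w - n%:R)) ~~> 0) ->
  (forall w, ee w != 1 -> 0 <= complex.Im w -> 0 <= complex.Re w < 1 ->
    series (fun k => psi (w + k%:R) + psi (w - 1 - k%:R)) ~~> phi w) ->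
  forall w, ee w != 1 -> 0 <= complex.Im w ->
    series (fun n => psi (w + n.+1%:R) + psi (w - n.+1%:R)) ~~> phi w - psi w.
Proof.
move=> phiS psi0 strip w w1 w0.
pose A v K := series (fun k => psi (v + k%:R) + psi (v - 1 - k%:R)) K.
have AK v K : A v K.+1 = A v K + (psi (v + K%:R) + psi (v - 1 - K%:R)).
  by rewrite /A /series /= big_nat_recr.
have AS v K : A (v + 1) K = A v K + (psi (v + K%:R) - psi (v - K%:R)).
  elim: K => [|K IHK]; first by rewrite /A /series /= !big_geq // addr0 subr0 subrr addr0.
  rewrite !AK IHK addrK.
  have -> : v + 1 + K%:R = v + K.+1%:R by rewrite mulrS; ring.
  have -> : v - 1 - K%:R = v - K.+1%:R by rewrite mulrS; ring.
  by ring.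
have up v : A v ~~> phi v -> A (v + 1) ~~> phi (v + 1).
  move=> cv; have [p1 p2] := psi0 v.
  have := tendsD cv (tendsB p1 p2); rewrite subrr addr0 phiS.
  by apply: tends_near 0%N _ => n _; rewrite AS.
have down v : A (v + 1) ~~> phi (v + 1) -> A v ~~> phi v.
  move=> cv; have [p1 p2] := psi0 v.
  have := tendsB cv (tendsB p1 p2); rewrite subrr subr0 phiS.
  by apply: tends_near 0%N _ => n _; rewrite AS addrK.
have upn v n : A v ~~> phi v -> A (v + n%:R) ~~> phi (v + n%:R).
  move=> cv; elim: n => [|n IHn]; first by rewrite addr0.
  by rewrite mulrSr addrA; apply: up.
have downn v n : A (v + n%:R) ~~> phi (v + n%:R) -> A v ~~> phi v.
  elim: n => [|n IHn]; first by rewrite addr0.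
  by rewrite mulrSr addrA => /down.
have ReN_nat j : complex.Re (j%:R : C) = j%:R by rewrite -RtoC_nat.
have ImN_nat j : complex.Im (j%:R : C) = 0 by rewrite -RtoC_nat.
have Acv : A w ~~> phi w.
  have /andP[] := floor_itv (complex.Re w); rewrite intrD.
  case: (Num.floor _) => n.
    rewrite -[n%:~R]/(n%:R) => n1 n2.
    have E : w = (w - n%:R) + n%:R by rewrite subrK.
    rewrite {1}E {2}E; apply: upn; apply: strip.
    - by rewrite -(eeS _ n) -E.
    - by rewrite ImD ImN ImN_nat subr0.
    - by rewrite ReD ReN ReN_nat; apply/andP; split; lra.
  rewrite NegzE mulrNz -[n.+1%:~R]/(n.+1%:R) => n1 n2.
  apply: (downn _ n.+1); apply: strip.
  - by rewrite eeS.
  - by rewrite ImD ImN_nat addr0.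
  - by rewrite ReD ReN_nat; apply/andP; split; lra.
(* From the pairing of k with -1 - k to the pairing of n + 1 with -(n + 1): the partial sums differ
   by psi (w + K) - psi w. *)
have [p1 _] := psi0 w; have := tendsB (tendsD Acv p1) (tends_cst (psi w)).
rewrite addr0; apply: tends_near 0%N _ => K _ {p1 Acv}.
elim: K => [|K IHK]; first by rewrite /A /series /= !big_geq // addr0 add0r subrr.
move: IHK; rewrite /A /series /= !big_nat_recr //= => <-.
have -> : w - 1 - K%:R = w - K.+1%:R by rewrite mulrS; ring.
by ring.
Qed.

Lemma csc2_series w : ee w != 1 -> 0 <= complex.Im w ->
  series (fun n => (w + n.+1%:R) ^- 2 + (w - n.+1%:R) ^- 2) ~~> csc2f w - w ^- 2.
Proof.
apply: (@bilateral_series csc2f (fun v => v ^- 2)).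
- by move=> v; apply: (csc2fS v 1).
- move=> v; have [p1 p2] := tends_inv_shift v.
  have a := tendsM p1 p1; have b := tendsM p2 p2; rewrite mul0r in a b.
  by split; [move: a|move: b]; apply: tends_near 0%N _ => n _; rewrite -invfM expr2.
- exact: csc2_strip.
Qed.

Lemma cot_series w : ee w != 1 -> 0 <= complex.Im w ->
  series (fun n => (w + n.+1%:R)^-1 + (w - n.+1%:R)^-1) ~~> cotf w - w^-1.
Proof.
apply: (@bilateral_series cotf (fun v => v^-1)).
- by move=> v; apply: (cotfS v 1).
- exact: tends_inv_shift.
- exact: cot_strip.
Qed.

Lemma zeta2_absum : absum (fun n => (n.+1%:R : C) ^- 2).
Proof.
exists 2 => n; under eq_bigr do rewrite nmV nmX nm_nat; exact: inv_sqr_sum.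
Qed.

(** The value is pi^2 / 6, as [twopii] squared is -4 pi^2. At w = 1/2 the expansion of [csc2f] gives
    8 times the sum over odd integers; the even terms make up a quarter of the whole, whence 8 Z - 2
    Z = pi^2. *)
Lemma zeta2 : csum (fun n => (n.+1%:R : C) ^- 2) = - (twopii ^+ 2 / 24).
Proof.
have sz := zeta2_absum; set Z := csum _.
pose a n : C := n%:R ^- 2.
have sa : absum a by apply: absum_unshift.
have aZ : csum a = Z.
  have a0 : a 0%N = 0 by rewrite /a mulr0n expr0n invr0.
  by rewrite csum_recl // a0 add0r.
have h2 : (2 : C) != 0 by rewrite pnatr_eq0.
have E : ee 2^-1 != 1 :> C.
  by rewrite ee_half -subr_eq0 -opprD oppr_eq0 -[1 + 1]/(2 : C).
have I2 : (2^-1 : C) = 2^-1%:C by rewrite RtoCV RtoC_nat.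
have := @csc2_strip 2^-1 E; rewrite I2 /= -I2 => /(_ (lexx _)).
have -> : 0 <= (2^-1 : R) < 1 by rewrite invr_ge0 ler0n /= invf_lt1 // ltr1n.
move=> /(_ isT) S1.
have c2 : csc2f 2^-1 = - (twopii ^+ 2 / 4).
  rewrite /csc2f ee_half opprK -[1 + 1]/(2 : C) mulrN1 mulNr; congr (- (_ / _)).
  by rewrite -natrX.
have S2 : series (fun k => 8 * (k.*2.+1%:R : C) ^- 2) ~~> - (twopii ^+ 2 / 4).
  rewrite -c2; apply: tends_near 0%N _ S1 => n _; rewrite /series /=.
  apply: eq_bigr => k _; have -> : 2^-1 - 1 - k%:R = - (2^-1 + k%:R) :> C.
    by apply: (mulfI h2); rewrite mulrN !mulrDr !mulrN mulr1 divff //; ring.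
  rewrite sqrrN -mulr2n.
  have -> : k.*2.+1%:R = 2 * (2^-1 + k%:R) :> C.
    by rewrite mulrDr divff // mulrS -muln2 natrM mulrC.
  have F8 (F : numFieldType) (u : F) : u != 0 -> u ^- 2 *+ 2 = 8 / (2 * u) ^+ 2.
    by move=> u0; field; rewrite u0.
  by apply: F8; have [] := natC_shift_neq0 k E.
have S3 : series (fun k => 8 * (a k.*2.+1 + a k.*2)) ~~> 8 * Z.
  have sub : (fun n => series a n.*2) ~~> Z.
    have /tendsP cv := absum_tends sa; rewrite aZ in cv.
    apply/tendsP => e /cv[N HN]; exists N => n Nn; apply: HN.
    by rewrite (leq_trans Nn) // -addnn leq_addr.
  apply: tends_near 0%N _ (tendsZ 8 sub) => n _.
  rewrite /series /= -mulr_sumr; congr (_ * _).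
  elim: n => [|n IHn]; first by rewrite !big_geq.
  by rewrite doubleS !big_nat_recr //= IHn -addrA [a _ + a _]addrC.
have S4 : series (fun k => 8 * a k.*2) ~~> 2 * Z.
  have := tendsZ 2 (absum_tends sa); rewrite aZ; apply: tends_near 0%N _ => n _.
  rewrite /series /= mulr_sumr; apply: eq_bigr => k _.
  have F8 (F : numFieldType) (u : F) : 2 * u ^- 2 = 8 / (u * 2) ^+ 2.
    have [->|u0] := eqVneq u 0; first by rewrite mul0r expr0n invr0 !mulr0.
    by field; rewrite u0.
  by rewrite /a -muln2 natrM; exact: F8.
have := tendsB S3 S4.
have cv : (fun n => series (fun k => 8 * (a k.*2.+1 + a k.*2)) n - series (fun k => 8 * a k.*2) n)
    ~~> - (twopii ^+ 2 / 4).
  apply: tends_near 0%N _ S2 => n _; rewrite /series /= -sumrB; apply: eq_bigr => k _.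
  by rewrite mulrDr addrK.
move=> /(tends_unique cv) /eqP; rewrite -mulrBl.
have -> : (8 - 2 : C) = 6 by rewrite -natrB.
move=> /eqP E6; have h6 : (6 : C) != 0 by rewrite pnatr_eq0.
apply: (mulfI h6); rewrite -E6 mulrN; congr (- _).
have F24 (F : numFieldType) (t : F) : t / 4 = 6 * (t / 24) by field.
exact: F24.
Qed.

(** * The Eisenstein series of weight 2 under z -> -1/z *)

Section Eisenstein.
Variable z : C.
Hypothesis z0 : 0 < complex.Im z.

Let ReN_nat j : complex.Re (j%:R : C) = j%:R. Proof. by rewrite -RtoC_nat. Qed.
Let ImN_nat j : complex.Im (j%:R : C) = 0. Proof. by rewrite -RtoC_nat. Qed.
Let Im_natM j (w : C) : complex.Im (j%:R * w) = j%:R * complex.Im w.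
Proof. by rewrite -RtoC_nat; case: w => a b /=; rewrite mul0r addr0. Qed.

(** For u = m z + n or u = m z - n one has m <= |u| / Im z and n <= |u| + m |z|; adding the two
    gives m + n <= |u| / kap. *)
Let kap : R := (1 + (1 + nm z) / complex.Im z)^-1.

Lemma lattice_lb m n : (0 < m + n)%N ->
  kap * (m + n)%:R <= nm (m%:R * z + n%:R) /\ kap * (m + n)%:R <= nm (m%:R * z - n%:R).
Proof.
move=> mn0; have k0 : 0 < 1 + (1 + nm z) / complex.Im z.
  by rewrite ltr_wpDr // divr_ge0 ?(ltW z0) // addr_ge0 ?nm_ge0.
have main (u v : C) : complex.Im u = m%:R * complex.Im z -> nm (u - m%:R * z) = n%:R ->
    kap * (m + n)%:R <= nm u.
  move=> ui un; rewrite /kap mulrC ler_pdivrMr // mulrDr mulr1.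
  have mu : m%:R <= nm u / complex.Im z.
    by rewrite ler_pdivlMr // -ui (le_trans (ler_norm _)) // Im_le_nm.
  have nu : n%:R <= nm u + m%:R * nm z.
    by rewrite -un; apply: le_trans (nmB _ _) _; rewrite nmM nm_nat.
  have := ler_wpM2r (nm_ge0 z) mu.
  rewrite natrD mulrDl mul1r mulrDr mulrA mulrAC; move: mu nu; lra.
split; apply: main => //; rewrite ?ImD ?ImN ?ImN_nat ?Im_natM ?addr0 ?subr0 //.
  by rewrite addrC addKr nm_nat.
by rewrite addrC addKr nmN nm_nat.
Qed.

Lemma kap_gt0 : 0 < kap.
Proof.
by rewrite invr_gt0 ltr_wpDr // divr_ge0 ?(ltW z0) // addr_ge0 ?nm_ge0.
Qed.

Let a (s : C) m n : C := m.+1%:R * z + s * n.+1%:R.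
(* The summand of the double series minus a comparison series that telescopes in m;
   the difference converges absolutely. *)
Let d s m n : C := (a s m n) ^- 2 - (a s m n)^-1 * (a s m.+1 n)^-1.

Lemma a_lb s m n : s = 1 \/ s = -1 -> kap * (m + n).+2%:R <= nm (a s m n).
Proof.
have [l1 l2] := @lattice_lb m.+1 n.+1 isT; rewrite addSn addnS in l1 l2.
by case=> ->; rewrite /a ?mul1r ?mulN1r.
Qed.

Lemma a_neq0 s m n : s = 1 \/ s = -1 -> a s m n != 0.
Proof.
move=> /(a_lb m n) l; rewrite -nm_gt0; apply: lt_le_trans l.
by rewrite mulr_gt0 ?kap_gt0 // ltr0n.
Qed.

Lemma aS s m n : a s m.+1 n = a s m n + z.
Proof. by rewrite /a [m.+2%:R]mulrSr mulrDl mul1r addrAC. Qed.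

(** Over a common denominator [d] is z / (a^2 (a + z)) with a = [a s m n]: the comparison series
    gains one order, and inverse cubes are summable over the lattice. *)
Lemma d_bound s m n : s = 1 \/ s = -1 ->
  nm (d s m n) <= nm z / kap ^+ 3 * (m + n).+2%:R ^- 3.
Proof.
move=> hs; have n0 := a_neq0 m n hs; have n1 := a_neq0 m.+1 n hs.
have -> : d s m n = z * ((a s m n) ^- 2 * (a s m.+1 n)^-1).
  move: n0 n1; rewrite /d aS; move: (a s m n) => A A0 A1.
  have E (F : fieldType) (x y : F) : x != 0 -> x + y != 0 ->
      x ^- 2 - x^-1 * (x + y)^-1 = y * (x ^- 2 * (x + y)^-1).
    by move=> x0 y0; field; rewrite x0 y0.
  exact: E.
have p : 0 < kap * (m + n).+2%:R by rewrite mulr_gt0 ?kap_gt0 // ltr0n.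
have -> : nm z / kap ^+ 3 * (m + n).+2%:R ^- 3 =
    nm z * ((kap * (m + n).+2%:R) ^- 2 * (kap * (m + n).+2%:R)^-1).
  have := kap_gt0; have : 0 < (m + n).+2%:R :> R by [].
  move: (_%:R) kap => x y x0 y0; field; rewrite (gt_eqF x0) (gt_eqF y0) //.
rewrite !nmM ler_wpM2l ?nm_ge0 // !nmV nmX.
have la := a_lb m n hs; have lb : kap * (m + n).+2%:R <= nm (a s m.+1 n).
  apply: le_trans (a_lb _ _ hs); rewrite ler_wpM2l ?ler_nat ?(ltW kap_gt0) //.
have pa := lt_le_trans p la; have pb := lt_le_trans p lb.
apply: ler_pM; rewrite ?invr_ge0 ?exprn_ge0 ?nm_ge0 //.
  by rewrite lef_pV2 ?posrE ?exprn_gt0 // lerXn2r ?nnegrE ?nm_ge0 ?(ltW p).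
by rewrite lef_pV2.
Qed.

(** With t = m + n + 2, the term 1/t^3 is at most half of 1/((t - 1) t) - 1/(t (t + 1)), so the
    inner sum telescopes to something of order 1/m^2. *)
Lemma inv_cube_sum M N :
  \sum_(0 <= m < M) \sum_(0 <= n < N) ((m + n).+2%:R ^- 3 : R) <= 2.
Proof.
have inner m : \sum_(0 <= n < N) ((m + n).+2%:R ^- 3 : R) <= m.+1%:R ^- 2.
  suff H : \sum_(0 <= n < N) ((m + n).+2%:R ^- 3 : R) <=
      2^-1 * ((m.+1%:R * m.+2%:R)^-1 - ((m + N).+1%:R * (m + N).+2%:R)^-1).
    apply: le_trans H _; apply: (@le_trans _ _ (2^-1 * (m.+1%:R * m.+2%:R)^-1)).
      by rewrite ler_wpM2l ?invr_ge0 // gerBl invr_ge0 mulr_ge0.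
    apply: (@le_trans _ _ ((m.+1%:R * m.+2%:R)^-1)).
      by rewrite ler_piMl ?invr_ge0 ?mulr_ge0 // invf_le1 // ler1n.
    by rewrite lef_pV2 ?posrE ?mulr_gt0 ?exprn_gt0 // expr2 ler_pM2l // ler_nat.
  elim: N => [|N IHN]; first by rewrite big_geq // addn0 subrr mulr0.
  rewrite big_nat_recr //=; apply: le_trans (lerD IHN (lexx _)) _.
  rewrite addnS; have t0 : 0 < (m + N).+1%:R :> R by [].
  rewrite ![(m + N).+3%:R]mulrSr ![(m + N).+2%:R]mulrSr.
  move: ((m + N).+1%:R) t0 (m.+1%:R * m.+2%:R)^-1 => t t0 c.
  have t1 : 0 < t + 1 by rewrite ltr_wpDr.
  have t2 : 0 < t + 1 + 1 by rewrite ltr_wpDr.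
  rewrite -subr_ge0.
  have -> : 2^-1 * (c - ((t + 1) * (t + 1 + 1))^-1) -
      (2^-1 * (c - (t * (t + 1))^-1) + (t + 1) ^- 3) =
      (t * (t + 1) ^+ 3 * (t + 1 + 1))^-1.
    by field; rewrite (gt_eqF t0) (gt_eqF t1) (gt_eqF t2).
  by rewrite invr_ge0 !mulr_ge0 ?exprn_ge0 ?ltW.
apply: le_trans (inv_sqr_sum M); apply: ler_sum => m _; exact: inner.
Qed.

Lemma ee_neq1_Im w : 0 < complex.Im w -> ee w != 1 /\ 0 <= complex.Im w.
Proof. by move=> w0; split; [apply: ee_neq1|apply: ltW]. Qed.

Let D m n := d 1 m n + d (- 1) m n.
Let w m : C := m.+1%:R * z.
Let v n : C := n.+1%:R * (- z^-1).
(** Summed over n and both signs, the comparison terms of row m give [P m - P m.+1], by partial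
    fractions and the cotangent expansion. *)
Let P m : C := z^-1 * (cotf (w m) - (w m)^-1).

Lemma z_neq0 : z != 0.
Proof. by apply: contraTneq z0 => ->; rewrite ltxx. Qed.

Lemma Im_invN (x : C) : 0 < complex.Im x -> 0 < complex.Im (- x^-1).
Proof.
case: x => x y /= y0; rewrite opprK divr_gt0 //.
by rewrite ltr_wpDl ?sqr_ge0 // exprn_gt0.
Qed.

Let Im_w m : 0 < complex.Im (w m).
Proof. by rewrite /w Im_natM mulr_gt0. Qed.
Let Im_v n : 0 < complex.Im (v n).
Proof. by rewrite /v Im_natM mulr_gt0 // Im_invN. Qed.

Lemma D_bound M N : \sum_(0 <= m < M) \sum_(0 <= n < N) nm (D m n) <=
  2 * (nm z / kap ^+ 3) * 2.
Proof.
have c0 : 0 <= 2 * (nm z / kap ^+ 3).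
  by rewrite mulr_ge0 // divr_ge0 ?nm_ge0 // exprn_ge0 // ltW // kap_gt0.
apply: le_trans (ler_wpM2l c0 (inv_cube_sum M N)).
rewrite mulr_sumr; apply: ler_sum => m _; rewrite mulr_sumr; apply: ler_sum => n _.
apply: le_trans (nmD _ _) _; rewrite mulr_natl mulr2n mulrDl.
by apply: lerD; apply: d_bound; [left|right].
Qed.

Lemma telescope (x : C) : x != 0 -> x + z != 0 ->
  x^-1 * (x + z)^-1 = z^-1 * (x^-1 - (x + z)^-1).
Proof.
have E (F : fieldType) (t s : F) : t != 0 -> s != 0 -> t + s != 0 ->
    t^-1 * (t + s)^-1 = s^-1 * (t^-1 - (t + s)^-1).
  by move=> t0 s0 ts0; field; rewrite t0 s0 ts0.
by move=> x0 xz; apply: E => //; apply: z_neq0.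
Qed.

Let dE s m n : s = 1 \/ s = -1 ->
  d s m n = (a s m n) ^- 2 - z^-1 * ((a s m n)^-1 - (a s m.+1 n)^-1).
Proof.
move=> hs; rewrite /d aS telescope ?a_neq0 // -aS; exact: a_neq0.
Qed.

Let row m : series (D m) ~~> csc2f (w m) - (w m) ^- 2 - (P m - P m.+1).
Proof.
have [e1 i1] := ee_neq1_Im (Im_w m); have [e2 i2] := ee_neq1_Im (Im_w m.+1).
have S1 := csc2_series e1 i1; have S2 := cot_series e1 i1; have S3 := cot_series e2 i2.
have := tendsB S1 (tendsB (tendsZ z^-1 S2) (tendsZ z^-1 S3)).
apply: tends_near 0%N _ => N _.
rewrite /series /= !mulr_sumr -!sumrB; apply: eq_bigr => n _.
rewrite /D !dE; try by [left|right]; rewrite /a !mul1r !mulN1r -/(w m) -/(w m.+1); ring.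
Qed.

Lemma a_col s n : s = 1 \/ s = -1 -> (fun m => (a s m n)^-1) ~~> 0.
Proof.
move=> hs; have [p1 _] := tends_inv_shift (1 + s * n.+1%:R / z).
have := tendsZ z^-1 p1; rewrite mulr0; apply: tends_near 0%N _ => m _.
rewrite -invfM; congr (_^-1); rewrite /a [m.+1%:R]mulrS !mulrDr mulr1 mulrDl mul1r.
have -> : z * (s * n.+1%:R / z) = s * n.+1%:R by rewrite mulrC divfK ?z_neq0.
by rewrite addrAC [z * _]mulrC.
Qed.

(** Along a column the comparison terms telescope to those with m = 0. The rest is a [csc2f] series
    at [v n], because [a s m n] equals z times m + 1 - s [v n]. *)
Lemma col n : series (D ^~ n) ~~>
  z ^- 2 * (csc2f (v n) - (v n) ^- 2) - z^-1 * ((a 1 0 n)^-1 + (a (- 1) 0 n)^-1).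
Proof.
have [e1 i1] := ee_neq1_Im (Im_v n).
have S1 := csc2_series e1 i1.
have p1 : (1 : C) = 1 \/ (1 : C) = -1 by left.
have p2 : (-1 : C) = 1 \/ (-1 : C) = -1 by right.
have S2 := tendsZ z^-1 (tendsD (tendsB (tends_cst (a 1 0 n)^-1) (a_col n p1))
  (tendsB (tends_cst (a (-1) 0 n)^-1) (a_col n p2))).
have := tendsB (tendsZ (z ^- 2) S1) S2; rewrite !subr0; apply: tends_near 0%N _ => M _.
elim: M => [|M IHM].
  by rewrite /series /= !big_geq // !subrr mulr0 addr0 mulr0 subr0.
have sS (f : nat -> C) K : series f K.+1 = series f K + f K.
  by rewrite /series /= big_nat_recr.
rewrite !sS -IHM /D !dE //.
have az s : a s M n = z * (M.+1%:R - s * v n).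
  rewrite /a /v mulrBr [z * M.+1%:R]mulrC mulrN mulrN mulrN opprK.
  by congr (_ + _); rewrite mulrCA; congr (_ * _); rewrite mulrCA divff ?z_neq0 ?mulr1.
have E1 : a 1 M n ^- 2 = z ^- 2 * (v n - M.+1%:R) ^- 2.
  by rewrite az mul1r exprMn invfM -[(v n - _) ^+ 2]sqrrN opprB.
have E2 : a (-1) M n ^- 2 = z ^- 2 * (v n + M.+1%:R) ^- 2.
  by rewrite az mulN1r opprK exprMn invfM [v n + _]addrC.
rewrite E1 E2; ring.
Qed.

(** [ee (w m)] is a power of [ee z] tending to 0, so [cotf (w m)] tends to - twopii / 2. This
    non-zero limit is the source of the anomaly of [Gf]. *)
Lemma cot_lim : P ~~> z^-1 * - (twopii / 2).
Proof.
have q1 : nm (ee z) < 1.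
  rewrite nm_ee -[ltRHS]expR0 ltr_expR oppr_lt0.
  by rewrite !mulr_gt0 ?pi_gt0.
have ew m : ee (w m) = ee z ^+ m.+1 by rewrite eeX /w mulr_natl.
have e0 : (fun m => ee (w m)) ~~> 0.
  apply/tendsP => e e0.
  have /cvgrPdist_lt/(_ e e0)[N _ HN] : (fun n => nm (ee z) ^+ n) @ \oo --> (0 : R).
    by apply: cvg_expr; rewrite ger0_norm ?nm_ge0.
  exists N => n Nn; have := HN n.+1 (leqW Nn).
  by rewrite /= sub0r normrN subr0 ew nmX ger0_norm ?exprn_ge0 ?nm_ge0.
have w0 : (fun m => (w m)^-1) ~~> 0.
  have [p1 _] := tends_inv_shift 1.
  have := tendsZ z^-1 p1; rewrite mulr0; apply: tends_near 0%N _ => m _.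
  by rewrite -invfM mulrC -mulrS.
have h1 : (0 - 1 : C) != 0 by rewrite sub0r oppr_eq0 oner_eq0.
have c1 := tendsM (tendsZ (twopii / 2) (tendsD e0 (tends_cst 1)))
  (tendsV h1 (tendsB e0 (tends_cst 1))).
apply: tends_eq (tendsZ z^-1 (tendsB c1 w0)) _.
by rewrite add0r mulr1 sub0r invrN1 mulrN1 subr0.
Qed.

(** The rows add up to A - z^-2 zeta(2) - (P 0 - lim P) and the columns to z^-2 B - zeta(2) - P 0.
    When the two are equated, P 0 cancels and lim P = - twopii / (2 z) remains. *)
Lemma eisenstein_swap : exists A B : C,
  [/\ series (fun m => csc2f (m.+1%:R * z)) ~~> A,
      series (fun n => csc2f (n.+1%:R * - z^-1)) ~~> B &
      z ^- 2 * B + twopii ^+ 2 / 24 = A - twopii / (2 * z) + twopii ^+ 2 / 24 * z ^- 2].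
Proof.
have [f1 f2 f3 f4 f5] := fubini_nat D_bound.
set X := csum (fun m => csum (D m)) in f5.
pose Z : C := csum (fun n => n.+1%:R ^- 2).
have SZ : series (fun n => n.+1%:R ^- 2) ~~> Z by apply/absum_tends/zeta2_absum.
have rowE m : csum (D m) = csc2f (w m) - (w m) ^- 2 - (P m - P m.+1).
  by apply: (tends_unique (absum_tends (f1 m))); apply: row.
have colE n : csum (D ^~ n) = z ^- 2 * (csc2f (v n) - (v n) ^- 2) -
    z^-1 * ((a 1 0 n)^-1 + (a (- 1) 0 n)^-1).
  by apply: (tends_unique (absum_tends (f2 n))); apply: col.
have SP : series (fun m => P m - P m.+1) ~~> P 0%N - z^-1 * - (twopii / 2).
  have := tendsB (tends_cst (P 0%N)) cot_lim; apply: tends_near 0%N _ => M _.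
  elim: M => [|M IHM]; first by rewrite /series /= big_geq // subrr.
  by move: IHM; rewrite /series /= big_nat_recr //= => <-; rewrite addrA subrK.
have SA : series (fun m => csc2f (w m)) ~~> X + (P 0%N - z^-1 * - (twopii / 2)) + z ^- 2 * Z.
  have := tendsD (tendsD (absum_tends f3) SP) (tendsZ (z ^- 2) SZ).
  apply: tends_near 0%N _ => M _.
  rewrite /series /= mulr_sumr -!big_split; apply: eq_bigr => m _ /=.
  by rewrite rowE subrK /w exprMn invfM [z ^- 2 * _]mulrC subrK.
have SB : series (fun n => z ^- 2 * csc2f (v n)) ~~> X + P 0%N + Z.
  have [e1 i1] := ee_neq1_Im (Im_w 0).
  have S2 := tendsZ z^-1 (cot_series e1 i1).
  rewrite f5; have := tendsD (tendsD (absum_tends f4) S2) SZ.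
  apply: tends_near 0%N _ => N _.
  rewrite /series /= mulr_sumr -!big_split; apply: eq_bigr => n _ /=.
  have E1 : a 1 0 n = w 0 + n.+1%:R by rewrite /a [1 * n.+1%:R]mul1r.
  have E2 : a (-1) 0 n = w 0 - n.+1%:R by rewrite /a mulN1r.
  have E3 : z ^- 2 * v n ^- 2 = n.+1%:R ^- 2.
    by rewrite -invfM -exprMn /v mulrCA mulrN divff ?z_neq0 // mulrN1 sqrrN.
  by rewrite colE E1 E2 subrK mulrBr E3 subrK.
have SB' : series (fun n => csc2f (v n)) ~~> z ^+ 2 * (X + P 0%N + Z).
  have := tendsZ (z ^+ 2) SB; apply: tends_near 0%N _ => N _.
  rewrite /series /= mulr_sumr; apply: eq_bigr => n _.
  by rewrite mulrA divff ?expf_neq0 ?z_neq0 // mul1r.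
exists (X + (P 0%N - z^-1 * - (twopii / 2)) + z ^- 2 * Z), (z ^+ 2 * (X + P 0%N + Z)).
split; [exact: SA|exact: SB'|].
have E (F : numFieldType) (x p t y : F) : y != 0 ->
    y ^- 2 * (y ^+ 2 * (x + p + - (t ^+ 2 / 24))) + t ^+ 2 / 24 =
    x + (p - y^-1 * - (t / 2)) + y ^- 2 * - (t ^+ 2 / 24) - t / (2 * y) + t ^+ 2 / 24 * y ^- 2.
  by move=> y0; field; rewrite y0.
by rewrite /Z zeta2; apply: E; apply: z_neq0.
Qed.
End Eisenstein.
End PartialFractions.

(** * Convolution of divisor sums *)

Section DivisorSums.
Local Open Scope nat_scope.

Definition posn (n : nat) := index_iota 1 n.+1.
Definition ppairs (n : nat) := [seq (a, x) | a <- posn n, x <- posn n].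
(** A divisor is carried together with its cofactor, so that a summand may depend on either. The
    list is empty for n = 0; divisor sums vanish there, and the end terms of a convolution over 0..n
    are zero. *)
Definition divp n := [seq p <- ppairs n | p.1 * p.2 == n].

Lemma mem_posn n a : (a \in posn n) = (0 < a <= n).
Proof. by rewrite mem_index_iota ltnS. Qed.

Lemma mem_ppairs n p : (p \in ppairs n) = (0 < p.1 <= n) && (0 < p.2 <= n).
Proof.
case: p => a x; rewrite -!mem_posn; apply/allpairsP/andP => [[[b y] [/= ? ? [-> ->]]] //|].
by move=> [ha hx]; exists (a, x).
Qed.

Lemma uniq_ppairs n : uniq (ppairs n).
Proof.
by apply: allpairs_uniq; rewrite ?iota_uniq // => -[? ?] [? ?] _ _ /= [-> ->].
Qed.

Lemma mem_divp n p : (p \in divp n) = [&& 0 < p.1, 0 < p.2 & p.1 * p.2 == n].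
Proof.
rewrite mem_filter mem_ppairs; case: p => a x /=.
apply/idP/idP => [/andP[-> /andP[/andP[-> _] /andP[-> _]]] //|].
move=> /and3P[a0 x0 /eqP <-]; rewrite eqxx a0 x0 /=.
by rewrite leq_pmulr // leq_pmull.
Qed.

Lemma uniq_divp n : uniq (divp n).
Proof. by rewrite filter_uniq // uniq_ppairs. Qed.

(** An entry [((a, x), (b, y))] is a solution of a x + b y = n in positive integers; the sum of a b
    over these solutions is the convolution of sigma_1 with itself. *)
Definition quads n := [seq u <- [seq (p, q) | p <- ppairs n, q <- ppairs n] |
  u.1.1 * u.1.2 + u.2.1 * u.2.2 == n].

Definition qpos (u : (nat * nat) * (nat * nat)) :=
  [&& 0 < u.1.1, 0 < u.1.2, 0 < u.2.1 & 0 < u.2.2].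
Definition qval (u : (nat * nat) * (nat * nat)) := u.1.1 * u.1.2 + u.2.1 * u.2.2.

Lemma mem_quads n u : (u \in quads n) = qpos u && (qval u == n).
Proof.
rewrite mem_filter -/(qval u) andbC; case: eqP => [E|_]; last by rewrite !andbF.
rewrite !andbT; case: u E => -[a x] [b y]; rewrite /qval /qpos /= => E.
apply/allpairsP/idP => [[[[? ?] [? ?]] /= []]|].
  by rewrite !mem_ppairs /= => + + [-> -> -> ->] => /andP[/andP[-> _] /andP[-> _]]
    /andP[/andP[-> _] /andP[-> _]].
move=> /and4P[a0 x0 b0 y0]; exists ((a, x), (b, y)); split=> //; rewrite mem_ppairs /=.
  by rewrite a0 x0 /= -E; apply/andP; split; apply: leq_trans (leq_addr _ _);
     rewrite ?leq_pmulr ?leq_pmull.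
by rewrite b0 y0 /= -E; apply/andP; split; apply: leq_trans (leq_addl _ _);
   rewrite ?leq_pmulr ?leq_pmull.
Qed.

Lemma uniq_quads n : uniq (quads n).
Proof.
rewrite filter_uniq //; apply: allpairs_uniq; rewrite ?uniq_ppairs //.
by move=> [? ?] [? ?] _ _ /= [-> ->].
Qed.

(* (a, b, x, y) -> (a - b, b, x, x + y) maps the solutions of a x + b y = n with
   b < a to those with x < y. *)
Definition qshift (u : (nat * nat) * (nat * nat)) :=
  ((u.1.1 - u.2.1, u.1.2), (u.2.1, u.1.2 + u.2.2)).

Lemma perm_qshift n :
  perm_eq [seq qshift u | u <- quads n & u.2.1 < u.1.1]
          [seq u <- quads n | u.1.2 < u.2.2].
Proof.
apply: uniq_perm.
- rewrite map_inj_in_uniq ?(filter_uniq _ (uniq_quads n)) //.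
  move=> [[a x] [b y]] [[a' x'] [b' y']]; rewrite !mem_filter /= => /andP[h _] /andP[h' _].
  by case=> e1 e2 e3 e4; congr ((_, _), (_, _)); lia.
- by rewrite (filter_uniq _ (uniq_quads n)).
move=> [[a x] [b y]]; rewrite mem_filter mem_quads /qpos /qval /=.
apply/mapP/idP => [[[[a' x'] [b' y']]]|].
  rewrite mem_filter mem_quads /qpos /qval /= => /andP[h /andP[/and4P[a0 x0 b0 y0] /eqP E]].
  case=> -> -> -> ->; rewrite subn_gt0 h x0 b0 addn_gt0 x0 /= -{1}[x']addn0 ltn_add2l y0 /=.
  by rewrite -E mulnBl mulnDr addnA subnK // leq_mul2r (ltnW h) orbT.
move=> /and3P[h /and4P[a0 x0 b0 y0] /eqP E].
exists ((a + b, x), (b, y - x)).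
  rewrite mem_filter mem_quads /qpos /qval /= addn_gt0 a0 x0 b0 subn_gt0 h /=.
  rewrite -{1}[b]add0n ltn_add2r a0 /= -E mulnDl -addnA -mulnDr subnKC //.
  exact: ltnW.
by rewrite /qshift /= addnK subnKC // ltnW.
Qed.

Definition qswap (u : (nat * nat) * (nat * nat)) := (u.2, u.1).

Lemma perm_qswap n : perm_eq [seq qswap u | u <- quads n] (quads n).
Proof.
apply: uniq_perm; rewrite ?uniq_quads //.
  by rewrite map_inj_uniq ?uniq_quads // => -[? ?] [? ?] [-> ->].
move=> [p q]; apply/mapP/idP => [[[p' q'] h [-> ->]]|h].
  move: h; rewrite !mem_quads /qpos /qval /= => /andP[/and4P[-> -> -> ->] /eqP <-].
  by rewrite addnC eqxx.
exists (q, p) => //; move: h; rewrite !mem_quads /qpos /qval /=.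
by move=> /andP[/and4P[-> -> -> ->] /eqP <-]; rewrite addnC eqxx.
Qed.

Lemma perm_qdiag_x n :
  perm_eq [seq u <- quads n | u.1.2 == u.2.2]
    [seq ((a, p.2), (p.1 - a, p.2)) | p <- divp n, a <- index_iota 1 p.1].
Proof.
apply: uniq_perm; first by rewrite (filter_uniq _ (uniq_quads n)).
  apply: allpairs_uniq_dep; rewrite ?uniq_divp //.
    by move=> p _; apply: iota_uniq.
  move=> [[d x] a] [[d' x'] a'] /allpairsPdep[[d1 x1] [a1 [_ h1 /= E1]]]
     /allpairsPdep[[d2 x2] [a2 [_ h2 /= E2]]].
  case: E1 h1 => -> -> ->; case: E2 h2 => -> -> ->.
  rewrite !mem_index_iota /= => /andP[_ l2] /andP[_ l1] [-> -> e2 _].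
  by have -> : d1 = d2 by lia.
move=> [[a x] [b y]]; rewrite mem_filter mem_quads /qpos /qval /=.
apply/idP/allpairsPdep => [/andP[/eqP <- /andP[/and4P[a0 x0 b0 _] /eqP E]]|].
  exists (a + b, x), a; rewrite mem_divp mem_index_iota /= addn_gt0 a0 x0 mulnDl E eqxx.
  by rewrite -{1}[a]addn0 ltn_add2l b0 addKn.
move=> [[d x1] [a1 [+ + [-> -> -> ->]]]].
rewrite mem_divp mem_index_iota /= => /and3P[d0 x0 /eqP E] /andP[a0 ad].
rewrite eqxx a0 x0 subn_gt0 ad /= -mulnDl subnKC ?E //; exact: ltnW.
Qed.

Lemma perm_qdiag_a n :
  perm_eq [seq u <- quads n | u.1.1 == u.2.1]
    [seq ((p.1, x), (p.1, p.2 - x)) | p <- divp n, x <- index_iota 1 p.2].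
Proof.
apply: uniq_perm; first by rewrite (filter_uniq _ (uniq_quads n)).
  apply: allpairs_uniq_dep; rewrite ?uniq_divp //.
    by move=> p _; apply: iota_uniq.
  move=> [[d x] a] [[d' x'] a'] /allpairsPdep[[d1 x1] [a1 [_ h1 /= E1]]]
     /allpairsPdep[[d2 x2] [a2 [_ h2 /= E2]]].
  case: E1 h1 => -> -> ->; case: E2 h2 => -> -> ->.
  rewrite !mem_index_iota /= => /andP[_ l2] /andP[_ l1] [-> -> _ e2].
  by have -> : x1 = x2 by lia.
move=> [[a x] [b y]]; rewrite mem_filter mem_quads /qpos /qval /=.
apply/idP/allpairsPdep => [/andP[/eqP <- /andP[/and4P[a0 x0 _ y0] /eqP E]]|].
  exists (a, x + y), x; rewrite mem_divp mem_index_iota /= addn_gt0 a0 x0 mulnDr E eqxx.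
  by rewrite -{1}[x]addn0 ltn_add2l y0 addKn.
move=> [[a1 k] [x1 [+ + [-> -> -> ->]]]].
rewrite mem_divp mem_index_iota /= => /and3P[a0 k0 /eqP E] /andP[x0 xk].
rewrite eqxx a0 x0 subn_gt0 xk /= -mulnDr subnKC ?E //; exact: ltnW.
Qed.

Lemma perm_quads_split n :
  perm_eq (quads n)
    [seq u | m <- index_iota 0 n.+1, u <- [seq (p, q) | p <- divp m, q <- divp (n - m)]].
Proof.
apply: uniq_perm; first exact: uniq_quads.
  apply: allpairs_uniq_dep; first exact: iota_uniq.
    move=> m _; apply: allpairs_uniq; rewrite ?uniq_divp //.
    by move=> [? ?] [? ?] _ _ [-> ->].
  move=> [m u] [m' u'] /allpairsPdep[m1 [u1 [_ h1 /= E1]]]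
     /allpairsPdep[m2 [u2 [_ h2 /= E2]]].
  case: E1 h1 => -> ->; case: E2 h2 => -> -> + + E; rewrite -{}E => h1 h2.
  case/allpairsP: h1 => -[p q] /= [h1 _ e1]; case/allpairsP: h2 => -[p' q'] /= [h2 _ e2].
  rewrite e1 in e2; case: e2 => e _; rewrite -{}e in h2.
  move: h1 h2; rewrite !mem_divp => /and3P[_ _ /eqP <-] /and3P[_ _ /eqP <-].
  by [].
move=> [[a x] [b y]]; rewrite mem_quads /qpos /qval.
apply/idP/allpairsPdep => [/= /andP[/and4P[a0 x0 b0 y0] /eqP E]|].
  exists (a * x), ((a, x), (b, y)); split=> //.
    by rewrite mem_index_iota /= ltnS -E leq_addr.
  apply/allpairsP; exists ((a, x), (b, y)); rewrite !mem_divp /= a0 x0 b0 y0 eqxx.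
  by rewrite -E addKn eqxx.
move=> [m [u [+ /allpairsP[[p q] /= [+ + ->]] E]]].
rewrite mem_index_iota /= ltnS => mn; case: E => <- <-; rewrite !mem_divp /=.
move=> /and3P[-> -> /eqP E1] /and3P[-> -> /eqP E2].
by rewrite E1 E2 subnKC /=.
Qed.
End DivisorSums.

(** * Liouville's elementary method for the convolution of sigma_1 *)

Section Besge.
Local Open Scope ring_scope.
Variable n : nat.
Implicit Types (F : (nat * nat) * (nat * nat) -> int).

Definition divsum (V : nmodType) (c : nat -> nat -> V) m : V :=
  \sum_(p <- divp m) c p.1 p.2.

Lemma sum_qshift F : \sum_(u <- quads n | (u.2.1 < u.1.1)%N) F (qshift u) =
  \sum_(u <- quads n | (u.1.2 < u.2.2)%N) F u.
Proof.
by rewrite -[RHS]big_filter -(perm_big _ (perm_qshift n)) big_map big_filter.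
Qed.

Lemma sum_qswap (P : pred ((nat * nat) * (nat * nat))) F :
  \sum_(u <- quads n | P u) F u = \sum_(u <- quads n | P (qswap u)) F (qswap u).
Proof. by rewrite -(perm_big _ (perm_qswap n)) big_map. Qed.

Lemma sum_trichotomy (f g : (nat * nat) * (nat * nat) -> nat) F :
  (forall u, f (qswap u) = g u) -> (forall u, g (qswap u) = f u) ->
  (forall u, F (qswap u) = F u) ->
  \sum_(u <- quads n) F u = 2 * \sum_(u <- quads n | (f u < g u)%N) F u
    + \sum_(u <- quads n | f u == g u) F u.
Proof.
move=> fg gf FF; rewrite (bigID (fun u => f u < g u)%N) /= [2 * _]mulr_natl mulr2n -addrA.
congr (_ + _); rewrite (bigID (fun u => g u < f u)%N) /=; congr (_ + _).
  rewrite [RHS]sum_qswap; apply: eq_big => u; first by rewrite fg gf; case: ltngtP.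
  by rewrite FF.
by apply: eq_bigl => u; case: ltngtP.
Qed.

Lemma besge_inner (k : nat) (e : int) :
  6 * \sum_(1 <= a < k.+1) (a%:Z ^+ 2 - a%:Z * e + e ^+ 2) =
  k%:Z * (k%:Z + 1) * (2 * k%:Z + 1) - 3 * k%:Z * (k%:Z + 1) * e + 6 * k%:Z * e ^+ 2.
Proof.
elim: k => [|k IHk]; first by rewrite big_geq //; ring.
have E : k.+1%:Z = k%:Z + 1 by rewrite -addn1 PoszD.
by rewrite big_nat_recr //= mulrDr IHk E; ring.
Qed.

(** The sums of a b and of a^2 + b^2 over all solutions are each split in two ways, by comparing a
    with b and by comparing x with y. [sum_qshift] expresses the part x < y through the part b < a.
    Eliminating every off-diagonal sum leaves 2 A = X - D, where X and D run over the diagonals x =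
    y and a = b and are therefore sums over divisors. *)
Lemma besge :
  12 * \sum_(0 <= m < n.+1) divsum (fun d _ => d%:Z) m * divsum (fun d _ => d%:Z) (n - m)%N =
  5 * divsum (fun d _ => d%:Z ^+ 3) n + divsum (fun d _ => d%:Z) n
  - 6 * n%:Z * divsum (fun d _ => d%:Z) n.
Proof.
pose a (u : (nat * nat) * (nat * nat)) := u.1.1%:Z.
pose b (u : (nat * nat) * (nat * nat)) := u.2.1%:Z.
pose A := \sum_(u <- quads n) a u * b u.
pose D := \sum_(u <- quads n | u.1.1 == u.2.1) a u ^+ 2.
pose X := \sum_(u <- quads n | u.1.2 == u.2.2) (a u * b u + a u ^+ 2 + b u ^+ 2).
have AE : A = \sum_(0 <= m < n.+1) divsum (fun d _ => d%:Z) m * divsum (fun d _ => d%:Z) (n - m)%N.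
  rewrite /A (perm_big _ (perm_quads_split n)) big_allpairs_dep /=.
  apply: eq_bigr => m _; rewrite big_allpairs_dep /= /divsum big_distrl /=.
  by apply: eq_bigr => p _; rewrite big_distrr.
have XE : 6 * X = \sum_(p <- divp n) (5 * p.1%:Z ^+ 3 - 6 * p.1%:Z ^+ 2 + p.1%:Z).
  rewrite /X -big_filter (perm_big _ (perm_qdiag_x n)) big_allpairs_dep /= mulr_sumr.
  rewrite big_seq [RHS]big_seq; apply: eq_bigr => -[d x] /=.
  rewrite mem_divp /= => /and3P[d0 _ _].
  (* On the diagonal x = y one has b = d - a, and a b + a^2 + b^2 becomes a^2 - a d + d^2. *)
  transitivity (6 * \sum_(1 <= c < d) (c%:Z ^+ 2 - c%:Z * d%:Z + d%:Z ^+ 2)).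
    congr (_ * _); rewrite big_nat_cond [RHS]big_nat_cond.
    apply: eq_bigr => c /andP[/andP[_ cd] _]; rewrite /a /b /= -subzn; last exact: ltnW.
    ring.
  case: d d0 => // k _; rewrite besge_inner.
  have E : k.+1%:Z = k%:Z + 1 by rewrite -addn1 PoszD.
  by rewrite E; ring.
have DE : D = \sum_(p <- divp n) (n%:Z * p.1%:Z - p.1%:Z ^+ 2).
  rewrite /D -big_filter (perm_big _ (perm_qdiag_a n)) big_allpairs_dep /=.
  rewrite big_seq [RHS]big_seq; apply: eq_bigr => -[d k] /=.
  rewrite mem_divp /= => /and3P[d0 k0 /eqP <-].
  case: k k0 => // k _; rewrite /a /= sumr_const_nat subn1 /= -mulr_natr PoszM.
  have E : k.+1%:Z = k%:Z + 1 by rewrite -addn1 PoszD.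
  by rewrite E natz; ring.
pose P := \sum_(u <- quads n | (u.2.1 < u.1.1)%N) a u * b u.
pose Q1 := \sum_(u <- quads n | (u.2.1 < u.1.1)%N) a u ^+ 2.
pose Q2 := \sum_(u <- quads n | (u.2.1 < u.1.1)%N) b u ^+ 2.
pose R1 := \sum_(u <- quads n | (u.1.2 < u.2.2)%N) a u * b u.
pose R2 := \sum_(u <- quads n | (u.1.2 < u.2.2)%N) (a u ^+ 2 + b u ^+ 2).
pose X1 := \sum_(u <- quads n | u.1.2 == u.2.2) a u * b u.
pose X2 := \sum_(u <- quads n | u.1.2 == u.2.2) (a u ^+ 2 + b u ^+ 2).
pose T := \sum_(u <- quads n) (a u ^+ 2 + b u ^+ 2).
have XX : X = X1 + X2.
  by rewrite /X1 /X2 -big_split; apply: eq_bigr => u _ /=; rewrite addrA.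
have eqD (F : int -> int -> int) :
    \sum_(u <- quads n | u.2.1 == u.1.1) F (a u) (b u) =
    \sum_(u <- quads n | u.1.1 == u.2.1) F (a u) (a u).
  apply: eq_big => u; first by rewrite eq_sym.
  by rewrite /a /b => /eqP ->.
have e1 : A = 2 * P + D.
  rewrite /A (@sum_trichotomy (fun u => u.2.1) (fun u => u.1.1)) //; last first.
    by move=> u; rewrite /a /b mulrC.
  congr (_ + _); rewrite (eqD (fun s t => s * t)) /D.
  by apply: eq_bigr => u _; rewrite expr2.
have e2 : T = 2 * (Q1 + Q2) + 2 * D.
  rewrite /T (@sum_trichotomy (fun u => u.2.1) (fun u => u.1.1)) //; last first.
    by move=> u; rewrite /a /b addrC.
  rewrite /Q1 /Q2 -big_split; congr (_ + _).
  rewrite (eqD (fun s t => s ^+ 2 + t ^+ 2)) /D mulr_sumr.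
  by apply: eq_bigr => u _; rewrite mulr_natl mulr2n.
have e3 : A = 2 * R1 + X1.
  by rewrite /A (@sum_trichotomy (fun u => u.1.2) (fun u => u.2.2)) // => u;
     rewrite /a /b mulrC.
have e4 : T = 2 * R2 + X2.
  by rewrite /T (@sum_trichotomy (fun u => u.1.2) (fun u => u.2.2)) // => u;
     rewrite /a /b addrC.
have e5 : R1 = P - Q2.
  rewrite /R1 -sum_qshift /P /Q2 -sumrB; apply: eq_bigr => u h.
  by rewrite /a /b /= -subzn ?(ltnW h) //; ring.
have e6 : R2 = Q1 - 2 * P + 2 * Q2.
  rewrite /R2 -sum_qshift /P /Q1 /Q2 !mulr_sumr -sumrB -big_split.
  by apply: eq_bigr => u h; rewrite /a /b /= -subzn ?(ltnW h) //; ring.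
have e7 : 2 * A = X - D by lia.
rewrite -AE; have -> : 12 * A = 6 * X - 6 * D by lia.
rewrite XE DE /divsum !mulr_sumr -big_split -!sumrB; apply: eq_bigr => p _ /=; ring.
Qed.
End Besge.

(** * Lambert series, eta and Ramanujan's differential equation *)

Section Lambert.
Variable R : realType.
Local Notation C := (cplx R).
Local Notation "x %:C" := ((x)%:C%C : C).
Local Notation uhp := (uhp R).
Local Notation twopii := (twopii R).
Implicit Types (c : nat -> nat -> C) (x : C) (z : uhp).

Lemma divsumE c N : divsum c N =
  \sum_(0 <= m < N) (if (m.+1 %| N)%N then c m.+1 (N %/ m.+1)%N else 0).
Proof.
rewrite /divsum big_filter /ppairs big_mkcond big_allpairs_dep /= /posn.
rewrite big_add1 /= big_nat_cond [RHS]big_nat_cond.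
apply: eq_bigr => m /andP[/andP[_ mN] _]; rewrite -big_mkcond /=.
have [/dvdnP[k Nk]|nd] := boolP (m.+1 %| N)%N; last first.
  rewrite big_seq_cond big1 // => k /andP[_ /eqP E].
  by rewrite -E dvdn_mulr in nd.
have k0 : (0 < k)%N by move: mN; rewrite Nk; case: (k).
have -> : (N %/ m.+1)%N = k by rewrite Nk mulnK.
rewrite (eq_bigl (fun i => i == k)) => [|i]; last first.
  by rewrite [in _ == N]Nk [(k * _)%N]mulnC eqn_pmul2l.
rewrite big_mkcond (bigD1_seq k) /= ?iota_uniq ?eqxx //; last first.
  by rewrite mem_index_iota k0 ltnS Nk leq_pmulr.
by rewrite big1 ?addr0 // => i /negPf ->.
Qed.

Lemma sum_ltn_const (t : R) M N :
  \sum_(0 <= m < M) (if (m < N)%N then t else 0) = t *+ minn M N.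
Proof.
elim: M => [|M IHM]; first by rewrite big_geq // min0n.
rewrite big_nat_recr //= IHM; case: ltnP => MN.
  by rewrite (minn_idPl MN) mulrSr.
by rewrite addr0 (minn_idPr (leqW MN)).
Qed.

Section Growth.
Variables (c : nat -> nat -> C) (p : nat).
Hypothesis cp : forall m k, nm (c m.+1 k.+1) <= (m.+1 * k.+1)%:R ^+ p.

Lemma tame_divsum : tame (divsum c).
Proof.
apply: tame_le (tame_natX (R:=R) p.+1) => N; rewrite divsumE nmX nm_nat exprS.
apply: le_trans (nm_sum _ _ _) _.
rewrite mulr_natl -[N in leRHS]subn0 -sumr_const_nat subn0.
rewrite big_nat_cond [leRHS]big_nat_cond; apply: ler_sum => m /andP[/andP[_ mN] _].
case: ifP => [/dvdnP[k E]|_]; last by rewrite nm0 exprn_ge0.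
rewrite E mulnK // mulnC; case: k E => [|k] E; last exact: cp.
by rewrite E ltn0 in mN.
Qed.

(** Row m of the array [a] is the m-th inner series spread over the multiples of m + 1, so the rows
    give the double series and column N gives the N-th divisor sum. The growth condition on [c]
    bounds the norms in column N by N^(p+1) |x|^N. *)
Lemma lambert x : nm x < 1 ->
  [/\ forall m, absum (fun k => c m.+1 k.+1 * x ^+ (m.+1 * k.+1)),
      absum (fun m => csum (fun k => c m.+1 k.+1 * x ^+ (m.+1 * k.+1))) &
      csum (fun m => csum (fun k => c m.+1 k.+1 * x ^+ (m.+1 * k.+1))) =
      pser (divsum c) x].
Proof.
move=> x1; have x01 : 0 <= nm x < 1 by rewrite nm_ge0.
pose b m k := if k is 0 then 0 else c m.+1 k * x ^+ (m.+1 * k).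
have sb m : absum (fun k => b m k).
  have [B HB] := tame_absum_nm (tame_natX (R:=R) p) x01.
  apply: (@absum_le _ _ (fun k => m.+1%:R ^+ p * (nm ((k%:R : C) ^+ p) * nm x ^+ k)) (m.+1%:R ^+ p * B)).
    case=> [|k] /=; first by rewrite nm0 !mulr_ge0 ?exprn_ge0 ?nm_ge0.
    rewrite nmM mulrA; apply: ler_pM; rewrite ?nm_ge0 //.
      by rewrite nmX nm_nat -exprMn -natrM.
    by rewrite nmX ler_wiXn2l ?nm_ge0 ?(ltW x1) // leq_pmull.
  by move=> n; rewrite -mulr_sumr ler_wpM2l ?exprn_ge0.
pose a m N := if (m.+1 %| N)%N then b m (N %/ m.+1)%N else 0.
have aE m N : a m N = (if (m < N)%N then (if (m.+1 %| N)%N then c m.+1 (N %/ m.+1)%N else 0) else 0) * x ^+ N.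
  rewrite /a; case: (boolP (m.+1 %| N)%N) => [/dvdnP[k E]|_]; last by rewrite if_same mul0r.
  rewrite E mulnK //; case: k E => [|k] E; first by rewrite mul0n ltn0 mul0r.
  by rewrite mulSn addSn ltnS leq_addr /= mulnC.
have [B HB] := tame_absum_nm (tame_natX (R:=R) p.+1) x01.
have [|f1 f2 f3 f4 f5] := @fubini_nat R a B.
  move=> M N; apply: le_trans (HB N); rewrite exchange_big /=.
  apply: ler_sum => n _.
  apply: (@le_trans _ _ (\sum_(0 <= m < M) (if (m < n)%N then n%:R ^+ p * nm x ^+ n else 0))).
    apply: ler_sum => m _; rewrite aE; case: ltnP => mn; last by rewrite mul0r nm0.
    rewrite nmM nmX ler_wpM2r ?exprn_ge0 ?nm_ge0 //.
    case: ifP => [/dvdnP[k E]|_]; last by rewrite nm0 exprn_ge0.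
    rewrite E mulnK // mulnC; case: k E => [|k] E; last exact: cp.
    by rewrite E ltn0 in mn.
  rewrite sum_ltn_const nmX nm_nat exprS -[leLHS]mulr_natl -[leRHS]mulrA.
  rewrite ler_wpM2r ?mulr_ge0 ?exprn_ge0 ?nm_ge0 // ?ler_nat ?geq_minr //.
have sbS m : absum (fun k => c m.+1 k.+1 * x ^+ (m.+1 * k.+1)).
  exact: absum_shift (sb m).
have cE m : csum (a m) = csum (fun k => c m.+1 k.+1 * x ^+ (m.+1 * k.+1)).
  by rewrite (csum_sparse (a := b m) _ _).2 // csum_recl // add0r.
split=> //.
- by under eq_fun do rewrite -cE.
- under eq_fun do rewrite -cE.
  rewrite f5 /pser; congr csum; apply/funext => N.
  rewrite (@csum_fin _ _ N) => [|m Nm]; last by rewrite aE ltnNge Nm mul0r.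
  rewrite divsumE mulr_suml big_nat_cond [RHS]big_nat_cond.
  by apply: eq_bigr => m /andP[/andP[_ mN] _]; rewrite aE mN.
Qed.
End Growth.

Lemma divsumC c N : divsum c N = divsum (fun m k => c k m) N.
Proof.
rewrite /divsum -[RHS](perm_big _ (_ : perm_eq [seq (p.2, p.1) | p <- divp N] _)) ?big_map //.
apply: uniq_perm; rewrite ?uniq_divp //.
  by rewrite map_inj_uniq ?uniq_divp // => -[? ?] [? ?] [-> ->].
move=> [a b]; apply/mapP/idP => [[[a' b'] + [-> ->]]|].
  by rewrite !mem_divp /= mulnC andbCA.
by move=> h; exists (b, a) => //; move: h; rewrite !mem_divp /= mulnC andbCA.
Qed.

Definition sig1 : nat -> C := divsum (fun d _ => d%:R).
Definition sig3 : nat -> C := divsum (fun d _ => d%:R ^+ 3).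
(** This is sigma_(-1), whose generating series is minus the logarithm of the product of the 1 -
    q^m; differentiating it gives sigma_1, by [nat_sigV]. *)
Definition sigV : nat -> C := divsum (fun _ k => k%:R^-1).

Lemma sig_tame : [/\ tame sig1, tame sig3 & tame sigV].
Proof.
have h (n p : nat) : 1 <= n.+1%:R ^+ p :> R by rewrite exprn_ege1 // ler1n.
split.
- apply: (@tame_divsum _ 1) => m k; rewrite nm_nat expr1 ler_nat leq_pmulr //.
- apply: (@tame_divsum _ 3) => m k; rewrite nmX nm_nat lerXn2r ?nnegrE ?ler0n //.
  by rewrite ler_nat leq_pmulr.
- apply: (@tame_divsum _ 0) => m k; rewrite nmV nm_nat expr0 invf_le1 ?ler1n ?ltr0n //.
Qed.

Lemma nat_sigV n : n%:R * sigV n = sig1 n.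
Proof.
rewrite /sigV /sig1 /divsum mulr_sumr big_seq [RHS]big_seq.
apply: eq_bigr => -[a b] /=; rewrite mem_divp /= => /and3P[_ b0 /eqP <-].
by rewrite natrM mulfK // pnatr_eq0 -lt0n.
Qed.

Lemma besge_conv n : 12 * conv sig1 sig1 n = 5 * sig3 n + sig1 n - 6 * (n%:R * sig1 n).
Proof.
have := besge n.
have E1 m : (divsum (fun d _ => d%:Z) m)%:~R = sig1 m.
  by rewrite /sig1 /divsum rmorph_sum; apply: eq_bigr => p _; rewrite /= pmulrn.
have E3 m : (divsum (fun d _ => d%:Z ^+ 3) m)%:~R = sig3 m.
  by rewrite /sig3 /divsum rmorph_sum; apply: eq_bigr => p _; rewrite /= rmorphXn /= pmulrn.
move: (E1 n) (E3 n); move: (divsum _ n) (divsum _ n) => u1 u3 Eu1 Eu3 E.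
have Ec : (\sum_(0 <= m < n.+1) divsum (fun d _ => d%:Z) m * divsum (fun d _ => d%:Z) (n - m)%N)%:~R
    = conv sig1 sig1 n.
  rewrite /conv big_mkord rmorph_sum /=; apply: eq_bigr => i _.
  by rewrite intrM !E1.
move: E Ec; move: (\sum_(_ <= _ < _) _) => uc E <-; rewrite -Eu1 -Eu3.
have nE : (n%:Z)%:~R = n%:R :> C by rewrite -pmulrn.
have := congr1 (fun i : int => i%:~R : C) E.
by rewrite /= rmorphB rmorphD !rmorphM /= !rmorph_nat /= nE mulrA.
Qed.

Lemma pser_geometric x : nm x < 1 -> pser (fun=> 1) x = (1 - x)^-1.
Proof.
move=> x1; have t1 := tame_cst (1 : C); have sa := tame_absum t1 x1.
have n0 : 1 - x != 0.
  by rewrite subr_eq0; apply: contraTneq x1 => <-; rewrite nm1 ltxx.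
apply: (mulIf n0); rewrite mulVf // mulrBr mulr1 {1}/pser csum_recl // expr0 mulr1.
have -> : csum (fun n => 1 * x ^+ n.+1) = pser (fun=> 1) x * x.
  by rewrite /pser mulrC -csumZ //; congr csum; apply/funext => n; rewrite exprS mulrCA.
by rewrite addrK.
Qed.

Lemma csum_geometric x : nm x < 1 ->
  absum (fun k => x ^+ k.+1) /\ csum (fun k => x ^+ k.+1) = x / (1 - x).
Proof.
move=> x1; have sa := tame_absum (tame_cst (1 : C)) x1.
have E : (fun k => x ^+ k.+1) = (fun k => x * (1 * x ^+ k)).
  by apply/funext => k; rewrite mul1r exprS.
by rewrite E; split; [apply: absumZ|rewrite csumZ // -/(pser _ _) pser_geometric].
Qed.

Lemma csum_nat_geometric x : nm x < 1 ->
  absum (fun k => k.+1%:R * x ^+ k.+1) /\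
  csum (fun k => k.+1%:R * x ^+ k.+1) = x / (1 - x) ^+ 2.
Proof.
move=> x1; have t1 := tame_cst (1 : C).
have tc := tame_conv t1 t1; have sa := tame_absum tc x1.
have E : (fun k => k.+1%:R * x ^+ k.+1) = (fun k => x * (conv (fun=> 1) (fun=> 1) k * x ^+ k)).
  apply/funext => k; rewrite /conv; under eq_bigr do rewrite mulr1.
  by rewrite sumr_const card_ord exprS mulrCA.
rewrite E; split; first exact: absumZ.
rewrite csumZ // -/(pser _ _) pser_conv // !pser_geometric // -invfM -expr2 //.
Qed.

Lemma tends_cont f l d (u : nat -> C) : cder f l d -> tends u l -> tends (fun n => f (u n)) (f l).
Proof.
move=> Hf /tendsP Hu; apply/tendsP => e e0.
have /nbhsCP[s s0 Hs] := Hf 1 ltr01.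
have K0 : 0 < 1 + nm d by rewrite ltr_wpDr // nm_ge0.
have m0 : 0 < Num.min s (e / (1 + nm d)) by rewrite lt_min s0 divr_gt0.
have [N HN] := Hu _ m0; exists N => n /HN; rewrite lt_min => /andP[h1 h2].
have := Hs (u n - l); rewrite subr0 => /(_ h1); rewrite mul1r [l + _]addrC subrK => h3.
have -> : f (u n) - f l = (f (u n) - f l - (u n - l) * d) + (u n - l) * d by rewrite subrK.
apply: le_lt_trans (nmD _ _) _; rewrite nmM.
apply: le_lt_trans (lerD h3 (lexx _)) _.
by rewrite -[X in X + _]mulr1 -mulrDr -ltr_pdivlMr.
Qed.

Lemma is_derive_real (f : R -> R) (x d : R) :
  (forall e : R, 0 < e -> exists2 s : R, 0 < s &
    forall h : R, `|h| < s -> `|f (x + h) - f x - h * d| <= e * `|h|) ->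
  is_derive x 1 f d.
Proof.
move=> H.
suff cv : (fun h : R => h^-1 *: ((f \o shift x) (h *: (1 : R)) - f x)) @ 0^' --> d.
  split; first by apply: cvgP cv.
  exact: cvg_lim cv.
apply/cvgrPdist_lt => e e0; have e20 : 0 < e / 2 by rewrite divr_gt0.
have [s s0 Hs] := H _ e20.
rewrite /dnbhs /within /=; apply/nbhs_ballP; exists s => // h hs h0.
have := Hs h; rewrite /ball /= sub0r normrN in hs => /(_ hs) le.
rewrite /= -[h *: 1]/(h * 1) mulr1 -[_ *: _]/(_ * _) (addrC h) distrC.
rewrite -(@ltr_pM2r _ `|h|) ?normr_gt0 // -normrM mulrBl mulrAC mulVf // mul1r.
rewrite (mulrC d); apply: le_lt_trans le _.
rewrite ltr_pM2r ?normr_gt0 // ltr_pdivrMr // ltr_pMr // ltr1n //.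
Qed.

(** On the segment from 0 to x the real and imaginary parts of H are functions of one real variable
    with zero derivative, to which the mean value theorem applies. *)
Lemma cder0_const (H : C -> C) x : (forall t : C, nm t < 1 -> cder H t 0) -> nm x < 1 ->
  H x = H 0.
Proof.
move=> H0 x1.
have comp (g : C -> R) : (forall a b : C, g (a - b) = g a - g b) -> (forall a, `|g a| <= nm a) ->
    g (H x) = g (H 0).
  move=> gB gn; pose u (s : R) := g (H (s%:C * x)).
  have du (s : R) : s \in `[0, 1] -> is_derive s 1 u 0.
    rewrite in_itv /= => /andP[s0 s1]; apply: is_derive_real => e e0.
    have sx : nm (s%:C * x) < 1.
      rewrite nmM nm_real ger0_norm //; apply: le_lt_trans x1.
      by rewrite ler_piMl ?nm_ge0.
    have K0 : 0 < nm x + 1 by rewrite ltr_wpDl // nm_ge0.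
    have e'0 : 0 < e / (nm x + 1) by rewrite divr_gt0.
    have /nbhsCP[t t0 Ht] := H0 _ sx _ e'0.
    exists (t / (nm x + 1)) => [|h]; first by rewrite divr_gt0.
    rewrite ltr_pdivlMr // => ht.
    have hx : nm (h%:C * x) <= `|h| * (nm x + 1).
      by rewrite nmM nm_real ler_wpM2l // lerDl.
    have := Ht (h%:C * x); rewrite subr0 => /(_ (le_lt_trans hx ht)).
    rewrite mulr0 subr0 -mulrDl -RtoCD mulr0 subr0 => le.
    rewrite /u -gB; apply: le_trans (gn _) _; apply: le_trans le _.
    apply: le_trans (ler_wpM2l (ltW e'0) hx) _.
    by rewrite mulrCA mulrC mulfVK ?gt_eqF.
  have du' (s : R) : s \in `]0, 1[ -> is_derive s 1 u ((fun=> 0) s).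
    by rewrite in_itv /= => /andP[s0 s1]; apply: du; rewrite in_itv /= !ltW.
  have cu : {within `[0, 1], continuous u}.
    by apply: derivable_within_continuous => s /du[].
  have [c _] := MVT_segment ler01 du' cu.
  rewrite mul0r /u mul1r mul0r => /eqP; rewrite subr_eq0 => /eqP //.
apply/eqP; rewrite eq_complex; apply/andP; split; apply/eqP; apply: comp.
- by move=> a b; rewrite ReD ReN.
- exact: Re_le_nm.
- by move=> a b; rewrite ImD ImN.
- exact: Im_le_nm.
Qed.

Lemma tame_inv : tame (fun n => (n%:R : C)^-1).
Proof.
apply: tame_le (tame_cst (1 : C)) => n; rewrite nmV nm_nat nm1.
by case: n => [|n]; [rewrite invr0|rewrite invf_le1 ?ler1n ?ltr0n].
Qed.

(** No branch of the complex logarithm is chosen: (1 - t) exp (L t) has derivative zero on the disc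
    and equals 1 at t = 0. The coefficient of index 0 in the series L is [0^-1], which is 0. *)
Lemma one_sub_exp x : nm x < 1 -> 1 - x = cexp (- pser (fun n => n%:R^-1) x).
Proof.
move=> x1; set L := pser _.
suff E : (1 - x) * cexp (L x) = 1.
  by apply: (mulIf (cexp_neq0 (L x))); rewrite E cexpN mulVf // cexp_neq0.
pose H t : C := (1 - t) * cexp (L t).
have L0 : L 0 = 0.
  rewrite /L /pser (@csum_fin _ _ 0) ?big_geq // => -[|n] _; rewrite ?invr0 ?mul0r //.
  by rewrite expr0n mulr0.
have H0 t : nm t < 1 -> cder H t 0.
  move=> t1; have dL : cder L t (1 - t)^-1.
    have := cder_pser tame_inv t1; rewrite -pser_geometric //.
    by congr cder; congr pser; apply/funext => n; rewrite divff // pnatr_eq0.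
  have d1 : cder (fun y : C => 1 - y) t (0 + -1 * 1).
    by have := cderD (cder_cst 1 t) (cderZ (-1) (cder_id t));
       congr cder; apply/funext => y; rewrite /= mulN1r.
  have := cderM d1 (cder_comp (cder_cexp (L t)) dL).
  have n0 : 1 - t != 0.
    by rewrite subr_eq0; apply: contraTneq t1 => <-; rewrite nm1 ltxx.
  by rewrite add0r mulr1 mulN1r /= mulrCA divff // mulr1 addNr.
by rewrite -/(H x) (cder0_const H0 x1) /H L0 cexp0 subr0 mulr1.
Qed.

Lemma csum_log x : nm x < 1 -> absum (fun k => k.+1%:R^-1 * x ^+ k.+1) /\
  csum (fun k => k.+1%:R^-1 * x ^+ k.+1) = pser (fun n => n%:R^-1) x.
Proof.
move=> x1; have sa := tame_absum tame_inv x1; split.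
  exact: absum_shift sa.
by rewrite /pser (csum_recl sa) invr0 mul0r add0r.
Qed.

Lemma qparX_lt1 z m : nm (qpar 1 z ^+ m.+1) < 1.
Proof. by rewrite nmX exprn_ilt1 ?nm_ge0 // qpar_lt1. Qed.

(** The exponents of the factors 1 - q^m form a double series of terms q^(m k) / k, rearranged by
    [lambert]. In exponential form eta visibly has no zero, and its logarithmic derivative can be
    read off. *)
Lemma etaE z : Defs.eta z = cexp (twopii * val z / 24 - qf 1 sigV z).
Proof.
rewrite /Defs.eta cexpD; congr (_ * _).
have q1 : nm (qpar 1 z) < 1 by apply: qpar_lt1.
have [|_ s2 s3] := @lambert (fun _ k => k%:R^-1) 0 _ (qpar 1 z) q1.
  by move=> m k; rewrite nmV nm_nat expr0 invf_le1 ?ler1n ?ltr0n.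
have E m : csum (fun k => k.+1%:R^-1 * qpar 1 z ^+ (m.+1 * k.+1)) =
    pser (fun n => n%:R^-1) (qpar 1 z ^+ m.+1).
  rewrite -(csum_log (qparX_lt1 z m)).2; congr csum; apply/funext => k.
  by rewrite exprM.
apply: cvg_lim => //; rewrite -/(tends _ _).
have cv : tends (fun n => cexp (- series (fun m => pser (fun n => n%:R^-1) (qpar 1 z ^+ m.+1)) n))
    (cexp (- qf 1 sigV z)).
  apply: (tends_cont (cder_cexp _)); rewrite /qf -s3 -[X in tends _ X]sub0r.
  have := tendsB (tends_cst (0 : C)) (absum_tends s2).
  by apply: tends_near 0%N _ => n _; rewrite sub0r; congr (- series _ _);
     apply/funext => m; rewrite E.
apply/tendsP => e e0; have /tendsP/(_ e e0)[N HN] := cv.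
exists N.+1 => -[//|n] Nn; have := HN n Nn; congr (nm (_ - _) < _).
rewrite /series /= big_add1 /= {HN cv Nn}.
elim: n => [|n IHn]; first by rewrite !big_geq // oppr0 cexp0.
by rewrite !big_nat_recr //= opprD cexpD IHn -one_sub_exp // qparX_lt1.
Qed.

(* twopii G is the logarithmic derivative of eta^4, i.e. G = E_2 / 6. *)
Definition Gf z : C := (1 - 24 * qf 1 sig1 z) / 6.

Lemma eta4_neq0 z : eta4 z != 0.
Proof. by rewrite /eta4 etaE expf_neq0 // cexp_neq0. Qed.

Lemma uder_eta4 z : uder (@eta4 R) z (twopii * Gf z * eta4 z).
Proof.
have [t1 t3 tV] := sig_tame.
pose f w := 4 * (twopii / 24 * val w - qf 1 sigV w).
have E : @eta4 R = (fun w => cexp (f w)).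
  apply/funext => w; rewrite /eta4 etaE cexpX; congr cexp.
  by rewrite /f -[LHS]mulr_natl; congr (_ * (_ - _)); rewrite mulrAC.
have H := uderZ 4 (uderB (uderZ (twopii / 24) (uder_id z)) (uder_qf z (ltn0Sn 0) tV)).
have := uder_comp (cder_cexp (f z)) H; rewrite -E mulrC => H'.
apply: uder_eq H' _; rewrite [eta4 z](congr1 (fun g => g z) E); congr (_ * _).
have -> : (fun n => n%:R * sigV n) = sig1 by apply/funext => n; rewrite nat_sigV.
rewrite /Gf; move: (qf 1 sig1 z) twopii => s t.
by field.
Qed.

Lemma dlog_eta4 z : dlog (@eta4 R) z = twopii * Gf z.
Proof. by rewrite /dlog (uder_uderiv (uder_eta4 z)) mulfK // eta4_neq0. Qed.

Lemma E4E z : E4 z = 1 + 240 * qf 1 sig3 z.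
Proof.
rewrite /E4; congr (_ + _ * _).
have q1 : nm (qpar 1 z) < 1 by apply: qpar_lt1.
have [|_ s2 s3] := @lambert (fun m _ => m%:R ^+ 3) 3 _ (qpar 1 z) q1.
  move=> m k; rewrite nmX nm_nat lerXn2r ?nnegrE ?ler0n //.
  by rewrite ler_nat leq_pmulr.
apply: cvg_lim => //; rewrite /qf -/sig3 in s3 *; rewrite -s3.
have cv := absum_tends s2; rewrite -/(tends _ _).
apply/tendsP => e e0; have /tendsP/(_ e e0)[N HN] := cv.
exists N.+1 => -[//|n] Nn; have := HN n Nn; congr (nm (_ - _) < _).
rewrite /series /= big_add1 /=; apply: eq_bigr => m _.
have [sg sE] := csum_geometric (qparX_lt1 z m).
by rewrite -sE -csumZ //; congr csum; apply/funext => k; rewrite exprM.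
Qed.

Lemma ramanujan z : exists d : C, uder Gf z d /\
  twopii^-1 * d - Gf z ^+ 2 / 2 = - (1 / 72) * E4 z.
Proof.
have [t1 t3 tV] := sig_tame; have q1 : nm (qpar 1 z) < 1 by apply: qpar_lt1.
have H := uderZ 6^-1 (uderB (uder_cst 1 z) (uderZ 24 (uder_qf z (ltn0Sn 0) t1))).
eexists; split.
  have -> : Gf = (fun w => 6^-1 * (1 - 24 * qf 1 sig1 w)).
    by apply/funext => w; rewrite /Gf mulrC.
  exact: H.
rewrite E4E /Gf.
have : 12 * (qf 1 sig1 z * qf 1 sig1 z) = 5 * qf 1 sig3 z + qf 1 sig1 z - 6 * qf 1 (fun n => n%:R * sig1 n) z.
  have tn := tame_nat t1; have tc := tame_conv t1 t1; rewrite /qf.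
  have h : (fun n => 12 * conv sig1 sig1 n) =
      (fun n => 5 * sig3 n + (1 * sig1 n + (-6) * (n%:R * sig1 n))).
    by apply/funext => n; rewrite besge_conv mul1r mulNr addrA.
  have := congr1 (fun c : nat -> C => pser c (qpar 1 z)) h.
  rewrite (pserZ _ tc q1) pser_conv //.
  rewrite (pserD (tameZ _ t3) (tameD (tameZ _ t1) (tameZ _ tn)) q1).
  rewrite (pserD (tameZ _ t1) (tameZ _ tn) q1).
  by rewrite (pserZ _ t3 q1) (pserZ _ t1 q1) (pserZ _ tn q1) mul1r mulNr addrA.
move: (qf 1 _ z) (qf 1 sig3 z) (qf 1 sig1 z) (twopii_neq0 R) => d s3 s1.
move: twopii => t t0 E.
have -> : d = (5 * s3 + s1 - 12 * (s1 * s1)) / 6 by rewrite E; field.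
by field.
Qed.

Lemma Gf_inversion z z' : val z' = - (val z)^-1 ->
  Gf z' / val z ^+ 2 = Gf z + 2 / (twopii * val z).
Proof.
move=> z'E; have q1 (w : uhp) : nm (qpar 1 w) < 1 by apply: qpar_lt1.
(* [csc2f] equals [twopii] squared times the sum of k q^k, so its series over the multiples of
   [val w] is a Lambert series, with sigma_1 as divisor sum after [divsumC] exchanges divisor and
   cofactor. *)
have key w A : tends (series (fun m => csc2f (m.+1%:R * val w))) A ->
    A = twopii ^+ 2 * qf 1 sig1 w.
  move=> cA; have [|_ s2 s3] := @lambert (fun _ k => k%:R) 1 _ (qpar 1 w) (q1 w).
    by move=> m k; rewrite nm_nat expr1 ler_nat leq_pmull.
  apply: tends_unique cA _.
  have -> : qf 1 sig1 w = pser (divsum (fun _ k => k%:R)) (qpar 1 w).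
    by rewrite /qf; congr pser; apply/funext => n; rewrite /sig1 divsumC.
  rewrite -s3; have := tendsZ (twopii ^+ 2) (absum_tends s2).
  apply: tends_near 0%N _ => n _; rewrite /series /= mulr_sumr; apply: eq_bigr => m _.
  have [sg sE] := csum_nat_geometric (qparX_lt1 w m).
  rewrite /csc2f -mulrA; congr (_ * _).
  have -> : ee (m.+1%:R * val w) = qpar 1 w ^+ m.+1.
    by rewrite /qpar cexpX /ee divr1 mulr_natl mulrnAr.
  by rewrite -sE; congr csum; apply/funext => k; rewrite exprM.
have [A [B [cA cB E]]] := eisenstein_swap (valP z).
rewrite -z'E in cB; rewrite (key _ _ cA) (key _ _ cB) in E.
have z0 : val z != 0 :> C.
  by apply: contraTneq (valP z) => ->; rewrite ltxx.
rewrite /Gf; move: E (twopii_neq0 R) z0.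
move: (qf 1 sig1 z) (qf 1 sig1 z') twopii (val z : C) => s s' t y E t0 y0.
have -> : s' = (t ^+ 2 * s - t / (2 * y) + t ^+ 2 / 24 * y ^- 2 - t ^+ 2 / 24) / (y ^- 2 * t ^+ 2).
  by rewrite -E; field; rewrite t0 y0.
by field; rewrite t0 y0.
Qed.
End Lambert.

(** * Slash action and the forms mu *)

Section SlashCalculus.
Variable R : realType.
Local Notation C := (cplx R).
Local Notation "x %:C" := ((x)%:C%C : C).
Local Notation uhp := (uhp R).
Local Notation twopii := (twopii R).
Implicit Types (a b g : GL2Qplus) (k l : nat) (z : uhp) (f h : uhp -> C).

Lemma mulmx22E (T : comNzRingType) (A B : 'M[T]_2) i j :
  (A *m B) i j = A i 0 * B 0 j + A i 1 * B 1 j.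
Proof.
rewrite mxE !big_ord_recl big_ord0 addr0; congr (_ + A i _ * B _ j); exact: val_inj.
Qed.

Lemma fadd_ev f h z : (f + h) z = f z + h z. Proof. by []. Qed.
Lemma fopp_ev f z : (- f) z = - f z. Proof. by []. Qed.
Lemma fmul_ev f h z : (f * h) z = f z * h z. Proof. by []. Qed.
Lemma fscale_ev (c : C) f z : (c *: f) z = c * f z. Proof. by []. Qed.
Definition f_ev := (fadd_ev, fopp_ev, fmul_ev, fscale_ev).

Lemma div_addK (F : fieldType) (p q u d : F) : d != 0 -> (p * (u / d) + q) * d = p * u + q * d.
Proof. by move=> d0; rewrite mulrDl mulrA divfK. Qed.

Local Notation co a := (@glq_coef R a).
Local Notation j a := (@automorphy R a).

(** The factor det^(k/2) of the slash operator is written as the k-th power of this root, which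
    treats even and odd weights alike. *)
Definition sdet a : C := (Num.sqrt (ratr (\det (val a)))) %:C.

Lemma glq_coefM a b i i' : co (a * b)%g i i' = co a i 0 * co b 0 i' + co a i 1 * co b 1 i'.
Proof. by rewrite /glq_coef mulmx22E rmorphD !rmorphM /= RtoCD !RtoCM. Qed.

Lemma sdet_sqr a : sdet a ^+ 2 = co a 0 0 * co a 1 1 - co a 0 1 * co a 1 0.
Proof.
rewrite /sdet /glq_coef -RtoCX sqr_sqrtr ?ler0q ?ltW ?(valP a) // det_mx22.
by rewrite rmorphB !rmorphM /= RtoCD RtoCN !RtoCM.
Qed.

Lemma sdetM a b : sdet (a * b)%g = sdet a * sdet b.
Proof.
by rewrite /sdet det_mulmx rmorphM /= sqrtrM ?RtoCM // ler0q ltW ?(valP a).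
Qed.

Lemma sdet_neq0 a : sdet a != 0.
Proof.
by rewrite /sdet -nm_eq0 nm_real normr_eq0 sqrtr_eq0 -ltNge ltr0q (valP a).
Qed.

Lemma automorphy_neq0 a z : j a z != 0.
Proof.
apply/eqP => E; have := moebius_subproof a z.
by rewrite E invr0 mulr0 ltxx.
Qed.

Lemma val_moebius a z : val (moebius a z) = (co a 0 0 * val z + co a 0 1) / j a z.
Proof. by []. Qed.

Lemma automorphyM a b z : j (a * b)%g z = j a (moebius b z) * j b z.
Proof.
rewrite {1 2}/automorphy val_moebius !glq_coefM div_addK ?automorphy_neq0 //.
rewrite /automorphy; move: (co a 1 0) (co a 1 1) (co b 0 0) (co b 0 1) (co b 1 0) (co b 1 1) (val z : C).
by move=> *; ring.
Qed.

Lemma uhp_inj z w : (val z : C) = val w -> z = w.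
Proof. exact: val_inj. Qed.

Lemma moebiusM a b z : moebius (a * b)%g z = moebius a (moebius b z).
Proof.
apply: uhp_inj; rewrite !val_moebius automorphyM !glq_coefM.
have E (F : fieldType) (n m d n' : F) : d != 0 -> m != 0 -> n = n' * d -> n / (m * d) = n' / m.
  by move=> d0 m0 ->; field; rewrite d0 m0.
apply: E; rewrite ?automorphy_neq0 // div_addK ?automorphy_neq0 //.
rewrite /automorphy; move: (co a 0 0) (co a 0 1) (co b 0 0) (co b 0 1) (co b 1 0) (co b 1 1) (val z : C).
by move=> *; ring.
Qed.

Lemma glq_coef1 (i i' : 'I_2) : co 1%g i i' = (i == i')%:R.
Proof. by rewrite /glq_coef mxE; case: eqP => _ /=; rewrite ?mulr0n ?rmorph1 ?rmorph0. Qed.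

Lemma automorphy1 z : j 1%g z = 1.
Proof. by rewrite /automorphy !glq_coef1 mul0r add0r. Qed.

Lemma moebius1 z : moebius 1%g z = z.
Proof.
by apply: uhp_inj; rewrite val_moebius automorphy1 !glq_coef1 mul1r addr0 divr1.
Qed.

Lemma slashE k f a z : slash k f a z = sdet a ^+ k * f (moebius a z) * j a z ^- k.
Proof. by []. Qed.

Lemma slashM k f a b : slash k f (a * b)%g = slash k (slash k f a) b.
Proof.
apply/funext => z; rewrite !slashE moebiusM automorphyM sdetM !exprMn invfM.
move: (sdet a ^+ k) (sdet b ^+ k) (f _) (j a _ ^- k) (j b z ^- k) => *.
by ring.
Qed.

Lemma slash1 k f : slash k f 1%g = f.
Proof.
apply/funext => z; rewrite slashE moebius1 automorphy1 expr1n invr1 mulr1 /sdet.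
by rewrite det1 rmorph1 sqrtr1 expr1n mul1r.
Qed.

Lemma slash_mul k l f h a : slash (k + l) (f * h) a = slash k f a * slash l h a.
Proof.
apply/funext => z; rewrite fmul_ev !slashE fmul_ev !exprD invfM.
move: (sdet a ^+ k) (sdet a ^+ l) (f _) (h _) (j a _ ^- k) (j a z ^- l) => *.
by ring.
Qed.

Lemma slashD k f h a : slash k (f + h) a = slash k f a + slash k h a.
Proof.
by apply/funext => z; rewrite fadd_ev !slashE fadd_ev mulrDr mulrDl.
Qed.

Lemma slashZ k (c : C) f a : slash k (c *: f) a = c *: slash k f a.
Proof.
by apply/funext => z; rewrite fscale_ev !slashE fscale_ev mulrCA -!mulrA.
Qed.

Lemma slash0 k a : slash k 0 a = 0 :> (uhp -> C).
Proof. by rewrite -[X in slash _ X _](scale0r (0 : uhp -> C)) slashZ scale0r. Qed.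

Lemma slashN k f a : slash k (- f) a = - slash k f a.
Proof. by rewrite -scaleN1r slashZ scaleN1r. Qed.

Lemma slashB k f h a : slash k (f - h) a = slash k f a - slash k h a.
Proof. by rewrite slashD slashN. Qed.

Lemma slash_one a : slash 0 1 a = 1 :> (uhp -> C).
Proof. by apply/funext => z; rewrite slashE !expr0 invr1 mulr1 mul1r. Qed.

Lemma uder_automorphy a z : uder (j a) z (co a 1 0).
Proof.
have := uderD (uderZ (co a 1 0) (uder_id z)) (uder_cst (co a 1 1) z).
by rewrite mulr1 addr0.
Qed.

Lemma uder_moebius a z : uder (fun w => val (moebius a w)) z (sdet a ^+ 2 / j a z ^+ 2).
Proof.
have jn0 := automorphy_neq0 a z.
have := uderM (uderD (uderZ (co a 0 0) (uder_id z)) (uder_cst (co a 0 1) z))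
  (uderV jn0 (uder_automorphy a z)).
move=> H; apply: uder_eq H _; rewrite sdet_sqr.
have -> : j a z = co a 1 0 * val z + co a 1 1 by [].
have : co a 1 0 * val z + co a 1 1 != 0 by [].
have E (F : fieldType) (p q r s w : F) : r * w + s != 0 ->
  (p * 1 + 0) / (r * w + s) + (p * w + q) * (- (r * w + s) ^- 2 * r) = (p * s - q * r) / (r * w + s) ^+ 2.
  by move=> d0; field.
exact: E.
Qed.

Lemma uder_slash k f a z d : uder f (moebius a z) d ->
  uder (slash k f a) z (sdet a ^+ k * d * (sdet a ^+ 2 / j a z ^+ 2) * j a z ^- k
    - k%:R * (co a 1 0 / j a z) * slash k f a z).
Proof.
move=> Hf.
have H1 : uder (fun w => f (moebius a w)) z (d * (sdet a ^+ 2 / j a z ^+ 2)).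
  have := @uder_comp _ (uext f) (fun w => val (moebius a w)) z d _ Hf (uder_moebius a z).
  by under [X in uder X]eq_fun do rewrite uextE.
have H2 := uderV (expf_neq0 k (automorphy_neq0 a z)) (uderX k (uder_automorphy a z)).
have H := uderM (uderZ (sdet a ^+ k) H1) H2.
apply: uder_eq H _; rewrite slashE.
move: (automorphy_neq0 a z); move: (j a z) (f _) (sdet a ^+ 2) (sdet a ^+ k) (co a 1 0).
have E (F : fieldType) (x y u v w dd : F) : x != 0 ->
  v * (dd * (u / x ^+ 2)) / x ^+ k + v * y * (- x ^+ k ^- 2 * (k%:R * x ^+ k.-1 * w)) =
  v * dd * (u / x ^+ 2) / x ^+ k - k%:R * (w / x) * (v * y / x ^+ k).
  case: (k) => [|k'] x0; first by rewrite !mul0r !mulr0 subr0 addr0 mulrA.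
  have xk : x ^+ k' != 0 by rewrite expf_neq0.
  rewrite /= !exprS; move: (x ^+ k') xk (k'.+1%:R : F) => t t0 n.
  by field; rewrite x0 t0.
by move=> x y u v w x0; apply: E.
Qed.

Definition Df f : uhp -> C := twopii^-1 *: uderiv f.
Lemma Df_ev f z : Df f z = twopii^-1 * uderiv f z. Proof. by []. Qed.

Definition kappa a : uhp -> C := fun z => 2 * co a 1 0 / (twopii * j a z).

Lemma Df_slash k f a : holomorphic f ->
  Df (slash k f a) = slash (k + 2) (Df f) a - (k%:R / 2) *: (kappa a * slash k f a).
Proof.
move=> hf; apply/funext => z; rewrite Df_ev !f_ev !slashE Df_ev.
rewrite (uder_uderiv (uder_slash k (holo_uder (moebius a z) hf))) slashE.
move: (automorphy_neq0 a z) (twopii_neq0 R); rewrite /kappa.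
move: (j a z) (f _) (sdet a) (co a 1 0) twopii (uderiv f _).
have E (F : fieldType) (x y u w t dd : F) : x != 0 -> t != 0 -> 2 != 0 :> F ->
  t^-1 * (u ^+ k * dd * (u ^+ 2 / x ^+ 2) / x ^+ k - k%:R * (w / x) * (u ^+ k * y / x ^+ k)) =
  u ^+ (k + 2) * (t^-1 * dd) / x ^+ (k + 2) -
  k%:R / 2 * (2 * w / (t * x) * (u ^+ k * y / x ^+ k)).
  move=> x0 t0 h0; rewrite !exprD; have xk : x ^+ k != 0 by rewrite expf_neq0.
  move: (x ^+ k) xk (u ^+ k) (k%:R : F) => s s0 v n.
  by field; rewrite x0 t0 s0 h0.
by move=> x y u w t dd x0 t0; apply: E => //; rewrite pnatr_eq0.
Qed.

Lemma slash_holo k f a : holomorphic f -> holomorphic (slash k f a).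
Proof.
move=> hf; apply: uder_holo => z; eexists.
exact: uder_slash (holo_uder (moebius a z) hf).
Qed.

Lemma Gf_holo : holomorphic (@Gf R).
Proof. by apply: uder_holo => z; have [d [Hd _]] := ramanujan z; exists d. Qed.

Lemma muE a : mu a = slash 2 (@Gf R) a - @Gf R - kappa a :> (uhp -> C).
Proof.
apply/funext => z; rewrite /mu !f_ev /dlog.
have n0 (w : uhp) : eta4 w != 0 := eta4_neq0 w.
have := uderM (uder_slash 2 (uder_eta4 (moebius a z))) (uderV (n0 z) (uder_eta4 z)).
move=> /uder_uderiv ->.
move: (n0 z) (n0 (moebius a z)) (automorphy_neq0 a z) (twopii_neq0 R) (sdet_neq0 a).
rewrite !slashE /kappa.
move: (Gf z) (Gf (moebius a z)) (eta4 z) (eta4 (moebius a z)) (j a z) (sdet a) (co a 1 0) twopii.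
have E (F : fieldType) (g g' e e' x u w t : F) :
    e != 0 -> e' != 0 -> x != 0 -> t != 0 -> u != 0 ->
  t^-1 * (((u ^+ 2 * (t * g' * e') * (u ^+ 2 / x ^+ 2) / x ^+ 2 -
    2 * (w / x) * (u ^+ 2 * e' / x ^+ 2)) / e +
    (u ^+ 2 * e' / x ^+ 2) * (- e ^- 2 * (t * g * e))) /
    (u ^+ 2 * e' / x ^+ 2 / e)) =
  u ^+ 2 * g' / x ^+ 2 - g - 2 * w / (t * x).
  move=> e0 e'0 x0 t0 u0.
  by field; rewrite e0 e'0 x0 t0 u0.
by move=> *; apply: E.
Qed.

Lemma kappaM a b : kappa (a * b)%g = slash 2 (kappa a) b + kappa b.
Proof.
apply/funext => z; rewrite fadd_ev slashE /kappa automorphyM !glq_coefM sdet_sqr.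
move: (automorphy_neq0 a (moebius b z)) (automorphy_neq0 b z) (twopii_neq0 R).
have : j a (moebius b z) * j b z = j (a * b)%g z by rewrite automorphyM.
rewrite [j (a * b)%g z]/automorphy !glq_coefM.
have : j b z = co b 1 0 * val z + co b 1 1 by [].
move: (j a _) (j b z) twopii (val z : C) (co a 1 0) (co a 1 1) (co b 0 0) (co b 0 1) (co b 1 0) (co b 1 1).
have E (F : fieldType) (x y t w c d p q r s : F) : y = r * w + s ->
   x * y = (c * p + d * r) * w + (c * q + d * s) -> x != 0 -> y != 0 -> t != 0 ->
   2 * (c * p + d * r) / (t * (x * y)) = (p * s - q * r) * (2 * c / (t * x)) / y ^+ 2 + 2 * r / (t * y).
  move=> yE xy x0 y0 t0.
  have -> : (p * s - q * r) * (2 * c / (t * x)) / y ^+ 2 + 2 * r / (t * y) =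
      2 * (c * (p * s - q * r) + r * (x * y)) / (t * x * y ^+ 2).
    by field; rewrite x0 y0 t0.
  have -> : c * (p * s - q * r) + r * (x * y) = (c * p + d * r) * y.
    by rewrite xy yE; ring.
  by field; rewrite x0 y0 t0.
by move=> x y t w c d p q r s *; apply: (E _ x y t w c d p q r s).
Qed.

Lemma muM a b : mu (a * b)%g = slash 2 (mu a) b + mu b :> (uhp -> C).
Proof. by rewrite !muE kappaM slashM !slashB; apply/funext => z; rewrite !f_ev; ring. Qed.

(* The weight k part of the derivation X of modular forms. *)
Definition Xk k f : uhp -> C := Df f - (k%:R / 2) *: (@Gf R * f).

Lemma Xk_slash k f a : holomorphic f ->
  Xk k (slash k f a) = slash (k + 2) (Xk k f) a + (k%:R / 2) *: (mu a * slash k f a).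
Proof.
move=> hf; rewrite /Xk Df_slash // slashB (slashZ _ (k%:R / 2)) [(k + 2)%N]addnC (slash_mul 2 k) addnC muE.
apply/funext => z; rewrite !f_ev.
move: (slash _ (Df f) a z) (slash k f a z) (slash 2 _ a z) (Gf z) (kappa a z) (k%:R / 2 : C).
by move=> *; ring.
Qed.

Lemma holoD f h : holomorphic f -> holomorphic h -> holomorphic (f + h).
Proof.
move=> hf hh; apply: uder_holo => z; exists (uderiv f z + uderiv h z).
exact: uderD (holo_uder z hf) (holo_uder z hh).
Qed.

Lemma holoM f h : holomorphic f -> holomorphic h -> holomorphic (f * h).
Proof.
move=> hf hh; apply: uder_holo => z; exists (uderiv f z * h z + f z * uderiv h z).
exact: uderM (holo_uder z hf) (holo_uder z hh).
Qed.

Lemma Df_holoM f h : holomorphic f -> holomorphic h -> Df (f * h) = Df f * h + f * Df h.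
Proof.
move=> hf hh; apply/funext => z; rewrite !(f_ev, Df_ev).
have -> : uderiv (f * h) z = uderiv f z * h z + f z * uderiv h z.
  by apply: uder_uderiv; apply: uderM; apply: holo_uder.
by move: (uderiv f z) (uderiv h z) (f z) (h z) (twopii^-1) => *; ring.
Qed.

Lemma Df_holoD (c : C) f h : holomorphic f -> holomorphic h ->
  Df (c *: f + h) = c *: Df f + Df h.
Proof.
move=> hf hh; apply/funext => z; rewrite !(f_ev, Df_ev).
have -> : uderiv (c *: f + h) z = c * uderiv f z + uderiv h z.
  by apply: uder_uderiv; apply: uderD; [apply: uderZ|]; apply: holo_uder.
by move: (uderiv f z) (uderiv h z) (twopii^-1) => *; ring.
Qed.

Lemma kappa_uder a z : uder (kappa a) z (- twopii / 2 * kappa a z ^+ 2).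
Proof.
have := uderZ (2 * co a 1 0 / twopii) (uderV (automorphy_neq0 a z) (uder_automorphy a z)).
have E (F : fieldType) (w x t : F) : t != 0 -> 2 != 0 :> F -> x != 0 ->
   (2 * w / t * (- x ^- 2 * w) = - t / 2 * (2 * w / (t * x)) ^+ 2) *
   (2 * w / t * x^-1 = 2 * w / (t * x)).
  by move=> t0 h0 x0; split; field; rewrite ?x0 t0 ?h0.
have h0 : 2 != 0 :> C by rewrite pnatr_eq0.
move=> H; have {H} := uder_eq H (E _ _ _ _ (twopii_neq0 R) h0 (automorphy_neq0 a z)).1.
congr uder; apply/funext => w; exact: (E _ _ _ _ (twopii_neq0 R) h0 (automorphy_neq0 a w)).2.
Qed.

Definition omega : uhp -> C := - (1 / 72) *: @E4 R.

Lemma omegaE : omega = Df (@Gf R) - 2^-1 *: (@Gf R * @Gf R).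
Proof.
apply/funext => z; rewrite /omega !(f_ev, Df_ev).
have [d [Hd <-]] := ramanujan z; rewrite (uder_uderiv Hd) expr2.
by congr (_ - _); rewrite mulrC.
Qed.

(** By [omegaE] the form [omega] is D G - G^2 / 2, and [kappa] satisfies the homogeneous equation D
    kappa = - kappa^2 / 2. The terms in [kappa] produced by differentiating the slash of G therefore
    combine with G and its slash into expressions in [mu] alone. *)
Lemma omega_slash a :
  slash 4 omega a - omega = Xk 2 (mu a) - 2^-1 *: (mu a * mu a).
Proof.
have alg (sd g G d k : uhp -> C) : sd - 2^-1 *: (g * g) - (d - 2^-1 *: (G * G)) =
  sd - k * g - d - - (2^-1 *: (k * k)) - G * (g - G - k) - 2^-1 *: ((g - G - k) * (g - G - k)).
  apply/funext => z; rewrite !f_ev; move: (sd z) (g z) (G z) (d z) (k z).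
  have E (F : fieldType) (s g' G' d' k' : F) : 2 != 0 :> F ->
    s - 2^-1 * (g' * g') - (d' - 2^-1 * (G' * G')) =
    s - k' * g' - d' - - (2^-1 * (k' * k')) - G' * (g' - G' - k')
    - 2^-1 * ((g' - G' - k') * (g' - G' - k')).
    by move=> h0; field.
  by move=> *; apply: E; rewrite pnatr_eq0.
have hk : holomorphic (kappa a) by apply: uder_holo => z; eexists; apply: kappa_uder.
have hs : holomorphic (slash 2 (@Gf R) a) by apply: slash_holo; apply: Gf_holo.
have hGk : holomorphic (@Gf R + kappa a).
  exact: holoD Gf_holo hk.
have -> : Xk 2 (mu a) = Df (slash 2 (@Gf R) a) - Df (@Gf R) - Df (kappa a) - @Gf R * mu a.
  rewrite /Xk divff ?pnatr_eq0 // scale1r; congr (_ - _).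
  have -> : mu a = (-1) *: (@Gf R + kappa a) + slash 2 (@Gf R) a.
    by rewrite muE scaleN1r [RHS]addrC opprD addrA.
  rewrite (Df_holoD (-1) hGk hs).
  have -> : Df (@Gf R + kappa a) = Df (@Gf R) + Df (kappa a).
    by have := Df_holoD 1 Gf_holo hk; rewrite !scale1r.
  by rewrite scaleN1r [LHS]addrC opprD addrA.
have -> : Df (kappa a) = - (2^-1 *: (kappa a * kappa a)).
  apply/funext => z; rewrite (Df_ev (kappa a)) (uder_uderiv (kappa_uder a z)).
  rewrite fopp_ev fscale_ev fmul_ev -expr2.
  by rewrite !mulNr mulrN !mulrA mulVf ?twopii_neq0 // mul1r.
rewrite (Df_slash 2 a Gf_holo) omegaE slashB (slashZ _ 2^-1).
rewrite (slash_mul 2 2 (@Gf R) (@Gf R)) muE divff ?pnatr_eq0 // scale1r.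
exact: alg.
Qed.

End SlashCalculus.

(** * Vanishing of mu on SL_2(Z), triangular decomposition and conjugation of levels *)

Section ModularForms.
Variable R : realType.
Local Notation C := (cplx R).
Local Notation "x %:C" := ((x)%:C%C : C).
Local Notation uhp := (uhp R).
Local Notation twopii := (twopii R).
Implicit Types (a b g : GL2Qplus) (k l : nat) (z : uhp) (f h : uhp -> C).
Local Notation co a := (@glq_coef R a).
Local Notation j a := (@automorphy R a).

Lemma ord2P (P : 'I_2 -> Prop) : P 0 -> P 1 -> forall i, P i.
Proof.
move=> P0 P1 i; have [->|->] : i = 0 \/ i = 1 => //.
by case: i => -[|[|//]] ?; [left|right]; apply: val_inj.
Qed.

Lemma glq_eqP a b : val a 0 0 = val b 0 0 -> val a 0 1 = val b 0 1 ->
  val a 1 0 = val b 1 0 -> val a 1 1 = val b 1 1 -> a = b.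
Proof.
move=> h00 h01 h10 h11; apply: val_inj; apply/matrixP.
by apply: ord2P; apply: ord2P.
Qed.

Lemma glq_ex (p q r s : rat) : 0 < p * s - q * r -> exists a : GL2Qplus,
  [/\ val a 0 0 = p, val a 0 1 = q, val a 1 0 = r & val a 1 1 = s].
Proof.
pose M : 'M[rat]_2 := \matrix_(i, i')
  (if i == 0 then if i' == 0 then p else q else if i' == 0 then r else s).
have -> : p * s - q * r = \det M by rewrite det_mx22 !mxE.
by move=> M0; exists (exist _ M M0); rewrite /= !mxE.
Qed.

Lemma SL2Z_ex (p q r s : int) : p * s - q * r = 1 -> exists a : GL2Qplus, SL2Z a /\
  [/\ val a 0 0 = p%:~R, val a 0 1 = q%:~R, val a 1 0 = r%:~R & val a 1 1 = s%:~R].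
Proof.
move=> d1; have d1' : (p%:~R * s%:~R - q%:~R * r%:~R : rat) = 1.
  by rewrite -!intrM -intrB d1.
have [|a [h00 h01 h10 h11]] := @glq_ex p%:~R q%:~R r%:~R s%:~R; first by rewrite d1'.
exists a; split=> //; split; last by rewrite det_mx22 h00 h01 h10 h11.
by apply: ord2P; apply: ord2P; rewrite ?h00 ?h01 ?h10 ?h11 intr_int.
Qed.

Lemma SL2ZP g : SL2Z g -> exists p q r s : int, p * s - q * r = 1 /\
  [/\ val g 0 0 = p%:~R, val g 0 1 = q%:~R, val g 1 0 = r%:~R & val g 1 1 = s%:~R].
Proof.
move=> [gZ g1]; have /intrP[p hp] := gZ 0 0; have /intrP[q hq] := gZ 0 1.
have /intrP[r hr] := gZ 1 0; have /intrP[s hs] := gZ 1 1.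
exists p, q, r, s; split=> //; move: g1; rewrite det_mx22 hp hq hr hs -!intrM -intrB.
by move/eqP; rewrite (eqr_int rat _ 1) => /eqP.
Qed.

Lemma SL2ZM a b : SL2Z a -> SL2Z b -> SL2Z (a * b)%g.
Proof.
move=> [aZ a1] [bZ b1]; split=> [i i'|]; last by rewrite det_mulmx a1 b1 mulr1.
by rewrite mulmx22E rpredD // rpredM.
Qed.

Lemma SL2ZV a : SL2Z a -> SL2Z a^-1%g.
Proof.
move=> /SL2ZP[p [q [r [s [d1 [h00 h01 h10 h11]]]]]].
have d1' : s * p - (- q) * (- r) = 1 by rewrite mulrNN mulrC.
have [a' [a'Z [k00 k01 k10 k11]]] := SL2Z_ex d1'.
suff E : (a * a')%g = 1%g by rewrite -[a^-1%g]mulg1 -E mulKg.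
apply: glq_eqP; rewrite mulmx22E ?h00 ?h01 ?h10 ?h11 ?k00 ?k01 ?k10 ?k11 mxE /= -!intrM -intrD.
- by rewrite mulrN d1.
- by rewrite mulrN mulrC addNr.
- by rewrite mulrN [s * r]mulrC subrr.
- by rewrite mulrN [r * q]mulrC addrC [s * p]mulrC d1.
Qed.

Lemma sdet_SL2Z a : SL2Z a -> sdet R a = 1.
Proof. by move=> [_ a1]; rewrite /sdet a1 rmorph1 sqrtr1. Qed.

Lemma RtoC_int (m : int) : ((ratr (m%:~R : rat) : R) %:C) = m%:~R.
Proof.
rewrite ratr_int; case: m => n; first by rewrite -!pmulrn RtoC_nat.
by rewrite NegzE !mulrNz RtoCN -!pmulrn RtoC_nat.
Qed.

Lemma cexp_int (m : int) : cexp (twopii * m%:~R) = 1.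
Proof.
case: m => n; first by rewrite -pmulrn -/(ee _) ee_nat.
by rewrite NegzE mulrNz mulrN cexpN -pmulrn -/(ee _) ee_nat invr1.
Qed.

Lemma Gf_shift z z' (m : int) : val z' = (val z : C) + m%:~R -> Gf z' = Gf z.
Proof.
move=> z'E; have qE : qpar 1 z' = qpar 1 z.
  by rewrite /qpar !divr1 z'E mulrDr cexpD cexp_int mulr1.
by rewrite /Gf /qf qE.
Qed.

Lemma mu_tri a : val a 1 0 = 0 -> mu a = slash 2 (@Gf R) a - @Gf R :> (uhp -> C).
Proof.
move=> a10; rewrite muE; apply/funext => z; rewrite !f_ev /kappa /glq_coef a10.
by rewrite rmorph0 mulr0 mul0r subr0.
Qed.

Lemma mu_SL2Z_tri g : SL2Z g -> val g 1 0 = 0 -> mu g = 0 :> (uhp -> C).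
Proof.
move=> gZ g10; rewrite mu_tri //; apply/funext => z; rewrite !f_ev slashE sdet_SL2Z //.
have [p [q [r [s [d1 [h00 h01 h10 h11]]]]]] := SL2ZP gZ.
have r0 : r = 0 by apply/eqP; rewrite -(@intr_eq0 rat) -h10 g10.
have jE : j g z = s%:~R.
  by rewrite /automorphy /glq_coef h10 h11 r0 !RtoC_int mul0r add0r.
have ps : p * s = 1 by rewrite -d1 r0 mulr0 subr0.
have ps1 : (p = 1 /\ s = 1) \/ (p = -1 /\ s = -1).
  have := congr1 absz ps; rewrite abszM => /eqP; rewrite muln_eq1 => /andP[/eqP p1 /eqP s1].
  have [pE|pE] : p = 1 \/ p = -1 by lia.
    by left; split=> //; move: ps; rewrite pE mul1r.
  by right; split=> //; move: ps; rewrite pE mulN1r => <-; rewrite opprK.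
have zE : val (moebius g z) = (val z : C) + (q * s)%:~R.
  rewrite val_moebius jE /glq_coef h00 h01 !RtoC_int.
  have [[-> ->]|[-> ->]] := ps1.
    by rewrite mul1r divr1 mulr1.
  by rewrite mulrN1 !mulrNz mulN1r invrN1 mulrN1 opprD opprK.
rewrite (Gf_shift zE) jE -[_ ^+ 2 in X in _ / X]rmorphXn /=.
have -> : s ^+ 2 = 1 by case: ps1 => -[_ ->].
by rewrite expr1n mul1r divr1 subrr.
Qed.

Lemma mu_inversion g : val g 0 0 = 0 -> val g 0 1 = -1 -> val g 1 0 = 1 -> val g 1 1 = 0 ->
  mu g = 0 :> (uhp -> C).
Proof.
move=> h00 h01 h10 h11; rewrite muE; apply/funext => z; rewrite !f_ev slashE /kappa.
have -> : sdet R g = 1.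
  by rewrite /sdet det_mx22 h00 h01 h10 h11 mul0r sub0r mulN1r opprK rmorph1 sqrtr1.
have jE : j g z = val z.
  by rewrite /automorphy /glq_coef h10 h11 rmorph1 rmorph0 mul1r addr0.
have zE : val (moebius g z) = - (val z : C)^-1.
  by rewrite val_moebius jE /glq_coef h00 h01 rmorph0 rmorphN1 mul0r add0r RtoCN mulN1r.
rewrite jE expr1n mul1r (Gf_inversion zE) /glq_coef h10 rmorph1 mulr1.
by rewrite [_ + _ - Gf z]addrAC subrr add0r subrr.
Qed.

(** Euclid's algorithm on the first column: the translation [t] reduces the upper left entry p
    modulo the lower left entry r, and the inversion [i] moves the remainder into the lower left
    corner, where it is smaller than r. The cocycle rule carries the vanishing at [i * t * g] and at
    [i * t] over to [g]. *)
Lemma mu_SL2Z g : SL2Z g -> mu g = 0 :> (uhp -> C).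
Proof.
move=> gZ; have [p [q [r [s [d1 [h00 h01 h10 h11]]]]]] := SL2ZP gZ.
have [n] := ubnP `|r|%N; elim: n g gZ p q r s d1 h00 h01 h10 h11 => // n IHn.
move=> g gZ p q r s d1 h00 h01 h10 h11 rn.
have [r0|r0] := eqVneq r 0; first by apply: mu_SL2Z_tri => //; rewrite h10 r0.
have [i [iZ [i00 i01 i10 i11]]] : exists i, SL2Z i /\ [/\ val i 0 0 = 0%:~R,
    val i 0 1 = (-1)%:~R, val i 1 0 = 1%:~R & val i 1 1 = 0%:~R] by apply: SL2Z_ex.
pose m := - (p %/ r)%Z.
have [t [tZ [t00 t01 t10 t11]]] : exists t, SL2Z t /\ [/\ val t 0 0 = 1%:~R,
    val t 0 1 = m%:~R, val t 1 0 = 0%:~R & val t 1 1 = 1%:~R].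
  by apply: SL2Z_ex; rewrite mulr0 subr0 mulr1.
have ig0 : mu (i * t * g)%g = 0 :> (uhp -> C).
  have h := SL2ZM (SL2ZM iZ tZ) gZ.
  apply: (IHn _ h (- r) (- s) (p + m * r) (q + m * s)).
  - by rewrite -d1; ring.
  - by rewrite !mulmx22E ?i00 ?i01 ?i10 ?i11 t00 t01 t10 t11 h00 h10 -!(intrM, intrD); congr _%:~R; ring.
  - by rewrite !mulmx22E ?i00 ?i01 ?i10 ?i11 t00 t01 t10 t11 h01 h11 -!(intrM, intrD); congr _%:~R; ring.
  - by rewrite !mulmx22E ?i00 ?i01 ?i10 ?i11 t00 t01 t10 t11 h00 h10 -!(intrM, intrD); congr _%:~R; ring.
  - by rewrite !mulmx22E ?i00 ?i01 ?i10 ?i11 t00 t01 t10 t11 h01 h11 -!(intrM, intrD); congr _%:~R; ring.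
  have -> : p + m * r = (p %% r)%Z by rewrite /m {1}(divz_eq p r) mulNr addrAC subrr add0r.
  have : (`|(p %% r)%Z| < `|r|)%N.
    by rewrite -ltz_nat !abszE (ger0_norm (modz_ge0 _ r0)) ltz_mod.
  by move=> h1; apply: leq_trans h1 _; rewrite -ltnS.
have i0 : mu (i * t)%g = 0 :> (uhp -> C).
  have i0 : mu i = 0 :> (uhp -> C) by apply: mu_inversion.
  by rewrite muM i0 slash0 add0r mu_SL2Z_tri.
by have := muM R (i * t)%g g; rewrite ig0 i0 slash0 add0r.
Qed.

Lemma common_den (A : 'M[rat]_2) :
  exists2 D : nat, (0 < D)%N & forall i i', D%:R * A i i' \is a Num.int.
Proof.
pose d i i' := `|denq (A i i')|%N.
exists (\prod_i \prod_i' d i i')%N => [|i i'].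
  by rewrite !prodn_gt0 // => i; rewrite prodn_gt0 // => i'; rewrite /d absz_gt0 denq_neq0.
rewrite (bigD1 i) //= (bigD1 i') //= -!mulnA natrM mulrAC rpredM ?natr_int //.
rewrite /d [X in X * _]pmulrn gez0_abs ?denq_ge0 // mulrC -numqE.
exact: intr_int.
Qed.

Lemma glq_common_den a : exists2 D : nat, (0 < D)%N & forall i i', exists m : int,
  D%:R * val a i i' = m%:~R /\ D%:R * co a i i' = m%:~R.
Proof.
have [D D0 HD] := common_den (val a); exists D => // i i'.
have /intrP[m Hm] := HD i i'; exists m; split=> //.
have := congr1 (fun x : rat => ratr x : R) Hm; rewrite rmorphM /= ratr_nat.
by move=> /(congr1 (fun x : R => x%:C)); rewrite RtoC_int RtoCM RtoC_nat.
Qed.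

(** After denominators are cleared, the first column is (p', s') times its gcd. A Bezout relation
    completes (-s', p') to an integral matrix [h] of determinant 1, and [h * a] has first column
    (gcd, 0) up to the positive denominator. *)
Lemma GL2Qplus_decomp a : exists h t : GL2Qplus,
  [/\ SL2Z h, a = (h * t)%g, val t 1 0 = 0 & 0 < val t 0 0].
Proof.
have [D D0 HD] := common_den (val a).
have DQ : (D%:R : rat) != 0 by rewrite pnatr_eq0 -lt0n.
have /intrP[P HP] := HD 0 0; have /intrP[S HS] := HD 1 0.
have [u [v uv]] := Bezoutz P S.
have g0 : gcdz P S != 0.
  rewrite gcdz_eq0; apply/negP => /andP[/eqP P0 /eqP S0].
  have p0 : val a 0 0 = 0 by apply: (mulfI DQ); rewrite HP P0 mulr0.
  have s0 : val a 1 0 = 0 by apply: (mulfI DQ); rewrite HS S0 mulr0.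
  by have := valP a; rewrite det_mx22 p0 s0 mul0r mulr0 subrr ltxx.
have [p' Ep] : exists p', P = p' * gcdz P S by apply/dvdzP/dvdz_gcdl.
have [s' Es] : exists s', S = s' * gcdz P S by apply/dvdzP/dvdz_gcdr.
have us : u * p' - v * (- s') = 1.
  by apply: (mulIf g0); rewrite mul1r mulrN opprK mulrDl -!mulrA -Ep -Es.
have [h [hZ [h00 h01 h10 h11]]] := SL2Z_ex us.
exists h^-1%g, (h * a)%g; split; first exact: SL2ZV.
- by rewrite mulKg.
- apply: (mulfI DQ); rewrite mulmx22E mulr0 mulrDr mulrCA HP mulrCA HS h10 h11.
  rewrite -!(intrM, intrD); suff -> : - s' * P + p' * S = 0 by [].
  by move: Ep Es; move: (gcdz P S) => gg -> ->; ring.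
have D0' : 0 < D%:R :> rat by rewrite ltr0n.
rewrite -(pmulr_rgt0 _ D0') mulmx22E mulrDr mulrCA HP mulrCA HS h00 h01.
by rewrite -!(intrM, intrD) uv ltr0z lt_neqAle eq_sym g0 /=.
Qed.

(** Both diagonal entries are positive, so up to a constant factor the slash by [t] is composition
    with an affine map (A z + e) / d, where A and d are positive integers. *)
Lemma qreg_tri (b : bool) k f (t : GL2Qplus) : val t 1 0 = 0 -> 0 < val t 0 0 -> qreg b f -> qreg b (slash k f t).
Proof.
move=> t10 t00 qf.
have t11 : 0 < val t 1 1.
  by have := valP t; rewrite det_mx22 t10 mulr0 subr0 pmulr_rgt0.
have [D D0 HD] := glq_common_den t.
have D0' : 0 < D%:R :> rat by rewrite ltr0n.
have DC : (D%:R : C) != 0 by rewrite pnatr_eq0 -lt0n.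
have [A [Aq AC]] := HD 0 0; have [e [_ eC]] := HD 0 1; have [d [dq dC]] := HD 1 1.
have c10 : co t 1 0 = 0 by rewrite /glq_coef t10 rmorph0.
have A0 : 0 < A by rewrite -(ltr0z rat) -Aq mulr_gt0.
have d0 : 0 < d by rewrite -(ltr0z rat) -dq mulr_gt0.
case: A A0 Aq AC => // A A0 _ AC; case: d d0 dq dC => // d d0 _ dC.
have := qreg_affine (g := moebius t) (e := e) A0 d0 _ qf.
have mE z : val (moebius t z) = (A%:R * val z + e%:~R) / d%:R.
  rewrite val_moebius /automorphy c10 mul0r add0r !pmulrn -AC -eC -dC.
  by rewrite -mulrA -mulrDr invfM mulrACA divff // mul1r.
move=> /(_ mE)/(qregZ (sdet R t ^+ k * (co t 1 1) ^- k)).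
congr qreg; apply/funext => z; rewrite fscale_ev slashE /automorphy c10 mul0r add0r.
by rewrite mulrAC.
Qed.

Lemma Gamma_SL2Z N g : Gamma N g -> SL2Z g.
Proof. by case. Qed.

Lemma GammaM N M g : Gamma (N * M) g -> Gamma N g.
Proof.
move=> [gZ H]; split=> // i i'; have [m ->] := H i i'; exists (m * M).
by rewrite PoszM mulrCA mulrC mulrAC.
Qed.

Lemma int_mulmx (A B : 'M[rat]_2) : (forall i i', A i i' \is a Num.int) ->
  (forall i i', B i i' \is a Num.int) -> forall i i', (A *m B) i i' \is a Num.int.
Proof. by move=> AZ BZ i i'; rewrite mulmx22E rpredD // rpredM. Qed.

(** With [D] and [D'] clearing the denominators of a and a^-1, the level is M = N D D'. If g = 1 + M
    m, its conjugate is 1 + N (D a) m (D' a^-1), and the product after N is integral. *)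
Lemma Gamma_conj a N : (0 < N)%N ->
  exists2 M, (0 < M)%N & forall g, Gamma M g -> Gamma N (a * g * a^-1)%g.
Proof.
move=> N0; have [D D0 HD] := common_den (val a).
have [D' D'0 HD'] := common_den (val a^-1%g).
exists (N * (D * D'))%N => [|g [[gZ g1] Hg]]; first by rewrite !muln_gt0 N0 D0.
pose m : 'M[rat]_2 := \matrix_(i, i') ((val g i i' - (i == i')%:R) / (N * (D * D'))%:R).
have M0 : ((N * (D * D'))%:R : rat) != 0 by rewrite pnatr_eq0 -lt0n !muln_gt0 N0 D0.
have mZ i i' : m i i' \is a Num.int.
  have [n Hn] := Hg i i'; rewrite mxE Hn addrAC subrr add0r intrM -pmulrn mulfK //.
have gE : val g = 1%:M + (N * (D * D'))%:R *: m.
  by apply/matrixP => i i'; rewrite !mxE mulrC divfK // addrC subrK.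
pose n := (D%:R *: val a) *m m *m (D'%:R *: val a^-1%g).
have nZ i i' : n i i' \is a Num.int.
  rewrite /n; do 2?[apply: int_mulmx => {i i'} i i'] => //; rewrite mxE //.
have E : val (a * g * a^-1)%g = 1%:M + N%:R *: n.
  rewrite /= gE mulmxDr mulmxDl mulmx1 mulmxV ?glq_unit //; congr (_ + _).
  rewrite /n -!scalemxAl -!scalemxAr -!scalemxAl !scalerA.
  by rewrite !natrM mulrA.
have entry i i' : exists k : int, val (a * g * a^-1)%g i i' = (i == i')%:R + (k * N%:Z)%:~R.
  have /intrP[k Hk] := nZ i i'; exists k.
  rewrite E [LHS]mxE [X in _ + X]mxE [X in X + _]mxE Hk; congr (_ + _).
  by rewrite intrM -pmulrn mulrC.
split=> //; split.
  by move=> i i'; have [k ->] := entry i i'; rewrite rpredD ?natr_int ?intr_int.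
by rewrite !det_mulmx g1 mulr1 -det_mulmx mulmxV ?glq_unit // det1.
Qed.

End ModularForms.

(** * Modular forms of all levels *)

Section FormsOfAllLevels.
Variable R : realType.
Local Notation C := (cplx R).
Local Notation uhp := (uhp R).
Implicit Types (a g : GL2Qplus) (b : bool) (k l N : nat) (z : uhp) (f h : uhp -> C).

(* [mform false k] is the space of modular forms of weight k and of all levels,
   [mform true k] that of cusp forms. *)
Definition mform b k f :=
  (exists2 N, (0 < N)%N & forall g, Gamma N g -> slash k f g = f) /\
  forall g, SL2Z g -> qreg b (slash k f g).

Lemma SL2Z1 : SL2Z 1%g.
Proof.
by split; [apply: ord2P; apply: ord2P; rewrite mxE /= ?rpred0 ?rpred1|rewrite det1].
Qed.

Lemma mform_qreg b k f : mform b k f -> qreg b f.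
Proof. by move=> [_ /(_ _ SL2Z1)]; rewrite slash1. Qed.

Lemma mform_holo b k f : mform b k f -> holomorphic f.
Proof. by move=> /mform_qreg/qreg_holo. Qed.

Lemma mform_weak b k f : mform b k f -> mform false k f.
Proof. by move=> [? H]; split=> // g gZ; apply: qreg_weak (H g gZ). Qed.

Lemma mform_qreg_slash b k f a : mform b k f -> qreg b (slash k f a).
Proof.
move=> [_ H]; have [h [t [hZ -> t10 t00]]] := GL2Qplus_decomp a.
by rewrite slashM; apply: qreg_tri => //; apply: H.
Qed.

Lemma mform_slash b k f a : mform b k f -> mform b k (slash k f a).
Proof.
move=> mf; split=> [|g gZ]; last by rewrite -slashM; apply: mform_qreg_slash.
have [[N N0 HN] _] := mf; have [M M0 HM] := Gamma_conj a N0.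
exists M => // g /HM/HN E; rewrite -slashM -[(a * g)%g](mulgVK a) slashM.
by rewrite E.
Qed.

Lemma mform0 b k : mform b k 0.
Proof.
by split=> [|g _]; [exists 1%N => // g _; rewrite slash0|rewrite slash0; apply: qreg0].
Qed.

Lemma mformZ b k (c : C) f : mform b k f -> mform b k (c *: f).
Proof.
move=> [[N N0 HN] H]; split=> [|g gZ]; last by rewrite slashZ; apply/qregZ/H.
by exists N => // g gN; rewrite slashZ HN.
Qed.

Lemma mformD b k f h : mform b k f -> mform b k h -> mform b k (f + h).
Proof.
move=> [[N N0 HN] Hf] [[M M0 HM] Hh]; split=> [|g gZ]; last first.
  by rewrite slashD; apply: qregD; [apply: Hf|apply: Hh].
exists (N * M)%N => [|g gNM]; first by rewrite muln_gt0 N0.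
by rewrite slashD HN ?HM //; [move: gNM; rewrite mulnC; apply: GammaM|apply: GammaM gNM].
Qed.

Lemma mformM b k l f h : mform b k f -> mform false l h -> mform b (k + l) (f * h).
Proof.
move=> [[N N0 HN] Hf] [[M M0 HM] Hh]; split=> [|g gZ]; last first.
  by rewrite slash_mul; apply: qregM; [apply: Hf|apply: Hh].
exists (N * M)%N => [|g gNM]; first by rewrite muln_gt0 N0.
by rewrite slash_mul HN ?HM //; [move: gNM; rewrite mulnC; apply: GammaM|apply: GammaM gNM].
Qed.

Lemma mform1 : mform false 0 1.
Proof.
split=> [|g _]; first by exists 1%N => // g _; rewrite slash_one.
by rewrite slash_one; apply: (qreg_cst 1).
Qed.

Lemma Gf_qreg : qreg false (@Gf R).
Proof.
have [t1 _ _] := sig_tame R.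
have q1 : qreg false (qf 1 (@sig1 R)) by exists 1%N, (@sig1 R).
have -> : @Gf R = 6^-1 *: ((fun=> 1) + (-24) *: qf 1 (@sig1 R)).
  apply/funext => z; rewrite fscale_ev fadd_ev fscale_ev /Gf mulrC mulNr //.
apply: qregZ; apply: qregD; first exact: qreg_cst.
exact: qregZ.
Qed.

Lemma mu_qreg a : qreg false (mu a : uhp -> C).
Proof.
have [h [t [hZ -> t10 t00]]] := GL2Qplus_decomp a.
rewrite muM mu_SL2Z // slash0 add0r mu_tri //; apply: qregD; last first.
  by rewrite -scaleN1r; apply/qregZ/Gf_qreg.
by apply: qreg_tri => //; apply: Gf_qreg.
Qed.

(** For g in SL_2(Z) the cocycle rule reads mu_(a g) = mu_a|g. If a g a^-1 also lies in SL_2(Z),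
    writing a g = (a g a^-1) a gives mu_(a g) = mu_a. Both hold on a principal congruence subgroup,
    by [Gamma_conj] with target level 1. *)
Lemma mform_mu a : mform false 2 (mu a : uhp -> C).
Proof.
split=> [|g gZ]; last first.
  have := muM R a g; rewrite (mu_SL2Z R gZ) addr0 => <-; exact: mu_qreg.
have [M M0 HM] := Gamma_conj a (ltn0Sn 0); exists M => // g gM.
have := muM R a g; rewrite (mu_SL2Z R (Gamma_SL2Z gM)) addr0 => <-.
rewrite -[(a * g)%g](mulgVK a) muM (mu_SL2Z R (Gamma_SL2Z (HM _ gM))).
by rewrite slash0 add0r.
Qed.

Lemma qreg_Xk b k f : qreg b f -> qreg b (Xk k f).
Proof.
move=> qf; rewrite /Xk /Df; apply: qregD; first exact/qregZ/qreg_uderiv.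
rewrite -scaleN1r; apply/qregZ/qregZ; rewrite mulrC.
by apply: qregM => //; apply: Gf_qreg.
Qed.

Lemma Xk_slash_SL2Z k f g : holomorphic f -> SL2Z g ->
  slash (k + 2) (Xk k f) g = Xk k (slash k f g).
Proof. by move=> hf gZ; rewrite Xk_slash // mu_SL2Z // mul0r scaler0 addr0. Qed.

Lemma mform_Xk b k f : mform b k f -> mform b (k + 2) (Xk k f).
Proof.
move=> mf; have hf := mform_holo mf; have [[N N0 HN] Hf] := mf.
split=> [|g gZ]; last by rewrite Xk_slash_SL2Z //; apply/qreg_Xk/Hf.
by exists N => // g gN; rewrite Xk_slash_SL2Z ?HN //; apply: Gamma_SL2Z gN.
Qed.

Lemma omega_SL2Z g : SL2Z g -> slash 4 (@omega R) g = @omega R.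
Proof.
move=> gZ; apply/eqP; rewrite -subr_eq0 omega_slash mu_SL2Z // mul0r scaler0 subr0.
have -> : Xk 2 (0 : uhp -> C) = 0.
  rewrite /Xk mulr0 scaler0 subr0; apply/funext => z.
  by rewrite Df_ev (uder_uderiv (uder_cst 0 z)) mulr0.
by [].
Qed.

Lemma mform_omega : mform false 4 (@omega R).
Proof.
have q : qreg false (@omega R).
  rewrite omegaE; apply: qregD; first exact/qregZ/qreg_uderiv/Gf_qreg.
  by rewrite -scaleN1r; apply/qregZ/qregZ/qregM; apply: Gf_qreg.
by split=> [|g gZ]; [exists 1%N => // g gZ|]; rewrite omega_SL2Z //; apply: Gamma_SL2Z gZ.
Qed.

Lemma modular_formP N k f : modular_form k (Gamma N) f <->
  (forall g, Gamma N g -> slash k f g = f) /\ forall g, SL2Z g -> qreg false (slash k f g).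
Proof.
split=> [[_ H1 H2]|[H1 H2]].
  by split=> // g gZ; apply/qreg_holoE/H2.
split=> //.
- by have := H2 _ SL2Z1; rewrite slash1 => /qreg_holo.
- by move=> g gZ; apply/qreg_holoE/H2.
Qed.

Lemma cusp_formP N k f : cusp_form k (Gamma N) f <->
  (forall g, Gamma N g -> slash k f g = f) /\ forall g, SL2Z g -> qreg true (slash k f g).
Proof.
split=> [[/modular_formP[H1 _] H2]|[H1 H2]].
  by split=> // g gZ; apply/qreg_vanE/H2.
split=> [|g gZ].
- by apply/modular_formP; split=> // g gZ; apply/qreg_weak/H2.
- exact/qreg_vanE/H2.
Qed.

Definition gmform b : set (gform R) :=
  [set u : gform R | (forall k, mform b k (u k)) /\ exists d, forall k, (d <= k)%N -> u k = 0].

(** Only finitely many components are non-zero, so a product of their levels serves all of them at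
    once. *)
Lemma gmform_level b u : gmform b u -> exists2 N, (0 < N)%N &
  forall k g, Gamma N g -> slash k (u k) g = u k.
Proof.
move=> [Hu [d Hd]].
have [N N0 HN] : exists2 N, (0 < N)%N &
    forall k g, (k < d)%N -> Gamma N g -> slash k (u k) g = u k.
  elim: d {Hd} => [|d [N N0 HN]]; first by exists 1%N.
  have [[M M0 HM] _] := Hu d; exists (N * M)%N => [|k g]; first by rewrite muln_gt0 N0.
  rewrite ltnS leq_eqVlt => /predU1P[->|kd] gNM; last exact/HN/GammaM/gNM.
  by apply: HM; move: gNM; rewrite mulnC; apply: GammaM.
exists N => // k g gN; have [kd|dk] := ltnP k d; first exact: HN.
by rewrite (Hd k dk) slash0.
Qed.

Lemma modforms_allE : @modforms_all R = gmform false.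
Proof.
apply/seteqP; split=> [u [N N0 [Hu Hd]]|u gu].
  split=> // k; have [H1 H2] := (modular_formP N k (u k)).1 (Hu k).
  by split=> //; exists N.
have [N N0 HN] := gmform_level gu; have [Hu Hd] := gu; exists N => //; split=> // k.
by apply/modular_formP; split=> [g|]; [apply: HN|case: (Hu k)].
Qed.

Lemma cuspforms_allE : @cuspforms_all R = gmform true.
Proof.
apply/seteqP; split=> [u [N N0 [Hu Hd]]|u gu].
  split=> // k; have [H1 H2] := (cusp_formP N k (u k)).1 (Hu k).
  by split=> //; exists N.
have [N N0 HN] := gmform_level gu; have [Hu Hd] := gu; exists N => //; split=> // k.
by apply/cusp_formP; split=> [g|]; [apply: HN|case: (Hu k)].
Qed.

End FormsOfAllLevels.

(** * The graded algebra of forms: product, slash, X, Y and the iterated derivatives of mu *)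

Section GradedForms.
Variable R : realType.
Local Notation C := (cplx R).
Local Notation uhp := (uhp R).
Local Notation gform := (gform R).
Local Notation gX := (@gX R).
Local Notation twopii := (twopii R).
Implicit Types (a g : GL2Qplus) (b : bool) (k l n : nat) (z : uhp) (f h : uhp -> C).
Implicit Types (u v w : gform) (c : C).

Lemma gadd_ev u v n : (u + v) n = u n + v n. Proof. by []. Qed.
Lemma gscale_ev c u n : (c *: u) n = c *: u n. Proof. by []. Qed.
Lemma g0_ev n : (0 : gform) n = 0. Proof. by []. Qed.

Lemma fscalerAl c f h : c *: (f * h) = (c *: f) * h.
Proof. by apply/funext => z; rewrite !f_ev mulrA. Qed.
Lemma fscalerAr c f h : c *: (f * h) = f * (c *: h).
Proof. by apply/funext => z; rewrite !f_ev mulrCA. Qed.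

Lemma gmulE u v n : gmul u v n = \sum_(i < n.+1) u i * v (n - i)%N.
Proof. by []. Qed.

Lemma fsum_ev (I : Type) (r : seq I) (P : pred I) (F : I -> uhp -> C) z :
  (\sum_(i <- r | P i) F i) z = \sum_(i <- r | P i) F i z.
Proof. by rewrite fct_sumE. Qed.

Section TruncatedPolynomial.
Variables (m : nat) (z : uhp).
(** At a fixed point [gmul] is multiplication of polynomials in the weight variable, truncated below
    [m]; associativity and commutativity are inherited from [{poly C}]. *)
Let gpoly u : {poly C} := \poly_(i < m) u i z.

Let gpolyE u i : (i < m)%N -> (gpoly u)`_i = u i z.
Proof. by move=> im; rewrite coef_poly im. Qed.

Lemma gmul_coef u v n : (n < m)%N -> gmul u v n z = (gpoly u * gpoly v)`_n.
Proof.
move=> nm; rewrite gmulE fsum_ev coefM; apply: eq_bigr => i _.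
by rewrite fmul_ev !gpolyE //; apply: leq_ltn_trans nm; rewrite ?leq_subr // -ltnS.
Qed.

Lemma gmul_coefA u v w n : (n < m)%N ->
  gmul u (gmul v w) n z = gmul (gmul u v) w n z.
Proof.
move=> nm.
have -> : gmul u (gmul v w) n z = (gpoly u * (gpoly v * gpoly w))`_n.
  rewrite gmulE fsum_ev coefM; apply: eq_bigr => i _; rewrite fmul_ev.
  have im : (i < m)%N by apply: leq_ltn_trans nm; rewrite -ltnS.
  by rewrite gpolyE // gmul_coef // (leq_ltn_trans (leq_subr _ _)).
rewrite mulrA gmulE fsum_ev coefM; apply: eq_bigr => i _; rewrite fmul_ev.
have im : (i < m)%N by apply: leq_ltn_trans nm; rewrite -ltnS.
by rewrite [in RHS]gmul_coef // gpolyE // (leq_ltn_trans (leq_subr _ _)).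
Qed.
End TruncatedPolynomial.

Lemma gform_eqP u v : (forall n z, u n z = v n z) -> u = v.
Proof. by move=> uv; apply/funext => n; apply/funext => z. Qed.

Lemma gmulA u v w : gmul u (gmul v w) = gmul (gmul u v) w.
Proof. by apply: gform_eqP => n z; apply: (@gmul_coefA n.+1). Qed.

Lemma gmulC u v : gmul u v = gmul v u.
Proof. by apply: gform_eqP => n z; rewrite !(@gmul_coef n.+1) // mulrC. Qed.

Lemma gmul_linl w c u v : gmul (c *: u + v) w = c *: gmul u w + gmul v w.
Proof.
apply/funext => n; rewrite gadd_ev gscale_ev !gmulE scaler_sumr -big_split.
by apply: eq_bigr => i _; rewrite gadd_ev gscale_ev mulrDl fscalerAl.
Qed.

Lemma gmul_linr w c u v : gmul w (c *: u + v) = c *: gmul w u + gmul w v.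
Proof. by rewrite gmulC gmul_linl !(gmulC w). Qed.

Lemma gmulDl u v w : gmul (u + v) w = gmul u w + gmul v w.
Proof. by have := gmul_linl w 1 u v; rewrite !scale1r. Qed.
Lemma gmulDr u v w : gmul w (u + v) = gmul w u + gmul w v.
Proof. by rewrite gmulC gmulDl !(gmulC w). Qed.
Lemma gmul0 u : gmul 0 u = 0.
Proof. by apply: (addIr (gmul 0 u)); rewrite -gmulDl !add0r. Qed.
Lemma gmulr0 u : gmul u 0 = 0. Proof. by rewrite gmulC gmul0. Qed.
Lemma gmulZl c u v : gmul (c *: u) v = c *: gmul u v.
Proof. by have := gmul_linl v c u 0; rewrite gmul0 !addr0. Qed.
Lemma gmulNl u v : gmul (- u) v = - gmul u v.
Proof. by rewrite -scaleN1r gmulZl scaleN1r. Qed.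
Lemma gmulBl u v w : gmul (u - v) w = gmul u w - gmul v w.
Proof. by rewrite gmulDl gmulNl. Qed.

Lemma gmulCA u v w : gmul u (gmul v w) = gmul v (gmul u w).
Proof. by rewrite !gmulA (gmulC u). Qed.

Lemma gmul_sumr (I : Type) (r : seq I) (F : I -> gform) u :
  gmul u (\sum_(i <- r) F i) = \sum_(i <- r) gmul u (F i).
Proof.
elim: r => [|i r IHr]; first by rewrite !big_nil gmulr0.
by rewrite !big_cons gmulDr IHr.
Qed.

Lemma gmul_homog k f u n : gmul (homog k f) u n = if (k <= n)%N then f * u (n - k)%N else 0.
Proof.
rewrite gmulE; case: leqP => kn; last first.
  rewrite big1 // => i _; rewrite /homog ifF ?mul0r //; apply: ltn_eqF.
  by apply: leq_ltn_trans kn; rewrite -ltnS.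
have kn' : (k < n.+1)%N by [].
rewrite (bigD1 (Ordinal kn')) //= /homog eqxx big1 ?addr0 // => i ik.
by rewrite ifF ?mul0r //; apply/negbTE; apply: contraNneq ik => ik; apply/eqP/val_inj.
Qed.

Lemma gmul1 u : gmul (homog 0 1) u = u.
Proof. by apply/funext => n; rewrite gmul_homog /= mul1r subn0. Qed.
Lemma gmulr1 u : gmul u (homog 0 1) = u.
Proof. by rewrite gmulC gmul1. Qed.

Lemma slash_sum k (I : Type) (r : seq I) (P : pred I) (F : I -> uhp -> C) a :
  slash k (\sum_(i <- r | P i) F i) a = \sum_(i <- r | P i) slash k (F i) a.
Proof. by apply: (big_morph (fun f => slash k f a)) => [f h|]; [apply: slashD|apply: slash0]. Qed.

Lemma gslash_mul u v a : gslash (gmul u v) a = gmul (gslash u a) (gslash v a).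
Proof.
apply/funext => n; rewrite /gslash !gmulE slash_sum; apply: eq_bigr => i _.
by rewrite -slash_mul subnKC // -ltnS.
Qed.

Lemma gslashM u a a' : gslash u (a * a')%g = gslash (gslash u a) a'.
Proof. by apply/funext => n; rewrite /gslash slashM. Qed.
Lemma gslash1 u : gslash u 1%g = u.
Proof. by apply/funext => n; rewrite /gslash slash1. Qed.
Lemma gslash_lin c u v a : gslash (c *: u + v) a = c *: gslash u a + gslash v a.
Proof. by apply/funext => n; rewrite /gslash gadd_ev gscale_ev slashD slashZ. Qed.
Lemma gslashD u v a : gslash (u + v) a = gslash u a + gslash v a.
Proof. by have := gslash_lin 1 u v a; rewrite !scale1r. Qed.
Lemma gslash0 a : gslash 0 a = 0 :> gform.
Proof. by apply/funext => n; rewrite /gslash g0_ev slash0. Qed.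
Lemma gslash_sum (I : Type) (r : seq I) (F : I -> gform) a :
  gslash (\sum_(i <- r) F i) a = \sum_(i <- r) gslash (F i) a.
Proof. by apply: (big_morph (fun u => gslash u a)) => [u v|]; [apply: gslashD|apply: gslash0]. Qed.
Lemma gslash_homog k f a : gslash (homog k f) a = homog k (slash k f a).
Proof.
by apply/funext => n; rewrite /gslash /homog; case: eqP => [->|_]; rewrite ?slash0.
Qed.

Lemma gY_ev u n : gY u n = (n%:R / 2) *: u n. Proof. by []. Qed.
Lemma gX_ev u n : gX u n.+2 = Xk n (u n).
Proof.
apply/funext => z.
have -> : gX u n.+2 z = twopii^-1 * uderiv (u n) z
  - twopii^-1 * (dlog (@eta4 R) z * (n%:R / 2 * u n z)) by [].
rewrite dlog_eta4 /Xk !f_ev Df_ev; congr (_ - _).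
by rewrite -mulrA mulKf ?twopii_neq0 // mulrCA.
Qed.

Definition gholo u := forall n, holomorphic (u n).

Lemma XkM k l f h : holomorphic f -> holomorphic h ->
  Xk (k + l) (f * h) = Xk k f * h + f * Xk l h.
Proof.
move=> hf hh; rewrite /Xk Df_holoM // natrD mulrDl scalerDl.
move: (Df f) (Df h) (@Gf R) => df dh G; apply/funext => z; rewrite !f_ev.
by move: (df z) (dh z) (G z) (f z) (h z) (k%:R / 2 : C) (l%:R / 2 : C) => *; ring.
Qed.

Lemma Xk_lin k c f h : holomorphic f -> holomorphic h ->
  Xk k (c *: f + h) = c *: Xk k f + Xk k h.
Proof.
move=> hf hh; rewrite /Xk Df_holoD //.
move: (Df f) (Df h) (@Gf R) => df dh G; apply/funext => z; rewrite !f_ev.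
by move: (df z) (dh z) (G z) (f z) (h z) (k%:R / 2 : C) => *; ring.
Qed.

Lemma holo0 : holomorphic (0 : uhp -> C).
Proof. exact: mform_holo (mform0 R false 0). Qed.

Lemma Xk0 k : Xk k (0 : uhp -> C) = 0.
Proof. by have := Xk_lin k (-1) holo0 holo0; rewrite scaler0 addr0 scaleN1r addNr. Qed.

Lemma XkZ k c f : holomorphic f -> Xk k (c *: f) = c *: Xk k f.
Proof. by move=> hf; have := Xk_lin k c hf holo0; rewrite Xk0 !addr0. Qed.

Lemma holo_sum (I : Type) (r : seq I) (F : I -> uhp -> C) :
  (forall i, holomorphic (F i)) -> holomorphic (\sum_(i <- r) F i).
Proof.
move=> HF; elim: r => [|i r IHr]; first by rewrite big_nil; apply: holo0.
by rewrite big_cons; exact: (holoD (HF i) IHr).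
Qed.

Lemma Xk_sum k (I : Type) (r : seq I) (F : I -> uhp -> C) :
  (forall i, holomorphic (F i)) -> Xk k (\sum_(i <- r) F i) = \sum_(i <- r) Xk k (F i).
Proof.
move=> HF; elim: r => [|i r IHr]; first by rewrite !big_nil Xk0.
rewrite !big_cons -IHr; have := Xk_lin k 1 (HF i) (holo_sum (r := r) HF).
by rewrite !scale1r.
Qed.

Lemma gmul_gXl u v n : gmul (gX u) v n.+2 = \sum_(i < n.+1) Xk i (u i) * v (n - i)%N.
Proof.
rewrite gmulE big_ord_recl (_ : gX u _ * _ = 0) ?mul0r // add0r.
rewrite big_ord_recl (_ : gX u _ * _ = 0) ?mul0r // add0r.
by apply: eq_bigr => i _; rewrite !lift0 gX_ev.
Qed.

Lemma gmul_gXr u v n :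
  gmul u (gX v) n.+2 = \sum_(i < n.+1) u i * Xk (n - i) (v (n - i)%N).
Proof.
rewrite gmulE big_ord_recr /= subnn mulr0 addr0 big_ord_recr /= subSnn mulr0 addr0.
by apply: eq_bigr => i _; rewrite subSn ?leqW ?subSn -1?ltnS // gX_ev.
Qed.

Lemma gmul_gX_low u v n : (n < 2)%N -> gmul (gX u) v n = 0 /\ gmul u (gX v) n = 0.
Proof.
by case: n => [|[|]] // _; split; rewrite gmulE !big_ord_recl !big_ord0 /= ?mul0r ?mulr0 ?addr0.
Qed.

Lemma gXM u v : gholo u -> gholo v -> gX (gmul u v) = gmul (gX u) v + gmul u (gX v).
Proof.
move=> hu hv; apply/funext => -[|[|n]]; rewrite gadd_ev.
- by have [|-> ->] := @gmul_gX_low u v 0 => //; rewrite addr0.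
- by have [|-> ->] := @gmul_gX_low u v 1 => //; rewrite addr0.
rewrite gX_ev gmulE Xk_sum; last by move=> i; apply: holoM.
rewrite gmul_gXl gmul_gXr -big_split; apply: eq_bigr => i _ /=.
have iN : (i <= n)%N by rewrite -ltnS.
by rewrite -XkM // subnKC.
Qed.

Lemma gX_lin c u v : gholo u -> gholo v -> gX (c *: u + v) = c *: gX u + gX v.
Proof.
move=> hu hv; apply/funext => -[|[|n]]; rewrite gadd_ev gscale_ev.
- by rewrite scaler0 addr0.
- by rewrite scaler0 addr0.
by rewrite !gX_ev Xk_lin.
Qed.

Lemma gX0 : gX 0 = 0.
Proof. by apply/funext => -[|[|n]] //; rewrite gX_ev Xk0. Qed.

Lemma gXD u v : gholo u -> gholo v -> gX (u + v) = gX u + gX v.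
Proof. by move=> hu hv; have := gX_lin 1 hu hv; rewrite !scale1r. Qed.

Lemma gXZ c u : gholo u -> gX (c *: u) = c *: gX u.
Proof. by move=> hu; have := gX_lin c hu (fun _ => holo0); rewrite gX0 !addr0. Qed.

Lemma gY_lin c u v : gY (c *: u + v) = c *: gY u + gY v.
Proof.
by apply/funext => n; rewrite gadd_ev gscale_ev !gY_ev gadd_ev gscale_ev scalerDr !scalerA mulrC.
Qed.
Lemma gYD u v : gY (u + v) = gY u + gY v.
Proof. by have := gY_lin 1 u v; rewrite !scale1r. Qed.
Lemma gY0 : gY 0 = 0 :> gform.
Proof. by apply/funext => n; rewrite gY_ev scaler0. Qed.

Lemma gYM u v : gY (gmul u v) = gmul (gY u) v + gmul u (gY v).
Proof.
apply/funext => n; rewrite gadd_ev gY_ev !gmulE scaler_sumr -big_split.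
apply: eq_bigr => i _; rewrite !gY_ev /= -fscalerAl -fscalerAr -scalerDl -mulrDl -natrD.
by rewrite subnKC // -ltnS.
Qed.

Lemma gY_slash u a : gY (gslash u a) = gslash (gY u) a.
Proof. by apply/funext => n; rewrite gY_ev /gslash gY_ev slashZ. Qed.

Lemma gY_gX u : gholo u -> gY (gX u) = gX (gY u) + gX u.
Proof.
move=> hu; apply/funext => -[|[|n]]; rewrite gadd_ev gY_ev.
- by rewrite scaler0 addr0.
- by rewrite scaler0 addr0.
rewrite !gX_ev gY_ev XkZ // -[X in _ + X]scale1r -scalerDl; congr (_ *: _).
by rewrite -addn2 natrD mulrDl divff ?pnatr_eq0.
Qed.

Lemma gX_slash u a : gholo u ->
  gX (gslash u a) = gslash (gX u) a + gmul (homog 2 (mu a)) (gY (gslash u a)).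
Proof.
move=> hu; apply/funext => -[|[|n]]; rewrite gadd_ev gmul_homog.
- by rewrite /gslash /= slash0 addr0.
- by rewrite /gslash /= slash0 addr0.
have -> : (n.+2 - 2 = n)%N by rewrite subSS subSS subn0.
rewrite gX_ev /gslash gX_ev (Xk_slash _ _ (hu n)) addn2 gY_ev /=.
by congr (_ + _); rewrite fscalerAr.
Qed.

Lemma gmform_holo b u : gmform b u -> gholo u.
Proof. by move=> [Hu _] n; apply: mform_holo (Hu n). Qed.

Lemma gmform_weak b u : gmform b u -> gmform false u.
Proof. by move=> [Hu Hd]; split=> // k; apply: mform_weak (Hu k). Qed.

Lemma gmform0 b : gmform b (0 : gform).
Proof. by split=> [k|]; [apply: mform0|exists 0%N]. Qed.

Lemma gmform_lin b c u v : gmform b u -> gmform b v -> gmform b (c *: u + v).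
Proof.
move=> [Hu [d Hd]] [Hv [e He]]; split=> [k|]; first by apply: mformD => //; apply: mformZ.
exists (maxn d e) => k; rewrite geq_max => /andP[dk ek].
by rewrite gadd_ev gscale_ev Hd // He // scaler0 addr0.
Qed.

Lemma gmformD b u v : gmform b u -> gmform b v -> gmform b (u + v).
Proof. by move=> gu gv; rewrite -[u]scale1r; apply: gmform_lin. Qed.

Lemma gmform_sum b (I : Type) (r : seq I) (F : I -> gform) :
  (forall i, gmform b (F i)) -> gmform b (\sum_(i <- r) F i).
Proof. by move=> HF; elim/big_ind: _ => //; [apply: gmform0|apply: gmformD]. Qed.

Lemma mform_sum b k (I : Type) (r : seq I) (F : I -> uhp -> C) :
  (forall i, mform b k (F i)) -> mform b k (\sum_(i <- r) F i).
Proof. by move=> HF; elim/big_ind: _ => //; [apply: mform0|apply: mformD]. Qed.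

Lemma gmformM b u v : gmform b u -> gmform false v -> gmform b (gmul u v).
Proof.
move=> [Hu [d Hd]] [Hv [e He]]; split=> [k|].
  rewrite gmulE; apply: mform_sum => i.
  by have := mformM (Hu i) (Hv (k - i)%N); rewrite subnKC // -ltnS.
exists (d + e)%N => k dek; rewrite gmulE big1 // => i _.
have [di|id] := leqP d i; first by rewrite Hd // mul0r.
rewrite He ?mulr0 // leq_subRL; last by apply: leq_trans dek; rewrite ltnW // ltn_addr.
by apply: leq_trans dek; rewrite leq_add2r ltnW.
Qed.

Lemma gmform_slash b u a : gmform b u -> gmform b (gslash u a).
Proof.
move=> [Hu [d Hd]]; split=> [k|]; first exact: mform_slash.
by exists d => k dk; rewrite /gslash Hd // slash0.
Qed.

Lemma gmform_homog b k f : mform b k f -> gmform b (homog k f).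
Proof.
move=> mf; split=> [n|]; rewrite /homog; first by case: eqP => [->|_] //; apply: mform0.
by exists k.+1 => n kn; rewrite ifF // gtn_eqF.
Qed.

Lemma gmform_gX b u : gmform b u -> gmform b (gX u).
Proof.
move=> [Hu [d Hd]]; split=> [[|[|k]]|]; try exact: mform0.
  by rewrite gX_ev -addn2; apply: mform_Xk.
by exists d.+2 => -[|[|k]] // dk; rewrite gX_ev Hd // Xk0.
Qed.

Lemma gmform_gY b u : gmform b u -> gmform b (gY u).
Proof.
move=> [Hu [d Hd]]; split=> [k|]; first by rewrite gY_ev; apply: mformZ.
by exists d => k dk; rewrite gY_ev Hd // scaler0.
Qed.

Lemma gmform1 : gmform false (homog 0 1 : gform).
Proof. exact/gmform_homog/mform1. Qed.

(** The index is shifted by one against delta: multiplication by [gmu n] is the operator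
    delta_(n+1). *)
Definition gmu n a : gform := iter n gX (homog 2 (mu a)).

Lemma gmform_gmu n a : gmform false (gmu n a).
Proof. by elim: n => [|n IHn]; [apply/gmform_homog/mform_mu|apply: gmform_gX]. Qed.

Lemma gY_gmu n a : gY (gmu n a) = n.+1%:R *: gmu n a.
Proof.
elim: n => [|n IHn].
  apply/funext => k; rewrite gY_ev gscale_ev /gmu /= /homog.
  by case: eqP => [->|_]; rewrite ?scaler0 // divff ?pnatr_eq0.
have hm := gmform_holo (gmform_gmu n a).
rewrite /gmu iterS -/(gmu n a) gY_gX // IHn gXZ // -{2}[gX (gmu n a)]scale1r -scalerDl.
by rewrite -mulrSr.
Qed.

Lemma gmuM a a' : gmu 0 (a * a')%g = gslash (gmu 0 a) a' + gmu 0 a'.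
Proof.
rewrite /gmu /= gslash_homog muM; apply/funext => n; rewrite gadd_ev /homog.
by case: eqP => // _; rewrite addr0.
Qed.

Lemma gmu_SL2Z n g : SL2Z g -> gmu n g = 0.
Proof.
move=> gZ; elim: n => [|n IHn]; last by rewrite /gmu iterS -/(gmu n g) IHn gX0.
by apply/funext => k; rewrite /gmu /= /homog mu_SL2Z // if_same.
Qed.

Definition gomega : gform := homog 4 (@omega R).

Lemma gomega_slash a :
  gslash gomega a - gomega = gmu 1 a - 2^-1 *: gmul (gmu 0 a) (gmu 0 a).
Proof.
apply/funext => n; rewrite /gomega gslash_homog /gmu /=.
have -> : gX (homog 2 (mu a)) = homog 4 (Xk 2 (mu a)).
  apply/funext => -[|[|k]] //; rewrite gX_ev /homog !eqSS.
  by case: eqP => [->|_] //; rewrite Xk0.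
have -> : gmul (homog 2 (mu a)) (homog 2 (mu a)) = homog 4 (mu a * mu a) :> gform.
  apply/funext => k; rewrite gmul_homog /homog; case: k => [|[|k]] //=.
  by rewrite !subSS subn0 !eqSS; case: eqP; rewrite ?mulr0.
rewrite -[LHS]/(homog 4 _ n - homog 4 _ n) -[RHS]/(homog 4 _ n - 2^-1 *: homog 4 _ n) /homog.
by case: eqP => [_|_]; [apply: omega_slash|rewrite scaler0 subrr].
Qed.

End GradedForms.

(** * The modular Hecke algebra *)

Section HeckeAlgebra.
Variables (R : realType) (Gam : set GL2Qplus).
Hypothesis GamP : congruence_subgroup Gam.
Local Notation C := (cplx R).
Local Notation gform := (gform R).
Local Notation hform := (hform R).
Local Notation rcoset := (rcoset Gam).
Local Notation hmul := (@hmul R Gam).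
Implicit Types (a g d : GL2Qplus) (b : bool) (u v w : gform) (c : C).
Implicit Types (phi psi : GL2Qplus -> gform) (s : seq GL2Qplus) (F : hform).

Lemma Gam_SL2Z g : Gam g -> SL2Z g.
Proof. by case: GamP => H _ _ _ /H. Qed.
Lemma Gam1 : Gam 1%g.
Proof. by case: GamP. Qed.
Lemma GamV g : Gam g -> Gam g^-1%g.
Proof. by case: GamP => _ G1 GD _ gG; rewrite -[g^-1%g]mul1g; apply: GD. Qed.
Lemma GamM g g' : Gam g -> Gam g' -> Gam (g * g')%g.
Proof. by case: GamP => _ G1 GD _ gG gG'; rewrite -[g']invgK; apply/GD/GamV. Qed.

Lemma rcosetP a d : rcoset a = rcoset d <-> exists2 g, Gam g & d = (g * a)%g.
Proof.
split=> [E|[g gG ->]].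
  have : rcoset d d by exists 1%g; [apply: Gam1|rewrite mul1g].
  by rewrite -E => -[g gG <-]; exists g.
apply/seteqP; split=> _ [h hG <-].
  by exists (h * g^-1)%g; [apply/GamM/GamV|rewrite mulgA mulgVK].
by exists (h * g)%g; [apply: GamM|rewrite mulgA].
Qed.

Lemma get_rcoset a : exists2 g, Gam g & get (rcoset a) = (g * a)%g.
Proof.
have : rcoset a (get (rcoset a)).
  by apply: getPex; exists a, 1%g; [apply: Gam1|rewrite mul1g].
by move=> [g gG E]; exists g.
Qed.

Lemma rcoset_mulr a d t : rcoset a = rcoset d <-> rcoset (a * t)%g = rcoset (d * t)%g.
Proof.
split=> /rcosetP[g gG E]; apply/rcosetP; exists g => //; first by rewrite E mulgA.
by apply: (can_inj (mulgK t)); rewrite E mulgA.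
Qed.

Lemma uniq_rcoset_mulr s t :
  uniq (map rcoset s) -> uniq (map rcoset [seq (d * t)%g | d <- s]).
Proof.
elim: s => //= d s IHs /andP[nd us]; rewrite IHs // andbT.
apply: contra nd => /mapP[_ /mapP[e es ->] /(rcoset_mulr d e t).2 ->].
exact: map_f.
Qed.

(* The elements of s represent distinct cosets, and among them those of the
   support of phi. *)
Definition cover s phi :=
  uniq (map rcoset s) /\ forall a, phi a <> 0 -> rcoset a \in map rcoset s.

Lemma cover_exists phi (A : set (set GL2Qplus)) : finite_set A ->
  (forall a, phi a <> 0 -> A (rcoset a)) -> A `<=` rcosets Gam -> exists s, cover s phi.
Proof.
move=> /finite_seqP[cs Acs] phiA AR.
exists (map (fun c : set GL2Qplus => get c) (undup cs)).
have E : map rcoset (map (fun c : set GL2Qplus => get c) (undup cs)) = undup cs.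
  rewrite -map_comp -[RHS]map_id; apply/eq_in_map => c /=.
  rewrite mem_undup => ccs; have : A c by rewrite Acs.
  by move=> /AR[a _ <-]; have [g gG ->] := get_rcoset a; apply/esym/rcosetP; exists g.
by split=> [|a /phiA]; rewrite E ?undup_uniq // mem_undup Acs.
Qed.

Lemma coverS s phi psi : (forall a, phi a = 0 -> psi a = 0) -> cover s phi -> cover s psi.
Proof. by move=> H [us Hs]; split=> // a psia; apply: Hs => /H. Qed.

Definition finsupp phi := finite_set (rcoset @` [set a | phi a <> 0]).

Lemma finsupp_cover phi : finsupp phi -> exists s, cover s phi.
Proof.
move=> fphi; apply: cover_exists fphi _ _; first by move=> a pa; exists a.
by move=> _ [a _ <-]; exists a.
Qed.

Lemma cover_finsupp s phi : cover s phi -> finsupp phi.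
Proof.
move=> [_ Hs]; apply: (@sub_finite_set _ _ [set` map rcoset s]); last exact: finite_seq.
by move=> _ [a pa <-]; apply: Hs.
Qed.

Lemma finsuppU phi psi : finsupp phi -> finsupp psi ->
  exists s, cover s phi /\ cover s psi.
Proof.
(* [chi] is non-zero exactly where [phi] or [psi] is, so a cover of it covers both. *)
move=> fphi fpsi; pose chi a := if `[< phi a <> 0 >] then phi a else psi a.
have [|||s [us Hs]] := @cover_exists chi
  (rcoset @` [set a | phi a <> 0] `|` rcoset @` [set a | psi a <> 0]).
- by rewrite finite_setU.
- by move=> a; rewrite /chi; case: asboolP => pa ?; [left|right]; exists a.
- by move=> _ [|] [a _ <-]; exists a.
exists s; split; split=> // a pa; apply: Hs; rewrite /chi; case: asboolP => //.
Qed.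

Definition linv phi := forall g a, Gam g -> phi (g * a)%g = phi a.

Definition cosum phi : gform := \sum_(c \in rcosets Gam) phi (get c).

Lemma hmul_cosum F1 F2 a :
  hmul F1 F2 a = cosum (fun d => gmul (F1 d) (gslash (F2 (a * d^-1)%g) d)).
Proof. by []. Qed.

Lemma linv_get phi a : linv phi -> phi (get (rcoset a)) = phi a.
Proof. by move=> H; have [g gG ->] := get_rcoset a; rewrite H. Qed.

(** Frees the coset sum from the representatives chosen by [get]: for a left invariant summand any
    list of representatives that covers the support will do. All identities for the product are
    proved on such lists. *)
Lemma cosumE s phi : linv phi -> cover s phi -> cosum phi = \sum_(a <- s) phi a.
Proof.
move=> Hl [us Hs]; rewrite /cosum.
rewrite -(@fsbig_widen _ _ 0 _ [set` map rcoset s]).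
- rewrite -fsbig_seq // big_map; apply: eq_bigr => a _; exact: linv_get.
- by move=> c /= /mapP[a _ ->]; exists a.
move=> c [[a _ <-] /= nc]; rewrite linv_get //.
by apply: contra_notP nc => pa; apply: Hs.
Qed.

(** When d is replaced by g d, the value F2 (a d^-1) is slashed by g^-1, and the outer slash by g d
    undoes this; so the summand is left invariant. Its support lies in that of [F1], hence a cover
    of [F1] suffices. *)
Lemma hmulE s F1 F2 a : cover s F1 -> linv F1 ->
  (forall a g, Gam g -> F2 (a * g)%g = gslash (F2 a) g) ->
  hmul F1 F2 a = \sum_(d <- s) gmul (F1 d) (gslash (F2 (a * d^-1)%g) d).
Proof.
move=> cs l1 r2; apply: (@cosumE s (fun d => gmul (F1 d) (gslash (F2 (a * d^-1)%g) d))).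
  move=> g d gG; rewrite (l1 _ _ gG) invgM mulgA (r2 _ _ (GamV gG)).
  by rewrite gslashM -(gslashM _ g^-1%g g) mulVg gslash1.
by apply: coverS cs => d ->; rewrite gmul0.
Qed.

Definition heck b : set hform := hecke_in Gam (gmform (R := R) b).

Lemma heckE : @hecke R Gam = heck false.
Proof. by rewrite /hecke modforms_allE. Qed.
Lemma heck0E : @hecke0 R Gam = heck true.
Proof. by rewrite /hecke0 cuspforms_allE. Qed.

Lemma heck_weak b F : heck b F -> heck false F.
Proof. by move=> [? ? H ?]; split=> // a; apply: gmform_weak (H a). Qed.

Lemma heck_cover b F : heck b F -> exists s, cover s F.
Proof. by case=> _ f _ _; apply: finsupp_cover f. Qed.

Lemma heck0 b : heck b 0.
Proof.
split=> //.
- by apply: (@cover_finsupp [::] (0 : hform)); split.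
- by move=> a; apply: gmform0.
- by move=> a g _; rewrite [in RHS]/(0 a) gslash0.
Qed.

Lemma heck_lin b c F1 F2 : heck b F1 -> heck b F2 -> heck b (c *: F1 + F2).
Proof.
move=> [l1 f1 m1 r1] [l2 f2 m2 r2]; have [s [[us H1] [_ H2]]] := finsuppU f1 f2.
have ev a : (c *: F1 + F2) a = c *: F1 a + F2 a by [].
split=> [g a gG||a|a g gG]; rewrite ?ev.
- by rewrite l1 // l2.
- apply: (@cover_finsupp s (c *: F1 + F2)); split=> // a; rewrite ev => H.
  have [F10|F1n] := pselect (F1 a = 0); last exact: H1.
  by apply: H2 => F20; apply: H; rewrite F10 F20 scaler0 addr0.
- exact: gmform_lin.
- by rewrite r1 // r2 // gslash_lin.
Qed.

Lemma heckD b F1 F2 : heck b F1 -> heck b F2 -> heck b (F1 + F2).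
Proof. by move=> H1 H2; rewrite -[F1]scale1r; apply: heck_lin. Qed.
Lemma heckB b F1 F2 : heck b F1 -> heck b F2 -> heck b (F1 - F2).
Proof. by move=> H1 H2; rewrite -scaleN1r addrC; apply: heck_lin. Qed.

Lemma heck_mulE b b' s F1 F2 a : cover s F1 -> heck b F1 -> heck b' F2 ->
  hmul F1 F2 a = \sum_(d <- s) gmul (F1 d) (gslash (F2 (a * d^-1)%g) d).
Proof. by move=> cs [l1 _ _ _] [_ _ _ r2]; apply: hmulE. Qed.

(** Right multiplication by t permutes the cosets Gam d. *)
Lemma cosum_translate phi t : linv phi -> finsupp phi ->
  cosum (fun d => phi (d * t)%g) = cosum phi.
Proof.
move=> l /finsupp_cover[s [us Hs]].
rewrite (@cosumE s phi) // (@cosumE [seq (d * t^-1)%g | d <- s]).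
- by rewrite big_map; apply: eq_bigr => d _; rewrite mulgVK.
- by move=> g d gG; rewrite -mulgA (l _ _ gG).
split=> [|d /Hs /mapP[e es E]].
  exact: uniq_rcoset_mulr.
rewrite -map_comp; apply/mapP; exists e => //=; apply/(rcoset_mulr _ _ t).
by rewrite E mulgVK.
Qed.

Lemma hk_linv b b' F1 F2 a : heck b F1 -> heck b' F2 ->
  linv (fun d => gmul (F1 d) (gslash (F2 (a * d^-1)%g) d)).
Proof.
move=> [l1 _ _ _] [_ _ _ r2] g d gG; rewrite (l1 _ _ gG) invgM mulgA (r2 _ _ (GamV gG)).
by rewrite gslashM -(gslashM _ g^-1%g g) mulVg gslash1.
Qed.

Lemma hk_finsupp b F1 F2 a : heck b F1 ->
  finsupp (fun d => gmul (F1 d) (gslash (F2 (a * d^-1)%g) d)).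
Proof.
move=> /heck_cover[s cs]; apply: (@cover_finsupp s).
by apply: coverS cs => d ->; rewrite gmul0.
Qed.

Lemma cosum_slash phi g : linv phi -> finsupp phi ->
  gslash (cosum phi) g = cosum (fun d => gslash (phi d) g).
Proof.
move=> l /finsupp_cover[s cs]; rewrite (cosumE l cs) gslash_sum (@cosumE s) //.
  by move=> h d hG; rewrite l.
by apply: coverS cs => d ->; rewrite gslash0.
Qed.

Lemma heckM b F1 F2 : heck b F1 -> heck false F2 -> heck b (hmul F1 F2).
Proof.
move=> h1 h2; have [l1 f1 m1 r1] := h1; have [l2 f2 m2 r2] := h2.
have [s1 c1] := heck_cover h1; have [s2 [_ c2]] := heck_cover h2.
split=> [g a gG||a|a g gG].
- rewrite !(heck_mulE _ c1 h1 h2); apply: eq_bigr => d _.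
  by rewrite -mulgA (l2 _ _ gG).
(* A non-zero term requires d in the support of [F1] and a d^-1 in that of [F2], so a lies in one of
   finitely many cosets of products e d. *)
- apply: (@sub_finite_set _ _ [set` [seq rcoset (e * d)%g | d <- s1, e <- s2]]);
    last exact: finite_seq.
  move=> _ [a pa <-] /=; apply: contra_notP pa => na.
  rewrite (heck_mulE _ c1 h1 h2) big_seq big1 // => d ds.
  have [F0|Fn] := pselect (F2 (a * d^-1)%g = 0); first by rewrite F0 gslash0 gmulr0.
  case: na; have /mapP[e es E] := c2 _ Fn; apply/allpairsP; exists (d, e); split=> //=.
  by apply/(rcoset_mulr _ _ d^-1%g); rewrite E mulgK.
- rewrite (heck_mulE _ c1 h1 h2); apply: gmform_sum => d.
  by apply: gmformM => //; apply: gmform_slash.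
have lk := hk_linv (a * g)%g h1 h2; have fk := hk_finsupp F2 (a * g)%g h1.
(* The summation variable is translated by g, so that (a g)(d g)^-1 = a d^-1 and g enters only
   through the slash. *)
rewrite !hmul_cosum -(cosum_translate g lk fk).
rewrite (cosum_slash g (hk_linv a h1 h2) (hk_finsupp F2 a h1)); congr cosum.
apply/funext => d; rewrite invgM mulgA mulgK gslash_mul -gslashM r1 //.
Qed.

Lemma hmul_linl c F1 F2 F3 : heck false F1 -> heck false F2 -> heck false F3 ->
  hmul (c *: F1 + F2) F3 = c *: hmul F1 F3 + hmul F2 F3.
Proof.
move=> h1 h2 h3; have [_ f1 _ _] := h1; have [_ f2 _ _] := h2.
have [s [c1 c2]] := finsuppU f1 f2; apply/funext => a.
have ev d : (c *: F1 + F2) d = c *: F1 d + F2 d by [].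
have c12 : cover s (c *: F1 + F2).
  split=> [|d Hd]; first by case: c1.
  have [F10|F1n] := pselect (F1 d = 0); last exact: c1.2.
  by apply: c2.2 => F20; apply: Hd; rewrite ev F10 F20 scaler0 addr0.
rewrite -[RHS]/(c *: hmul F1 F3 a + hmul F2 F3 a).
rewrite (heck_mulE _ c12 (heck_lin c h1 h2) h3) (heck_mulE _ c1 h1 h3) (heck_mulE _ c2 h2 h3).
rewrite scaler_sumr -big_split; apply: eq_bigr => d _.
by rewrite ev gmul_linl.
Qed.

Lemma hmul_linr c F1 F2 F3 : heck false F1 -> heck false F2 -> heck false F3 ->
  hmul F3 (c *: F1 + F2) = c *: hmul F3 F1 + hmul F3 F2.
Proof.
move=> h1 h2 h3; have [s cs] := heck_cover h3; apply/funext => a.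
rewrite -[RHS]/(c *: hmul F3 F1 a + hmul F3 F2 a).
rewrite (heck_mulE _ cs h3 (heck_lin c h1 h2)) (heck_mulE _ cs h3 h1) (heck_mulE _ cs h3 h2).
rewrite scaler_sumr -big_split; apply: eq_bigr => d _.
rewrite [(c *: F1 + F2) _](_ : _ = c *: F1 (a * d^-1)%g + F2 (a * d^-1)%g) //.
by rewrite gslash_lin gmul_linr.
Qed.

Lemma finsupp_sum (I : Type) (r : seq I) (P : I -> GL2Qplus -> gform) :
  (forall i, finsupp (P i)) -> finsupp (fun d => \sum_(i <- r) P i d).
Proof.
move=> HP; elim: r => [|i r IHr].
  by apply: (@cover_finsupp [::]); split=> // a; rewrite big_nil.
have [s [[us H1] [_ H2]]] := finsuppU (HP i) IHr; apply: (@cover_finsupp s); split=> // a.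
rewrite big_cons => H; have [P0|Pn] := pselect (P i a = 0); last exact: H1.
by apply: H2 => S0; apply: H; rewrite P0 S0 addr0.
Qed.

Lemma cosum_sum (I : Type) (r : seq I) (P : I -> GL2Qplus -> gform) :
  (forall i, linv (P i)) -> (forall i, finsupp (P i)) ->
  cosum (fun d => \sum_(i <- r) P i d) = \sum_(i <- r) cosum (P i).
Proof.
move=> lP fP; elim: r => [|i r IHr].
  rewrite big_nil (@cosumE [::]) ?big_nil //; last by split=> // a; rewrite big_nil.
  by move=> g a _; rewrite !big_nil.
have [s [c1 c2]] := finsuppU (fP i) (finsupp_sum r fP).
have lS : linv (fun d => \sum_(i <- r) P i d).
  by move=> g a gG; apply: eq_bigr => i' _; rewrite lP.
rewrite big_cons -IHr (cosumE (lP i) c1) (cosumE lS c2) -big_split.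
rewrite (@cosumE s); first by apply: eq_bigr => d _; rewrite big_cons.
  by move=> g a gG; apply: eq_bigr => i' _; rewrite lP.
split=> [|a]; first by case: c1.
rewrite big_cons => H; have [P0|Pn] := pselect (P i a = 0); last exact: c1.2.
by apply: c2.2 => S0; apply: H; rewrite P0 S0 addr0.
Qed.

Lemma hmulA F1 F2 F3 : heck false F1 -> heck false F2 -> heck false F3 ->
  hmul F1 (hmul F2 F3) = hmul (hmul F1 F2) F3.
Proof.
move=> h1 h2 h3; have [s1 c1] := heck_cover h1; have [s2 c2] := heck_cover h2.
have h12 := heckM h1 h2; have h23 := heckM h2 h3; have [l2 _ _ r2] := h2.
have [_ _ _ r3] := h3.
apply/funext => a; rewrite (heck_mulE _ c1 h1 h23).
rewrite [RHS](_ : _ = cosum (fun d => \sum_(e <- s1)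
    gmul (gmul (F1 e) (gslash (F2 (d * e^-1)%g) e)) (gslash (F3 (a * d^-1)%g) d))); last first.
  rewrite hmul_cosum; congr cosum; apply/funext => d.
  by rewrite (heck_mulE _ c1 h1 h2) gmulC gmul_sumr; apply: eq_bigr => e _; rewrite gmulC.
(* For fixed [e] the sum over d runs over the cosets of d' e with d' in the cover of [F2]; the
   substitution d = d' e turns the double sum on the right into the one on the left. *)
pose psi e d := gmul (gmul (F1 e) (gslash (F2 (d * e^-1)%g) e)) (gslash (F3 (a * d^-1)%g) d).
have lpsi e : linv (psi e).
  move=> g d gG; rewrite /psi -mulgA (l2 _ _ gG) invgM mulgA (r3 _ _ (GamV gG)).
  by rewrite gslashM -(gslashM _ g^-1%g g) mulVg gslash1.
have cpsi e : cover [seq (d * e)%g | d <- s2] (psi e).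
  split=> [|d]; last first.
    rewrite /psi => H; have Fn : F2 (d * e^-1)%g <> 0.
      by move=> F0; apply: H; rewrite F0 gslash0 gmulr0 gmul0.
    have /mapP[t ts E] := c2.2 _ Fn.
    rewrite -map_comp; apply/mapP; exists t => //=.
    by apply/(rcoset_mulr _ _ e^-1%g); rewrite E mulgK.
  exact: uniq_rcoset_mulr c2.1.
rewrite (@cosum_sum _ s1 psi) // => [|e]; last exact: cover_finsupp (cpsi e).
apply: eq_bigr => e _; rewrite (cosumE (lpsi e) (cpsi e)) big_map.
rewrite (heck_mulE _ c2 h2 h3) gslash_sum gmul_sumr; apply: eq_bigr => d _.
by rewrite /psi mulgK gslash_mul gmulA -gslashM invgM mulgA.
Qed.

Lemma heck_embed b u : gmform b u -> (forall g, Gam g -> gslash u g = u) ->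
  heck b (hembed Gam u).
Proof.
move=> gu Hu.
have GE g a : Gam g -> `[< Gam (g * a)%g >] = `[< Gam a >].
  move=> gG; apply/asboolP/asboolP => H; last exact: GamM.
  by rewrite -[a](mulKg g); apply: GamM => //; apply: GamV.
have GE' a g : Gam g -> `[< Gam (a * g)%g >] = `[< Gam a >].
  move=> gG; apply/asboolP/asboolP => H; last exact: GamM.
  by rewrite -[a](mulgK g); apply: GamM => //; apply: GamV.
rewrite /hembed; split=> [g a gG||a|a g gG].
- by rewrite GE.
- apply: (@cover_finsupp [:: 1%g]); split=> // a; case: asboolP => // aG _.
  by rewrite inE; apply/eqP/esym/rcosetP; exists a; rewrite ?mulg1.
- by case: ifP => // _; apply: gmform0.
- by rewrite GE' //; case: ifP => _; rewrite ?Hu ?gslash0.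
Qed.

Lemma cover_embed u : cover [:: 1%g] (hembed Gam u).
Proof.
split=> // a; rewrite /hembed; case: asboolP => // aG _.
by rewrite inE; apply/eqP/esym/rcosetP; exists a; rewrite ?mulg1.
Qed.

Lemma hmul_embedl b u F a : heck false (hembed Gam u) -> heck b F ->
  hmul (hembed Gam u) F a = gmul u (F a).
Proof.
move=> hu hF; rewrite (heck_mulE _ (cover_embed u) hu hF) big_seq1 invg1 mulg1 gslash1.
by rewrite /hembed asboolT //; apply: Gam1.
Qed.

Lemma hmul_embedr b u F a : heck false (hembed Gam u) -> heck b F ->
  hmul F (hembed Gam u) a = gmul (F a) (gslash u a).
Proof.
move=> hu hF; have lk := hk_linv a hF hu; rewrite hmul_cosum (@cosumE [:: a]) //.
  by rewrite big_seq1 mulgV /hembed asboolT //; apply: Gam1.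
split=> // d; rewrite /hembed; case: asboolP => [aG _|_]; last by rewrite gslash0 gmulr0.
rewrite inE; apply/eqP/rcosetP; exists (a * d^-1)%g => //.
by rewrite mulgVK.
Qed.

End HeckeAlgebra.

(** * Actions of enveloping algebras *)

Record module_action (K : comNzRingType) (H : algType K) (V : lmodType K) (S : set V)
    (act : H -> V -> V) : Prop := {
  mact_in : forall h v, S v -> S (act h v);
  mact_linr : forall h c v w, S v -> S w -> act h (c *: v + w) = c *: act h v + act h w;
  mact_linl : forall c h h' v, S v -> act (c *: h + h') v = c *: act h v + act h' v;
  mact1 : forall v, S v -> act 1 v = v;
  mactM : forall h h' v, S v -> act (h * h') v = act h (act h' v)
}.

Section EnvelopingAction.
Variables (K : comNzRingType) (G : Type) (br : G -> G -> seq (K * G)).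
Variables (V : lmodType K) (S : set V) (op : G -> V -> V).
Hypothesis S0 : S 0.
Hypothesis S_lin : forall c v w, S v -> S w -> S (c *: v + w).
Hypothesis S_op : forall x v, S v -> S (op x v).
Hypothesis op_lin : forall x c v w, S v -> S w -> op x (c *: v + w) = c *: op x v + op x w.
Hypothesis op_lie : forall x y v, S v ->
  op x (op y v) = op y (op x v) + \sum_(p <- br x y) p.1 *: op p.2 v.
Local Notation H := (uea br).
Implicit Types (c : K) (v w : V) (h : H).

Let S_scale c v : S v -> S (c *: v).
Proof. by move=> Sv; rewrite -[_ *: _]addr0; apply: S_lin. Qed.
Let S_add v w : S v -> S w -> S (v + w).
Proof. by move=> Sv Sw; rewrite -[v]scale1r; apply: S_lin. Qed.

(** The universal property [ulift] would require linear operators on all of [V] satisfying the Lie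
    relations, but linearity and relations are given on [S] only. So terms are interpreted directly,
    and [tact_eq] checks the defining congruence on [S]. *)
Fixpoint tact (t : uterm K G) : V -> V :=
  match t with
  | UVar x => op x
  | UCst c => fun v => c *: v
  | UAdd s t => fun v => tact s v + tact t v
  | UMul s t => fun v => tact s (tact t v)
  end.

Lemma tact_in t v : S v -> S (tact t v).
Proof.
elim: t v => [x|c|s IHs t IHt|s IHs t IHt] v Sv /=; first exact: S_op.
- exact: S_scale.
- exact: S_add (IHs _ Sv) (IHt _ Sv).
- exact/IHs/IHt.
Qed.

Lemma tact_lin t c v w : S v -> S w -> tact t (c *: v + w) = c *: tact t v + tact t w.
Proof.
elim: t v w => [x|c'|s IHs t IHt|s IHs t IHt] v w Sv Sw /=; first exact: op_lin.
- by rewrite scalerDr !scalerA mulrC.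
- by rewrite IHs // IHt // scalerDr addrACA.
- by rewrite IHt // IHs //; apply: tact_in.
Qed.

Lemma tact0 t : tact t 0 = 0.
Proof. by have := tact_lin t (-1) S0 S0; rewrite scaler0 addr0 scaleN1r addNr. Qed.

Lemma tactZ t c v : S v -> tact t (c *: v) = c *: tact t v.
Proof. by move=> Sv; have := tact_lin t c Sv S0; rewrite tact0 !addr0. Qed.

Lemma tactD t v w : S v -> S w -> tact t (v + w) = tact t v + tact t w.
Proof. by move=> Sv Sw; have := tact_lin t 1 Sv Sw; rewrite !scale1r. Qed.

Lemma tact_ulin l v : tact (ulin l) v = \sum_(p <- l) p.1 *: op p.2 v.
Proof.
by elim: l => [|p l IHl] /=; rewrite ?big_nil ?big_cons ?scale0r // IHl.
Qed.

Lemma tact_eq s t : ueq br s t -> forall v, S v -> tact s v = tact t v.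
Proof.
elim=> //= {s t}.
- by move=> s t _ IH v Sv; rewrite IH.
- by move=> s t u _ IH1 _ IH2 v Sv; rewrite IH1 // IH2.
- by move=> s s' t t' _ IH1 _ IH2 v Sv; rewrite IH1 // IH2.
- by move=> s s' t t' _ IH1 _ IH2 v Sv; rewrite IH2 // IH1 //; apply: tact_in.
- by move=> s t u v Sv; rewrite addrA.
- by move=> s t v Sv; rewrite addrC.
- by move=> s v Sv; rewrite scale0r add0r.
- by move=> s v Sv; rewrite scaleN1r addNr scale0r.
- by move=> s v Sv; rewrite scale1r.
- by move=> s t u v Sv; rewrite tactD //; apply: tact_in.
- by move=> c d v Sv; rewrite scalerDl.
- by move=> c d v Sv; rewrite scalerA.
- by move=> c s v Sv; rewrite tactZ.
- by move=> x y v Sv; rewrite op_lie // tact_ulin.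
Qed.

Definition uea_act (h : H) v : V := tact (repr h) v.

Lemma uea_actE t v : S v -> uea_act (ucls br t) v = tact t v.
Proof. exact/tact_eq/ucls_repr. Qed.

Lemma uea_actP : module_action S uea_act.
Proof.
split=> [h v|h c v w|c h h' v|v|h h' v].
- exact: tact_in.
- exact: tact_lin.
- elim/ucls_ind: h => s; elim/ucls_ind: h' => t Sv.
  rewrite [c *: _](umulE br (UCst _ c) s) [_ + _ in LHS](uaddE br _ t).
  by rewrite !uea_actE.
- by move=> Sv; rewrite [LHS](uea_actE (UCst _ 1)) //= scale1r.
elim/ucls_ind: h => s; elim/ucls_ind: h' => t Sv.
by rewrite [_ * _ in LHS](umulE br s t) !uea_actE //; apply: tact_in.
Qed.

Lemma uea_act_gen x v : S v -> uea_act (ugen br x) v = op x v.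
Proof. exact: (uea_actE (UVar _ x)). Qed.

End EnvelopingAction.

Lemma uea_ind (K : comNzRingType) (G : Type) (br : G -> G -> seq (K * G))
    (P : uea br -> Prop) :
  (forall c, P (c *: 1)) -> (forall x, P (ugen br x)) ->
  (forall a b, P a -> P b -> P (a + b)) -> (forall a b, P a -> P b -> P (a * b)) ->
  forall h, P h.
Proof.
move=> Pc Px Padd Pmul; elim/ucls_ind.
elim=> [x|c|s IHs t IHt|s IHs t IHt]; first exact: Px.
- have := Pc c; congr P; rewrite [LHS](umulE br (UCst _ c) (UCst _ 1)).
  by apply/uclsP; rewrite -{2}[c]mulr1; apply/ueq_sym/ueq_cstM.
- by rewrite -uaddE; apply: Padd.
- by rewrite -umulE; apply: Pmul.
Qed.

Section ActionUniqueness.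
Variables (K : comNzRingType) (G : Type) (br : G -> G -> seq (K * G)).
Variables (V : lmodType K) (S : set V) (act act' : uea br -> V -> V).
Hypotheses (S0 : S 0) (actP : module_action S act) (actP' : module_action S act').

Lemma module_action_uniq :
  (forall x v, S v -> act (ugen br x) v = act' (ugen br x) v) ->
  forall h v, S v -> act h v = act' h v.
Proof.
move=> gen; elim/uea_ind=> [c|x|h h' IH IH'|h h' IH IH'] v Sv; last 1 first.
- rewrite (mactM actP) // (mactM actP') // IH' // IH //.
  exact: (mact_in actP').
- have E f (fP : module_action S f) : f (c *: 1) v = c *: v.
    have f0 : f 0 v = 0.
      have := mact_linl fP (-1) 0 0 Sv; rewrite scaler0 addr0 => ->.
      by rewrite scaleN1r addNr.
    by have := mact_linl fP c 1 0 Sv; rewrite f0 !addr0 (mact1 fP).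
  by rewrite !E.
- exact: gen.
have E f (fP : module_action S f) : f (h + h') v = f h v + f h' v.
  by have := mact_linl fP 1 h h' Sv; rewrite !scale1r.
by rewrite !E // IH // IH'.
Qed.

End ActionUniqueness.

(** * The product rule attached to a coproduct, for an action on a subset *)

Section PartialAction.
Variables (K : comNzRingType) (H : algType K) (V : lmodType K) (S : set V).
Variables (mul : V -> V -> V) (one : V) (act : H -> V -> V).
Hypothesis algP : unital_algebra S mul one.
Hypothesis actP : module_action S act.
Implicit Types (s : seq (H * H)) (h : H) (v w : V).

Let S0 := ualg0 algP.
Let S_lin := ualgP algP.
Let S_mul := ualgM algP.
Let mul_linl := ualg_linl algP.
Let mul_linr := ualg_linr algP.
Let act_in := mact_in actP.
Let act_linr := mact_linr actP.
Let act_linl := mact_linl actP.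
Let act1 := mact1 actP.
Let actM := mactM actP.

Lemma act_addl h h' v : S v -> act (h + h') v = act h v + act h' v.
Proof. by move=> Sv; have := act_linl 1 h h' Sv; rewrite !scale1r. Qed.
Lemma act0l v : S v -> act 0 v = 0.
Proof. by move=> Sv; have := act_linl (-1) 0 0 Sv; rewrite scaler0 addr0 scaleN1r addNr. Qed.
Lemma act_scalel c h v : S v -> act (c *: h) v = c *: act h v.
Proof. by move=> Sv; have := act_linl c h 0 Sv; rewrite act0l // !addr0. Qed.
Lemma act0r h : act h 0 = 0.
Proof. by have := act_linr h (-1) S0 S0; rewrite scaler0 addr0 scaleN1r addNr. Qed.
Lemma act_addr h v w : S v -> S w -> act h (v + w) = act h v + act h w.
Proof. by move=> Sv Sw; have := act_linr h 1 Sv Sw; rewrite !scale1r. Qed.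
Lemma act_scaler h c v : S v -> act h (c *: v) = c *: act h v.
Proof. by move=> Sv; have := act_linr h c Sv S0; rewrite act0r !addr0. Qed.
Let S_add v w : S v -> S w -> S (v + w).
Proof. by move=> Sv Sw; rewrite -[v]scale1r; apply: S_lin. Qed.
Let S_sum (I : Type) (r : seq I) (F : I -> V) :
  (forall i, S (F i)) -> S (\sum_(i <- r) F i).
Proof. by move=> SF; elim/big_ind: _ => //; apply: S_add. Qed.
Lemma act_sum h (I : Type) (r : seq I) (F : I -> V) : (forall i, S (F i)) ->
  act h (\sum_(i <- r) F i) = \sum_(i <- r) act h (F i).
Proof.
move=> SF; elim: r => [|i r IHr]; first by rewrite !big_nil act0r.
by rewrite !big_cons act_addr ?IHr //; apply: S_sum.
Qed.

Lemma act_bilin v w : S v -> S w -> bilin (fun h h' => mul (act h v) (act h' w)).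
Proof.
move=> Sv Sw; split=> [a c b b'|b c a a'] /=.
  by rewrite act_linl // mul_linr //; apply: act_in.
by rewrite act_linl // mul_linl //; apply: act_in.
Qed.

(** Equality in the tensor product is equality under every bilinear map, and for fixed v, w in [S]
    the summand is bilinear in the two algebra elements. Hence the sum does not depend on the
    decomposition of the tensor. *)
Lemma sum_tcls s s' v w : S v -> S w -> tcls s = tcls s' ->
  \sum_(p <- s) mul (act p.1 v) (act p.2 w) = \sum_(p <- s') mul (act p.1 v) (act p.2 w).
Proof. by move=> Sv Sw /tclsP E; apply: E (act_bilin Sv Sw). Qed.

Lemma chi_tcls s v w : S v -> S w ->
  chi mul act (tcls s) v w = \sum_(p <- s) mul (act p.1 v) (act p.2 w).
Proof. by move=> Sv Sw; apply: sum_tcls => //; rewrite /tcls reprK. Qed.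

(* h acts on products through the element x of the tensor square. *)
Definition leibniz (x : tensor H H) h : Prop := exists2 s, x = tcls s &
  forall v w, S v -> S w -> act h (mul v w) = \sum_(p <- s) mul (act p.1 v) (act p.2 w).

Lemma leibnizP x h s v w : leibniz x h -> S v -> S w -> x = tcls s ->
  act h (mul v w) = \sum_(p <- s) mul (act p.1 v) (act p.2 w).
Proof. by move=> [s' -> E] Sv Sw E'; rewrite E //; apply: sum_tcls. Qed.

Lemma leibniz_add x y h h' : leibniz x h -> leibniz y h' -> leibniz (tadd x y) (h + h').
Proof.
move=> [s -> E] [s' -> E']; exists (s ++ s'); first by rewrite taddE.
by move=> v w Sv Sw; rewrite act_addl ?big_cat ?E ?E' //; apply: S_mul.
Qed.

Lemma leibniz_scale c x h : leibniz x h -> leibniz (tscale c x) (c *: h).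
Proof.
move=> [s -> E]; exists (tscales c s); first by rewrite tscaleE.
move=> v w Sv Sw; rewrite (tsum_scales _ _ (act_bilin Sv Sw)) -E //.
by rewrite act_scalel //; apply: S_mul.
Qed.

(** Applying h to each product in the expansion for h' gives a sum over pairs of tensors, which is
    the product in the tensor square. Together with the rules for sums and scalars this reduces the
    product rule to generators. *)
Lemma leibniz_mul x y h h' : leibniz x h -> leibniz y h' -> leibniz (tmul x y) (h * h').
Proof.
move=> [s -> E] [s' -> E']; exists (tmuls s s'); first by rewrite tmulE.
move=> v w Sv Sw; rewrite actM ?E' //; last exact: S_mul.
rewrite act_sum => [|p]; last by apply: S_mul; apply: act_in.
rewrite (tsum_muls (fun a b => mul (act a v) (act b w))) exchange_big /=.
apply: eq_bigr => q _; rewrite E; try exact: act_in.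
by apply: eq_bigr => p _; rewrite !actM.
Qed.

Lemma leibniz1 : leibniz (tcls [:: (1, 1)]) 1.
Proof.
by exists [:: (1, 1)] => // v w Sv Sw; rewrite big_seq1 !act1 //; apply: S_mul.
Qed.

End PartialAction.

(** * The action of the Hopf algebra *)

Section HopfAction.
Variables (R : realType) (Gam : set GL2Qplus).
Hypothesis GamP : congruence_subgroup Gam.
Local Notation C := (cplx R).
Local Notation gform := (gform R).
Local Notation hform := (hform R).
Local Notation hmul := (@hmul R Gam).
Local Notation heck := (@heck R Gam).
Local Notation hX := (@hX R).
Local Notation hY := (@hY R).
Local Notation hdelta := (@hdelta R).
Local Notation gmu := (@gmu R).
Local Notation gX := (@gX R).
Local Notation gY := (@gY R).
Implicit Types (a g d : GL2Qplus) (b : bool) (u v w : gform) (c : C) (F : hform) (n : nat).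

Lemma hadd_ev F1 F2 a : (F1 + F2) a = F1 a + F2 a. Proof. by []. Qed.
Lemma hscale_ev c F a : (c *: F) a = c *: F a. Proof. by []. Qed.
Lemma hX_ev F a : hX F a = gX (F a). Proof. by []. Qed.
Lemma hY_ev F a : hY F a = gY (F a). Proof. by []. Qed.
Lemma hdelta_ev n F a : hdelta n.+1 F a = gmul (gmu n a) (F a). Proof. by []. Qed.

Lemma heck_gholo b F a : heck b F -> gholo (F a).
Proof. by move=> [_ _ m _]; apply: gmform_holo (m a). Qed.

Lemma heck_fin_op b F (F' : hform) : heck b F -> (forall a, F a = 0 -> F' a = 0) ->
  finsupp Gam F'.
Proof. by move=> /(heck_cover GamP)[s cs] H; apply: cover_finsupp (coverS H cs). Qed.

Lemma gmu0_homog a : homog 2 (mu a) = gmu 0 a. Proof. by []. Qed.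

Lemma gX_slash_SL2Z u g : SL2Z g -> gholo u -> gX (gslash u g) = gslash (gX u) g.
Proof. by move=> gZ hu; rewrite gX_slash // gmu0_homog gmu_SL2Z // gmul0 addr0. Qed.

Lemma gmu_SL2Zl n g a : SL2Z g -> gmu n (g * a)%g = gmu n a.
Proof.
move=> gZ; elim: n => [|n IHn]; last by rewrite /gmu !iterS -!/(gmu n _) IHn.
by rewrite gmuM gmu_SL2Z // gslash0 add0r.
Qed.

Lemma gmu_SL2Zr n g a : SL2Z g -> gmu n (a * g)%g = gslash (gmu n a) g.
Proof.
move=> gZ; elim: n => [|n IHn].
  by rewrite gmuM [X in _ + X]gmu_SL2Z // addr0.
rewrite /gmu !iterS -!/(gmu n _) IHn gX_slash_SL2Z //.
exact: gmform_holo (gmform_gmu R n a).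
Qed.

Lemma heck_hX b F : heck b F -> heck b (hX F).
Proof.
move=> hF; have [l f m r] := hF; split=> [g a gG||a|a g gG]; rewrite ?hX_ev.
- by rewrite (l _ _ gG).
- by apply: heck_fin_op hF _ => a F0; rewrite hX_ev F0 gX0.
- exact: gmform_gX.
- by rewrite (r _ _ gG) gX_slash_SL2Z //; [apply: Gam_SL2Z gG|apply: heck_gholo hF].
Qed.

Lemma heck_hY b F : heck b F -> heck b (hY F).
Proof.
move=> hF; have [l f m r] := hF; split=> [g a gG||a|a g gG]; rewrite ?hY_ev.
- by rewrite (l _ _ gG).
- by apply: heck_fin_op hF _ => a F0; rewrite hY_ev F0 gY0.
- exact: gmform_gY.
- by rewrite (r _ _ gG) gY_slash.
Qed.

Lemma heck_hdelta b n F : heck b F -> heck b (hdelta n.+1 F).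
Proof.
move=> hF; have [l f m r] := hF; split=> [g a gG||a|a g gG]; rewrite ?hdelta_ev.
- by rewrite (l _ _ gG) gmu_SL2Zl //; apply: Gam_SL2Z gG.
- by apply: heck_fin_op hF _ => a F0; rewrite hdelta_ev F0 gmulr0.
- by rewrite gmulC; apply: gmformM (gmform_gmu R n a).
- by rewrite (r _ _ gG) gslash_mul gmu_SL2Zr //; apply: Gam_SL2Z gG.
Qed.

Lemma hX_lin c F1 F2 : heck false F1 -> heck false F2 ->
  hX (c *: F1 + F2) = c *: hX F1 + hX F2.
Proof.
move=> h1 h2; apply/funext => a; rewrite hX_ev !hadd_ev !hscale_ev gX_lin //;
  [apply: heck_gholo h1|apply: heck_gholo h2].
Qed.

Lemma hY_lin c F1 F2 : hY (c *: F1 + F2) = c *: hY F1 + hY F2.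
Proof. by apply/funext => a; rewrite hY_ev !hadd_ev !hscale_ev gY_lin. Qed.

Lemma hdelta_lin n c F1 F2 :
  hdelta n.+1 (c *: F1 + F2) = c *: hdelta n.+1 F1 + hdelta n.+1 F2.
Proof.
by apply/funext => a; rewrite hdelta_ev !hadd_ev !hscale_ev gmul_linr.
Qed.

Lemma hY_hX F : heck false F -> hY (hX F) = hX (hY F) + hX F.
Proof.
by move=> hF; apply/funext => a; rewrite hadd_ev hY_ev !hX_ev gY_gX //; apply: heck_gholo hF.
Qed.

Lemma hY_hdelta n F : hY (hdelta n.+1 F) = hdelta n.+1 (hY F) + n.+1%:R *: hdelta n.+1 F.
Proof.
apply/funext => a; rewrite hadd_ev hscale_ev hY_ev !hdelta_ev gYM gY_gmu gmulZl.
by rewrite addrC.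
Qed.

Lemma hX_hdelta n F : heck false F ->
  hX (hdelta n.+1 F) = hdelta n.+1 (hX F) + hdelta n.+2 F.
Proof.
move=> hF; apply/funext => a; rewrite hadd_ev hX_ev !hdelta_ev gXM.
- by rewrite addrC /gmu iterS.
- exact: gmform_holo (gmform_gmu R n a).
- exact: heck_gholo hF.
Qed.

Lemma hdeltaC m n F : hdelta m.+1 (hdelta n.+1 F) = hdelta n.+1 (hdelta m.+1 F).
Proof. by apply/funext => a; rewrite !hdelta_ev gmulCA. Qed.

Definition h1_op (x : h1_basis) : hform -> hform :=
  match x with h1_X => hX | h1_Y => hY | h1_D n => hdelta n.+1 end.

Lemma heck_op b x F : heck b F -> heck b (h1_op x F).
Proof. by case: x => [||n]; [apply: heck_hX|apply: heck_hY|apply: heck_hdelta]. Qed.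

Lemma op_lin x c F1 F2 : heck false F1 -> heck false F2 ->
  h1_op x (c *: F1 + F2) = c *: h1_op x F1 + h1_op x F2.
Proof.
move=> h1 h2; case: x => [||n] /=; first exact: hX_lin.
  exact: hY_lin.
exact: hdelta_lin.
Qed.

Lemma op_lie x y F : heck false F ->
  h1_op x (h1_op y F) =
  h1_op y (h1_op x F) + \sum_(p <- h1_bracket C x y) p.1 *: h1_op p.2 F.
Proof.
move=> hF; case: x y => [||m] [||n]; rewrite /h1_bracket ?big_nil ?big_seq1 ?addr0;
  rewrite /= ?scale1r ?scaleN1r //.
- by rewrite hY_hX // addrK.
- exact: hX_hdelta.
- exact: hY_hX.
- exact: hY_hdelta.
- by rewrite hX_hdelta // addrK.
- by rewrite hY_hdelta scaleNr addrK.
- exact: hdeltaC.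
Qed.

Lemma hX0 F d : F d = 0 -> hX F d = 0. Proof. by rewrite hX_ev => ->; rewrite gX0. Qed.
Lemma hY0 F d : F d = 0 -> hY F d = 0. Proof. by rewrite hY_ev => ->; rewrite gY0. Qed.
Lemma hdelta0 n F d : F d = 0 -> hdelta n.+1 F d = 0.
Proof. by rewrite hdelta_ev => ->; rewrite gmulr0. Qed.

Lemma gX_sum (I : Type) (r : seq I) (P : I -> gform) : (forall i, gholo (P i)) ->
  gX (\sum_(i <- r) P i) = \sum_(i <- r) gX (P i).
Proof.
move=> hP; have H : gholo (\sum_(i <- r) P i) /\ gX (\sum_(i <- r) P i) = \sum_(i <- r) gX (P i).
  elim: r => [|i r [IH1 IH2]]; first by rewrite !big_nil gX0; split=> // n; apply: holo0.
  rewrite !big_cons -IH2; split; first by move=> n; exact: (holoD (hP i n) (IH1 n)).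
  exact: gXD (hP i) IH1.
exact: H.2.
Qed.

Lemma gY_sum (I : Type) (r : seq I) (P : I -> gform) :
  gY (\sum_(i <- r) P i) = \sum_(i <- r) gY (P i).
Proof.
elim: r => [|i r IHr]; first by rewrite !big_nil gY0.
by rewrite !big_cons gYD IHr.
Qed.

Lemma hX_mul F1 F2 : heck false F1 -> heck false F2 ->
  hX (hmul F1 F2) = hmul (hX F1) F2 + hmul F1 (hX F2) + hmul (hdelta 1 F1) (hY F2).
Proof.
move=> h1 h2; have [s cs] := heck_cover GamP h1; apply/funext => a.
have X1 := heck_hX h1; have X2 := heck_hX h2; have D1 := heck_hdelta 0 h1.
have Y2 := heck_hY h2.
rewrite !hadd_ev hX_ev (heck_mulE _ _ cs h1 h2) // (heck_mulE _ _ cs h1 X2) //.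
rewrite (heck_mulE _ _ (coverS (@hX0 F1) cs) X1 h2) //.
rewrite (heck_mulE _ _ (coverS (@hdelta0 0 F1) cs) D1 Y2) //.
have hs d : gholo (gslash (F2 (a * d^-1)%g) d).
  by apply: gmform_holo (gmform_slash _ _); case: h2.
have hF d : gholo (F1 d) by apply: heck_gholo h1.
have hm d : gholo (gmul (F1 d) (gslash (F2 (a * d^-1)%g) d)).
  case: h1 h2 => _ _ m1 _ [_ _ m2 _].
  by apply: gmform_holo (gmformM (m1 d) (gmform_slash _ (m2 _))).
rewrite gX_sum // -!big_split; apply: eq_bigr => d _ /=.
(* Differentiating the slashed factor produces mu_d times its image under Y. Moved onto [F1 d], mu_d
   gives delta_1 (F1), and this is the term delta_1 (x) Y of the coproduct of X. *)
rewrite gXM // gX_slash; last by apply: heck_gholo h2.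
rewrite gmulDr addrA hdelta_ev hX_ev hY_ev gmu0_homog gY_slash.
by rewrite gmulCA gmulA.
Qed.

Lemma hY_mul F1 F2 : heck false F1 -> heck false F2 ->
  hY (hmul F1 F2) = hmul (hY F1) F2 + hmul F1 (hY F2).
Proof.
move=> h1 h2; have [s cs] := heck_cover GamP h1; apply/funext => a.
have Y1 := heck_hY h1; have Y2 := heck_hY h2.
rewrite hadd_ev hY_ev (heck_mulE _ _ cs h1 h2) // (heck_mulE _ _ cs h1 Y2) //.
rewrite (heck_mulE _ _ (coverS (@hY0 F1) cs) Y1 h2) //.
rewrite gY_sum -big_split; apply: eq_bigr => d _ /=.
by rewrite gYM gY_slash.
Qed.

Lemma hdelta_mul F1 F2 : heck false F1 -> heck false F2 ->
  hdelta 1 (hmul F1 F2) = hmul (hdelta 1 F1) F2 + hmul F1 (hdelta 1 F2).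
Proof.
move=> h1 h2; have [s cs] := heck_cover GamP h1; apply/funext => a.
have D1 := heck_hdelta 0 h1; have D2 := heck_hdelta 0 h2.
rewrite hadd_ev hdelta_ev (heck_mulE _ _ cs h1 h2) // (heck_mulE _ _ cs h1 D2) //.
rewrite (heck_mulE _ _ (coverS (@hdelta0 0 F1) cs) D1 h2) //.
rewrite gmul_sumr -big_split; apply: eq_bigr => d _ /=.
rewrite !hdelta_ev gmu0_homog gslash_mul.
(* The cocycle rule for the factorization a = (a d^-1) d: one summand is absorbed by [F2], the other
   by [F1], so delta_1 is a derivation. *)
have -> : gmu 0 a = gslash (gmu 0 (a * d^-1)%g) d + gmu 0 d by rewrite -gmuM mulgVK.
rewrite gmulDl addrC.
by congr (_ + _); [rewrite gmulCA|rewrite gmulA].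
Qed.

End HopfAction.

(** * The Hopf action, the inner Schwarzian and the Rankin-Cohen cocycle *)

Section ModularAction.
Variables (R : realType) (Gam : set GL2Qplus).
Hypothesis GamP : congruence_subgroup Gam.
Local Notation C := (cplx R).
Local Notation gform := (gform R).
Local Notation hform := (hform R).
Local Notation hmul := (@hmul R Gam).
Local Notation hone := (@hone R Gam).
Local Notation heck := (@heck R Gam).
Local Notation hX := (@hX R).
Local Notation hY := (@hY R).
Local Notation hdelta := (@hdelta R).
Local Notation X := (H1X C).
Local Notation Y := (H1Y C).
Local Notation delta := (H1D C).
Local Notation H1 := (H1 C).
Implicit Types (a g d : GL2Qplus) (b : bool) (u v w : gform) (c : C) (F : hform) (n : nat).

Lemma heck_hone : heck false hone.
Proof.
apply: (heck_embed GamP); first exact: gmform1.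
by move=> g _; rewrite gslash_homog slash_one.
Qed.

Lemma hecke_algebra : unital_algebra (heck false) hmul hone.
Proof.
split.
- exact: heck0.
- by move=> c a a'; apply: (heck_lin GamP).
- exact: heck_hone.
- by move=> a a'; apply: (heckM GamP).
- by move=> *; apply: (hmul_linl GamP).
- by move=> *; apply: (hmul_linr GamP).
- by move=> *; apply: (hmulA GamP).
- move=> F hF; apply/funext => a; rewrite (hmul_embedl GamP a heck_hone hF).
  exact: gmul1.
- move=> F hF; apply/funext => a; rewrite (hmul_embedr GamP a heck_hone hF).
  by rewrite gslash_homog slash_one gmulr1.
Qed.

Definition hact : H1 -> hform -> hform := uea_act (@h1_op R).

Lemma hactP : module_action (heck false) hact.
Proof.
apply: uea_actP.
- exact: heck0.
- by move=> c a a'; apply: (heck_lin GamP).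
- by move=> x F; apply: (heck_op GamP).
- by move=> x c F F' h h'; apply: op_lin h h'.
- by move=> x y F h; apply: op_lie h.
Qed.

Lemma hact_gen F x : heck false F -> hact (ugen (h1_bracket C) x) F = h1_op x F.
Proof.
apply: uea_act_gen.
- exact: heck0.
- by move=> c a a'; apply: (heck_lin GamP).
- by move=> x' F'; apply: (heck_op GamP).
- by move=> x' c F1 F2 h h'; apply: op_lin h h'.
- by move=> x' y F' h; apply: op_lie h.
Qed.

(** With [b] free, the same induction on terms covers the algebra and its cuspidal ideal, since
    every generator preserves both. *)
Lemma hact_in b h F : heck b F -> heck b (hact h F).
Proof.
apply: (tact_in (S := heck b)) => [|c F1 F2|x F1]; first exact: heck0.
  exact: (heck_lin GamP).
exact: (heck_op GamP).
Qed.

Local Notation leibniz := (leibniz (heck false) hmul hact).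

Lemma leibniz_X : leibniz (H1comul C X) X.
Proof.
exists [:: (X, 1); (1, X); (delta 1%N, Y)].
  by have [-> _ _] := H1comulE C; rewrite tclsE !big_cons big_nil addr0 addrA.
move=> F1 F2 h1 h2; rewrite !big_cons big_nil addr0 /= !(mact1 hactP) //.
have h12 := heckM GamP h1 h2.
by rewrite !hact_gen // [LHS](hX_mul GamP h1 h2) addrA.
Qed.

Lemma leibniz_Y : leibniz (H1comul C Y) Y.
Proof.
exists [:: (Y, 1); (1, Y)].
  by have [_ -> _] := H1comulE C; rewrite tclsE !big_cons big_nil addr0.
move=> F1 F2 h1 h2; rewrite !big_cons big_nil addr0 /= !(mact1 hactP) //.
have h12 := heckM GamP h1 h2.
by rewrite !hact_gen // [LHS](hY_mul GamP h1 h2).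
Qed.

(** Only delta_1 has a prescribed coproduct; delta_(n+2) is the commutator of X with delta_(n+1),
    and the coproduct is an algebra map, so the rule propagates by induction. *)
Lemma leibniz_delta n : leibniz (H1comul C (delta n.+1)) (delta n.+1).
Proof.
elim: n => [|n IHn].
  exists [:: (delta 1%N, 1); (1, delta 1%N)].
    by have [_ _ ->] := H1comulE C; rewrite tclsE !big_cons big_nil addr0.
  move=> F1 F2 h1 h2; rewrite !big_cons big_nil addr0 /= !(mact1 hactP) //.
  have h12 := heckM GamP h1 h2.
  by rewrite !hact_gen // [LHS](hdelta_mul GamP h1 h2).
have -> : delta n.+2 = X * delta n.+1 + (-1) *: (delta n.+1 * X).
  by rewrite scaleN1r -[RHS]/(lie X (delta n.+1)) H1_lieXD.
rewrite linearD linearZ !rmorphM.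
apply: (leibniz_add hecke_algebra hactP); first exact: (leibniz_mul hecke_algebra hactP leibniz_X).
apply: (leibniz_scale hecke_algebra hactP).
exact: (leibniz_mul hecke_algebra hactP IHn leibniz_X).
Qed.

Lemma hact_leibniz h : leibniz (H1comul C h) h.
Proof.
elim/uea_ind: h => [c|[||n]|h h' IH IH'|h h' IH IH'].
- rewrite linearZ rmorph1; apply: (leibniz_scale hecke_algebra hactP).
  exact: (leibniz1 hecke_algebra hactP).
- exact: leibniz_X.
- exact: leibniz_Y.
- exact: leibniz_delta.
- by rewrite linearD; apply: (leibniz_add hecke_algebra hactP).
- by rewrite rmorphM; apply: (leibniz_mul hecke_algebra hactP).
Qed.

Lemma h1_op_hone x : h1_op x hone = 0.
Proof.
apply/funext => a; case: x => [||n] /=.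
- rewrite hX_ev /hone /hembed; case: ifP => _; last by rewrite gX0.
  apply/funext => -[|[|k]] //; rewrite gX_ev /homog; case: eqP => [->|_]; last by rewrite Xk0.
  rewrite /Xk mul0r scale0r subr0; apply/funext => z.
  by rewrite Df_ev (uder_uderiv (uder_cst 1 z)) mulr0.
- rewrite hY_ev /hone /hembed; case: ifP => _; last by rewrite gY0.
  by apply/funext => k; rewrite gY_ev /homog; case: eqP => [->|_]; rewrite ?scaler0 // mul0r scale0r.
rewrite hdelta_ev /hone /hembed; case: asboolP => [aG|_]; last by rewrite gmulr0.
by rewrite gmu_SL2Z ?gmul0 //; apply: Gam_SL2Z aG.
Qed.

Lemma hact_hone h : hact h hone = H1counit C h *: hone.
Proof.
have hh := heck_hone; have ua := hactP.
elim/uea_ind: h => [c|x|h h' IH IH'|h h' IH IH'].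
- have := mact_linl hactP c 1 0 hh; rewrite addr0 => ->.
  rewrite (act0l hactP) // addr0 (mact1 hactP) // linearZ rmorph1.
  by congr (_ *: _); apply/esym/mulr1.
- have -> : H1counit C (ugen (h1_bracket C) x) = 0 by apply: ulift_gen.
  by rewrite hact_gen // h1_op_hone scale0r.
- by rewrite (act_addl hactP) // IH IH' linearD scalerDl.
- rewrite (mactM hactP) // IH' (act_scaler hecke_algebra hactP) // IH.
  by rewrite scalerA rmorphM mulrC.
Qed.

Lemma hact_hopf_action :
  hopf_action (heck false) hmul hone (H1comul C) (H1counit C) hact.
Proof.
split.
- by move=> h F; apply: hact_in.
- by move=> h c F1 F2; apply: (mact_linr hactP).
- by move=> c h h' F; apply: (mact_linl hactP).
- by move=> F; apply: (mact1 hactP).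
- by move=> h h' F; apply: (mactM hactP).
- move=> h s F1 F2 h1 h2; rewrite -tclsE => E.
  exact: (leibnizP hecke_algebra hactP (hact_leibniz h)).
- exact: hact_hone.
Qed.

Lemma lin_sub3 (K : comNzRingType) (V : lmodType K) (c : K) (p p' q q' r r' : V) :
  c *: p + p' - (c *: q + q') - (c *: r + r') = c *: (p - q - r) + (p' - q' - r').
Proof. by rewrite !scalerBr !opprD (addrACA (c *: p)) (addrACA (c *: p - c *: q)). Qed.

(** The letters are the triple products left after expanding the coboundary by the product rules,
    for instance F = delta_1 (F1) Y (F2) Y (F3). This term arises both from X (F1 F2) and from
    delta_1 (Y (F1 F2)) and cancels between them. *)
Lemma cocycle_cancel (V : zmodType) (A B D E F G I J L M N : V) :
  A - B - D - (E + A + F - (G + B) - (I + J + (F + D))) +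
  (L + E - (M + G + J) - (N + I)) - (L - M - N) = 0.
Proof.
have -> : E + A + F - (G + B) - (I + J + (F + D)) = (A - B - D) + (E - G - I - J).
  rewrite !opprD !addrA [LHS](ACl ((2*5*9)*(1*4*6*7)*(3*8)))%AC /=.
  by rewrite subrr addr0 !addrA.
have -> : L + E - (M + G + J) - (N + I) = (L - M - N) + (E - G - I - J).
  by rewrite !opprD !addrA [LHS](ACl ((1*3*6)*(2*4*7*5)))%AC /= !addrA.
move: (A - B - D) (E - G - I - J) (L - M - N) => x w y.
by rewrite opprD [x + _]addrA subrr sub0r addrCA addNr addr0 subrr.
Qed.

Lemma hmulDl F1 F2 F3 : heck false F1 -> heck false F2 -> heck false F3 ->
  hmul (F1 + F2) F3 = hmul F1 F3 + hmul F2 F3.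
Proof. by move=> h1 h2 h3; have := hmul_linl GamP 1 h1 h2 h3; rewrite !scale1r. Qed.

Lemma hmulDr F1 F2 F3 : heck false F1 -> heck false F2 -> heck false F3 ->
  hmul F3 (F1 + F2) = hmul F3 F1 + hmul F3 F2.
Proof. by move=> h1 h2 h3; have := hmul_linr GamP 1 h1 h2 h3; rewrite !scale1r. Qed.

Lemma hmul0l F : heck false F -> hmul 0 F = 0.
Proof.
move=> hF; have h0 := heck0 R Gam false.
by have := hmul_linl GamP (-1) h0 h0 hF; rewrite scaler0 addr0 scaleN1r addNr.
Qed.

Lemma hmulBl F1 F2 F3 : heck false F1 -> heck false F2 -> heck false F3 ->
  hmul (F1 - F2) F3 = hmul F1 F3 - hmul F2 F3.
Proof.
move=> h1 h2 h3; have := hmul_linl GamP (-1) h2 h1 h3.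
by rewrite !scaleN1r addrC => ->; rewrite addrC.
Qed.

Lemma hmulBr F1 F2 F3 : heck false F1 -> heck false F2 -> heck false F3 ->
  hmul F3 (F1 - F2) = hmul F3 F1 - hmul F3 F2.
Proof.
move=> h1 h2 h3; have := hmul_linr GamP (-1) h2 h1 h3.
by rewrite !scaleN1r addrC => ->; rewrite addrC.
Qed.

Definition rcH F1 F2 : hform :=
  hmul (hX F1) (hY F2) - hmul (hY F1) (hX F2) - hmul (hdelta 1 (hY F1)) (hY F2).

Local Ltac inH := repeat match goal with
  | H : heck ?b ?F |- heck ?b ?F => exact: H
  | |- heck _ (hmul _ _) => apply: (heckM GamP)
  | |- heck _ (_ - _) => apply: (heckB GamP)
  | |- heck _ (_ + _) => apply: (heckD GamP)
  | |- heck _ (hX _) => apply: (heck_hX GamP)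
  | |- heck _ (hY _) => apply: (heck_hY GamP)
  | |- heck _ (hdelta 1 _) => apply: (heck_hdelta GamP)
  end.

Lemma heck_rcH F1 F2 : heck false F1 -> heck false F2 -> heck false (rcH F1 F2).
Proof. by move=> h1 h2; rewrite /rcH; inH. Qed.

Lemma rcH_linl c F1 F2 F3 : heck false F1 -> heck false F2 -> heck false F3 ->
  rcH (c *: F1 + F2) F3 = c *: rcH F1 F3 + rcH F2 F3.
Proof.
move=> h1 h2 h3; rewrite /rcH (hX_lin c h1 h2) !hY_lin hdelta_lin.
rewrite !(hmul_linl GamP); try inH.
exact: lin_sub3.
Qed.

Lemma rcH_linr c F1 F2 F3 : heck false F1 -> heck false F2 -> heck false F3 ->
  rcH F3 (c *: F1 + F2) = c *: rcH F3 F1 + rcH F3 F2.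
Proof.
move=> h1 h2 h3; rewrite /rcH (hX_lin c h1 h2) !hY_lin.
rewrite !(hmul_linr GamP); try inH.
exact: lin_sub3.
Qed.

Lemma hdeltaD F1 F2 : hdelta 1 (F1 + F2) = hdelta 1 F1 + hdelta 1 F2.
Proof. by have := hdelta_lin 0 1 F1 F2; rewrite !scale1r. Qed.

Lemma rcH_cocycle F1 F2 F3 : heck false F1 -> heck false F2 -> heck false F3 ->
  hmul F1 (rcH F2 F3) - rcH (hmul F1 F2) F3 + rcH F1 (hmul F2 F3) - hmul (rcH F1 F2) F3 = 0.
Proof.
move=> h1 h2 h3; rewrite /rcH.
rewrite !(hX_mul GamP) // !(hY_mul GamP) // hdeltaD !(hdelta_mul GamP); try inH.
rewrite !hmulBl; try inH.
rewrite !hmulBr; try inH.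
rewrite !hmulDl; try inH.
rewrite !hmulDr; try inH.
rewrite !(hmulA GamP); try inH.
exact: cocycle_cancel.
Qed.

Lemma rcH_hochschild (c2 : hform -> hform -> hform) :
  (forall F1 F2, heck false F1 -> heck false F2 -> c2 F1 F2 = rcH F1 F2) ->
  hochschild_2cocycle (heck false) hmul c2.
Proof.
move=> E; split=> [F1 F2 h1 h2|c F1 F2 F3 h1 h2 h3|c F1 F2 F3 h1 h2 h3|F1 F2 F3 h1 h2 h3].
- by rewrite E //; apply: heck_rcH.
- have h12 := heck_lin GamP c h1 h2.
  by rewrite (E _ _ h12 h3) (E _ _ h1 h3) (E _ _ h2 h3); apply: rcH_linl.
- have h12 := heck_lin GamP c h1 h2.
  by rewrite (E _ _ h3 h12) (E _ _ h3 h1) (E _ _ h3 h2); apply: rcH_linr.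
have h12 := heckM GamP h1 h2; have h23 := heckM GamP h2 h3.
by rewrite (E _ _ h2 h3) (E _ _ h12 h3) (E _ _ h1 h23) (E _ _ h1 h2); apply: rcH_cocycle.
Qed.

Lemma RC_tcls : tens X Y - tens Y X - tens (delta 1%N * Y) Y =
  tcls [:: (X, Y); ((-1) *: Y, X); ((-1) *: (delta 1%N * Y), Y)].
Proof.
have tZ (a a' : H1) : tens ((-1) *: a) a' = - tens a a'.
  by rewrite (bilinZl (@tens_bilin _ _ _)) scaleN1r.
by rewrite tclsE !big_cons big_nil addr0 !tZ addrA.
Qed.

Section AnyAction.
Variable act : H1 -> hform -> hform.
Hypothesis actP : hopf_action (heck false) hmul hone (H1comul C) (H1counit C) act.
Hypothesis actY : forall F, heck false F -> act Y F = hY F.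
Hypothesis actX : forall F, heck false F -> act X F = hX F.
Hypothesis actD : forall n F, (0 < n)%N -> heck false F -> act (delta n) F = hdelta n F.

Lemma hopf_module_action : module_action (heck false) act.
Proof. by case: actP. Qed.

(** Prescribed values on the generators determine the whole action, so what is known of [hact] holds
    for [act] on A(Gamma). *)
Lemma act_hact h F : heck false F -> act h F = hact h F.
Proof.
apply: (module_action_uniq hopf_module_action hactP) => x F' hF'.
rewrite hact_gen //; case: x => [||n]; [exact: actX|exact: actY|].
exact: (actD (n := n.+1)).
Qed.

Lemma chi_RC F1 F2 : heck false F1 -> heck false F2 ->
  chi hmul act (tens X Y - tens Y X - tens (delta 1%N * Y) Y) F1 F2 = rcH F1 F2.
Proof.
move=> h1 h2; have aP := hopf_module_action; rewrite RC_tcls.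
rewrite (chi_tcls hecke_algebra aP) // !big_cons big_nil addr0 /= !(act_scalel aP) //.
have Y1 := heck_hY GamP h1; have D1 := heck_hdelta GamP 0 Y1.
have X2 := heck_hX GamP h2; have Y2 := heck_hY GamP h2.
rewrite (mactM aP) // !actX // !actY // actD // !scaleN1r.
have Nl F F' : heck false F -> heck false F' -> hmul (- F) F' = - hmul F F'.
  move=> hF hF'; have h0 := heck0 R Gam false.
  by have := hmulBl h0 hF hF'; rewrite !sub0r hmul0l // sub0r.
by rewrite !Nl // addrA.
Qed.

(** The form sits on the trivial coset: multiplying by it on the left leaves it as it is,
    multiplying on the right slashes it by a. The commutator at a is therefore (omega|a - omega)
    F_a, and [gomega_slash] identifies the factor with X mu_a - mu_a^2 / 2. *)
Lemma schwarzian_inner F : heck false (hembed Gam (@gomega R)) -> heck false F ->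
  act (delta 2%N - 2^-1 *: delta 1%N ^+ 2) F =
  hmul F (hembed Gam (@gomega R)) - hmul (hembed Gam (@gomega R)) F.
Proof.
move=> ho hF; have aP := hopf_module_action.
rewrite addrC -scaleNr (mact_linl aP) // expr2 (mactM aP) // !actD //; last exact: (heck_hdelta GamP).
apply/funext => a; rewrite -[RHS]/(hmul _ _ a - hmul _ _ a).
rewrite (hmul_embedl GamP a ho hF) (hmul_embedr GamP a ho hF).
rewrite (gmulC (F a)) -gmulBl gomega_slash -scaleNr hadd_ev hscale_ev !hdelta_ev.
by rewrite gmulDl gmulZl gmulA addrC.
Qed.

Lemma act_cuspidal h F : heck true F -> heck true (act h F).
Proof. by move=> hF; rewrite act_hact; [apply: hact_in|apply: heck_weak hF]. Qed.

End AnyAction.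

Lemma modforms_gmform u : modforms Gam u ->
  gmform false u /\ forall g, Gam g -> gslash u g = u.
Proof.
move=> [Hu Hd]; split=> [|g gG]; last first.
  by apply/funext => k; have [_ H _] := Hu k; apply: H.
split=> // k; have [_ H1 H2] := Hu k; split=> [|g gZ]; last exact/qreg_holoE/H2.
by have [_ _ _ [N N0 HN]] := GamP; exists N => // g /HN; apply: H1.
Qed.

Lemma heck_omega4 : heck false (hembed Gam (@gomega R)).
Proof.
apply: (heck_embed GamP); first exact/gmform_homog/mform_omega.
by move=> g gG; rewrite gslash_homog omega_SL2Z //; apply: Gam_SL2Z gG.
Qed.

(** The corrections by [Gf] in the two products are both (k/2)(l/2) G f h and cancel, so X may take
    the place of the plain derivative. *)
Lemma rankin_cohen1E u v : gholo u -> gholo v ->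
  rankin_cohen1 u v = gmul (gX u) (gY v) - gmul (gY u) (gX v).
Proof.
move=> hu hv; apply/funext => n.
rewrite -[RHS]/(gmul (gX u) (gY v) n - gmul (gY u) (gX v) n).
case: n => [|[|n]].
- by rewrite /rankin_cohen1 big_ord0 !(gmul_gX_low _ _ _).1 // (gmul_gX_low _ _ _).2 // subr0.
- by rewrite /rankin_cohen1 big_ord0 !(gmul_gX_low _ _ _).1 // (gmul_gX_low _ _ _).2 // subr0.
rewrite gmul_gXl gmul_gXr /rankin_cohen1 -sumrB; apply: eq_bigr => i _.
have -> : (n.+2 - 2 - i = n - i)%N by rewrite !subSS subn0.
move: (n - i)%N => l; apply/funext => z; rewrite /rc1 /Xk !gY_ev !f_ev !Df_ev.
move: (twopii_neq0 R).
move: (u i z) (v l z) (uderiv (u i) z) (uderiv (v l) z) (i%:R : C) (l%:R : C) (twopii R).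
move: (Gf z).
have E (K : fieldType) (s f h G df dh k m : K) : s != 0 -> 2 != 0 :> K ->
  (2 * s)^-1 * (m * (df * h) - k * (f * dh)) =
  (s^-1 * df - k / 2 * (G * f)) * (m / 2 * h) - k / 2 * f * (s^-1 * dh - m / 2 * (G * h)).
  by move=> s0 h0; field; rewrite s0 h0.
by move=> *; apply: E => //; rewrite pnatr_eq0.
Qed.

Lemma rcH_embed u v : modforms Gam u -> modforms Gam v ->
  rcH (hembed Gam u) (hembed Gam v) = hembed Gam (rankin_cohen1 u v).
Proof.
move=> /modforms_gmform[gu Su] /modforms_gmform[gv Sv].
have hu := heck_embed GamP gu Su; have hv := heck_embed GamP gv Sv.
rewrite rankin_cohen1E; [|exact: gmform_holo gu|exact: gmform_holo gv].
have eX w : hX (hembed Gam w) = hembed Gam (gX w).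
  by apply/funext => a; rewrite hX_ev /hembed; case: ifP => // _; apply: gX0.
have eY w : hY (hembed Gam w) = hembed Gam (gY w).
  by apply/funext => a; rewrite hY_ev /hembed; case: ifP => // _; apply: gY0.
(* An embedded form is supported on [Gam], where mu vanishes; this removes the third term of the
   cocycle and leaves the classical bracket. *)
have eD w : hdelta 1 (hembed Gam w) = 0.
  apply/funext => a; rewrite hdelta_ev /hembed; case: asboolP => [aG|_]; last by rewrite gmulr0.
  by rewrite gmu_SL2Z ?gmul0 //; apply: Gam_SL2Z aG.
have eM w w' : heck false (hembed Gam w) -> heck false (hembed Gam w') ->
    hmul (hembed Gam w) (hembed Gam w') = hembed Gam (gmul w w').
  move=> hw hw'; apply/funext => a; rewrite (hmul_embedl GamP a hw hw') /hembed.
  by case: ifP => // _; rewrite gmulr0.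
have Xu := heck_hX GamP hu; have Yu := heck_hY GamP hu.
have Xv := heck_hX GamP hv; have Yv := heck_hY GamP hv.
rewrite /rcH (eY u) eD hmul0l // subr0 -(eY u).
move: Xu Yu Xv Yv; rewrite !eX !eY => Xu Yu Xv Yv; rewrite !eM //.
apply/funext => a; rewrite -[LHS]/(hembed Gam _ a - hembed Gam _ a) /hembed.
by case: ifP => // _; rewrite subr0.
Qed.

End ModularAction.

Theorem theorem12 (R : realType) (Gam : set GL2Qplus)
    (Gam_congruence : congruence_subgroup Gam) :
  (* 1 *)
  (unital_algebra (@hecke R Gam) (hmul Gam) (hone Gam) /\
   exists act : H1 (cplx R) -> hform R -> hform R,
     modular_H1_action Gam act /\
     forall act', modular_H1_action Gam act' ->
       forall h F, hecke Gam F -> act' h F = act h F) /\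
  forall act : H1 (cplx R) -> hform R -> hform R, modular_H1_action Gam act ->
    let X := H1X (cplx R) in let Y := H1Y (cplx R) in let delta := H1D (cplx R) in
    let RC := tens X Y - tens Y X - tens (delta 1%N * Y) Y in
    [/\ (* 2 *)
        @hecke R Gam (omega4 Gam) /\
        (forall a, hecke Gam a ->
           act (delta 2%N - 2^-1 *: delta 1%N ^+ 2) a =
           hmul Gam a (omega4 Gam) - hmul Gam (omega4 Gam) a),
        (* 3 *)
        [/\ forall a1 a2, hecke Gam a1 -> hecke Gam a2 ->
              chi (hmul Gam) act RC a1 a2 =
              hmul Gam (act X a1) (act Y a2) - hmul Gam (act Y a1) (act X a2)
              - hmul Gam (act (delta 1%N) (act Y a1)) (act Y a2),
            hochschild_2cocycle (@hecke R Gam) (hmul Gam) (chi (hmul Gam) act RC) &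
            forall u v, modforms Gam u -> modforms Gam v ->
              chi (hmul Gam) act RC (hembed Gam u) (hembed Gam v) =
              hembed Gam (rankin_cohen1 u v) /\
              rankin_cohen1 u v = gmul (gX u) (gY v) - gmul (gY u) (gX v)] &
        (* 4 *)
        forall h F, hecke0 Gam F -> hecke0 Gam (act h F)].
Proof.
rewrite /modular_H1_action !heckE heck0E; have GamP := Gam_congruence.
split.
  split; first exact: hecke_algebra.
  exists (@hact R); split=> [|act' [aP aY aX aD] h F hF].
    split=> [|F hF|F hF|n F n0 hF]; first exact: hact_hopf_action.
    - exact: (hact_gen GamP h1_Y).
    - exact: (hact_gen GamP h1_X).
    by case: n n0 => // n _; apply: (hact_gen GamP (h1_D n)).
  exact: (act_hact GamP aP aY aX aD).
move=> act [aP aY aX aD].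
have chiE := chi_RC GamP aP aY aX aD.
split.
- split=> [|F hF]; first exact: heck_omega4.
  exact: (schwarzian_inner GamP aP aD (heck_omega4 R GamP)).
- split=> [F1 F2 h1 h2||u v mu mv].
  + rewrite chiE // aX // aX // aY // aY // aD //; exact: (heck_hY GamP).
  + exact: (rcH_hochschild GamP).
  have [gu Su] := modforms_gmform GamP mu; have [gv Sv] := modforms_gmform GamP mv.
  have hu := heck_embed GamP gu Su; have hv := heck_embed GamP gv Sv.
  split; first by rewrite chiE //; apply: (rcH_embed GamP).
  by apply: rankin_cohen1E; [apply: gmform_holo gu|apply: gmform_holo gv].
by move=> h F; apply: (act_cuspidal GamP aP aY aX aD).
Qed.
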